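(* Let $\mathcal{M}$ be a uniquely geodesic Riemannian manifold with sectional curvature in $[\kappa_{\min},\kappa_{\max}]$, let $f:\mathcal{M}\to\mathbb{R}$ have a minimizer $x^*$, let $x_0$ be an initial point with $R=\mathrm{dist}(x_0,x^* )$, and suppose $f$ is g-convex and $G$-Lipschitz in $\mathcal{X}=\bar B(x^*,\sqrt2R)\subset\mathcal{M}$. Consider $T$ steps of Riemannian subgradient descent $x_{t+1}=\mathrm{Exp}_{x_t}(-\eta v_t)$, $v_t\in\partial f(x_t)$, with $\eta = R/\big(G\sqrt{\zeta_{\sqrt2R}\,T}\big)$. Then the iterates lie in $\mathcal{X}$, and for every $\epsilon>0$, the uniform geodesic average of the iterates $x_0,\dots,x_{T-1}$ is an $\epsilon$-minimizer of $f$ after $T=O(\zeta_R G^2R^2/\epsilon^2)$ iterations.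
   Context: A space is uniquely geodesic if every two points are connected by one and only one geodesic. $\mathrm{Exp}_x$ is the Riemannian exponential map and $\mathrm{Exp}_x^{-1}$ its inverse; $\bar B(x,r)$ is the closed Riemannian ball. A set is g-convex if every two of its points are joined by a geodesic contained in it; a function is g-convex in a g-convex set $\mathcal{X}$ if it is convex along every geodesic in $\mathcal{X}$. (The class of functions that are g-convex in $\mathcal{X}$ presupposes that $\mathcal{X}$ is g-convex.) $v\in\partial f(x)$ means $f(y)\ge f(x)+\langle v,\mathrm{Exp}_x^{-1}(y)\rangle$ for $y\in\mathcal{X}$. $f$ is $G$-Lipschitz in $\mathcal{X}$ if $|f(x)-f(y)|\le G\,\mathrm{dist}(x,y)$ for $x,y\in\mathcal{X}$. The uniform geodesic average of a sequence of points $p_1,\dots,p_T$ is the point $\bar p_T$ defined by $\bar p_1=p_1$, $\bar p_{t+1}=\mathrm{Exp}_{\bar p_t}\big(\frac{1}{t+1}\mathrm{Exp}_{\bar p_t}^{-1}(p_{t+1})\big)$. For $r>0$, $\zeta_r = r\sqrt{|\kappa_{\min}|}\coth(r\sqrt{|\kappa_{\min}|})$ if $\kappa_{\min}<0$ and $\zeta_r=1$ otherwise. A point $x$ is an $\epsilon$-minimizer if $f(x)-f(x^* )\le\epsilon$. $O(\cdot)$ hides universal constants only. *)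

(* Defs.v *)
From HB Require Import structures.
From mathcomp Require Import all_boot all_order all_algebra.
From mathcomp Require Import all_classical all_reals all_analysis.

Set Implicit Arguments.
Unset Strict Implicit.
Unset Printing Implicit Defensive.

Import Order.TTheory GRing.Theory Num.Theory.
Import numFieldNormedType.Exports.

Local Open Scope classical_set_scope.
Local Open Scope ring_scope.

Fixpoint class_C (R : realType) (V W : normedModType R) (k : nat) (U : set V)
    (f : V -> W) : Prop :=
  match k with
  | 0%N => forall x, U x -> {for x, continuous f}
  | k'.+1 => (forall x, U x -> differentiable f x) /\
             (forall v : V, class_C k' U ('D_v f))
  end.

(* Only meant for an open set U: derivatives are taken in the whole space. *)
Definition smooth_on (R : realType) (V W : normedModType R) (U : set V)
    (f : V -> W) : Prop :=
  forall k, class_C k U f.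

(* A smooth n-manifold without boundary, given by a smooth atlas: the chart i
   is the homeomorphism mcoord i from the open set mdom i onto an open subset
   of R^n, with inverse mpoint i.  The values of mcoord i and mpoint i outside
   of these sets are irrelevant.  The chart mchart_at p is a choice of a chart
   around p: a tangent vector at p is represented by its row of components in
   this chart, so that the tangent space at p is 'rV[R]_n. *)
Record smoothManifold (R : realType) (n : nat) := SmoothManifold {
  mcarrier :> topologicalType ;
  mchart : Type ;
  mdom : mchart -> set mcarrier ;
  mcoord : mchart -> mcarrier -> 'rV[R]_n ;
  mpoint : mchart -> 'rV[R]_n -> mcarrier ;
  mchart_at : mcarrier -> mchart ;
  mcarrier_hausdorff : hausdorff_space mcarrier ;
  mcarrier_second_countable : @second_countable mcarrier ;
  mdom_chart_at : forall p, mdom (mchart_at p) p ;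
  open_mdom : forall i, open (mdom i) ;
  open_mcoord : forall i, open (mcoord i @` mdom i) ;
  mcoordK : forall i p, mdom i p -> mpoint i (mcoord i p) = p ;
  continuous_mcoord : forall i p, mdom i p -> {for p, continuous (mcoord i)} ;
  continuous_mpoint : forall i p, mdom i p ->
    {for mcoord i p, continuous (mpoint i)} ;
  smooth_transition : forall i j,
    smooth_on (mcoord i @` (mdom i `&` mdom j)) (mcoord j \o mpoint i)
}.

Definition bilin (R : realType) (n : nat) (A : 'M[R]_n) (u w : 'rV[R]_n) : R :=
  (u *m A *m w^T) 0 0.

(* gram i x is the matrix of the metric in the chart i at the point of
   coordinates x. *)
Record riemannianManifold (R : realType) (n : nat) := RiemannianManifold {
  rmanifold :> smoothManifold R n ;
  gram : mchart rmanifold -> 'rV[R]_n -> 'M[R]_n ;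
  gram_smooth : forall i, smooth_on (mcoord i @` mdom i) (gram i) ;
  gram_sym : forall (i : mchart rmanifold) p, mdom i p ->
    (gram i (mcoord i p))^T = gram i (mcoord i p) ;
  gram_pos : forall (i : mchart rmanifold) p u, mdom i p -> u != 0 ->
    0 < bilin (gram i (mcoord i p)) u u ;
  gram_transition : forall (i j : mchart rmanifold) p u w,
    mdom i p -> mdom j p ->
    bilin (gram i (mcoord i p)) u w =
    bilin (gram j (mcoord j p)) ('D_u (mcoord j \o mpoint i) (mcoord i p))
                                ('D_w (mcoord j \o mpoint i) (mcoord i p))
}.

Section LocalMetric.
Variables (R : realType) (n : nat) (g : 'rV[R]_n -> 'M[R]_n).

Definition partial (a : 'I_n) (F : 'rV[R]_n -> R) (x : 'rV[R]_n) : R :=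
  'D_(delta_mx 0 a) F x.

(* christoffel k a b is the symbol with upper index k. *)
Definition christoffel (k a b : 'I_n) (x : 'rV[R]_n) : R :=
  2^-1 * \sum_(l < n) invmx (g x) k l *
    (partial a (fun y => g y b l) x + partial b (fun y => g y a l) x
     - partial l (fun y => g y a b) x).

(* The component along d_l of R(d_a, d_b) d_k, with the sign convention
   R(X, Y) = [nabla_X, nabla_Y] - nabla_[X, Y]. *)
Definition riemann_tensor (l k a b : 'I_n) (x : 'rV[R]_n) : R :=
  partial a (christoffel l b k) x - partial b (christoffel l a k) x
  + \sum_(m < n) (christoffel l a m x * christoffel m b k x
                  - christoffel l b m x * christoffel m a k x).

Definition curvature_op (x u w z : 'rV[R]_n) : 'rV[R]_n :=
  \row_(l < n) \sum_(a < n) \sum_(b < n) \sum_(k < n)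
    riemann_tensor l k a b x * u 0 a * w 0 b * z 0 k.

Definition sectional_curvature (x u w : 'rV[R]_n) : R :=
  bilin (g x) (curvature_op x u w w) u /
  (bilin (g x) u u * bilin (g x) w w - bilin (g x) u w ^+ 2).

End LocalMetric.

Section Riemannian.
Variables (R : realType) (n : nat) (M : riemannianManifold R n).

Implicit Types (p q : M) (u v w : 'rV[R]_n) (c : R -> M) (X : set M)
  (f : M -> R).

Definition inner p u w : R :=
  bilin (gram (mchart_at p) (mcoord (mchart_at p) p)) u w.

Definition sectional_curvature_in (kmin kmax : R) : Prop :=
  forall p u w, row_free (col_mx u w) ->
    kmin <= sectional_curvature (gram (mchart_at p))
              (mcoord (mchart_at p) p) u w <= kmax.

Definition velocity c (t : R) : 'rV[R]_n :=
  derive1 (mcoord (mchart_at (c t)) \o c) t.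

Definition geodesic_at c (t : R) : Prop :=
  {for t, continuous c} /\
  forall i : mchart M, mdom i (c t) ->
    let x := mcoord i \o c in
    let x' := derive1 x in
    let x'' := derive1 x' in
    [/\ \forall s \near t, derivable x s 1,
        derivable x' t 1 &
        forall k, x'' t 0 k
          + \sum_(a < n) \sum_(b < n)
              christoffel (gram i) k a b (x t) * x' t 0 a * x' t 0 b
          = 0].

(* Curves on [0, 1] are represented by the restriction to [0, 1] of curves
   R -> M which are regular on an open neighbourhood of [0, 1]; only this
   restriction matters. *)
Definition geodesic c : Prop :=
  exists2 d : R, 0 < d & forall t, - d < t < 1 + d -> geodesic_at c t.

Definition geodesic_joins c p q : Prop := [/\ geodesic c, c 0 = p & c 1 = q].

Definition uniquely_geodesic : Prop :=
  forall p q,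
    (exists c, geodesic_joins c p q) /\
    (forall c1 c2, geodesic_joins c1 p q -> geodesic_joins c2 p q ->
       {in `[0, 1], c1 =1 c2}).

Definition C1_at c (t : R) : Prop :=
  {for t, continuous c} /\
  forall i : mchart M, mdom i (c t) ->
    (\forall s \near t, derivable (mcoord i \o c) s 1) /\
    {for t, continuous (derive1 (mcoord i \o c))}.

Definition C1_curve c : Prop :=
  exists2 d : R, 0 < d & forall t, - d < t < 1 + d -> C1_at c t.

Definition curve_length c : R :=
  \int[lebesgue_measure]_(t in `[0, 1])
    Num.sqrt (inner (c t) (velocity c t) (velocity c t)).

(* The lengths of the piecewise C^1 curves from p to q, seen as finite
   concatenations of C^1 curves. *)
Inductive piecewise_C1_length : M -> M -> R -> Prop :=
| piecewise_C1_nil p : piecewise_C1_length p p 0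
| piecewise_C1_cons c q l : C1_curve c -> piecewise_C1_length (c 1) q l ->
    piecewise_C1_length (c 0) q (curve_length c + l).

Definition dist p q : R := inf [set l | piecewise_C1_length p q l].

Definition closed_riemannian_ball p (r : R) : set M := [set q | dist p q <= r].

Definition is_exp p v q : Prop :=
  exists2 c, geodesic_joins c p q & velocity c 0 = v.

(* No completeness is assumed: the exponential map at p is a partial function,
   with domain exp_dom p (and value p outside of its domain). *)
Definition exp_dom p : set 'rV[R]_n := [set v | exists q, is_exp p v q].

Definition Exp p v : M := xget p [set q | is_exp p v q].

Definition Log p q : 'rV[R]_n := xget 0 [set v | is_exp p v q].

Definition gconvex_set X : Prop :=
  forall p q, X p -> X q ->
    exists2 c, geodesic_joins c p q & forall t, 0 <= t <= 1 -> X (c t).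

Definition gconvex_on X f : Prop :=
  gconvex_set X /\
  forall c, geodesic c -> (forall t, 0 <= t <= 1 -> X (c t)) ->
    forall t, 0 <= t <= 1 -> f (c t) <= (1 - t) * f (c 0) + t * f (c 1).

Definition subdifferential X f p : set 'rV[R]_n :=
  [set v | forall q, X q -> f q >= f p + inner p v (Log p q)].

Definition glipschitz_on (G : R) X f : Prop :=
  forall p q, X p -> X q -> `|f p - f q| <= G * dist p q.

(* Indices start from 0: geodesic_average s t is the average of the t.+1
   points s 0, ..., s t. *)
Fixpoint geodesic_average (s : nat -> M) (t : nat) : M :=
  match t with
  | 0%N => s 0%N
  | t'.+1 => let b := geodesic_average s t' in
             Exp b (t'.+2%:R^-1 *: Log b (s t'.+1))
  end.

End Riemannian.

Definition coth (R : realType) (r : R) : R :=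
  (expR r + expR (- r)) / (expR r - expR (- r)).

Definition zeta (R : realType) (kmin r : R) : R :=
  if kmin < 0 then r * Num.sqrt `|kmin| * coth (r * Num.sqrt `|kmin|) else 1.

(* Main.v *)
(* Let [p] be the minimizer.  Along one step [g] of the method the function
   [h s = dist p (g s) ^+ 2 / 2] satisfies [h'' <= zeta * |g'| ^+ 2] in the barrier
   sense as long as [g s] stays at distance at most [sqrt 2 * r] from [p], hence
     dist p (g 1) ^+ 2 <= dist p (g 0) ^+ 2 - 2 <Log p, g'(0)> + zeta * |g'(0)| ^+ 2;
   the subgradient inequality and the choice of the step size then telescope, give
   [dist p (x t) ^+ 2 <= r ^+ 2 * (1 + t / T)], and bound the mean of [f (x t) - f p].

   Completeness is not assumed, so the usual exponential-map arguments are not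
   available.  That the unique geodesic minimizes length is obtained as follows:
   short geodesics minimize by an energy estimate in a chart, and along a geodesic
   from [p] the local minimality of the junction point of a broken geodesic is
   continued from one parameter to the next, by shortcutting corners, because the
   shortcut map has the junction as its only fixed point.  The barrier comes from the
   second variation, for the variation field [(f t / f 1) * E t] with [E] parallel and
   [f'' = k ^+ 2 * f]; the bound is propagated chart by chart along the geodesic from
   [p], so that conjugate points play no role. *)

Require Import Defs.
From HB Require Import structures.
From mathcomp Require Import all_boot all_order all_algebra.
From mathcomp Require Import all_classical all_reals all_analysis.
From mathcomp Require Import ring lra.

Set Implicit Arguments.
Unset Strict Implicit.
Unset Printing Implicit Defensive.

Import Order.TTheory GRing.Theory Num.Theory.
Import numFieldNormedType.Exports.

Local Open Scope classical_set_scope.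
Local Open Scope ring_scope.

(** [uniquely_geodesic] compares geodesics with the same two ends. It says nothing about lengths,
    about dependence on the ends or about initial velocities, while [dist] is an infimum over all
    piecewise C^1 curves. The link is that a function which is infinitesimally 1-Lipschitz cannot
    grow along a curve by more than its length. So the geodesic length from [p] equals the distance
    as soon as it satisfies the triangle inequality between nearby points; this inequality, with
    continuity of the geodesic in its end, is what the continuation transports. That the initial
    velocity determines a geodesic is proved separately, from the differential equation.

    The radius [sqrt 2 * r] is circular: the barrier is valid inside the ball only, and the iterates
    stay there because of the barrier. Across steps the budget [r ^+ 2 / T] per step closes the
    circle; within a step a minimum argument does, applied to the excess over a parabola.

    Barriers bound [dist] by [(q / lam + lam) / 2], with [q] an energy and [lam] free. Such bounds
    add up over consecutive charts; optimizing over [lam] at the end gives the bound on the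
    square. *)

Ltac gn := repeat match goal with
  |- context [@Num.Def.normr ?a ?b ?x] => move: (@Num.Def.normr a b x) => ? end.

(** * Calculus *)

Section Calculus1.
Variable R : realType.
Implicit Types (t s : R).

Lemma is_derive_mxP (m n : nat) (M : R -> 'M[R]_(m, n)) t (A : 'M[R]_(m, n)) :
  is_derive t 1 M A <-> forall i j, is_derive t 1 (fun s => M s i j) (A i j).
Proof.
split=> [[dM <-] i j|h].
  split; first by have /derivable_mxP := dM; apply.
  by rewrite derive_mx// mxE.
have dM : derivable M t 1 by apply/derivable_mxP => i j; case: (h i j).
split=> //; rewrite derive_mx//; apply/matrixP => i j; rewrite mxE.
by case: (h i j).
Qed.

Lemma is_derive_id1 t : is_derive t 1 (fun s : R => s) 1.
Proof. exact: is_derive_id. Qed.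

Lemma is_derive_diff_comp (V W : normedModType R) (F : V -> W) (x : R -> V) t v :
  differentiable F (x t) -> is_derive t 1 x v ->
  is_derive t 1 (fun s => F (x s)) ('D_v F (x t)).
Proof.
move=> dF [/derivable1_diffP dx xv].
have dFx : differentiable (F \o x) t by exact: differentiable_comp.
split; first exact/derivable1_diffP.
rewrite -[LHS]/('D_1 (F \o x) t) (deriveE _ dFx) diff_comp//=.
by rewrite -(deriveE _ dx) xv deriveE.
Qed.

Lemma is_derive_continuous (V : normedModType R) (f : R -> V) t v :
  is_derive t 1 f v -> {for t, continuous f}.
Proof.
by move=> [/derivable1_diffP df _]; exact: differentiable_continuous.
Qed.

Lemma is_derive_unique (V : normedModType R) (f : R -> V) t v w :
  is_derive t 1 f v -> is_derive t 1 f w -> v = w.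
Proof. by move=> [_ <-] [_ <-]. Qed.

Lemma is_derive_affine (V : normedModType R) (f : R -> V) (a b : R) t v :
  is_derive (a + b * t) 1 f v -> is_derive t 1 (fun s => f (a + b * s)) (b *: v).
Proof.
move=> df.
have dab : is_derive t 1 (fun s : R => a + b * s) b.
  have h1 := @is_derive_cst R R R a t 1.
  have h2 : is_derive t 1 (b *: @id R) (b *: 1).
    by apply: is_deriveZ; exact: is_derive_id.
  by have := is_deriveD h1 h2; rewrite add0r [b *: 1]mulr1; apply.
have [/derivable1_diffP df' fv] := df.
have := @is_derive_diff_comp _ _ f (fun s => a + b * s) t b df' dab.
congr is_derive; rewrite (deriveE _ df') -fv (deriveE _ df').
by rewrite -linearZ/= [b *: 1]mulr1.
Qed.

Lemma is_derive_near (V : normedModType R) (f g : R -> V) t v :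
  (\near t, f t = g t) -> is_derive t 1 f v -> is_derive t 1 g v.
Proof. exact: near_eq_is_derive. Qed.

Lemma MVT_is_derive (f df : R -> R) (a b : R) : a <= b ->
  (forall t, a <= t <= b -> is_derive t 1 f (df t)) ->
  exists2 c, a <= c <= b & f b - f a = df c * (b - a).
Proof.
move=> ab h.
have [|| c] := @MVT_segment _ f df a b ab.
- by move=> x; rewrite in_itv/= => /andP[ax xb]; apply: h; rewrite !ltW.
- apply: derivable_within_continuous => x; rewrite in_itv/= => /h.
  by case.
by rewrite in_itv/= => cab e; exists c.
Qed.

Lemma derive_ge0_le (f df : R -> R) (a b : R) : a <= b ->
  (forall t, a <= t <= b -> is_derive t 1 f (df t)) ->
  (forall t, a <= t <= b -> 0 <= df t) -> f a <= f b.
Proof.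
move=> ab h h0; have [c cab e] := MVT_is_derive ab h.
by rewrite -subr_ge0 e mulr_ge0 ?h0// subr_ge0.
Qed.

Lemma derive_le_le (f df g dg : R -> R) (a b : R) : a <= b ->
  (forall t, a <= t <= b -> is_derive t 1 f (df t)) ->
  (forall t, a <= t <= b -> is_derive t 1 g (dg t)) ->
  (forall t, a <= t <= b -> df t <= dg t) -> f b - f a <= g b - g a.
Proof.
move=> ab hf hg h.
have := @derive_ge0_le (fun t => g t - f t) (fun t => dg t - df t) a b ab.
have H1 : forall t, a <= t <= b ->
    is_derive t 1 (fun t : R => g t - f t) (dg t - df t).
  by move=> t tab; apply: is_deriveB; [exact: hg|exact: hf].
have H2 : forall t, a <= t <= b -> 0 <= dg t - df t.
  by move=> t tab; rewrite subr_ge0 h.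
by move=> /(_ H1 H2); lra.
Qed.

Lemma derive0_cst (f : R -> R) (a b : R) : a <= b ->
  (forall t, a <= t <= b -> is_derive t 1 f 0) -> f a = f b.
Proof.
move=> ab h; have [c cab] := @MVT_is_derive f (fun=> 0) a b ab h.
by rewrite mul0r; lra.
Qed.

(** A nondecreasing function without total increase is constant. It serves the equality case of the
    energy comparison. *)
Lemma derive_eq0_of_ends (f df : R -> R) (a b : R) : a < b ->
  (forall t, a <= t <= b -> is_derive t 1 f (df t)) ->
  (forall t, a <= t <= b -> 0 <= df t) -> f b <= f a ->
  forall t, a < t < b -> df t = 0.
Proof.
move=> ab h h0 fba t /andP[a_t tb].
have mono s1 s2 : a <= s1 -> s1 <= s2 -> s2 <= b -> f s1 <= f s2.
  move=> as1 s12 s2b; apply: (derive_ge0_le s12) => u /andP[u1 u2].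
    by apply: h; rewrite (le_trans as1 u1) (le_trans u2 s2b).
  by apply: h0; rewrite (le_trans as1 u1) (le_trans u2 s2b).
have fcst s : a <= s <= b -> f s = f a.
  move=> /andP[as_ sb]; apply/eqP; rewrite eq_le [f a <= _]mono// andbT.
  by rewrite (le_trans _ fba)// mono.
have dt : is_derive t 1 f (df t) by apply: h; rewrite !ltW.
apply: (is_derive_unique dt).
apply: (is_derive_near _ (is_derive_cst (f a) t 1)).
near=> s; rewrite fcst//; apply/andP; split; apply: ltW; near: s.
  exact: lt_nbhsr.
exact: lt_nbhsl.
Unshelve. all: by end_near. Qed.

(** Connectedness of the interval, in the form on which the continuations below rest: the supremum
    of the points where [P] holds is approached by such points, and the local hypothesis carries [P]
    past it. Transport in one direction suffices, so [P] can be a bound with an accumulated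
    error. *)
Lemma local_propagation (P : R -> Prop) (a b : R) : a <= b -> P a ->
  (forall s, a <= s <= b -> exists2 d, 0 < d & forall s1 s2,
     a <= s1 <= b -> a <= s2 <= b -> `|s1 - s| < d -> `|s2 - s| < d ->
     s1 <= s2 -> P s1 -> P s2) ->
  P b.
Proof.
move=> ab Pa H; pose T := [set s | a <= s <= b /\ P s].
have supT : has_sup T.
  split; first by exists a; split => //; rewrite lexx.
  by exists b => s [/andP[]].
have aT : a <= sup T by apply: ub_le_sup => //; [case: supT|split=> //; rewrite lexx].
have Tb : sup T <= b.
  by apply: ge_sup; [case: supT|move=> s [/andP[]]].
have [d d0 Hd] : exists2 d, 0 < d & forall s1 s2,
     a <= s1 <= b -> a <= s2 <= b -> `|s1 - sup T| < d -> `|s2 - sup T| < d ->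
     s1 <= s2 -> P s1 -> P s2 by apply: H; rewrite aT.
have [s1 [s1ab Ps1] s1d] := sup_adherent d0 supT.
have s1T : s1 <= sup T by apply: ub_le_sup => //; case: supT.
have [bT|bT] := leP b (sup T).
  have -> : b = sup T by apply/eqP; rewrite eq_le bT Tb.
  apply: (Hd s1) => //; first by rewrite aT Tb.
    by rewrite ler0_norm ?subr_le0//; lra.
  by rewrite subrr normr0.
pose s2 := Num.min b (sup T + d / 2).
have s2T : sup T < s2 by rewrite lt_min bT/=; lra.
have s2b : s2 <= b by rewrite ge_min lexx.
have s2d : s2 <= sup T + d / 2 by rewrite ge_min lexx orbT.
suff /(ub_le_sup supT.2) : T s2 by rewrite leNgt s2T.
split; first by rewrite s2b andbT; lra.
apply: (Hd s1) => //; first by rewrite s2b andbT; lra.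
- by rewrite ler0_norm ?subr_le0//; lra.
- by rewrite gtr0_norm ?subr_gt0//; lra.
- by lra.
Qed.

(** Precomposition with [clamp a b] turns a function controlled on [a, b] into one that is
    continuous on the whole line, where the integrals and the fixed point theorem are stated. *)
Definition clamp (a b t : R) : R := Num.max a (Num.min b t).

Lemma clamp_in a b t : a <= b -> a <= clamp a b t <= b.
Proof. by move=> ab; rewrite /clamp le_max lexx/= ge_max ab ge_min lexx. Qed.

Lemma clamp_id a b t : a <= t <= b -> clamp a b t = t.
Proof. by move=> /andP[a_t tb]; rewrite /clamp min_r// max_r. Qed.

Lemma clamp_continuous a b : continuous (clamp a b).
Proof.
move=> t; apply: (@continuous_max R R (fun=> a) (fun t => Num.min b t)).
  exact: cst_continuous.
apply: (@continuous_min R R (fun=> b) id); first exact: cst_continuous.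
exact: cvg_id.
Qed.

(** The primitive that vanishes at 0. Integration starts at -3 so that it is differentiable at
    negative times too; the time intervals in use stay to the right of -3. *)
Definition prim1 (u : R -> R) (t : R) : R :=
  \int[lebesgue_measure]_(s in `[-3, t]) u s
  - \int[lebesgue_measure]_(s in `[-3, 0]) u s.

Lemma prim1_0 u : prim1 u 0 = 0. Proof. by rewrite /prim1 subrr. Qed.

Lemma is_derive_prim1 u t : continuous u -> -3 < t ->
  is_derive t 1 (prim1 u) (u t).
Proof.
move=> cu t3.
have [||//||d e] := @continuous_FTC1_closed R u (-3) t (t + 1).
- by rewrite ltrDl.
- apply: continuous_compact_integrable; first exact: segment_compact.
  exact: continuous_subspaceT.
- exact: cu.
rewrite derive1E in e.
rewrite -[u t]subr0; apply: is_deriveB.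
by split.
Qed.

Lemma curve_integral (f : R -> R) : continuous f ->
  \int[lebesgue_measure]_(s in `[0, 1]) f s = prim1 f 1.
Proof.
move=> cf; rewrite /Rintegral.
rewrite (@continuous_FTC2 R f (prim1 f) 0 1)//.
- by rewrite prim1_0 sube0.
- exact: continuous_subspaceT.
- have d (x : R) : -3 < x -> is_derive x 1 (prim1 f) (f x).
    exact: is_derive_prim1.
  split.
  + move=> x; rewrite in_itv/= => /andP[x0 _]; have [] // := d x; lra.
  + by apply/cvg_at_right_filter/(is_derive_continuous (d 0 _)); lra.
  + by apply/cvg_at_left_filter/(is_derive_continuous (d 1 _)); lra.
- move=> x; rewrite in_itv/= => /andP[x0 _]; rewrite derive1E.
  by have [] // := @is_derive_prim1 f x cf; lra.
Qed.

Definition prim n (u : R -> 'rV[R]_n) (t : R) : 'rV[R]_n :=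
  \row_i prim1 (fun s => u s 0 i) t.

Lemma prim_0 n (u : R -> 'rV[R]_n) : prim u 0 = 0.
Proof. by apply/rowP => i; rewrite !mxE prim1_0. Qed.

Lemma continuous_coord (T : topologicalType) m n (u : T -> 'M[R]_(m, n)) (x : T)
    (i : 'I_m) (j : 'I_n) :
  {for x, continuous u} -> {for x, continuous (fun s : T => u s i j)}.
Proof.
move=> cu; apply: (@continuous_comp _ _ _ u (fun M : 'M[R]_(m, n) => M i j)) => //.
by apply: differentiable_continuous; exact: differentiable_coord.
Qed.

Lemma is_derive_prim n (u : R -> 'rV[R]_n) t : continuous u -> -3 < t ->
  is_derive t 1 (prim u) (u t).
Proof.
move=> cu t3; apply/is_derive_mxP => i j; rewrite ord1.
rewrite [X in is_derive _ _ X _](_ : _ = prim1 (fun s => u s 0 j)).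
  by apply: is_derive_prim1 => // x; apply: continuous_coord; exact: cu.
by apply/funext => s; rewrite mxE.
Qed.

Lemma mx_norm_le m n (A : 'M[R]_(m, n)) e : 0 <= e ->
  (forall i j, `|A i j| <= e) -> `|A| <= e.
Proof.
move=> e0 h; rewrite [leLHS]/Num.Def.normr/= mx_normrE.
by apply: bigmax_le => // -[i j] _; exact: h.
Qed.

Lemma le_mx_norm m n (A : 'M[R]_(m, n)) i j : `|A i j| <= `|A|.
Proof.
rewrite [leRHS]/Num.Def.normr/= mx_normrE.
exact: (@le_bigmax _ _ _ _ (fun ij => `|A ij.1 ij.2|) (i, j)).
Qed.

(** The norm of a matrix is its largest entry, so the scalar mean value theorem applies entry by
    entry without loss in the constant. *)
Lemma derive_norm_le m n (f df : R -> 'M[R]_(m, n)) a b K : a <= b ->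
  (forall t, a <= t <= b -> is_derive t 1 f (df t)) ->
  (forall t, a <= t <= b -> `|df t| <= K) -> `|f b - f a| <= K * (b - a).
Proof.
move=> ab h hK.
have K0 : 0 <= K by rewrite (le_trans _ (hK a _))// ?lexx.
apply: mx_norm_le => [|i j]; first by rewrite mulr_ge0// subr_ge0.
have [|c cab e] := @MVT_is_derive (fun s => f s i j) (fun s => df s i j) a b ab.
  by move=> t /h /is_derive_mxP.
rewrite !mxE e normrM [`|b - a|]ger0_norm ?subr_ge0//.
by rewrite ler_wpM2r ?subr_ge0// (le_trans (le_mx_norm _ i j))// hK.
Qed.

Lemma derive_norm_le2 m n (f df : R -> 'M[R]_(m, n)) a b K s t :
  (forall t, a <= t <= b -> is_derive t 1 f (df t)) ->
  (forall t, a <= t <= b -> `|df t| <= K) ->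
  a <= s <= b -> a <= t <= b -> `|f t - f s| <= K * `|t - s|.
Proof.
move=> h hK; wlog st : s t / s <= t.
  move=> H sab tab; have [st|/ltW ts] := leP s t; first exact: H.
  by rewrite distrC [`|t - s|]distrC H.
move=> /andP[as_ _] /andP[_ tb]; rewrite [`|t - s|]ger0_norm ?subr_ge0//.
apply: (derive_norm_le st) => u /andP[su ut]; [apply: h|apply: hK];
  by rewrite (le_trans as_ su) (le_trans ut tb).
Qed.

End Calculus1.

(** * Functions of class C^k: closure properties and symmetry of second derivatives *)

Section MultivariateCalculus.
Variable R : realType.

Lemma differentiable_near (V W : normedModType R) (f g : V -> W) x :
  (\near x, f x = g x) -> differentiable f x -> differentiable g x.
Proof.
move=> fg /diff_locallyP[cd /eqaddoP h].
have hg : g \o shift x = cst (g x) + 'd f x +o_ (0 : V) id.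
  apply/eqaddoP => e e0; have := h e e0.
  have fgx : f x = g x by exact: nbhs_singleton fg.
  have : \forall h \near (0 : V), f (h + x) = g (h + x).
    by move: fg; rewrite (near_shift 0 x)/= subr0.
  move=> H1 H2; apply: filterS2 H1 H2 => y H1.
  by rewrite !fctE/= H1 fgx.
by apply/diff_locallyP; rewrite (diff_unique cd hg).
Qed.

Lemma open_near (V : normedModType R) (U : set V) (P : V -> Prop) x :
  open U -> U x -> (forall y, U y -> P y) -> \near x, P x.
Proof.
move=> oU Ux h; apply: filterS (open_nbhs_nbhs (conj oU Ux)) => y; exact: h.
Qed.

Lemma class_C_eq (V W : normedModType R) k (U : set V) (f g : V -> W) :
  open U -> (forall x, U x -> f x = g x) -> class_C k U f -> class_C k U g.
Proof.
move=> oU; elim: k f g => [|k IH] f g fg /=.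
  move=> h x Ux; have fgx : \near x, f x = g x by exact: (open_near oU Ux fg).
  rewrite /prop_for /continuous_at -fg//; apply: cvg_trans (h x Ux).
  by apply: near_eq_cvg; exact: filterS fgx.
move=> [h1 h2]; split.
  move=> x Ux; apply: differentiable_near (h1 x Ux).
  exact: (open_near oU Ux fg).
move=> v; apply: IH (h2 v) => x Ux; apply: near_eq_derive.
exact: (open_near oU Ux fg).
Unshelve. all: by end_near. Qed.

Lemma class_CS (V W : normedModType R) k (U : set V) (f : V -> W) :
  class_C k.+1 U f -> class_C k U f.
Proof.
elim: k f => [|k IH] f [h1 h2].
  by move=> x Ux; apply: differentiable_continuous; exact: h1.
by split=> // v; apply: IH; exact: h2.
Qed.

Lemma class_C_cst (V W : normedModType R) k (U : set V) (a : W) :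
  class_C k U (fun _ : V => a).
Proof.
elim: k a => [|k IH] a /=; first by move=> x _; exact: cst_continuous.
split; first by move=> x _; exact: differentiable_cst.
move=> v; have -> : 'D_v (fun _ : V => a) = (fun _ => 0).
  by apply/funext => x; exact: derive_cst.
exact: IH.
Qed.

Lemma class_CD (V W : normedModType R) k (U : set V) (f g : V -> W) : open U ->
  class_C k U f -> class_C k U g -> class_C k U (fun x => f x + g x).
Proof.
move=> oU; elim: k f g => [|k IH] f g /=.
  by move=> hf hg x Ux; apply: continuousD; [exact: hf|exact: hg].
move=> [f1 f2] [g1 g2]; split.
  by move=> x Ux; apply: differentiableD; [exact: f1|exact: g1].
move=> v; apply: class_C_eq (IH _ _ (f2 v) (g2 v)) => // x Ux.
by rewrite -deriveD//; apply: diff_derivable; [exact: f1|exact: g1].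
Qed.

Lemma class_CM (V : normedModType R) k (U : set V) (f g : V -> R) : open U ->
  class_C k U f -> class_C k U g -> class_C k U (fun x => f x * g x).
Proof.
move=> oU; elim: k f g => [|k IH] f g.
  by move=> hf hg x Ux; apply: continuousM; [exact: hf|exact: hg].
move=> hf hg; have [f1 f2] := hf; have [g1 g2] := hg; split.
  by move=> x Ux; apply: differentiableM; [exact: f1|exact: g1].
move=> v; have h1 := IH _ _ (class_CS hf) (g2 v).
have h2 := IH _ _ (class_CS hg) (f2 v).
apply: class_C_eq (class_CD oU h1 h2) => // x Ux.
by rewrite -[RHS]/('D_v (f * g) x) deriveM//; apply: diff_derivable;
  [exact: f1|exact: g1].
Qed.

Lemma class_CZ (V : normedModType R) k (U : set V) (c : R) (f : V -> R) : open U ->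
  class_C k U f -> class_C k U (fun x => c * f x).
Proof. by move=> oU; apply: class_CM => //; exact: class_C_cst. Qed.

Lemma class_CN (V : normedModType R) k (U : set V) (f : V -> R) : open U ->
  class_C k U f -> class_C k U (fun x => - f x).
Proof.
move=> oU /(class_CZ (-1) oU); apply: class_C_eq => // x _.
by rewrite mulN1r.
Qed.

Lemma class_CV (V : normedModType R) k (U : set V) (f : V -> R) : open U ->
  (forall x, U x -> f x != 0) ->
  class_C k U f -> class_C k U (fun x => (f x)^-1).
Proof.
move=> oU f0; elim: k => [|k IH].
  by move=> hf x Ux; apply: continuousV; [exact: f0|exact: hf].
move=> hf; have [f1 f2] := hf; split.
  by move=> x Ux; apply: differentiableV; [exact: f1|exact: f0].
move=> v; have h := IH (class_CS hf).
apply: class_C_eq (class_CN oU (class_CM oU (class_CM oU h h) (f2 v))) => //.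
move=> x Ux; rewrite deriveV ?f0//; last by apply: diff_derivable; exact: f1.
by rewrite -[_ *: _]/(_ * _) mulNr; congr (- (_ * _)); rewrite expr2 invfM.
Qed.

Lemma class_C_sum (V : normedModType R) k (U : set V) (I : Type) (r : seq I)
    (P : pred I) (f : I -> V -> R) : open U -> (forall i, class_C k U (f i)) ->
  class_C k U (fun x => \sum_(i <- r | P i) f i x).
Proof.
move=> oU h; elim: r => [|i r IH].
  apply: class_C_eq (class_C_cst k U 0) => // x _; by rewrite big_nil.
have [Pi|nPi] := boolP (P i).
  by apply: class_C_eq (class_CD oU (h i) IH) => // x _; rewrite big_cons Pi.
by apply: class_C_eq IH => // x _; rewrite big_cons (negbTE nPi).
Qed.

Lemma class_C_prod (V : normedModType R) k (U : set V) (I : Type) (r : seq I)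
    (P : pred I) (f : I -> V -> R) : open U -> (forall i, class_C k U (f i)) ->
  class_C k U (fun x => \prod_(i <- r | P i) f i x).
Proof.
move=> oU h; elim: r => [|i r IH].
  by apply: class_C_eq (class_C_cst k U (1 : R)) => // x _; rewrite big_nil.
have [Pi|nPi] := boolP (P i).
  by apply: class_C_eq (class_CM oU (h i) IH) => // x _; rewrite big_cons Pi.
by apply: class_C_eq IH => // x _; rewrite big_cons (negbTE nPi).
Qed.

Lemma differentiable_entry (V : normedModType R) m n (f : V -> 'M[R]_(m, n)) x
   (i : 'I_m) (j : 'I_n) :
  differentiable f x -> differentiable (fun y => f y i j) x.
Proof.
move=> df.
apply: (@differentiable_comp R V _ _ f (fun M : 'M[R]_(m, n) => M i j)) => //.
exact: differentiable_coord.
Qed.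

Lemma derive_entry (V : normedModType R) m n (f : V -> 'M[R]_(m, n)) x v
   (i : 'I_m) (j : 'I_n) :
  derivable f x v -> ('D_v f x) i j = 'D_v (fun y => f y i j) x.
Proof. by move=> df; rewrite derive_mx// mxE. Qed.

Lemma class_C_entry (V : normedModType R) k (U : set V) m n
    (f : V -> 'M[R]_(m, n)) (i : 'I_m) (j : 'I_n) : open U ->
  class_C k U f -> class_C k U (fun y => f y i j).
Proof.
move=> oU; elim: k f => [|k IH] f.
  by move=> h x Ux; apply: continuous_coord; exact: h.
move=> [h1 h2]; split.
  by move=> x Ux; apply: differentiable_entry; exact: h1.
move=> v; apply: class_C_eq (IH _ (h2 v)) => // x Ux.
by rewrite derive_entry//; apply: diff_derivable; exact: h1.
Qed.

Lemma class_C_det (V : normedModType R) k (U : set V) n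
    (A : V -> 'M[R]_n) : open U ->
  (forall i j, class_C k U (fun x => A x i j)) ->
  class_C k U (fun x => \det (A x)).
Proof.
move=> oU h; rewrite /determinant; apply: class_C_sum => // s.
by apply: class_CZ => //; apply: class_C_prod.
Qed.

Lemma class_C_invmx (V : normedModType R) k (U : set V) n
    (A : V -> 'M[R]_n) : open U ->
  (forall x, U x -> A x \in unitmx) ->
  (forall i j, class_C k U (fun x => A x i j)) ->
  forall i j, class_C k U (fun x => invmx (A x) i j).
Proof.
move=> oU uA h i j.
have hd := class_C_det oU h.
have hdV : class_C k U (fun x => (\det (A x))^-1).
  by apply: class_CV => // x /uA; rewrite unitmxE unitfE.
have hc : class_C k U (fun x => cofactor (A x) j i).
  rewrite /cofactor; apply: class_CZ => //; apply: class_C_det => // a b.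
  by apply: class_C_eq (h (lift j a) (lift i b)) => // x _; rewrite !mxE.
apply: class_C_eq (class_CM oU hdV hc) => // x /uA uAx.
by rewrite /invmx uAx !mxE.
Qed.

Lemma deriveDr (V W : normedModType R) (f : V -> W) x u w : differentiable f x ->
  'D_(u + w) f x = 'D_u f x + 'D_w f x.
Proof. by move=> df; rewrite !deriveE// linearD. Qed.

Lemma deriveZr (V W : normedModType R) (f : V -> W) x c u : differentiable f x ->
  'D_(c *: u) f x = c *: 'D_u f x.
Proof. by move=> df; rewrite !deriveE// linearZ. Qed.

Lemma derive_sum_delta (W : normedModType R) n (f : 'rV[R]_n -> W) x u :
  differentiable f x ->
  'D_u f x = \sum_(a < n) u 0 a *: 'D_(delta_mx 0 a) f x.
Proof.
move=> df; rewrite [in LHS](row_sum_delta u) deriveE// linear_sum.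
by apply: eq_bigr => a _; rewrite linearZ deriveE.
Qed.

Lemma is_derive_line (V W : normedModType R) (f : V -> W) x u (t : R) :
  differentiable f (x + t *: u) ->
  is_derive t 1 (fun s : R => f (x + s *: u)) ('D_u f (x + t *: u)).
Proof.
move=> df; apply: (@is_derive_diff_comp R V W f (fun s => x + s *: u)) => //.
have h1 := @is_derive_cst R R V x t 1.
have h2 : is_derive t 1 (fun s : R => s *: u) u.
  have := @is_diff_scalel R V t u.
  move=> [d1 d2]; split; first exact/derivable1_diffP.
  by rewrite deriveE// d2 scale1r.
by have := is_deriveD h1 h2; rewrite add0r; apply.
Qed.

End MultivariateCalculus.

Section Schwarz.
Variable R : realType.

Lemma nbhs_normP (V : normedModType R) (x : V) (P : V -> Prop) :
  (\near x, P x) <-> exists2 d : R, 0 < d & forall y, `|y - x| < d -> P y.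
Proof.
split=> [/nbhs_ballP[d /= d0 h]|[d d0 h]].
  by exists d => // y yx; apply: h; rewrite -ball_normE/= distrC.
apply/nbhs_ballP; exists d => //= y; rewrite -ball_normE/= distrC; exact: h.
Qed.

Lemma continuous_normP (V W : normedModType R) (f : V -> W) (x : V) :
  {for x, continuous f} <->
  forall e, 0 < e -> exists2 d : R, 0 < d &
    forall y, `|y - x| < d -> `|f y - f x| < e.
Proof.
split=> [/cvgrPdist_lt h e /h /nbhs_normP[d d0 hd]|h].
  by exists d => // y /hd; rewrite distrC.
apply/cvgrPdist_lt => e /h[d d0 hd]; apply/nbhs_normP; exists d => // y /hd.
by rewrite distrC.
Qed.

Lemma open_normP (V : normedModType R) (U : set V) x : open U -> U x ->
  exists2 d : R, 0 < d & forall y, `|y - x| < d -> U y.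
Proof.
by move=> oU Ux; apply/nbhs_normP; exact: open_nbhs_nbhs.
Qed.

(** The mean value theorem in the direction [u], then in the direction [w]. The left side is
    symmetric in [u] and [w], so the two mixed derivatives take a common value at points near
    [x]. *)
Lemma second_difference (V : normedModType R) (U : set V) (f : V -> R) x u w (h d : R) :
  0 < h -> (forall y, `|y - x| < d -> U y) ->
  h * (`|u| + `|w|) < d -> class_C 2 U f ->
  exists2 y, `|y - x| <= h * (`|u| + `|w|) &
    f (x + h *: u + h *: w) - f (x + h *: u) - f (x + h *: w) + f x =
    h ^+ 2 * 'D_w ('D_u f) y.
Proof.
move=> h0 hU hd [f1 f2].
have dU (s t : R) : 0 <= s <= h -> 0 <= t <= h ->
    `|x + s *: u + t *: w - x| <= h * (`|u| + `|w|).
  move=> /andP[s0 sh] /andP[t0 th].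
  rewrite (addrAC (x + s *: u)) (addrAC x) subrr add0r.
  rewrite (le_trans (ler_normD _ _))// !normrZ mulrDr.
  by rewrite !ger0_norm// lerD// ler_wpM2r.
have Us (s t : R) : 0 <= s <= h -> 0 <= t <= h -> U (x + s *: u + t *: w).
  by move=> s1 t1; apply: hU; apply: le_lt_trans hd; exact: dU.
have h00 : 0 <= (0 : R) <= h by rewrite lexx ltW.
have hh : 0 <= h <= h by rewrite lexx ltW.
pose g (s : R) := f (x + h *: w + s *: u) - f (x + s *: u).
pose dg (s : R) := 'D_u f (x + h *: w + s *: u) - 'D_u f (x + s *: u).
have [|s s01 es] := @MVT_is_derive R g dg 0 h (ltW h0).
  move=> s sh; apply: is_deriveB; apply: is_derive_line; apply: f1.
    by rewrite addrAC; exact: Us.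
  by have := Us s 0 sh h00; rewrite scale0r addr0.
pose k (t : R) := 'D_u f (x + s *: u + t *: w).
pose dk (t : R) := 'D_w ('D_u f) (x + s *: u + t *: w).
have [|t t01 et] := @MVT_is_derive R k dk 0 h (ltW h0).
  by move=> t th; apply: is_derive_line; apply: (f2 u).1; exact: Us.
exists (x + s *: u + t *: w); first exact: dU.
transitivity (g h - g 0).
  by rewrite /g !scale0r !addr0 [x + h *: w + _]addrAC; ring.
rewrite es subr0 /dg.
have -> : 'D_u f (x + h *: w + s *: u) - 'D_u f (x + s *: u) = k h - k 0.
  by rewrite /k scale0r addr0 [x + s *: u + _]addrAC.
by rewrite et /dk subr0 expr2; ring.
Qed.

Lemma eq_of_close_values (V : normedModType R) (P Q : V -> R) (x : V) :
  {for x, continuous P} -> {for x, continuous Q} ->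
  (forall m : R, 0 < m -> exists y1 y2, [/\ `|y1 - x| < m, `|y2 - x| < m &
     P y1 = Q y2]) -> P x = Q x.
Proof.
move=> cP cQ H; apply/eqP; rewrite -subr_eq0 -normr_le0 leNgt; apply/negP => e0.
have e20 : 0 < `|P x - Q x| / 2 by rewrite divr_gt0.
have [d1 d10 h1] := (continuous_normP _ _).1 cP _ e20.
have [d2 d20 h2] := (continuous_normP _ _).1 cQ _ e20.
have [|y1 [y2 [y1x y2x E]]] := H (Num.min d1 d2); first by rewrite lt_min d10.
move: y1x y2x; rewrite !lt_min => /andP[/h1 + _] /andP[_ /h2].
rewrite E [`|Q y2 - P x|]distrC.
have := ler_distD (Q y2) (P x) (Q x).
move: (`|_ - _|) (`|_ - _|) (`|_ - _|) => a b c; lra.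
Qed.

Lemma class_C2_schwarz (V : normedModType R) (U : set V) (f : V -> R) x u w :
  open U -> U x -> class_C 2 U f -> 'D_w ('D_u f) x = 'D_u ('D_w f) x.
Proof.
move=> oU Ux C2.
apply: (@eq_of_close_values V ('D_w ('D_u f)) ('D_u ('D_w f)) x).
- by apply: (C2.2 u).2.
- by apply: (C2.2 w).2.
move=> m0 m00; have [d d0 hU] := open_normP oU Ux.
have [m [m_gt0 mm0 md]] : exists m, [/\ 0 < m, m <= m0 & m <= d].
  by exists (Num.min m0 d); rewrite lt_min m00 d0 !ge_min !lexx ?orbT.
have [h [h0 hm]] : exists h, 0 < h /\ h * (`|u| + `|w|) < m.
  exists (m / (`|u| + `|w| + 1)).
  have N0 : 0 < `|u| + `|w| + 1 by rewrite ltr_wpDl// addr_ge0.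
  by rewrite divr_gt0// mulrAC ltr_pdivrMr// ltr_pM2l// ltrDl.
have [y1 y1x E1] := second_difference h0 hU (lt_le_trans hm md) C2.
have hm' : h * (`|w| + `|u|) < m by rewrite [`|w| + _]addrC.
have [y2 y2x E2] := second_difference h0 hU (lt_le_trans hm' md) C2.
exists y1, y2; split.
- exact: le_lt_trans y1x (lt_le_trans hm mm0).
- exact: le_lt_trans y2x (lt_le_trans hm' mm0).
apply: (@mulfI R (h ^+ 2)); first by rewrite expf_neq0// gt_eqF.
apply: etrans (esym E1) _; apply: etrans _ E2.
rewrite (addrAC x (h *: u)); congr (_ + _).
by rewrite (addrAC _ (- f (x + h *: u))).
Qed.

End Schwarz.

(** * Uniform estimates on closed balls *)

Section BallBounds.
Variables (R : realType) (n : nat).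
Implicit Types (U : set 'rV[R]_n) (z : 'rV[R]_n).

Lemma compact_norm_ball z (r : R) : compact [set y : 'rV[R]_n | `|y - z| <= r].
Proof.
apply: bounded_closed_compact.
  exists (`|z| + r); split; first exact: num_real.
  move=> M hM y /= yz; rewrite (le_trans _ (ltW hM))//.
  by rewrite -[y](subrK z) addrC (le_trans (ler_normD _ _))// lerD2l.
rewrite (_ : [set _ | _] = (fun y => `|y - z|) @^-1` [set s | s <= r])//.
apply: closed_comp; last exact: closed_le.
move=> y _.
have h : {for y, continuous (fun y : 'rV[R]_n => y - z)}.
  by apply: continuousB; [exact: cvg_id|exact: cst_continuous].
exact: (cvg_norm h).
Qed.

Lemma bounded_on_ball z (r : R) (f : 'rV[R]_n -> R) :
  (forall y, `|y - z| <= r -> {for y, continuous f}) ->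
  exists2 K, 0 <= K & forall y, `|y - z| <= r -> `|f y| <= K.
Proof.
move=> cf; have [r0|r0] := ltP r 0.
  by exists 0 => // y yr; have := lt_le_trans r0 (le_trans (normr_ge0 _) yr);
    rewrite ltxx.
have [||| c _ h] := @compact_EVT_max _ R (fun y => `|f y|)
    [set y : 'rV[R]_n | `|y - z| <= r].
- by exists z; rewrite /= subrr normr0.
- exact: compact_norm_ball.
- apply: continuous_in_subspaceT => y; rewrite inE/= => /cf cy.
  by apply: (@continuous_comp _ _ _ f (@Num.Def.normr _ _)) => //; exact: norm_continuous.
exists `|f c| => // y yr; apply: h; exact/mem_set.
Qed.

Lemma segment_in_ball z (r : R) (x y : 'rV[R]_n) t :
  `|x - z| <= r -> `|y - z| <= r -> 0 <= t <= 1 -> `|x + t *: (y - x) - z| <= r.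
Proof.
move=> xr yr /andP[t0 t1].
have -> : x + t *: (y - x) - z = (1 - t) *: (x - z) + t *: (y - z).
  by apply/rowP => i; rewrite !mxE; ring.
rewrite (le_trans (ler_normD _ _))// !normrZ !ger0_norm ?subr_ge0//.
rewrite (le_trans (lerD (ler_wpM2l _ xr) (ler_wpM2l _ yr))) ?subr_ge0//.
by rewrite -mulrDl subrK mul1r.
Qed.

Lemma derive_bound_ball z (r : R) (f : 'rV[R]_n -> R) :
  (forall y, `|y - z| <= r -> differentiable f y) ->
  (forall v y, `|y - z| <= r -> {for y, continuous ('D_v f)}) ->
  exists2 K, 0 <= K & forall y v, `|y - z| <= r -> `|'D_v f y| <= K * `|v|.
Proof.
move=> df cf.
have /choice[k hk] : forall a : 'I_n, exists K, 0 <= K /\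
    forall y, `|y - z| <= r -> `|'D_(delta_mx 0 a) f y| <= K.
  by move=> a; have [K K0 h] := bounded_on_ball (cf (delta_mx 0 a)); exists K.
exists (\sum_a k a); first by apply: sumr_ge0 => a _; exact: (hk a).1.
move=> y v yr; rewrite derive_sum_delta; last exact: df.
rewrite mulr_suml (le_trans (ler_norm_sum _ _ _))//; apply: ler_sum => a _.
rewrite normrZ mulrC; apply: ler_pM => //; first exact: (hk a).2.
exact: le_mx_norm.
Qed.

Lemma class_C1_lip U z (r : R) (f : 'rV[R]_n -> R) :
  (forall y, `|y - z| <= r -> U y) -> class_C 1 U f ->
  exists2 K, 0 <= K & forall x y, `|x - z| <= r -> `|y - z| <= r ->
    `|f y - f x| <= K * `|y - x|.
Proof.
move=> rU [f1 f2].
have [||K K0 hK] := @derive_bound_ball z r f.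
- by move=> y /rU; exact: f1.
- by move=> v y /rU; exact: f2.
exists K => // x y xr yr.
have [|t t01] := @MVT_is_derive R (fun t => f (x + t *: (y - x)))
   (fun t => 'D_(y - x) f (x + t *: (y - x))) 0 1 ler01.
  move=> t t01; apply: is_derive_line; apply: f1; apply: rU.
  exact: segment_in_ball.
rewrite scale1r scale0r addr0 [x + (y - x)]addrC subrK subr0 mulr1 => ->.
by apply: hK; exact: segment_in_ball.
Qed.

Lemma class_C2_taylor U z (r : R) (f : 'rV[R]_n -> R) :
  (forall y, `|y - z| <= r -> U y) -> class_C 2 U f ->
  exists2 K, 0 <= K & forall x y, `|x - z| <= r -> `|y - z| <= r ->
    `|f y - f x - 'D_(y - x) f x| <= K * `|y - x| ^+ 2.
Proof.
move=> rU [f1 f2].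
have /choice[k hk] : forall a : 'I_n, exists K, 0 <= K /\
    forall x y, `|x - z| <= r -> `|y - z| <= r ->
     `|'D_(delta_mx 0 a) f y - 'D_(delta_mx 0 a) f x| <= K * `|y - x|.
  move=> a; have [K K0 h] := class_C1_lip rU (f2 (delta_mx 0 a)).
  by exists K.
have K0 : 0 <= \sum_a k a by apply: sumr_ge0 => a _; exact: (hk a).1.
have hK x y v : `|x - z| <= r -> `|y - z| <= r ->
    `|'D_v f y - 'D_v f x| <= (\sum_a k a) * `|y - x| * `|v|.
  move=> xr yr; rewrite !derive_sum_delta; [|exact/f1/rU|exact/f1/rU].
  rewrite -sumrB !mulr_suml (le_trans (ler_norm_sum _ _ _))//.
  apply: ler_sum => a _; rewrite -scalerBr normrZ mulrC.
  by apply: ler_pM => //; [exact: (hk a).2|exact: le_mx_norm].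
exists (\sum_a k a) => // x y xr yr.
have [|t t01] := @MVT_is_derive R
   (fun t => f (x + t *: (y - x)) - t * 'D_(y - x) f x)
   (fun t => 'D_(y - x) f (x + t *: (y - x)) - 'D_(y - x) f x) 0 1 ler01.
  move=> t t01; apply: is_deriveB.
    apply: is_derive_line; apply: f1; apply: rU.
    exact: segment_in_ball.
  have := @is_derive_affine R R (fun s => s * 'D_(y - x) f x) 0 1 t.
  have := @is_deriveM R R id (cst ('D_(y - x) f x)) t 1 1 0 _ _.
  rewrite scaler0 add0r.
  move=> h _; have {h} := h (is_derive_id _ _) (is_derive_cst _ _ _).
  by rewrite -[X in is_derive _ _ _ X]/(_ * _) mulr1; apply.
rewrite scale1r scale0r addr0 [x + (y - x)]addrC subrK subr0 mulr1 mul1r mul0r subr0.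
rewrite addrAC => ->.
rewrite (le_trans (hK _ _ _ xr (segment_in_ball xr yr t01)))//.
rewrite addrAC subrr add0r normrZ expr2 mulrA.
move/andP: t01 => [t0 t1]; rewrite ger0_norm// -!mulrA ler_wpM2l//.
by rewrite ler_piMl// mulr_ge0.
Qed.

End BallBounds.

(** * Christoffel symbols and curvature in a chart *)

Lemma is_derive_eqr (R : realType) (V : normedModType R) (f : R -> V) (t : R) (v w : V) :
  v = w -> is_derive t 1 f v -> is_derive t 1 f w.
Proof. by move->. Qed.

Section Bilin.
Variables (R : realType) (n : nat).
Implicit Types (A : 'M[R]_n) (u w z : 'rV[R]_n) (c : R).

Lemma bilin_def A u w : bilin A u w = (u *m A *m w^T) 0 0.
Proof. by []. Qed.

Lemma bilinE A u w : bilin A u w = \sum_i \sum_j u 0 i * A i j * w 0 j.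
Proof.
rewrite /bilin mxE exchange_big/=; apply: eq_bigr => j _.
by rewrite !mxE mulr_suml; apply: eq_bigr => i _.
Qed.

Lemma bilinDl A u u' w : bilin A (u + u') w = bilin A u w + bilin A u' w.
Proof. by rewrite /bilin !mulmxDl mxE. Qed.
Lemma bilinDr A u w w' : bilin A u (w + w') = bilin A u w + bilin A u w'.
Proof. by rewrite /bilin raddfD/= mulmxDr mxE. Qed.
Lemma bilinZl A c u w : bilin A (c *: u) w = c * bilin A u w.
Proof. by rewrite /bilin -!scalemxAl mxE. Qed.
Lemma bilinZr A c u w : bilin A u (c *: w) = c * bilin A u w.
Proof. by rewrite /bilin linearZ/= -scalemxAr mxE. Qed.
Lemma bilinNl A u w : bilin A (- u) w = - bilin A u w.
Proof. by rewrite -scaleN1r bilinZl mulN1r. Qed.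
Lemma bilinNr A u w : bilin A u (- w) = - bilin A u w.
Proof. by rewrite -scaleN1r bilinZr mulN1r. Qed.
Lemma bilinBl A u u' w : bilin A (u - u') w = bilin A u w - bilin A u' w.
Proof. by rewrite bilinDl bilinNl. Qed.
Lemma bilinBr A u w w' : bilin A u (w - w') = bilin A u w - bilin A u w'.
Proof. by rewrite bilinDr bilinNr. Qed.
Lemma bilin0l A w : bilin A 0 w = 0.
Proof. by rewrite -(scale0r 0) bilinZl mul0r. Qed.
Lemma bilin0r A u : bilin A u 0 = 0.
Proof. by rewrite -(scale0r 0) bilinZr mul0r. Qed.
Lemma bilinDA A A' u w : bilin (A + A') u w = bilin A u w + bilin A' u w.
Proof. by rewrite /bilin mulmxDr mulmxDl mxE. Qed.
Lemma bilinZA A c u w : bilin (c *: A) u w = c * bilin A u w.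
Proof. by rewrite /bilin -scalemxAr -scalemxAl mxE. Qed.
Lemma bilinBA A A' u w : bilin (A - A') u w = bilin A u w - bilin A' u w.
Proof. by rewrite bilinDA -scaleN1r bilinZA mulN1r. Qed.
Lemma bilin_sumA (I : Type) (r : seq I) (P : pred I) (F : I -> 'M[R]_n) u w :
  bilin (\sum_(i <- r | P i) F i) u w = \sum_(i <- r | P i) bilin (F i) u w.
Proof. by rewrite /bilin mulmx_sumr mulmx_suml summxE. Qed.
Lemma bilinC A u w : A^T = A -> bilin A u w = bilin A w u.
Proof.
move=> sA; have h : (u *m A *m w^T)^T = w *m A *m u^T.
  by rewrite !trmx_mul trmxK sA mulmxA.
by rewrite /bilin -h [RHS]mxE.
Qed.

Lemma bilin_le A u w : `|bilin A u w| <= (n * n)%:R * `|A| * `|u| * `|w|.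
Proof.
rewrite bilinE (le_trans (ler_norm_sum _ _ _))//.
rewrite -!mulrA natrM -mulrA.
have -> : n%:R * (n%:R * (`|A| * (`|u| * `|w|))) =
  \sum_(i < n) \sum_(j < n) (`|A| * (`|u| * `|w|)).
  set c := `|A| * _.
  by rewrite !sumr_const card_ord -(mulr_natl (c *+ n)) -(mulr_natl c).
apply: ler_sum => i _; rewrite (le_trans (ler_norm_sum _ _ _))//.
apply: ler_sum => j _; rewrite !normrM mulrCA -mulrA mulrCA.
rewrite mulrCA; apply: ler_pM; rewrite ?mulr_ge0//; first exact: le_mx_norm.
by apply: ler_pM => //; exact: le_mx_norm.
Qed.

Lemma is_derive_bigsum (I : Type) (r : seq I) (f : I -> R -> R) (df : I -> R) (t : R) :
  (forall i, is_derive t 1 (f i) (df i)) ->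
  is_derive t 1 (fun s => \sum_(i <- r) f i s) (\sum_(i <- r) df i).
Proof.
move=> h; elim: r => [|i r IH].
  rewrite big_nil (_ : (fun s => _) = cst 0); first exact: is_derive_cst.
  by apply/funext => s; rewrite big_nil.
rewrite big_cons (_ : (fun s => _) = f i + (fun s => \sum_(i <- r) f i s)).
  exact: is_deriveD.
by apply/funext => s; rewrite big_cons.
Qed.

Lemma is_derive_mul (f g : R -> R) (df dg t : R) :
  is_derive t 1 f df -> is_derive t 1 g dg ->
  is_derive t 1 (fun s => f s * g s) (df * g t + f t * dg).
Proof.
move=> hf hg; have := is_deriveM hf hg; apply: is_derive_eqr.
by rewrite -![_ *: _]/(_ * _) addrC [g t * _]mulrC.
Qed.

Lemma is_derive_bilin (A : R -> 'M[R]_n) (u w : R -> 'rV[R]_n) A' u' w' (t : R) :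
  is_derive t 1 A A' -> is_derive t 1 u u' -> is_derive t 1 w w' ->
  is_derive t 1 (fun s => bilin (A s) (u s) (w s))
   (bilin A' (u t) (w t) + bilin (A t) u' (w t) + bilin (A t) (u t) w').
Proof.
move=> /is_derive_mxP hA /is_derive_mxP hu /is_derive_mxP hw.
rewrite (_ : (fun s => _) =
    fun s => \sum_i \sum_j u s 0 i * A s i j * w s 0 j); last first.
  by apply/funext => s; rewrite bilinE.
rewrite !bilinE -!big_split/=; apply: is_derive_bigsum => i.
rewrite -!big_split/=; apply: is_derive_bigsum => j.
have := is_derive_mul (is_derive_mul (hu 0 i) (hA i j)) (hw 0 j).
by apply: is_derive_eqr; ring.
Qed.

Definition tri (T : 'I_n -> 'I_n -> 'I_n -> R) u w : 'rV[R]_n :=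
  \row_k \sum_a \sum_b T k a b * u 0 a * w 0 b.

Lemma triDl T u u' w : tri T (u + u') w = tri T u w + tri T u' w.
Proof.
apply/rowP => k; rewrite !mxE -big_split/=; apply: eq_bigr => a _.
by rewrite -big_split/=; apply: eq_bigr => b _; rewrite mxE; ring.
Qed.
Lemma triDr T u w w' : tri T u (w + w') = tri T u w + tri T u w'.
Proof.
apply/rowP => k; rewrite !mxE -big_split/=; apply: eq_bigr => a _.
by rewrite -big_split/=; apply: eq_bigr => b _; rewrite mxE; ring.
Qed.
Lemma triZl T c u w : tri T (c *: u) w = c *: tri T u w.
Proof.
apply/rowP => k; rewrite !mxE mulr_sumr; apply: eq_bigr => a _.
by rewrite mulr_sumr; apply: eq_bigr => b _; rewrite mxE; ring.
Qed.
Lemma triZr T c u w : tri T u (c *: w) = c *: tri T u w.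
Proof.
apply/rowP => k; rewrite !mxE mulr_sumr; apply: eq_bigr => a _.
by rewrite mulr_sumr; apply: eq_bigr => b _; rewrite mxE; ring.
Qed.
Lemma tri0l T w : tri T 0 w = 0.
Proof. by have := triZl T 0 0 w; rewrite !scale0r. Qed.
Lemma tri0r T w : tri T w 0 = 0.
Proof. by have := triZr T 0 w 0; rewrite !scale0r. Qed.
Lemma is_derive_tri (T dT : R -> 'I_n -> 'I_n -> 'I_n -> R) (u w : R -> 'rV[R]_n)
    u' w' (t : R) :
  (forall k a b, is_derive t 1 (fun s => T s k a b) (dT t k a b)) ->
  is_derive t 1 u u' -> is_derive t 1 w w' ->
  is_derive t 1 (fun s => tri (T s) (u s) (w s))
   (tri (dT t) (u t) (w t) + tri (T t) u' (w t) + tri (T t) (u t) w').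
Proof.
move=> hT /is_derive_mxP hu /is_derive_mxP hw.
apply/is_derive_mxP => i k; rewrite !mxE.
rewrite (_ : (fun s => _) =
    fun s => \sum_a \sum_b T s k a b * u s 0 a * w s 0 b); last first.
  by apply/funext => s; rewrite mxE.
rewrite -!big_split/=; apply: is_derive_bigsum => a.
rewrite -!big_split/=; apply: is_derive_bigsum => b.
have := is_derive_mul (is_derive_mul (hT k a b) (hu 0 a)) (hw 0 b).
by apply: is_derive_eqr; ring.
Qed.

End Bilin.

(** The Christoffel symbols contracted with two vectors: the geodesic equation reads
    [v' = - Gam g x v v], and [E' = - Gam g x v E] is parallel transport. Locked, so that the sums
    over indices stay folded. *)
HB.lock Definition Gam (R : realType) (n : nat) (g : 'rV[R]_n -> 'M[R]_n)
    (x u w : 'rV[R]_n) : 'rV[R]_n :=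
  tri (fun k a b => christoffel g k a b x) u w.

HB.lock Definition dGam (R : realType) (n : nat) (g : 'rV[R]_n -> 'M[R]_n)
    (x z u w : 'rV[R]_n) : 'rV[R]_n :=
  tri (fun k a b => 'D_z (christoffel g k a b) x) u w.

HB.lock Definition dmetric (R : realType) (n : nat) (g : 'rV[R]_n -> 'M[R]_n)
    (x z u w : 'rV[R]_n) : R := bilin ('D_z g x) u w.

Section LocalGeometry.
Variables (R : realType) (n : nat) (U : set 'rV[R]_n) (g : 'rV[R]_n -> 'M[R]_n).
Hypothesis oU : open U.
Hypothesis g_smooth : smooth_on U g.
Hypothesis g_sym : forall x, U x -> (g x)^T = g x.
Hypothesis g_pos : forall x u, U x -> u != 0 -> 0 < bilin (g x) u u.
Implicit Types (x u w z : 'rV[R]_n).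

Local Notation Gam := (Gam g).
Local Notation dGam := (dGam g).
Local Notation dmetric := (dmetric g).

Lemma metric_unit x : U x -> g x \in unitmx.
Proof.
move=> Ux; rewrite -row_free_unit; apply/inj_row_free => v v0.
apply/eqP; apply/negP => /negP vN0; have := g_pos Ux vN0.
by rewrite bilin_def v0 mul0mx mxE ltxx.
Qed.

Lemma metric_entry_smooth k a b : class_C k U (fun y => g y a b).
Proof. by apply: class_C_entry => //; exact: g_smooth. Qed.

Lemma metric_differentiable x : U x -> differentiable g x.
Proof. by move=> Ux; have [h _] := g_smooth 1; exact: h. Qed.

Lemma christoffel_smooth k c a b : class_C k U (christoffel g c a b).
Proof.
rewrite /christoffel.
apply: class_C_eq (_ : class_C k U (fun x => 2^-1 * \sum_(l < n) (invmx (g x) c l *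
    (partial a (fun y => g y b l) x + (partial b (fun y => g y a l) x
     - partial l (fun y => g y a b) x))))) => //.
  move=> x _; congr (_ * _).
  by apply: eq_bigr => l _; rewrite addrA.
apply: class_CZ => //; apply: class_C_sum => // l; apply: class_CM => //.
  apply: class_C_invmx => //; first exact: metric_unit.
  by move=> i j; exact: metric_entry_smooth.
have h i j m : class_C k U (partial m (fun y => g y i j)).
  by have [_] := metric_entry_smooth k.+1 i j; apply.
by apply: class_CD => //; apply: class_CD => //; apply: class_CN.
Qed.

Lemma christoffel_differentiable c a b x : U x ->
  differentiable (christoffel g c a b) x.
Proof. by move=> Ux; have [h _] := christoffel_smooth 1 c a b; exact: h. Qed.

Lemma derive_metric_sym x z u w : U x ->
  dmetric x z u w = dmetric x z w u.
Proof.
move=> Ux; rewrite dmetric.unlock; apply: bilinC; apply/matrixP => i j; rewrite mxE.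
have dg : derivable g x z by exact/diff_derivable/metric_differentiable.
rewrite !derive_entry//; apply: near_eq_derive.
by apply: (open_near oU Ux) => y /g_sym {1}<-; rewrite mxE.
Qed.

Lemma metric_sym x u w : U x -> bilin (g x) u w = bilin (g x) w u.
Proof. by move=> /g_sym; exact: bilinC. Qed.

Lemma metric_nondegenerate x u w : U x ->
  (forall z, bilin (g x) u z = bilin (g x) w z) -> u = w.
Proof.
move=> Ux h; apply/eqP; rewrite -subr_eq0; apply/negP => /negP uw.
by have := g_pos Ux uw; rewrite bilinBl h subrr ltxx.
Qed.

Lemma derive_bilin_sum x z u w : U x ->
  dmetric x z u w = \sum_l z 0 l * \sum_a \sum_b
    partial l (fun y => g y a b) x * u 0 a * w 0 b.
Proof.
move=> Ux; have dg := metric_differentiable Ux.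
rewrite dmetric.unlock derive_sum_delta// bilin_sumA; apply: eq_bigr => l _.
rewrite bilinZA bilinE; congr (_ * _); apply: eq_bigr => a _.
apply: eq_bigr => b _; rewrite /partial derive_entry; first by ring.
exact: diff_derivable.
Qed.

(** The Koszul formula for constant coordinate fields, whose brackets vanish. It characterizes [Gam]
    without indices: symmetry, compatibility with the metric and the change of coordinates are all
    deduced from it. *)
Lemma koszul x u w z : U x -> 2 * bilin (g x) (Gam x u w) z =
  dmetric x u w z + dmetric x w u z - dmetric x z u w.
Proof.
move=> Ux.
pose S : 'rV[R]_n := \row_l \sum_a \sum_b
  (partial a (fun y => g y b l) x + partial b (fun y => g y a l) x
     - partial l (fun y => g y a b) x) * u 0 a * w 0 b.
have -> : Gam x u w = 2^-1 *: (S *m invmx (g x)).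
  rewrite Gam.unlock; apply/rowP => k; rewrite !mxE mulr_sumr.
  under eq_bigr do under eq_bigr do rewrite /christoffel -!mulrA mulr_suml mulr_sumr.
  under eq_bigr do rewrite exchange_big/=.
  rewrite exchange_big/=; apply: eq_bigr => l _; rewrite !mxE.
  rewrite mulr_suml mulr_sumr; apply: eq_bigr => a _.
  rewrite mulr_suml mulr_sumr; apply: eq_bigr => b _.
  have -> : invmx (g x) l k = invmx (g x) k l.
    by rewrite -[in RHS](g_sym Ux) -trmx_inv mxE.
  by ring.
rewrite bilinZl mulVKf ?pnatr_eq0// bilin_def mulmxKV ?metric_unit//.
rewrite mxE !derive_bilin_sum//.
have -> : \sum_l u 0 l * (\sum_a \sum_b partial l (fun y => g y a b) x * w 0 a * z 0 b)
  = \sum_l \sum_a \sum_b partial a (fun y => g y b l) x * u 0 a * w 0 b * z 0 l.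
  rewrite [RHS]exchange_big/=; apply: eq_bigr => a _.
  rewrite mulr_sumr [RHS]exchange_big/=; apply: eq_bigr => b _.
  rewrite mulr_sumr.
  by apply: eq_bigr => c _; ring.
have -> : \sum_l w 0 l * (\sum_a \sum_b partial l (fun y => g y a b) x * u 0 a * z 0 b)
  = \sum_l \sum_a \sum_b partial b (fun y => g y a l) x * u 0 a * w 0 b * z 0 l.
  under [RHS]eq_bigr do rewrite exchange_big/=.
  rewrite exchange_big/=; apply: eq_bigr => b _; rewrite mulr_sumr.
  rewrite exchange_big/=; apply: eq_bigr => a _; rewrite mulr_sumr.
  by apply: eq_bigr => c _; ring.
rewrite -big_split/= -sumrB; apply: eq_bigr => l _; rewrite !mxE.
rewrite mulr_suml mulr_sumr -big_split/= -sumrB; apply: eq_bigr => a _.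
rewrite mulr_suml mulr_sumr -big_split/= -sumrB; apply: eq_bigr => b _.
by ring.
Qed.

Lemma Gam_sym x u w : U x -> Gam x u w = Gam x w u.
Proof.
move=> Ux; apply: (metric_nondegenerate Ux) => z.
apply: (@mulfI R 2); first by rewrite pnatr_eq0.
rewrite !(koszul _ _ _ Ux) (derive_metric_sym z w u Ux).
by rewrite [X in X - _]addrC.
Qed.

Lemma metric_compat x z u w : U x ->
  dmetric x z u w = bilin (g x) (Gam x z u) w + bilin (g x) u (Gam x z w).
Proof.
move=> Ux; apply: (@mulfI R 2); first by rewrite pnatr_eq0.
rewrite mulrDr (koszul _ _ _ Ux) (metric_sym u _ Ux) (koszul _ _ _ Ux).
rewrite (derive_metric_sym z w u Ux).
move: (dmetric _ _ u w) (dmetric _ _ z w) (dmetric _ _ z u) => a b c; ring.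
Qed.

Lemma is_derive_Gam (x u w : R -> 'rV[R]_n) x' u' w' (t : R) : U (x t) ->
  is_derive t 1 x x' -> is_derive t 1 u u' -> is_derive t 1 w w' ->
  is_derive t 1 (fun s => Gam (x s) (u s) (w s))
    (dGam (x t) x' (u t) (w t) + Gam (x t) u' (w t) + Gam (x t) (u t) w').
Proof.
move=> Ux hx; rewrite Gam.unlock dGam.unlock; apply: (@is_derive_tri R n (fun s k a b => christoffel g k a b (x s))
  (fun s k a b => 'D_x' (christoffel g k a b) (x s))) => k a b.
by apply: is_derive_diff_comp => //; exact: christoffel_differentiable.
Qed.

(** The product rule in covariant form: [u' + Gam g x x' u] is the covariant derivative of [u] along
    the curve. Parallel fields therefore have constant inner products. *)
Lemma is_derive_metric (x u w : R -> 'rV[R]_n) x' u' w' (t : R) : U (x t) ->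
  is_derive t 1 x x' -> is_derive t 1 u u' -> is_derive t 1 w w' ->
  is_derive t 1 (fun s => bilin (g (x s)) (u s) (w s))
   (bilin (g (x t)) (u' + Gam (x t) x' (u t)) (w t)
    + bilin (g (x t)) (u t) (w' + Gam (x t) x' (w t))).
Proof.
move=> Ux hx hu hw.
have hg := is_derive_diff_comp (metric_differentiable Ux) hx.
have := is_derive_bilin hg hu hw; apply: is_derive_eqr.
have <- : dmetric (x t) x' (u t) (w t) = bilin ('D_x' g (x t)) (u t) (w t).
  by rewrite dmetric.unlock.
rewrite metric_compat// bilinDl bilinDr.
move: (bilin _ _ _) (bilin _ _ _) (bilin _ _ _) (bilin _ _ _) => a b c d; ring.
Qed.

End LocalGeometry.

(** * Change of coordinates for the Christoffel symbols *)

HB.lock Definition hess (R : realType) (m n : nat) (phi : 'rV[R]_m -> 'rV[R]_n)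
    (x : 'rV[R]_m) (z w : 'rV[R]_m) : 'rV[R]_n :=
  \row_k \sum_a w 0 a * 'D_z ('D_(delta_mx 0 a) (fun y => phi y 0 k)) x.

Lemma hessE (R : realType) (m n : nat) (phi : 'rV[R]_m -> 'rV[R]_n) x z w k :
  hess phi x z w 0 k =
  \sum_a w 0 a * 'D_z ('D_(delta_mx 0 a) (fun y => phi y 0 k)) x.
Proof. by rewrite hess.unlock mxE. Qed.

Section Hessian.
Variables (R : realType) (m n : nat) (U : set 'rV[R]_m) (phi : 'rV[R]_m -> 'rV[R]_n).
Hypothesis oU : open U.
Hypothesis phi_smooth : smooth_on U phi.

Lemma smooth_differentiable x : U x -> differentiable phi x.
Proof. by move=> Ux; have [h _] := phi_smooth 1; exact: h. Qed.

Lemma hess_sym x z w : U x -> hess phi x z w = hess phi x w z.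
Proof.
move=> Ux; apply/rowP => k; rewrite (hessE _ _ z) (hessE _ _ w).
have h1 a u : 'D_u ('D_(delta_mx 0 a) (fun y => phi y 0 k)) x =
  \sum_b u 0 b * 'D_(delta_mx 0 b) ('D_(delta_mx 0 a) (fun y => phi y 0 k)) x.
  have [_ h] := class_C_entry (0 : 'I_1) k oU (phi_smooth 2).
  by rewrite derive_sum_delta//; apply: (h _).1.
pose D a b := 'D_(delta_mx 0 b) ('D_(delta_mx 0 a) (fun y => phi y 0 k)) x.
have DC a b : D a b = D b a.
  apply: (class_C2_schwarz _ _ oU Ux); exact: class_C_entry.
have E1 (u v : 'rV[R]_m) : \sum_a u 0 a * 'D_v ('D_(delta_mx 0 a) (fun y => phi y 0 k)) x =
    \sum_a \sum_b u 0 a * (v 0 b * D a b).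
  by apply: eq_bigr => a _; rewrite h1 mulr_sumr.
apply: etrans (E1 w z) _; apply: etrans _ (esym (E1 z w)).
clearbody D; rewrite exchange_big/=.
apply: eq_bigr => b _; apply: eq_bigr => a _; by rewrite mulrCA DC.
Qed.

Lemma is_derive_differential (x w : R -> 'rV[R]_m) x' w' (t : R) : U (x t) ->
  is_derive t 1 x x' -> is_derive t 1 w w' ->
  is_derive t 1 (fun s => 'D_(w s) phi (x s))
    (hess phi (x t) x' (w t) + 'D_w' phi (x t)).
Proof.
move=> Uxt dx dw.
have Unear : \forall s \near t, U (x s).
  by apply: (is_derive_continuous dx); exact: open_nbhs_nbhs.
have entryE y u k : U y ->
    ('D_u phi y) 0 k = \sum_a u 0 a * 'D_(delta_mx 0 a) (fun y => phi y 0 k) y.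
  move=> Uy; rewrite derive_entry; last exact/diff_derivable/smooth_differentiable.
  rewrite derive_sum_delta//; apply: differentiable_entry.
  exact: smooth_differentiable.
apply/is_derive_mxP => i k; rewrite ord1 [in X in is_derive _ _ _ X]mxE.
apply: (@is_derive_near _ _ (fun s =>
  \sum_a w s 0 a * 'D_(delta_mx 0 a) (fun y => phi y 0 k) (x s))).
  by apply: filterS Unear => s Uxs; rewrite -entryE.
rewrite entryE// hessE -big_split/=; apply: is_derive_bigsum => a.
have dk : differentiable ('D_(delta_mx 0 a) (fun y => phi y 0 k)) (x t).
  have [_ h] := class_C_entry (0 : 'I_1) k oU (phi_smooth 2).
  by apply: (h _).1.
have /is_derive_mxP/(_ 0 a) dwa := dw.
have := is_derive_mul dwa (is_derive_diff_comp dk dx).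
by apply: is_derive_eqr; rewrite addrC.
Qed.

End Hessian.

Section Transform.
Variables (R : realType) (n : nat).
Variables (U V W : set 'rV[R]_n) (g h : 'rV[R]_n -> 'M[R]_n).
Variable (phi : 'rV[R]_n -> 'rV[R]_n).
Hypotheses (oU : open U) (oV : open V) (oW : open W).
Hypotheses (g_smooth : smooth_on U g) (h_smooth : smooth_on V h).
Hypotheses (g_sym : forall x, U x -> (g x)^T = g x)
           (h_sym : forall x, V x -> (h x)^T = h x).
Hypotheses (g_pos : forall x u, U x -> u != 0 -> 0 < bilin (g x) u u)
           (h_pos : forall x u, V x -> u != 0 -> 0 < bilin (h x) u u).
Hypotheses (phi_smooth : smooth_on W phi) (WU : W `<=` U)
  (WV : forall x, W x -> V (phi x)).
Hypothesis phi_isom : forall x u w, W x ->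
  bilin (g x) u w = bilin (h (phi x)) ('D_u phi x) ('D_w phi x).
Hypothesis phi_surj : forall x z, W x -> exists u, 'D_u phi x = z.

Lemma line_is_derive (x z : 'rV[R]_n) (t : R) : is_derive t 1 (fun s => x + s *: z) z.
Proof.
have := @is_derive_line R _ _ id x z t; rewrite derive_id; apply.
by have [] := @is_diff_id R _ (x + t *: z).
Qed.

Lemma dmetric_transform x z u w : W x ->
  dmetric g x z u w = dmetric h (phi x) ('D_z phi x) ('D_u phi x) ('D_w phi x)
    + bilin (h (phi x)) (hess phi x z u) ('D_w phi x)
    + bilin (h (phi x)) ('D_u phi x) (hess phi x z w).
Proof.
move=> Wx.
have x0 : x = x + 0 *: z by rewrite scale0r addr0.
have Wx0 : W (x + (0 : R) *: z) by rewrite -x0.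
have dl := line_is_derive x z 0.
have cst (c : 'rV[R]_n) : is_derive (0 : R) 1 (fun _ : R => c) 0.
  exact: is_derive_cst.
have dg : is_derive (0 : R) 1 (fun s => g (x + s *: z)) ('D_z g x).
  rewrite {2}x0; apply: (@is_derive_line R _ _ g).
  by rewrite -x0; apply: (metric_differentiable g_smooth); exact: WU.
have H1 := is_derive_bilin dg (cst u) (cst w).
have dphi : is_derive (0 : R) 1 (fun s => phi (x + s *: z)) ('D_z phi x).
  by rewrite {2}x0; apply: (@is_derive_line R _ _ phi);
    rewrite -x0; exact: (smooth_differentiable phi_smooth).
have dh := is_derive_diff_comp
  (@metric_differentiable _ _ _ _ h_smooth _ (WV Wx0)) dphi.
have du (a : 'rV[R]_n) := is_derive_differential oW phi_smooth Wx0 dl (cst a).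
have H2 := is_derive_bilin dh (du u) (du w).
have near_eq : \forall s \near (0 : R), bilin (g (x + s *: z)) u w =
  bilin (h (phi (x + s *: z))) ('D_u phi (x + s *: z)) ('D_w phi (x + s *: z)).
  have : \forall s \near (0 : R), W (x + s *: z).
    by apply: (is_derive_continuous dl); exact: open_nbhs_nbhs.
  by apply: filterS => s; exact: phi_isom.
have := is_derive_unique (is_derive_near near_eq H1) H2.
by rewrite !derive0 !addr0 -!x0 bilin0l bilin0r !addr0 dmetric.unlock.
Qed.

(** Koszul on both sides, then the differentiated isometry identity [dmetric_transform]. Of the six
    Hessian terms four cancel by symmetry of second derivatives and the other two are equal.
    [phi_surj] writes every test vector as an image. *)
Lemma Gam_transform x u w : W x ->
  'D_(Gam g x u w) phi x =
  Gam h (phi x) ('D_u phi x) ('D_w phi x) + hess phi x u w.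
Proof.
move=> Wx; have Ux := WU Wx; have Vx := WV Wx.
apply: (metric_nondegenerate h_pos Vx) => z'.
have [z <-] := phi_surj z' Wx.
apply: (@mulfI R 2); first by rewrite pnatr_eq0.
rewrite -phi_isom// (koszul g_smooth g_sym g_pos)// bilinDl mulrDr.
rewrite (koszul h_smooth h_sym h_pos)// !dmetric_transform//.
have hs (a b c : 'rV[R]_n) : bilin (h (phi x)) ('D_a phi x) (hess phi x b c) =
  bilin (h (phi x)) (hess phi x b c) ('D_a phi x) by exact: (metric_sym h_sym).
rewrite !hs (hess_sym oW phi_smooth w u)// (hess_sym oW phi_smooth w z)//.
rewrite (hess_sym oW phi_smooth u z)//.
move: ('D_u phi x) ('D_w phi x) ('D_z phi x) => du dw dz.
move: (bilin _ (hess _ _ u w) dz) (bilin _ (hess _ _ z u) dw)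
  (bilin _ (hess _ _ z w) du) (dmetric _ _ du dw dz) (dmetric _ _ dw du dz)
  (dmetric _ _ dz du dw) => a b c d e f; ring.
Qed.

End Transform.

(** * The curvature operator in a chart *)

Section Curvature.
Variables (R : realType) (n : nat) (U : set 'rV[R]_n) (g : 'rV[R]_n -> 'M[R]_n).
Hypothesis oU : open U.
Hypothesis g_smooth : smooth_on U g.
Hypothesis g_sym : forall x, U x -> (g x)^T = g x.
Hypothesis g_pos : forall x u, U x -> u != 0 -> 0 < bilin (g x) u u.
Local Notation Gam := (Gam g).
Local Notation dGam := (dGam g).

(** The curvature [R(u, w) z] for constant coordinate fields, free of indices; [curvature_opE]
    identifies it with the contraction of [riemann_tensor]. *)
Definition Rop x u w z := dGam x u w z - dGam x w u z
  + Gam x u (Gam x w z) - Gam x w (Gam x u z).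

Lemma GamDl x u u' w : Gam x (u + u') w = Gam x u w + Gam x u' w.
Proof. by rewrite Gam.unlock triDl. Qed.
Lemma GamDr x u w w' : Gam x u (w + w') = Gam x u w + Gam x u w'.
Proof. by rewrite Gam.unlock triDr. Qed.
Lemma GamZl x c u w : Gam x (c *: u) w = c *: Gam x u w.
Proof. by rewrite Gam.unlock triZl. Qed.
Lemma GamZr x c u w : Gam x u (c *: w) = c *: Gam x u w.
Proof. by rewrite Gam.unlock triZr. Qed.
Lemma Gam0l x w : Gam x 0 w = 0.
Proof. by rewrite Gam.unlock tri0l. Qed.
Lemma Gam0r x w : Gam x w 0 = 0.
Proof. by rewrite Gam.unlock tri0r. Qed.

Lemma curvature_opE x u w z : U x -> curvature_op g x u w z = Rop x u w z.
Proof.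
move=> Ux; apply/rowP => l; rewrite /Rop dGam.unlock Gam.unlock !mxE.
have dE (v : 'rV[R]_n) b k : 'D_v (christoffel g l b k) x =
    \sum_a v 0 a * partial a (christoffel g l b k) x.
  by rewrite derive_sum_delta//; exact: (christoffel_differentiable oU g_smooth g_pos).
have -> : \sum_b \sum_k 'D_u (christoffel g l b k) x * w 0 b * z 0 k =
  \sum_a \sum_b \sum_k partial a (christoffel g l b k) x * u 0 a * w 0 b * z 0 k.
  rewrite [RHS]exchange_big/=; apply: eq_bigr => b _.
  rewrite [RHS]exchange_big/=; apply: eq_bigr => k _.
  by rewrite dE !mulr_suml; apply: eq_bigr => a _; ring.
have -> : \sum_a \sum_k 'D_w (christoffel g l a k) x * u 0 a * z 0 k =
  \sum_a \sum_b \sum_k partial b (christoffel g l a k) x * u 0 a * w 0 b * z 0 k.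
  apply: eq_bigr => a _.
  rewrite [RHS]exchange_big/=; apply: eq_bigr => k _.
  by rewrite dE !mulr_suml; apply: eq_bigr => b _; ring.
have -> : \sum_a \sum_m christoffel g l a m x * u 0 a *
   (tri (fun k a b => christoffel g k a b x) w z) 0 m =
  \sum_a \sum_b \sum_k \sum_m christoffel g l a m x * christoffel g m b k x *
     u 0 a * w 0 b * z 0 k.
  apply: eq_bigr => a _.
  under [RHS]eq_bigr do rewrite exchange_big/=.
  rewrite [RHS]exchange_big/=; apply: eq_bigr => m _; rewrite mxE mulr_sumr.
  by apply: eq_bigr => b _; rewrite mulr_sumr; apply: eq_bigr => k _; ring.
have -> : \sum_b \sum_m christoffel g l b m x * w 0 b *
   (tri (fun k a b => christoffel g k a b x) u z) 0 m =
  \sum_a \sum_b \sum_k \sum_m christoffel g l b m x * christoffel g m a k x *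
     u 0 a * w 0 b * z 0 k.
  rewrite [RHS]exchange_big/=; apply: eq_bigr => b _.
  under [RHS]eq_bigr do rewrite exchange_big/=.
  rewrite [RHS]exchange_big/=; apply: eq_bigr => m _; rewrite mxE mulr_sumr.
  by apply: eq_bigr => a _; rewrite mulr_sumr; apply: eq_bigr => k _; ring.
rewrite -sumrB -big_split/= -sumrB; apply: eq_bigr => a _.
rewrite -sumrB -big_split/= -sumrB; apply: eq_bigr => b _.
rewrite -sumrB -big_split/= -sumrB; apply: eq_bigr => k _.
rewrite /riemann_tensor sumrB -!mulr_suml.
move: (partial a _ x) (partial b _ x) (\sum_(_ < n) _) (\sum_(_ < n) _) (u 0 a)
  (w 0 b) (z 0 k) => A B C D u' w' z'; ring.
Qed.

(** The second derivatives of the function [F y = bilin (g y) a b] commute. Expanded by metric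
    compatibility, their commutator is [<R(u, w) a, b> + <a, R(u, w) b>], since the products of two
    first order terms match in pairs. *)
Lemma Rop_antisym34 x u w a b : U x ->
  bilin (g x) (Rop x u w a) b = - bilin (g x) (Rop x u w b) a.
Proof.
move=> Ux.
have cst (c : 'rV[R]_n) : is_derive (0 : R) 1 (fun _ : R => c) 0.
  exact: is_derive_cst.
pose F y := bilin (g y) a b.
have F_C k : class_C k U F.
  apply: class_C_eq (_ : class_C k U (fun y => \sum_i \sum_j (a 0 i * g y i j) * b 0 j)) => //.
    by move=> y _; rewrite /F bilinE.
  apply: class_C_sum => // i; apply: class_C_sum => // j; apply: class_CM => //.
    by apply: class_CZ => //; exact: (metric_entry_smooth oU g_smooth).
  exact: class_C_cst.
have dF z y : U y -> 'D_z F y = bilin (g y) (Gam y z a) b + bilin (g y) a (Gam y z b).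
  move=> Uy; have y0 : y = y + (0 : R) *: z by rewrite scale0r addr0.
  have Uy0 : U (y + (0 : R) *: z) by rewrite -y0.
  have dFy : differentiable F (y + (0 : R) *: z) by apply: (F_C 1).1.
  have := is_derive_unique (is_derive_line dFy)
    (is_derive_metric oU g_smooth g_sym g_pos Uy0 (line_is_derive y z 0) (cst a) (cst b)).
  by rewrite -!y0 !add0r.
pose S z y c d := bilin (g x) (dGam x y z c + Gam x y (Gam x z c)) d
   + bilin (g x) (Gam x z c) (Gam x y d).
have ddF z y : 'D_y ('D_z F) x = S z y a b + S z y b a.
  have x0 : x = x + (0 : R) *: y by rewrite scale0r addr0.
  have Ux0 : U (x + (0 : R) *: y) by rewrite -x0.
  have dDF : differentiable ('D_z F) (x + (0 : R) *: y) by apply: ((F_C 2).2 z).1.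
  have dl := line_is_derive x y 0.
  have dG c := is_derive_Gam oU g_smooth g_pos Ux0 dl (cst z) (cst c).
  have H1 := is_derive_metric oU g_smooth g_sym g_pos Ux0 dl (dG a) (cst b).
  have H2 := is_derive_metric oU g_smooth g_sym g_pos Ux0 dl (cst a) (dG b).
  have H := is_deriveD H1 H2.
  have near_eq : \forall s \near (0 : R), bilin (g (x + s *: y)) (Gam (x + s *: y) z a) b
     + bilin (g (x + s *: y)) a (Gam (x + s *: y) z b) = 'D_z F (x + s *: y).
    have : \forall s \near (0 : R), U (x + s *: y).
      by apply: (is_derive_continuous dl); exact: open_nbhs_nbhs.
    by apply: filterS => s Us; rewrite dF.
  have := is_derive_unique (is_derive_line dDF) (is_derive_near near_eq H).
  rewrite -!x0 !Gam0l !Gam0r !addr0 !add0r => ->; rewrite /S -!addrA.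
  congr (_ + (_ + _)); rewrite addrC; congr (_ + _); exact: (metric_sym g_sym).
have := class_C2_schwarz w u oU Ux (F_C 2).
rewrite !ddF /S /Rop !bilinDl !bilinNl.
rewrite [bilin _ (Gam x u b) (Gam x w a)](metric_sym g_sym)//.
rewrite [bilin _ (Gam x u a) (Gam x w b)](metric_sym g_sym)//.
lra.
Qed.

End Curvature.

(** * Boundary value problems and linear equations *)

Section FixedPoint.
Variables (R : realType) (n : nat).
Local Notation V := 'rV[R]_n.

Lemma geometric_limit (x : nat -> V) (C : R) :
  (forall k, `|x k.+1 - x k| <= C * 2^-1 ^+ k) ->
  exists l, forall k, `|l - x k| <= 2 * C * 2^-1 ^+ k.
Proof.
move=> hx.
have C0 : 0 <= C by have := le_trans (normr_ge0 _) (hx 0%N); rewrite expr0 mulr1.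
have H k m : `|x (m + k)%N - x k| <= 2 * C * (2^-1 ^+ k - 2^-1 ^+ (m + k)).
  elim: m => [|m IH]; first by rewrite add0n !subrr normr0 mulr0.
  rewrite addSn -(subrKA (x (m + k)%N)) (le_trans (ler_normD _ _))//.
  rewrite (le_trans (lerD (hx _) IH))// exprS.
  by move: (2^-1 ^+ (m + k)) (2^-1 ^+ k) => a b; lra.
have pos k : 0 <= 2^-1 ^+ k :> R by rewrite exprn_ge0// invr_ge0.
have H' k m : (k <= m)%N -> `|x m - x k| <= 2 * C * 2^-1 ^+ k.
  move=> km; rewrite -(subnK km) (le_trans (H _ _))//.
  by rewrite ler_wpM2l ?mulr_ge0// gerBl.
have small e : 0 < e -> exists k, 2 * C * 2^-1 ^+ k < e :> R.
  move=> e0; have := @cvg_geometric R (2 * C) 2^-1.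
  rewrite ger0_norm ?invr_ge0// invf_lt1// ltr1n => /(_ isT).
  move=> /cvgrPdist_lt/(_ e e0)[N _ /(_ N (leqnn N))] /=.
  rewrite sub0r normrN ger0_norm ?mulr_ge0// => ?; by exists N.
have cx : cvgn x.
  apply/cauchy_cvgP/cauchy_ballP => e e0.
  have [N hN] := small _ (divr_gt0 e0 (ltr0n R 2)).
  rewrite near_simpl; exists ([set m | (N <= m)%N], [set m | (N <= m)%N]).
    by split; exists N.
  move=> [m1 m2] /= [m1N m2N]; rewrite -ball_normE/=.
  rewrite -(subrKA (x N)) (le_lt_trans (ler_normD _ _))// (splitr e).
  rewrite ltrD//; first exact: le_lt_trans (H' _ _ m1N) hN.
  by rewrite distrC; exact: le_lt_trans (H' _ _ m2N) hN.
exists (limn x) => k; apply/ler_addgt0Pr => e e0.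
have /cvgrPdist_lt/(_ e e0)[N _ hN] := cx.
have := hN (N + k)%N (leq_addr _ _).
move=> h; rewrite -(subrKA (x (N + k)%N)) (le_trans (ler_normD _ _))//.
by rewrite addrC lerD// ?(ltW h)// H'// leq_addl.
Qed.

(** Banach's fixed point theorem for continuous functions in the ball of radius [eta] of the sup
    norm, with contraction factor 1/2. The iterates start at 0, and their geometric rate makes the
    pointwise limit uniform, hence continuous. *)
Lemma contraction_fixpoint (Phi : (R -> V) -> (R -> V)) (eta : R) : 0 <= eta ->
  (forall u, continuous u -> (forall t, `|u t| <= eta) ->
     continuous (Phi u) /\ forall t, `|Phi u t| <= eta) ->
  (forall u w e, continuous u -> continuous w -> (forall t, `|u t| <= eta) ->
     (forall t, `|w t| <= eta) -> 0 <= e ->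
     (forall t, `|u t - w t| <= e) -> forall t, `|Phi u t - Phi w t| <= e / 2) ->
  exists u, [/\ continuous u, forall t, `|u t| <= eta & Phi u = u].
Proof.
move=> eta0 hPhi hctr.
pose u k := iter k Phi (fun=> 0).
have hu k : continuous (u k) /\ forall t, `|u k t| <= eta.
  elim: k => [|k [IH1 IH2]]; last exact: hPhi.
  by split=> [x|t]; [exact: cst_continuous|rewrite normr0].
have pos k : 0 <= 2^-1 ^+ k :> R by rewrite exprn_ge0// invr_ge0.
have hs t k : `|u k.+1 t - u k t| <= eta * 2^-1 ^+ k.
  elim: k t => [|k IH] t.
    by rewrite expr0 mulr1 /= subr0; exact: (hu 1%N).2.
  rewrite exprSr mulrA; apply: (hctr (u k.+1) (u k)) => //.
  - exact: (hu _).1.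
  - exact: (hu _).1.
  - exact: (hu _).2.
  - exact: (hu _).2.
  - exact: mulr_ge0.
have /choice[l hl] : forall t, exists l, forall k, `|l - u k t| <= 2 * eta * 2^-1 ^+ k.
  by move=> t; apply: geometric_limit => k; exact: hs.
have small e : 0 < e -> exists k, 2 * eta * 2^-1 ^+ k < e :> R.
  move=> e0; have := @cvg_geometric R (2 * eta) 2^-1.
  rewrite ger0_norm ?invr_ge0// invf_lt1// ltr1n => /(_ isT).
  move=> /cvgrPdist_lt/(_ e e0)[N _ /(_ N (leqnn N))] /=.
  rewrite sub0r normrN ger0_norm ?mulr_ge0// => ?; by exists N.
have cl : continuous l.
  move=> t; apply/continuous_normP => e e0.
  have e30 : 0 < e / 3 by rewrite divr_gt0.
  have [k hk] := small _ e30.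
  have [d d0 hd] := (continuous_normP _ _).1 ((hu k).1 t) _ e30.
  exists d => // s /hd sd.
  have h1 := le_lt_trans (hl s k) hk.
  have h2 := le_lt_trans (hl t k) hk.
  rewrite -(subrKA (u k s)) (le_lt_trans (ler_normD _ _))//.
  rewrite -(subrKA (u k t) (u k s)).
  rewrite (le_lt_trans (lerD (lexx _) (ler_normD _ _)))//.
  rewrite [`|u k t - l t|]distrC.
  by move: h1 h2 sd; move: (`|_|) (`|_|) (`|_|) => a b c; lra.
have bl t : `|l t| <= eta.
  apply/ler_addgt0Pr => e e0; have [k hk] := small _ e0.
  rewrite -[l t](subrK (u k t)) addrC (le_trans (ler_normD _ _))// lerD//.
    exact: (hu k).2.
  by rewrite (le_trans (hl _ _))// ltW.
exists l; split => //; apply/funext => t.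
apply/eqP; rewrite -subr_eq0 -normr_le0; apply/ler_addgt0Pr => e e0; rewrite add0r.
have e20 : 0 < e / 2 by rewrite divr_gt0.
have [k hk] := small _ e20.
rewrite -(subrKA (u k.+1 t)) (le_trans (ler_normD _ _))// (splitr e) lerD//.
  have := hctr l (u k) (2 * eta * 2^-1 ^+ k) cl (hu k).1 bl (hu k).2 _ (fun t => hl t k) t.
  move=> /(_ (mulr_ge0 (mulr_ge0 (ler0n _ 2) eta0) (pos k))) h.
  rewrite (le_trans h)// (le_trans _ (ltW hk))// ler_piMr ?mulr_ge0//.
  by rewrite invf_le1// ler1n.
rewrite distrC (le_trans (hl t k.+1))// (le_trans _ (ltW hk))//.
by rewrite exprS ler_wpM2l ?mulr_ge0// ler_piMl// invf_le1// ler1n.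
Qed.

End FixedPoint.

(* The argument is clamped so that the primitive is continuous on R. *)
HB.lock Definition cprim (R : realType) (n : nat) (a b : R) (u : R -> 'rV[R]_n)
  (t : R) : 'rV[R]_n := prim u (clamp a b t).

Section Primitives.
Variables (R : realType) (n : nat).
Local Notation V := 'rV[R]_n.
Implicit Types (u w : R -> V) (a b d : R).

Lemma cprim_continuous a b u : -3 < a -> a <= b -> continuous u ->
  continuous (cprim a b u).
Proof.
move=> a3 ab cu t; rewrite cprim.unlock; apply: (@continuous_comp _ _ _ (clamp a b) (prim u)).
  exact: clamp_continuous.
have /andP[ca _] := clamp_in t ab.
by apply: is_derive_continuous (is_derive_prim cu _); exact: lt_le_trans ca.
Qed.

Lemma cprim_dist a b u w e (L : R) t : -3 < a -> a <= 0 -> 0 <= b ->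
  - a <= L -> b <= L ->
  continuous u -> continuous w -> (forall t, `|u t - w t| <= e) ->
  `|cprim a b u t - cprim a b w t| <= L * e.
Proof.
move=> a3 a0 b0 aL bL cu cw h; have ab := le_trans a0 b0.
have e0 : 0 <= e := le_trans (normr_ge0 _) (h 0).
have /andP[ca cb] := clamp_in t ab; rewrite cprim.unlock; set c := clamp a b t in ca cb *.
have H := @derive_norm_le2 R 1 n (fun t => prim u t - prim w t) (fun t => u t - w t)
  a b e 0 c.
have {}H : `|(prim u c - prim w c) - (prim u 0 - prim w 0)| <= e * `|c - 0|.
  apply: H => //; rewrite ?a0 ?b0 ?ca ?cb//.
  move=> s /andP[as_ _]; have s3 : -3 < s by exact: lt_le_trans as_.
  by apply: is_deriveB; exact: is_derive_prim.
rewrite !prim_0 subrr !subr0 in H.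
rewrite (le_trans H)// mulrC ler_wpM2r// ler_norml.
by apply/andP; split; lra.
Qed.

Lemma cprim_cst0 a b : a <= b -> cprim a b (fun=> 0 : V) = fun=> 0.
Proof.
move=> ab; apply/funext => t; rewrite cprim.unlock; apply/rowP => i; rewrite !mxE /prim1.
by rewrite !Rintegral_cst// !mul0r subr0.
Qed.

Lemma cprim_bound a b u e (L : R) t : -3 < a -> a <= 0 -> 0 <= b ->
  - a <= L -> b <= L ->
  continuous u -> (forall t, `|u t| <= e) -> `|cprim a b u t| <= L * e.
Proof.
move=> a3 a0 b0 aL bL cu h.
have := @cprim_dist a b u (fun=> 0) e L t a3 a0 b0 aL bL cu.
rewrite cprim_cst0 ?(le_trans a0)// subr0; apply; first by move=> x; exact: cst_continuous.
by move=> s; rewrite subr0.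
Qed.

Lemma cprim0 a b u : a <= 0 -> 0 <= b -> cprim a b u 0 = 0.
Proof. by move=> a0 b0; rewrite cprim.unlock clamp_id ?a0// prim_0. Qed.

Lemma is_derive_cprim a b u t : -3 < a -> a < t < b -> continuous u ->
  is_derive t 1 (cprim a b u) (u t).
Proof.
move=> a3 /andP[a_t tb] cu.
have near_eq : \forall s \near t, prim u s = cprim a b u s.
  near=> s; rewrite cprim.unlock clamp_id//; apply/andP; split; apply: ltW; near: s.
    exact: lt_nbhsr.
  exact: lt_nbhsl.
apply: (is_derive_near near_eq); apply: is_derive_prim => //.
exact: lt_trans a_t.
Unshelve. all: by end_near. Qed.

End Primitives.

Local Notation P := (cprim (-1) 2).
Local Notation PP u := (P (P u)).

(** The unknown of the boundary value problem is the acceleration [u = x'']. The position integrates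
    it twice and corrects by an affine term, so [x 0 = a] and [x 1 = b] hold for every [u], and the
    equation becomes the fixed point equation [u = F x x']. Times run over [-1, 2], because a
    geodesic has to extend beyond [0, 1]. *)
HB.lock Definition bvp_vel (R : realType) (n : nat) (a b : 'rV[R]_n)
    (u : R -> 'rV[R]_n) (t : R) : 'rV[R]_n := (b - a) + P u t - PP u 1.

HB.lock Definition bvp_pos (R : realType) (n : nat) (a b : 'rV[R]_n)
    (u : R -> 'rV[R]_n) (t : R) : 'rV[R]_n :=
  a + clamp (-1) 2 t *: (b - a) + PP u t - clamp (-1) 2 t *: PP u 1.

Section BVP.
Variables (R : realType) (n : nat).
Local Notation V := 'rV[R]_n.
Variables (F : V -> V -> V) (z : V) (rho K : R).
Hypotheses (rho0 : 0 < rho) (K0 : 0 <= K).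
Hypothesis Fbound : forall x v, `|x - z| <= rho -> `|F x v| <= K * `|v| ^+ 2.
Hypothesis Flip : forall x y v w, `|x - z| <= rho -> `|y - z| <= rho ->
  `|F x v - F y w| <= K * `|x - y| * `|v| ^+ 2 + K * `|v - w| * (`|v| + `|w|).

Definition bvp_op a b u (t : R) : V := F (bvp_pos a b u t) (bvp_vel a b u t).

(** Integration from 0 over [-1, 2] costs a factor 2, twice a factor 4. Hence the constants below:
    [6 = 2 + 4] for the velocity, and [12 = 4 + 2 * 4] for the position, whose correction is
    multiplied by a time of size at most 2. *)
Lemma P_bound (u : R -> V) (e : R) (t : R) : continuous u -> (forall t, `|u t| <= e) -> `|P u t| <= 2 * e.
Proof. by move=> cu h; apply: cprim_bound => //; lra. Qed.

Lemma P_dist (u : R -> V) (w : R -> V) (e : R) (t : R) : continuous u -> continuous w ->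
  (forall t, `|u t - w t| <= e) -> `|P u t - P w t| <= 2 * e.
Proof. by move=> cu cw h; apply: cprim_dist => //; lra. Qed.

Lemma P_cont (u : R -> V) : continuous u -> continuous (P u).
Proof. by move=> cu; apply: cprim_continuous => //; lra. Qed.

Lemma clamp_bound (t : R) : `|clamp (-1) 2 t : R| <= 2.
Proof.
have /andP[h1 h2] : (-1 : R) <= clamp (-1) 2 t <= 2 by apply: clamp_in; lra.
by rewrite ler_norml h2 andbT; lra.
Qed.

Lemma bvp_vel_bound (a : V) (b : V) (u : R -> V) (e : R) (t : R) : continuous u -> (forall t, `|u t| <= e) ->
  `|bvp_vel a b u t| <= `|b - a| + 6 * e.
Proof.
move=> cu h; have h1 := P_bound _ cu h.
have h2 := P_bound 1 (P_cont cu) h1.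
rewrite bvp_vel.unlock (le_trans (ler_normB _ _))// (le_trans (lerD (ler_normD _ _) h2))//.
by move: (h1 t); gn; lra.
Qed.

Lemma bvp_pos_bound (a : V) (b : V) (u : R -> V) (e : R) (t : R) : continuous u -> (forall t, `|u t| <= e) ->
  `|bvp_pos a b u t - z| <= `|a - z| + 2 * `|b - a| + 12 * e.
Proof.
move=> cu h; have h1 := P_bound _ cu h.
have h2 s := P_bound s (P_cont cu) h1.
rewrite bvp_pos.unlock; set k := clamp _ _ t.
have kb : `|k| <= 2 by exact: clamp_bound.
have -> : a + k *: (b - a) + PP u t - k *: PP u 1 - z =
  (a - z) + k *: (b - a) + PP u t - k *: PP u 1.
  move: (PP u t) (PP u 1) => p q; clearbody k.
  by apply/rowP => i; rewrite !mxE; ring.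
rewrite (le_trans (ler_normB _ _))//.
have h3 : `|k *: PP u 1| <= 8 * e.
  rewrite normrZ (le_trans (ler_pM _ _ kb (h2 1)))//; lra.
have h4 : `|k *: (b - a)| <= 2 * `|b - a| by rewrite normrZ ler_wpM2r.
rewrite (le_trans (lerD (ler_normD _ _) h3))//.
by move: h4 (ler_normD (a - z) (k *: (b - a))) (h2 t); gn; lra.
Qed.

Lemma bvp_vel_dist (a : V) (b : V) (a' : V) (b' : V) (u : R -> V) (w : R -> V) (e : R) (t : R) : continuous u -> continuous w ->
  (forall t, `|u t - w t| <= e) ->
  `|bvp_vel a b u t - bvp_vel a' b' w t| <= `|a - a'| + `|b - b'| + 6 * e.
Proof.
move=> cu cw h; have h1 s := P_dist s cu cw h.
have h2 := P_dist 1 (P_cont cu) (P_cont cw) h1.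
have -> : bvp_vel a b u t - bvp_vel a' b' w t =
    ((b - b') - (a - a')) + (P u t - P w t) - (PP u 1 - PP w 1).
  rewrite bvp_vel.unlock; move: (P u t) (P w t) (PP u 1) (PP w 1) => p p' q q'.
  by apply/rowP => i; rewrite !mxE; ring.
rewrite (le_trans (ler_normB _ _))// (le_trans (lerD (ler_normD _ _) h2))//.
by move: (h1 t) (ler_normB (b - b') (a - a')); gn; lra.
Qed.

Lemma bvp_pos_dist (a : V) (b : V) (a' : V) (b' : V) (u : R -> V) (w : R -> V) (e : R) (t : R) : continuous u -> continuous w ->
  (forall t, `|u t - w t| <= e) ->
  `|bvp_pos a b u t - bvp_pos a' b' w t| <= 3 * (`|a - a'| + `|b - b'|) + 12 * e.
Proof.
move=> cu cw h; have h1 s := P_dist s cu cw h.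
have h2 s := P_dist s (P_cont cu) (P_cont cw) h1.
rewrite bvp_pos.unlock; set k := clamp _ _ t.
have kb : `|k| <= 2 by exact: clamp_bound.
have -> : a + k *: (b - a) + PP u t - k *: PP u 1 -
   (a' + k *: (b' - a') + PP w t - k *: PP w 1) =
  (a - a') + k *: ((b - b') - (a - a')) + (PP u t - PP w t) - k *: (PP u 1 - PP w 1).
  move: (PP u t) (PP w t) (PP u 1) (PP w 1) => p p' q q'; clearbody k.
  by apply/rowP => i; rewrite !mxE; ring.
have h3 : `|k *: (PP u 1 - PP w 1)| <= 8 * e.
  rewrite normrZ (le_trans (ler_pM _ _ kb (h2 1)))//; lra.
have h4 : `|k *: ((b - b') - (a - a'))| <= 2 * (`|a - a'| + `|b - b'|).
  by rewrite normrZ ler_pM// (le_trans (ler_normB _ _))// addrC.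
rewrite (le_trans (ler_normB _ _))//.
rewrite (le_trans (lerD (ler_normD _ _) h3))//.
move: (ler_normD (a - a') (k *: ((b - b') - (a - a')))) (h2 t) h4.
by move: (normr_ge0 (b - b')); gn; lra.
Qed.

Lemma bvp_pos_cont (a b : V) (u : R -> V) : continuous u -> continuous (bvp_pos a b u).
Proof.
move=> cu t; rewrite bvp_pos.unlock; have ck := @clamp_continuous R (-1) 2 t.
have cP : {for t, continuous (PP u)} by exact: (P_cont (P_cont cu)).
have ckZ (c : V) : {for t, continuous (fun s => clamp (-1) 2 s *: c)}.
  exact: (cvgZr_tmp ck).
apply: (@continuousB R V _ (fun t => a + clamp (-1) 2 t *: (b - a) + PP u t)
  (fun t => clamp (-1) 2 t *: PP u 1)); last exact: ckZ.
apply: (@continuousD R V _ (fun t => a + clamp (-1) 2 t *: (b - a)) (PP u)) => //.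
apply: (@continuousD R V _ (fun t => a) (fun t => clamp (-1) 2 t *: (b - a))).
  exact: cst_continuous.
exact: ckZ.
Qed.

Lemma bvp_vel_cont (a b : V) (u : R -> V) : continuous u -> continuous (bvp_vel a b u).
Proof.
move=> cu t; rewrite bvp_vel.unlock.
apply: (@continuousB R V _ (fun t => (b - a) + P u t) (fun=> PP u 1)); last first.
  exact: cst_continuous.
apply: (@continuousD R V _ (fun=> b - a) (P u)); first exact: cst_continuous.
exact: (P_cont cu).
Qed.

Variable r0 : R.
Hypotheses (r00 : 0 < r0) (r0rho : 16 * r0 <= rho) (r01 : 2 * r0 <= 1)
  (Kr0 : 288 * K * r0 <= 1).

Lemma bvp_dist_le (a : V) (b : V) : `|a - z| <= r0 -> `|b - z| <= r0 -> `|b - a| <= 2 * r0.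
Proof.
move=> ha hb; rewrite -(subrKA z) (le_trans (ler_normD _ _))//.
by rewrite (distrC z); lra.
Qed.

(** The velocity stays below [2 * |b - a|], so [Fbound] limits the acceleration to
    [K * (2 * |b - a|) ^+ 2]. *)
Let eta (a b : V) : R := 4 * K * `|b - a| ^+ 2.

Lemma eta_le (a : V) (b : V) : `|a - z| <= r0 -> `|b - z| <= r0 ->
  0 <= eta a b /\ 36 * eta a b <= `|b - a|.
Proof.
move=> ha hb; have d := bvp_dist_le ha hb; split.
  by rewrite /eta !mulr_ge0// exprn_ge0.
have -> : 36 * eta a b = (144 * K * `|b - a|) * `|b - a| by rewrite /eta; ring.
rewrite ler_piMl// (le_trans _ Kr0)// -!mulrA.
have -> : 288 * (K * r0) = 144 * (K * (2 * r0)) by ring.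
by rewrite ler_wpM2l// ler_wpM2l.
Qed.

Lemma bvp_pos_in (a : V) (b : V) (u : R -> V) (t : R) : `|a - z| <= r0 -> `|b - z| <= r0 ->
  continuous u -> (forall t, `|u t| <= eta a b) -> `|bvp_pos a b u t - z| <= rho.
Proof.
move=> ha hb cu h; have [e1 e] := eta_le ha hb; have d := bvp_dist_le ha hb.
move: (bvp_pos_bound a b t cu h) e d ha; clear h; move: (eta a b) e1 => E ?; gn.
have := r00; have := r0rho; lra.
Qed.

Lemma bvp_vel_in (a : V) (b : V) (u : R -> V) (t : R) : `|a - z| <= r0 -> `|b - z| <= r0 ->
  continuous u -> (forall t, `|u t| <= eta a b) -> `|bvp_vel a b u t| <= 2 * `|b - a|.
Proof.
move=> ha hb cu h; have [e1 e] := eta_le ha hb.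
by move: (bvp_vel_bound a b t cu h) e; clear h; move: (eta a b) e1 => E ?; gn; lra.
Qed.

(** With [E] the total displacement of the ends, the two terms of [Flip] add up to
    [8 * r0 * K * (4 * E + 18 * e)], which [288 * K * r0 <= 1] turns into at most [E / 9 + e / 2].
    Equal ends give the contraction, different ends the dependence on them. *)
Lemma bvp_op_dist (a : V) (b : V) (a' : V) (b' : V) (u : R -> V) (w : R -> V) (e : R) (t : R) :
  `|a - z| <= r0 -> `|b - z| <= r0 -> `|a' - z| <= r0 -> `|b' - z| <= r0 ->
  continuous u -> (forall t, `|u t| <= eta a b) ->
  continuous w -> (forall t, `|w t| <= eta a' b') -> 0 <= e ->
  (forall t, `|u t - w t| <= e) ->
  `|bvp_op a b u t - bvp_op a' b' w t| <= e / 2 + (`|a - a'| + `|b - b'|).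
Proof.
move=> ha hb ha' hb' cu bu cw bw e0 h.
rewrite (le_trans (Flip _ _ (bvp_pos_in t ha hb cu bu) (bvp_pos_in t ha' hb' cw bw)))//.
have p := bvp_pos_dist a b a' b' t cu cw h.
have v := bvp_vel_dist a b a' b' t cu cw h.
have v1 := bvp_vel_in t ha hb cu bu; have v2 := bvp_vel_in t ha' hb' cw bw.
have d1 := bvp_dist_le ha hb; have d2 := bvp_dist_le ha' hb'.
set E := `|a - a'| + `|b - b'| in p v *.
have E0 : 0 <= E by rewrite addr_ge0.
have q1 : `|bvp_vel a b u t| <= 4 * r0 by move: v1 d1; gn; lra.
have q2 : `|bvp_vel a' b' w t| <= 4 * r0 by move: v2 d2; gn; lra.
have q3 : `|bvp_vel a b u t| ^+ 2 <= 8 * r0.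
  rewrite expr2 (le_trans (ler_pM _ _ q1 q1))//.
  have -> : 4 * r0 * (4 * r0) = (8 * r0) * (2 * r0) by ring.
  by rewrite ler_piMr// mulr_ge0// ltW.
have H1 : K * `|bvp_pos a b u t - bvp_pos a' b' w t| * `|bvp_vel a b u t| ^+ 2 <=
   K * (3 * E + 12 * e) * (8 * r0).
  by apply: ler_pM; [exact: mulr_ge0|exact: exprn_ge0|exact: ler_wpM2l|].
have H2 : K * `|bvp_vel a b u t - bvp_vel a' b' w t| *
   (`|bvp_vel a b u t| + `|bvp_vel a' b' w t|) <= K * (E + 6 * e) * (8 * r0).
  apply: ler_pM; [exact: mulr_ge0|exact: addr_ge0|exact: ler_wpM2l|by move: q1 q2; gn; lra].
rewrite (le_trans (lerD H1 H2))//.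
have -> : K * (3 * E + 12 * e) * (8 * r0) + K * (E + 6 * e) * (8 * r0) =
  (288 * K * r0) * (E / 9 + e / 2) by field.
rewrite (le_trans (ler_wpM2r _ Kr0)) ?mul1r; clearbody E; lra.
Qed.

Lemma bvp_op_cont (a : V) (b : V) (u : R -> V) : `|a - z| <= r0 -> `|b - z| <= r0 ->
  continuous u -> (forall t, `|u t| <= eta a b) -> continuous (bvp_op a b u).
Proof.
move=> ha hb cu bu t; apply/continuous_normP => e e0.
have d1 := bvp_dist_le ha hb.
pose C := K * (4 * r0) ^+ 2 + K * (8 * r0) + 1.
have A1 : 0 <= K * (4 * r0) ^+ 2 by rewrite mulr_ge0// exprn_ge0// mulr_ge0// ltW.
have A2 : 0 <= K * (8 * r0) by rewrite mulr_ge0// mulr_ge0// ltW.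
have C0 : 0 < C by rewrite /C; lra.
have eC : 0 < e / C by rewrite divr_gt0.
have [dx dx0 hx] := (continuous_normP _ _).1 (@bvp_pos_cont a b u cu t) _ eC.
have [dv dv0 hv] := (continuous_normP _ _).1 (@bvp_vel_cont a b u cu t) _ eC.
exists (Num.min dx dv); first by rewrite lt_min dx0.
move=> s; rewrite lt_min => /andP[/hx sx /hv sv].
have bp r := bvp_pos_in r ha hb cu bu; have bv r := bvp_vel_in r ha hb cu bu.
apply: le_lt_trans (Flip _ _ (bp s) (bp t)) _.
have q r : `|bvp_vel a b u r| <= 4 * r0 by move: (bv r) d1; gn; lra.
have qq r : `|bvp_vel a b u r| ^+ 2 <= (4 * r0) ^+ 2.
  by rewrite ler_pXn2r// nnegrE// mulr_ge0// ltW.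
apply: (@le_lt_trans _ _ (K * (e / C) * (4 * r0) ^+ 2 + K * (e / C) * (8 * r0))).
  apply: lerD; apply: ler_pM.
  - exact: mulr_ge0.
  - exact: exprn_ge0.
  - by apply: ler_wpM2l => //; exact: ltW.
  - exact: qq.
  - exact: mulr_ge0.
  - exact: addr_ge0.
  - by apply: ler_wpM2l => //; exact: ltW.
  by move: (q s) (q t); gn; lra.
have -> : K * (e / C) * (4 * r0) ^+ 2 + K * (e / C) * (8 * r0) =
   (e / C) * (K * (4 * r0) ^+ 2 + K * (8 * r0)) by ring.
rewrite -[ltRHS](divfK (lt0r_neq0 C0)) ltr_pM2l// /C; lra.
Qed.

Lemma bvp_exists (a : V) (b : V) : `|a - z| <= r0 -> `|b - z| <= r0 ->
  exists u, [/\ continuous u, forall t, `|u t| <= eta a b & bvp_op a b u = u].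
Proof.
move=> ha hb; have [e0 _] := eta_le ha hb.
apply: contraction_fixpoint => //.
- move=> u cu bu; split; first exact: bvp_op_cont.
  move=> t; rewrite (le_trans (Fbound _ (bvp_pos_in t ha hb cu bu)))//.
  rewrite /eta [4 * K]mulrC -mulrA ler_wpM2l//.
  have -> : 4 * `|b - a| ^+ 2 = (2 * `|b - a|) ^+ 2 by ring.
  by rewrite ler_pXn2r ?nnegrE ?mulr_ge0// bvp_vel_in.
- move=> u w e cu cw bu bw e00 h t.
  have := bvp_op_dist t ha hb ha hb cu bu cw bw e00 h.
  by rewrite (subrr a) (subrr b) normr0 !addr0.
Qed.

(** More than existence is at stake. By uniqueness the solution will be identified with the geodesic
    between its ends, which is thereby known to stay in the chart, with a velocity controlled by
    [b - a] and a Lipschitz dependence on the ends. The constant is [27 = 3 + 12 * 2], as two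
    accelerations differ by at most twice the displacement of the ends. *)
Lemma bvp_family : exists x v : V -> V -> R -> V,
  (forall a b : V, `|a - z| <= r0 -> `|b - z| <= r0 ->
    [/\ x a b 0 = a, x a b 1 = b,
       (forall t : R, `|x a b t - z| <= rho /\ `|v a b t| <= 2 * `|b - a|) &
       (forall t : R, -1 < t < 2 -> is_derive t 1 (x a b) (v a b t) /\
          is_derive t 1 (v a b) (F (x a b t) (v a b t)))]) /\
  (forall (a b a' b' : V) (t : R), `|a - z| <= r0 -> `|b - z| <= r0 ->
     `|a' - z| <= r0 -> `|b' - z| <= r0 ->
     `|x a b t - x a' b' t| <= 27 * (`|a - a'| + `|b - b'|)).
Proof.
have /choice[U hU] : forall ab : V * V, exists u, `|ab.1 - z| <= r0 -> `|ab.2 - z| <= r0 ->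
  [/\ continuous u, forall t, `|u t| <= eta ab.1 ab.2 & bvp_op ab.1 ab.2 u = u].
  move=> [a b] /=; have [ha|ha] := boolP (`|a - z| <= r0); last by exists (fun=> 0).
  have [hb|hb] := boolP (`|b - z| <= r0); last by exists (fun=> 0).
  by have [u hu] := bvp_exists ha hb; exists u.
exists (fun a b => bvp_pos a b (U (a, b))), (fun a b => bvp_vel a b (U (a, b))); split.
  move=> a b ha hb; have [cu bu eu] := hU (a, b) ha hb.
  have [] : (-1 : R) <= 0 /\ (0 : R) <= 2 by split; lra.
  move=> m1 m2; split.
  - by rewrite bvp_pos.unlock clamp_id ?m1// !scale0r cprim0// !addr0 subr0.
  - rewrite bvp_pos.unlock clamp_id; last by apply/andP; split; lra.
    by rewrite !scale1r addrK addrC subrK.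
  - by move=> t; split; [exact: bvp_pos_in|exact: bvp_vel_in].
  - move=> t t12; split; last first.
      rewrite -/(bvp_op a b (U (a, b)) t) eu bvp_vel.unlock.
      have h1 : is_derive t 1 (P (U (a, b))) (U (a, b) t).
        by apply: is_derive_cprim => //; lra.
      have h2 := is_deriveD (is_derive_cst (b - a) t 1) h1.
      have := is_deriveB h2 (is_derive_cst (PP (U (a, b)) 1) t 1).
      by rewrite add0r subr0; apply.
    have h1 : is_derive t 1 (PP (U (a, b))) (P (U (a, b)) t).
      by apply: is_derive_cprim => //; [lra|exact: P_cont].
    have hl (c : V) : is_derive t 1 (fun s => clamp (-1) 2 s *: c) c.
      have := @is_derive_line R _ _ id 0 c t; rewrite derive_id add0r => h.
      apply: (@is_derive_near _ _ (fun s => id (0 + s *: c))).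
        near=> s; rewrite add0r clamp_id//; apply/andP; split; apply: ltW; near: s.
          by apply: lt_nbhsr; case/andP: t12.
        by apply: lt_nbhsl; case/andP: t12.
      by apply: h; have [] := @is_diff_id R _ (t *: c).
    have h2 := is_deriveD (is_deriveD (is_derive_cst a t 1) (hl (b - a))) h1.
    have := is_deriveB h2 (hl (PP (U (a, b)) 1)).
    by rewrite add0r bvp_pos.unlock bvp_vel.unlock; apply.
move=> a b a' b' t ha hb ha' hb'.
have [cu bu eu] := hU (a, b) ha hb; have [cu' bu' eu'] := hU (a', b') ha' hb'.
pose S := [set x | exists t, x = `|U (a, b) t - U (a', b') t|].
have supS : has_sup S.
  split; first by exists `|U (a, b) 0 - U (a', b') 0|; exists 0.
  exists (eta a b + eta a' b') => x [s ->].
  by rewrite (le_trans (ler_normB _ _))// lerD.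
have hS s : `|U (a, b) s - U (a', b') s| <= sup S.
  by apply: ub_le_sup; [case: supS|exists s].
have S0 : 0 <= sup S := le_trans (normr_ge0 _) (hS 0).
have : sup S <= 2 * (`|a - a'| + `|b - b'|).
  (* The supremum is finite, so half of it can be absorbed. *)
  suff : sup S <= sup S / 2 + (`|a - a'| + `|b - b'|) by lra.
  apply: ge_sup; first by case: supS.
  move=> x [s ->]; have -> : U (a, b) s - U (a', b') s =
    bvp_op a b (U (a, b)) s - bvp_op a' b' (U (a', b')) s.
    by have /= -> := eu; have /= -> := eu'.
  exact: bvp_op_dist.
have := bvp_pos_dist a b a' b' t cu cu' hS; lra.
Unshelve. all: by end_near. Qed.

End BVP.

(** * Differential equations for parallel fields on a short interval *)

Section LinearODE.
Variables (R : realType) (n : nat).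
Local Notation V := 'rV[R]_n.

(** The unknown is [E'], in the ball of radius [2 * L * |w0|]. The condition [L * d <= 1 / 2] both
    keeps this ball invariant and gives the contraction factor 1/2. *)
Lemma linear_ode_exists (A : R -> V -> V) (d L : R) (w0 : V) :
  0 < d -> d <= 1 -> 0 <= L -> L * d <= 2^-1 ->
  (forall t, -d <= t <= d -> A t 0 = 0) ->
  (forall t w w', -d <= t <= d -> `|A t w - A t w'| <= L * `|w - w'|) ->
  (forall y : R -> V, continuous y -> continuous (fun t => A (clamp (-d) d t) (y t))) ->
  exists E : R -> V, E 0 = w0 /\ forall t, - d < t < d -> is_derive t 1 E (A t (E t)).
Proof.
move=> d0 d1 L0 Ld A0 AL Ac.
have dd : - d <= d by lra.
have d3 : -3 < - d by lra.
have d00 : - d <= 0 by lra.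
have d0' : 0 <= d by lra.
pose Y u t := w0 + cprim (-d) d u t.
pose Phi u t := A (clamp (-d) d t) (Y u t).
have cY u : continuous u -> continuous (Y u).
  move=> cu t; apply: continuousD; first exact: cst_continuous.
  exact: cprim_continuous.
have [|||u [cu bu eu]] := @contraction_fixpoint R n Phi (2 * (L * `|w0|)).
- by rewrite !mulr_ge0.
- move=> u cu bu; split; first by apply: Ac; exact: cY.
  move=> t; rewrite -[Phi u t]subr0 -(A0 (clamp (-d) d t)); last exact: clamp_in.
  rewrite (le_trans (AL _ _ _ _))//; first exact: clamp_in.
  rewrite subr0 /Y.
  have h : `|cprim (-d) d u t| <= d * (2 * (L * `|w0|)).
    by apply: cprim_bound => //; rewrite opprK.
  rewrite (le_trans (ler_wpM2l L0 (ler_normD _ _)))//.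
  rewrite mulrDr (le_trans (lerD (lexx _) (ler_wpM2l L0 h)))//.
  rewrite (mulrA L d); have := ler_wpM2r _ Ld; move=> /(_ (2 * (L * `|w0|))).
  by have := mulr_ge0 L0 (normr_ge0 w0); lra.
- move=> u w e cu cw bu bw e0 h t.
  rewrite (le_trans (AL _ _ _ _))//; first exact: clamp_in.
  have h1 : `|cprim (-d) d u t - cprim (-d) d w t| <= d * e.
    by apply: cprim_dist => //; rewrite opprK.
  have -> : Y u t - Y w t = cprim (-d) d u t - cprim (-d) d w t.
    rewrite /Y; move: (cprim _ _ u t) (cprim _ _ w t) => p q.
    by apply/rowP => i; rewrite !mxE; ring.
  rewrite (le_trans (ler_wpM2l L0 h1))// mulrA [leRHS]mulrC.
  by rewrite ler_wpM2r.
exists (Y u); split; first by rewrite /Y cprim0// addr0.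
move=> t td; have h1 : is_derive t 1 (cprim (-d) d u) (u t) by exact: is_derive_cprim.
have -> : A t (Y u t) = u t.
  rewrite -[in RHS]eu /Phi clamp_id//; case/andP: td => t1 t2; by rewrite !ltW.
by have := is_deriveD (is_derive_cst w0 t 1) h1; rewrite add0r; apply.
Qed.

End LinearODE.

(** * Curves and distance *)

Lemma near_open (T : topologicalType) (A : set T) (x : T) :
  open A -> A x -> \forall y \near x, A y.
Proof. by move=> oA Ax; apply: open_nbhs_nbhs; split. Qed.

Section Charts.
Variables (R : realType) (n : nat) (M : riemannianManifold R n).
Implicit Types (i j : mchart M) (p q : M) (c : R -> M) (x u v w : 'rV[R]_n).

Definition chart_range i : set 'rV[R]_n := mcoord i @` mdom i.
Local Notation U := chart_range.

Lemma chart_range_open i : open (U i). Proof. exact: open_mcoord. Qed.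

Lemma chart_rangeP i p : mdom i p -> U i (mcoord i p).
Proof. by move=> ip; exists p. Qed.

Lemma mpoint_dom i x : U i x -> mdom i (mpoint i x).
Proof. by move=> [p ip <-]; rewrite mcoordK. Qed.

Lemma mpointK i x : U i x -> mcoord i (mpoint i x) = x.
Proof. by move=> [p ip <-]; rewrite mcoordK. Qed.

Lemma mpoint_continuous i x : U i x -> {for x, continuous (mpoint i)}.
Proof. by move=> [p ip <-]; exact: continuous_mpoint. Qed.

Lemma gram_smooth' i : smooth_on (U i) (@gram _ _ M i).
Proof. exact: gram_smooth. Qed.

Lemma gram_sym' i x : U i x -> (gram i x)^T = gram i x.
Proof. by move=> [p ip <-]; exact: gram_sym. Qed.

Lemma gram_pos' i x u : U i x -> u != 0 -> 0 < bilin (gram i x) u u.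
Proof. by move=> [p ip <-]; exact: gram_pos. Qed.

Lemma gram_ge0 i x u : U i x -> 0 <= bilin (gram i x) u u.
Proof.
move=> Ux; have [->|u0] := eqVneq u 0; first by rewrite bilin0l.
by rewrite ltW// gram_pos'.
Qed.

Definition transition i j x : 'rV[R]_n := mcoord j (mpoint i x).

Definition overlap i j : set 'rV[R]_n := mcoord i @` (mdom i `&` mdom j).

Lemma overlapP i j x : overlap i j x <-> U i x /\ mdom j (mpoint i x).
Proof.
split=> [[p [ip jp] <-]|[[p ip <-]]]; last by rewrite mcoordK//; exists p.
by split; [exists p|rewrite mcoordK].
Qed.

Lemma overlap_open i j : open (overlap i j).
Proof.
rewrite openE => x /overlapP[Ux jx].
have h1 : \forall y \near x, U i y by exact: (near_open (@chart_range_open i)).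
have h2 : \forall y \near x, mdom j (mpoint i y).
  by apply: (mpoint_continuous Ux); exact: (near_open (@open_mdom _ _ _ _)).
by apply: filterS2 h1 h2 => y ? ?; apply/overlapP.
Qed.

Lemma overlap_coord i j p : mdom i p -> mdom j p -> overlap i j (mcoord i p).
Proof. by move=> ip jp; exists p. Qed.

Lemma transition_smooth i j : smooth_on (overlap i j) (transition i j).
Proof. exact: smooth_transition. Qed.

Lemma overlap_sub i j : overlap i j `<=` U i.
Proof. by move=> x /overlapP[]. Qed.

Lemma transition_range i j x : overlap i j x -> U j (transition i j x).
Proof. by move=> /overlapP[Ux jx]; exact: chart_rangeP. Qed.

Lemma transition_coord i j p : mdom i p -> transition i j (mcoord i p) = mcoord j p.
Proof. by move=> ip; rewrite /transition mcoordK. Qed.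

Lemma transition_isom i j x u w : overlap i j x ->
  bilin (gram i x) u w =
  bilin (gram j (transition i j x)) ('D_u (transition i j) x) ('D_w (transition i j) x).
Proof.
move=> [p [ip jp] <-]; rewrite transition_coord//.
by rewrite (gram_transition u w ip jp).
Qed.

Lemma transitionK i j x : overlap i j x ->
  overlap j i (transition i j x) /\ transition j i (transition i j x) = x.
Proof.
move=> [p [ip jp] <-]; rewrite transition_coord//; split; first by exists p.
by rewrite transition_coord.
Qed.

Lemma transition_differentiable i j x : overlap i j x -> differentiable (transition i j) x.
Proof. exact: (smooth_differentiable (@transition_smooth i j)). Qed.

Lemma transition_inv i j x z : overlap i j x ->
  'D_('D_z (transition i j) x) (transition j i) (transition i j x) = z.
Proof.
move=> ox; have [oy yx] := transitionK ox.
have x0 : x = x + (0 : R) *: z by rewrite scale0r addr0.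
have d1 : is_derive (0 : R) 1 (fun s => transition i j (x + s *: z))
    ('D_z (transition i j) x).
  rewrite {2}x0; apply: (@is_derive_line R _ _ (transition i j)).
  by rewrite -x0; exact: transition_differentiable.
have d2 : differentiable (transition j i) (transition i j (x + (0 : R) *: z)).
  by rewrite -x0; exact: transition_differentiable.
have d3 := is_derive_diff_comp d2 d1.
have d4 := line_is_derive x z 0.
have ne : \forall s \near (0 : R), x + s *: z = transition j i (transition i j (x + s *: z)).
  have : \forall s \near (0 : R), overlap i j (x + s *: z).
    apply: (is_derive_continuous d4); rewrite -x0.
    exact: (near_open (@overlap_open _ _)).
  by apply: filterS => s os; have [_ ->] := transitionK os.
have := is_derive_unique (is_derive_near ne d4) d3.
by rewrite -x0 => <-.
Qed.

Lemma transition_surj i j x z : overlap i j x ->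
  exists u, 'D_u (transition i j) x = z.
Proof.
move=> ox; have [oy yx] := transitionK ox.
exists ('D_z (transition j i) (transition i j x)).
by have := transition_inv z oy; rewrite yx.
Qed.

Lemma christoffel_transition i j x u w : overlap i j x ->
  'D_(Gam (gram i) x u w) (transition i j) x =
  Gam (gram j) (transition i j x) ('D_u (transition i j) x) ('D_w (transition i j) x)
  + hess (transition i j) x u w.
Proof.
move=> ox.
apply: (@Gam_transform R n (U i) (U j) (overlap i j) (gram i) (gram j)
  (transition i j) (@overlap_open i j)).
- exact: gram_smooth'.
- exact: gram_smooth'.
- exact: gram_sym'.
- exact: gram_sym'.
- exact: gram_pos'.
- exact: gram_pos'.
- exact: transition_smooth.
- exact: overlap_sub.
- exact: transition_range.
- by move=> *; exact: transition_isom.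
- by move=> *; exact: transition_surj.
- exact: ox.
Qed.

Lemma near_dom i c (t : R) : {for t, continuous c} -> mdom i (c t) ->
  \forall s \near t, mdom i (c s).
Proof. by move=> ct it; apply: ct; exact: (near_open (@open_mdom _ _ _ _)). Qed.

Lemma continuous_mcoord_comp i c (t : R) : {for t, continuous c} -> mdom i (c t) ->
  {for t, continuous (mcoord i \o c)}.
Proof.
move=> ct it; apply: continuous_comp => //; exact: continuous_mcoord.
Qed.

Lemma is_derive_transition i j c (t : R) v : {for t, continuous c} ->
  mdom i (c t) -> mdom j (c t) -> is_derive t 1 (mcoord i \o c) v ->
  is_derive t 1 (mcoord j \o c) ('D_v (transition i j) (mcoord i (c t))).
Proof.
move=> ct it jt dv.
have ne : \forall s \near t, transition i j ((mcoord i \o c) s) = (mcoord j \o c) s.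
  by apply: filterS (near_dom ct it) => s is_; rewrite /= transition_coord.
apply: (is_derive_near ne); apply: is_derive_diff_comp => //.
by apply: transition_differentiable; exact: overlap_coord.
Qed.

Lemma speed_transition i j c (t : R) v v' : {for t, continuous c} ->
  mdom i (c t) -> mdom j (c t) -> is_derive t 1 (mcoord i \o c) v ->
  is_derive t 1 (mcoord j \o c) v' ->
  bilin (gram i (mcoord i (c t))) v v = bilin (gram j (mcoord j (c t))) v' v'.
Proof.
move=> ct it jt dv dv'.
have -> := is_derive_unique dv' (is_derive_transition ct it jt dv).
by rewrite (transition_isom v v (overlap_coord it jt)) transition_coord.
Qed.

Definition speed c (t : R) : R := Num.sqrt (inner (c t) (velocity c t) (velocity c t)).

Lemma velocityE c (t : R) v :
  is_derive t 1 (mcoord (mchart_at (c t)) \o c) v -> velocity c t = v.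
Proof. by move=> [_ <-]; rewrite /velocity derive1E. Qed.

Lemma sq_speedE i c (t : R) v : {for t, continuous c} -> mdom i (c t) ->
  is_derive t 1 (mcoord i \o c) v ->
  inner (c t) (velocity c t) (velocity c t) = bilin (gram i (mcoord i (c t))) v v.
Proof.
move=> ct it dv; have jt := mdom_chart_at (c t).
have dv' := is_derive_transition ct it jt dv.
by rewrite (velocityE dv') (speed_transition ct it jt dv dv').
Qed.

Lemma speedE i c (t : R) v : {for t, continuous c} -> mdom i (c t) ->
  is_derive t 1 (mcoord i \o c) v ->
  speed c t = Num.sqrt (bilin (gram i (mcoord i (c t))) v v).
Proof. by move=> ct it dv; rewrite /speed (sq_speedE ct it dv). Qed.

Lemma C1_atP i c (t : R) : C1_at c t -> mdom i (c t) ->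
  [/\ {for t, continuous c},
   \forall s \near t, is_derive (s : R) 1 (mcoord i \o c) (derive1 (mcoord i \o c) s) &
   {for t, continuous (derive1 (mcoord i \o c))}].
Proof.
move=> [ct h] it; have [h1 h2] := h i it; split => //.
by apply: filterS h1 => s ds; rewrite derive1E; exact: derivableP.
Qed.

Lemma continuous_bigsum (T : topologicalType) (I : Type) (r : seq I) (f : I -> T -> R) (t : T) :
  (forall k : I, {for t, continuous (f k)}) ->
  {for t, continuous (fun s : T => \sum_(k <- r) f k s)}.
Proof.
move=> h; elim: r => [|k r IH].
  rewrite (_ : (fun s => _) = cst 0); first exact: cst_continuous.
  by apply/funext => s; rewrite big_nil.
rewrite (_ : (fun s => _) = (fun s => f k s + \sum_(k <- r) f k s)).
  by apply: cvgD; [exact: h|exact: IH].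
by apply/funext => s; rewrite big_cons.
Qed.

Lemma continuous_bilin (T : topologicalType) (A : T -> 'M[R]_n) (u w : T -> 'rV[R]_n) (t : T) :
  {for t, continuous A} -> {for t, continuous u} -> {for t, continuous w} ->
  {for t, continuous (fun s : T => bilin (A s) (u s) (w s))}.
Proof.
move=> cA cu cw.
rewrite (_ : (fun s => _) = (fun s => \sum_i \sum_j u s 0 i * A s i j * w s 0 j)); last first.
  by apply/funext => s; rewrite bilinE.
apply: continuous_bigsum => i; apply: continuous_bigsum => j.
apply: cvgM; last exact: continuous_coord cw.
by apply: cvgM; [exact: continuous_coord cu|exact: continuous_coord cA].
Qed.

Lemma speed_continuous c (t : R) : C1_at c t ->
  (\forall s \near t, C1_at c s) -> {for t, continuous (speed c)}.
Proof.
move=> Ct Cn; have it := mdom_chart_at (c t); set i := mchart_at (c t) in it.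
have [ct dn cd] := C1_atP Ct it.
have ne : \forall s \near t,
   Num.sqrt (bilin (gram i (mcoord i (c s))) (derive1 (mcoord i \o c) s) (derive1 (mcoord i \o c) s))
   = speed c s.
  near=> s.
  have cs : {for s, continuous c} by have [] : C1_at c s by near: s.
  have is_ : mdom i (c s) by near: s; exact: near_dom.
  have ds : is_derive s 1 (mcoord i \o c) (derive1 (mcoord i \o c) s) by near: s.
  by rewrite (speedE cs is_ ds).
have cs : {for t, continuous (fun s => Num.sqrt (bilin (gram i (mcoord i (c s)))
   (derive1 (mcoord i \o c) s) (derive1 (mcoord i \o c) s)))}.
  apply: (@continuous_comp _ _ _ (fun s => bilin (gram i (mcoord i (c s)))
   (derive1 (mcoord i \o c) s) (derive1 (mcoord i \o c) s)) Num.sqrt); last exact: sqrt_continuous.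
  apply: continuous_bilin => //.
  apply: (@continuous_comp _ _ _ (mcoord i \o c) (gram i)).
    exact: continuous_mcoord_comp.
  apply: differentiable_continuous; apply: (metric_differentiable (@gram_smooth' i)).
  exact: chart_rangeP.
rewrite /prop_for /continuous_at -(nbhs_singleton ne).
by apply: cvg_trans cs; apply: near_eq_cvg; exact: ne.
Unshelve. all: by end_near. Qed.

Lemma C1_curve_near c : C1_curve c -> exists2 d, 0 < d &
  forall t, - d < t < 1 + d -> C1_at c t /\ {for t, continuous (speed c)}.
Proof.
move=> [d d0 h]; exists d => // t td; split; first exact: h.
apply: speed_continuous; first exact: h.
move: td => /andP[t1 t2]; near=> s; apply: h; apply/andP; split; near: s.
  exact: lt_nbhsr.
exact: lt_nbhsl.
Unshelve. all: by end_near. Qed.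

(** The speed is known to be continuous near [0, 1] only, hence the clamped integrand. *)
Lemma arclength c : C1_curve c -> exists L : R -> R,
  L 1 - L 0 = curve_length c /\
  forall t : R, 0 <= t <= 1 -> is_derive t 1 L (speed c t).
Proof.
move=> /C1_curve_near[d d0 h]; pose f t := speed c (clamp 0 1 t).
have cf : continuous f.
  move=> t; apply: (@continuous_comp _ _ _ (clamp 0 1) (speed c)).
    exact: clamp_continuous.
  have /andP[h1 h2] := @clamp_in R 0 1 t ler01.
  by have [] := h (clamp 0 1 t); last by []; apply/andP; split; lra.
exists (prim1 f); split; last first.
  move=> t t01; have -> : speed c t = f t by rewrite /f clamp_id.
  by apply: is_derive_prim1 => //; case/andP: t01 => ? _; lra.
have E := curve_integral cf; rewrite prim1_0 subr0 -E.
apply: eq_Rintegral => t; rewrite inE/= in_itv/= => t01.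
by rewrite /f clamp_id.
Qed.

Lemma speed_ge0 c t : 0 <= speed c t. Proof. exact: sqrtr_ge0. Qed.

Lemma curve_length_ge0 c : C1_curve c -> 0 <= curve_length c.
Proof.
move=> /arclength[L [<- dL]]; rewrite subr_ge0.
by apply: (derive_ge0_le ler01 dL) => t _; exact: speed_ge0.
Qed.

Lemma curve_length_le c (Psi psi : R -> R) : C1_curve c ->
  (forall t : R, 0 <= t <= 1 -> is_derive t 1 Psi (psi t)) ->
  (forall t : R, 0 <= t <= 1 -> speed c t <= psi t) ->
  curve_length c <= Psi 1 - Psi 0.
Proof.
by move=> /arclength[L [<- dL]] dP h; exact: (derive_le_le ler01 dL dP).
Qed.

Lemma piecewise_ge0 p q l : piecewise_C1_length p q l -> 0 <= l.
Proof. by elim=> // c r m /curve_length_ge0 *; exact: addr_ge0. Qed.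

Lemma piecewise_cat p q r l m : piecewise_C1_length p q l ->
  piecewise_C1_length q r m -> piecewise_C1_length p r (l + m).
Proof.
elim=> [p0|c q0 l0 Cc _ IH] h; first by rewrite add0r.
by rewrite -addrA; apply: piecewise_C1_cons => //; exact: IH.
Qed.

Lemma piecewise1 c : C1_curve c -> piecewise_C1_length (c 0) (c 1) (curve_length c).
Proof.
by move=> h; rewrite -[curve_length c]addr0; apply: piecewise_C1_cons => //;
  exact: piecewise_C1_nil.
Qed.

Lemma dist_le p q l : piecewise_C1_length p q l -> dist p q <= l.
Proof.
move=> h; apply: ge_inf => //; exists 0 => m; exact: piecewise_ge0.
Qed.

(** A connecting curve must be exhibited, because the infimum of the empty set is 0. *)
Lemma dist_ge p q a : (exists l, piecewise_C1_length p q l) ->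
  (forall l, piecewise_C1_length p q l -> a <= l) -> a <= dist p q.
Proof. by move=> [l hl] h; apply: lb_le_inf; [exists l|exact: h]. Qed.

Lemma dist_ge0 p q : 0 <= dist p q.
Proof. rewrite /dist; have [->|/set0P ne] := eqVneq [set l | piecewise_C1_length p q l] set0.
  by rewrite inf0.
by apply: lb_le_inf => // l; exact: piecewise_ge0. Qed.

Lemma dist_le_triangle p q r l : (exists l, piecewise_C1_length p q l) ->
  piecewise_C1_length q r l -> dist p r <= dist p q + l.
Proof.
move=> ex h; rewrite -lerBlDr; apply: dist_ge => // m hm.
by rewrite lerBlDr; apply: dist_le; exact: piecewise_cat hm h.
Qed.

Lemma dist_triangle p q r : (exists l, piecewise_C1_length p q l) ->
  (exists l, piecewise_C1_length q r l) -> dist p r <= dist p q + dist q r.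
Proof.
move=> ex1 ex2; rewrite addrC -lerBlDr; apply: dist_ge => // l hl.
by rewrite lerBlDr addrC; exact: dist_le_triangle.
Qed.

(* rho is, infinitesimally at p, 1-Lipschitz for the Riemannian metric. *)
Definition locally_lip (rho : M -> R) p : Prop := exists i, mdom i p /\
  forall e, 0 < e -> exists2 d, 0 < d & forall a b, mdom i a -> mdom i b ->
   `|mcoord i a - mcoord i p| < d -> `|mcoord i b - mcoord i p| < d ->
   rho b - rho a <= Num.sqrt (bilin (gram i (mcoord i p))
      (mcoord i b - mcoord i a) (mcoord i b - mcoord i a))
      + e * `|mcoord i b - mcoord i a|.

(** Both ends of the secant vary: a C^1 curve is strictly differentiable, so increments over any
    subinterval near [t] are controlled, not only those that start at [t]. *)
Lemma curve_secant m k (f df : R -> 'M[R]_(m, k)) (t e : R) : 0 < e ->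
  (\forall s \near t, is_derive (s : R) 1 f (df s)) -> {for t, continuous df} ->
  exists2 d, 0 < d & forall s1 s2, `|s1 - t| < d -> `|s2 - t| < d -> s1 <= s2 ->
    `|f s2 - f s1 - (s2 - s1) *: df t| <= e * (s2 - s1).
Proof.
move=> e0 /nbhs_normP[d1 d10 h1] /continuous_normP/(_ e e0)[d2 d20 h2].
exists (Num.min d1 d2); first by rewrite lt_min d10.
move=> s1 s2; rewrite !lt_min => /andP[a1 a2] /andP[b1 b2] s12.
have hd s : s1 <= s <= s2 -> `|s - t| < d1 /\ `|s - t| < d2.
  move=> /andP[u1 u2]; move: a1 a2 b1 b2; rewrite !ltr_norml.
  move=> /andP[? ?] /andP[? ?] /andP[? ?] /andP[? ?].
  by split; apply/andP; split; lra.
have := @derive_norm_le R m k (fun s => f s - s *: df t) (fun s => df s - df t)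
  s1 s2 e s12.
have -> : f s2 - s2 *: df t - (f s1 - s1 *: df t) = f s2 - f s1 - (s2 - s1) *: df t.
  by apply/matrixP => a b; rewrite !mxE; ring.
apply.
- move=> s /hd[sd _]; apply: is_deriveB; first exact: h1.
  have := @is_derive_line R _ _ id 0 (df t) s; rewrite derive_id.
  have -> : (fun r : R => id (0 + r *: df t)) = (fun r => r *: df t).
    by apply/funext => r; rewrite add0r.
  by apply; have [] := @is_diff_id R _ (0 + s *: df t).
- by move=> s /hd[_ sd]; apply/ltW/h2.
Qed.

End Charts.

Section InnerProduct.
Variables (R : realType) (n : nat) (A : 'M[R]_n).
Hypothesis A_sym : A^T = A.
Hypothesis A_pos : forall u, u != 0 -> 0 < bilin A u u.
Implicit Types u w : 'rV[R]_n.

Lemma ip_ge0 u : 0 <= bilin A u u.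
Proof. by have [->|/A_pos/ltW//] := eqVneq u 0; rewrite bilin0l. Qed.

Lemma cauchy_schwarz u w : bilin A u w ^+ 2 <= bilin A u u * bilin A w w.
Proof.
have [->|w0] := eqVneq w 0; first by rewrite !bilin0r mulr0 expr0n.
have ww := A_pos w0; set c := bilin A u w / bilin A w w.
have := ip_ge0 (u - c *: w).
rewrite !bilinBl !bilinBr !bilinZl !bilinZr (bilinC w u A_sym) => h.
have e : c * bilin A w w = bilin A u w by rewrite /c divfK// gt_eqF.
have h2 : 0 <= (bilin A u u * bilin A w w - bilin A u w ^+ 2) / bilin A w w.
  have -> : (bilin A u u * bilin A w w - bilin A u w ^+ 2) / bilin A w w =
    bilin A u u - c * bilin A u w - (c * bilin A u w - c * (c * bilin A w w)).
    by rewrite e /c; field; rewrite gt_eqF.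
  exact: h.
by move: h2; rewrite pmulr_lge0 ?invr_gt0// subr_ge0.
Qed.

Definition gnorm u := Num.sqrt (bilin A u u).

Lemma gnorm_ge0 u : 0 <= gnorm u. Proof. exact: sqrtr_ge0. Qed.

Lemma sqr_gnorm u : gnorm u ^+ 2 = bilin A u u.
Proof. by rewrite sqr_sqrtr// ip_ge0. Qed.

Lemma cauchy_schwarz_norm u w : `|bilin A u w| <= gnorm u * gnorm w.
Proof.
rewrite -(@ler_pXn2r _ 2)// ?nnegrE ?mulr_ge0 ?gnorm_ge0//.
by rewrite exprMn !sqr_gnorm real_normK ?num_real// cauchy_schwarz.
Qed.

Lemma gnormD u w : gnorm (u + w) <= gnorm u + gnorm w.
Proof.
rewrite -(@ler_pXn2r _ 2)// ?nnegrE ?addr_ge0 ?gnorm_ge0//.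
rewrite sqrrD !sqr_gnorm !bilinDl !bilinDr (bilinC w u A_sym).
have := le_trans (ler_norm _) (cauchy_schwarz_norm u w).
move: (bilin A u w) (bilin A u u) (bilin A w w) (gnorm u * gnorm w) => a b c d; lra.
Qed.

Lemma gnormZ (c : R) u : gnorm (c *: u) = `|c| * gnorm u.
Proof.
by rewrite /gnorm bilinZl bilinZr mulrA -expr2 sqrtrM ?sqr_ge0// sqrtr_sqr.
Qed.

Lemma gnorm_le u : gnorm u <= Num.sqrt ((n * n)%:R * `|A|) * `|u|.
Proof.
rewrite /gnorm -[`|u|]normr_id -sqrtr_sqr -sqrtrM ?mulr_ge0//.
rewrite ler_wsqrtr// (le_trans (ler_norm _))// (le_trans (bilin_le A u u))//.
by rewrite expr2 mulrA.
Qed.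

End InnerProduct.

Lemma near_near (T : topologicalType) (t : T) (P : T -> Prop) :
  (\forall s \near t, P s) -> \forall s \near t, \forall r \near s, P r.
Proof. exact: nbhs_interior. Qed.

Lemma near_interval (R : realType) (a b t : R) (P : R -> Prop) : a < t < b ->
  (forall s, a < s < b -> P s) -> \forall s \near t, P s.
Proof.
move=> /andP[t1 t2] h; near=> s; apply: h; apply/andP; split; near: s.
  exact: lt_nbhsr.
exact: lt_nbhsl.
Unshelve. all: by end_near. Qed.

Lemma dist_between (R : realType) (s d r1 r2 r : R) : `|r1 - s| < d -> `|r2 - s| < d ->
  r1 <= r <= r2 -> `|r - s| < d.
Proof.
rewrite !ltr_norml => /andP[? ?] /andP[? ?] /andP[? ?].
by apply/andP; split; lra.
Qed.

Lemma in_between (R : realType) (a b r1 r2 r : R) : a <= r1 <= b -> a <= r2 <= b ->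
  r1 <= r <= r2 -> a <= r <= b.
Proof. by move=> /andP[? ?] /andP[? ?] /andP[? ?]; apply/andP; split; lra. Qed.

Lemma norm_lower (R : realType) (a b e : R) : `|a - b| < e -> b - e <= a.
Proof. by rewrite ltr_norml => /andP[? _]; lra. Qed.

Section Curves.
Variables (R : realType) (n : nat) (M : riemannianManifold R n).
Implicit Types (i j : mchart M) (p q : M) (c : R -> M) (x u v w : 'rV[R]_n) (t s : R).
Local Notation U := chart_range.

Lemma gram_symp i p : mdom i p ->
  (gram i (mcoord i p))^T = gram i (mcoord i p).
Proof. exact: gram_sym. Qed.

Lemma gram_posp i p : mdom i p ->
  forall u, u != 0 -> 0 < bilin (gram i (mcoord i p)) u u.
Proof. by move=> ip u; exact: gram_pos. Qed.

(** [rho] need not be differentiable along [c], so the bound is propagated with an error [e * s],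
    and [e] tends to 0. One [e / 4] covers both the Lipschitz defect of [rho] and the deviation of
    the curve from its tangent, which fixes [e1]; another covers the variation of the speed. *)
Lemma curve_locally_lip rho c : (forall p, locally_lip rho p) -> C1_curve c ->
  rho (c 1) - rho (c 0) <= curve_length c.
Proof.
move=> hrho Cc; have [L [<- dL]] := arclength Cc.
have [d d0 Cd] := C1_curve_near Cc.
have E e : 0 < e -> rho (c 1) - rho (c 0) <= L 1 - L 0 + e.
  move=> e0.
  suff : rho (c 1) - rho (c 0) <= L 1 - L 0 + e * 1 by rewrite mulr1.
  apply: (@local_propagation R (fun s => rho (c s) - rho (c 0) <= L s - L 0 + e * s) 0 1).
  - exact: ler01.
  - by rewrite !subrr mulr0 addr0.
  move=> s /andP[s0 s1].
  have [i [is_ hi]] := hrho (c s).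
  have sd : - d < s < 1 + d by apply/andP; split; lra.
  have [C1s csp] := Cd s sd.
  have [cs dn cd] := C1_atP C1s is_.
  set A := gram i (mcoord i (c s)).
  have As : A^T = A by exact: gram_symp.
  have Ap : forall u, u != 0 -> 0 < bilin A u u by exact: gram_posp.
  set x' := derive1 (mcoord i \o c) s in cd.
  pose N := Num.sqrt ((n * n)%:R * `|A|).
  have N0 : 0 <= N by exact: sqrtr_ge0.
  pose e1 := e / (4 * (N + `|x'| + 2)).
  have K0 : 0 < N + `|x'| + 2 by rewrite ltr_wpDl// addr_ge0.
  have e10 : 0 < e1 by rewrite divr_gt0// mulr_gt0.
  pose e2 := Num.min 1 e1.
  have e20 : 0 < e2 by rewrite lt_min ltr01.
  have e21 : e2 <= 1 by rewrite ge_min lexx.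
  have e2e1 : e2 <= e1 by rewrite ge_min lexx orbT.
  have [d1 d10 H1] := hi e1 e10.
  have [d2 d20 H2] := curve_secant e20 dn cd.
  have [d3 d30 H3] := (continuous_normP _ _).1 csp _ (divr_gt0 e0 (ltr0n R 4)).
  have cx : {for s, continuous (mcoord i \o c)} by exact: continuous_mcoord_comp.
  have [d4 d40 H4] := (continuous_normP _ _).1 cx _ d10.
  have [d5 d50 H5] := (nbhs_normP _ _).1 (near_dom cs is_).
  exists (Num.min d2 (Num.min d3 (Num.min d4 d5))).
    by rewrite !lt_min d20 d30 d40.
  move=> r1 r2 r1ab r2ab; rewrite !lt_min => /and4P[a2 a3 a4 a5] /and4P[b2 b3 b4 b5] r12.
  move=> IH.
  have := H1 (c r1) (c r2) (H5 _ a5) (H5 _ b5) (H4 _ a4) (H4 _ b4).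
  have := H2 _ _ a2 b2 r12; rewrite /=.
  set D := mcoord i (c r2) - mcoord i (c r1).
  rewrite -/A -/x' => Dx hD.
  have r0 : 0 <= r2 - r1 by rewrite subr_ge0.
  have Dn : `|D| <= (r2 - r1) * (`|x'| + 1).
    rewrite -[D](subrK ((r2 - r1) *: x')) (le_trans (ler_normD _ _))//.
    rewrite normrZ ger0_norm// mulrDr mulr1 addrC lerD2l (le_trans Dx)//.
    by rewrite ler_piMl.
  have Dg : Num.sqrt (bilin A D D) <= (r2 - r1) * Num.sqrt (bilin A x' x') + N * e2 * (r2 - r1).
    rewrite -[Num.sqrt (bilin A D D)]/(gnorm A D).
    rewrite -[D](subrK ((r2 - r1) *: x')) (le_trans (gnormD As Ap _ _))//.
    rewrite addrC lerD//; first by rewrite gnormZ ger0_norm.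
    by rewrite (le_trans (gnorm_le _ _))// -mulrA ler_wpM2l.
  have dsx : is_derive (s : R) 1 (mcoord i \o c) x' by exact: nbhs_singleton dn.
  have sp : speed c s = Num.sqrt (bilin A x' x') by exact: speedE cs is_ dsx.
  have Ls : (r2 - r1) * (speed c s - e / 4) <= L r2 - L r1.
    have := @derive_le_le R (fun r => r * (speed c s - e / 4)) (fun=> speed c s - e / 4)
      L (speed c) r1 r2 r12.
    rewrite -mulrBl; apply.
    - move=> r _; have := is_derive_mul (is_derive_id1 r) (is_derive_cst (speed c s - e / 4) r 1).
      by rewrite mul1r mulr0 addr0; apply.
    - by move=> r q; apply: dL; exact: in_between r1ab r2ab q.
    - move=> r q; have /H3 := dist_between a3 b3 q.
      exact: norm_lower.
  have K1 : N * e2 + e1 * (`|x'| + 1) <= e / 4.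
    have -> : e / 4 = e1 * (N + `|x'| + 2).
      by rewrite /e1; field; rewrite gt_eqF.
    have := ler_wpM2l N0 e2e1; move: (N * e2) (`|x'|) => a b; nra.
  have K2 : e1 * `|D| <= e1 * ((r2 - r1) * (`|x'| + 1)) by rewrite ler_pM2l.
  have K3 := ler_wpM2l r0 K1.
  move: IH hD Dg K2 K3 Ls; rewrite sp.
  move: (Num.sqrt _) (Num.sqrt _) (`|D|) (`|x'|) => S1 S2 ND Nx IH hD Dg K2 K3 Ls.
  move: (rho (c r2)) (rho (c r1)) (rho (c 0)) (L r2) (L r1) (L 0) IH hD Ls
    => q2 q1 q0 l2 l1 l0 IH hD Ls.
  move: Dg K2 K3 Ls IH hD; clear -r0 e0; move: (e1) (e2) (N) => f1 f2 NN.
  nra.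
apply/ler_addgt0Pr => e e0; exact: E.
Qed.

Lemma piecewise_locally_lip rho p q l : (forall p, locally_lip rho p) ->
  piecewise_C1_length p q l -> rho q - rho p <= l.
Proof.
move=> h; elim=> [p0|c q0 l0 Cc _ IH]; first by rewrite subrr.
have := curve_locally_lip h Cc; lra.
Qed.

Lemma continuous_dphi i j (x v : R -> 'rV[R]_n) t : overlap i j (x t) ->
  {for t, continuous x} -> {for t, continuous v} ->
  {for t, continuous (fun s => 'D_(v s) (transition i j) (x s))}.
Proof.
move=> ox cx cv.
have ne : \forall s \near t, \sum_a (v s 0 a *: 'D_(delta_mx 0 a) (transition i j) (x s)) =
    'D_(v s) (transition i j) (x s).
  have : \forall s \near t, overlap i j (x s).
    by apply: cx; exact: (near_open (@overlap_open _ _ _ _ _)).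
  by apply: filterS => s os; rewrite -derive_sum_delta//; exact: transition_differentiable.
have cs : {for t, continuous (fun s => \sum_a (v s 0 a *: 'D_(delta_mx 0 a) (transition i j) (x s)))}.
  have h a : {for t, continuous (fun s => v s 0 a *: 'D_(delta_mx 0 a) (transition i j) (x s))}.
    apply: cvgZ; first exact: continuous_coord cv.
    apply: (@continuous_comp _ _ _ x ('D_(delta_mx 0 a) (transition i j))) => //.
    by have [_ +] := @transition_smooth _ _ M i j 1; apply.
  elim: (index_enum _) => [|a r IH].
    rewrite (_ : (fun s => _) = cst 0); first exact: cst_continuous.
    by apply/funext => s; rewrite big_nil.
  rewrite (_ : (fun s => _) = (fun s => v s 0 a *: 'D_(delta_mx 0 a) (transition i j) (x s) +
    \sum_(a <- r) (v s 0 a *: 'D_(delta_mx 0 a) (transition i j) (x s)))).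
    by apply: cvgD; [exact: h|exact: IH].
  by apply/funext => s; rewrite big_cons.
rewrite /prop_for /continuous_at -(nbhs_singleton ne).
by apply: cvg_trans cs; apply: near_eq_cvg; exact: ne.
Qed.

Lemma C1_at_chart i c (x v : R -> 'rV[R]_n) t : {for t, continuous c} ->
  (\forall s \near t, mdom i (c s) /\ mcoord i (c s) = x s) ->
  (\forall s \near t, is_derive (s : R) 1 x (v s)) -> {for t, continuous v} -> C1_at c t.
Proof.
move=> ct nx nd cv; split => // j jt.
have cx : {for t, continuous x} by exact: is_derive_continuous (nbhs_singleton nd).
have [it xt] := nbhs_singleton nx.
have ox : overlap i j (x t) by rewrite -xt; exact: overlap_coord.
have njo : \forall s \near t, overlap i j (x s).
  by apply: cx; exact: (near_open (@overlap_open _ _ _ _ _)).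
have E : \forall s \near t, transition i j (x s) = (mcoord j \o c) s.
  by apply: filterS nx => s [is_ <-]; rewrite transition_coord.
have D : \forall s \near t, is_derive (s : R) 1 (mcoord j \o c) ('D_(v s) (transition i j) (x s)).
  near=> s.
  have Es : \forall s \near s, transition i j (x s) = (mcoord j \o c) s.
    by near: s; exact: (near_near E).
  apply: (is_derive_near Es); apply: is_derive_diff_comp; last by near: s.
  by apply: transition_differentiable; near: s.
split; first by apply: filterS D => s [].
have ne : \forall s \near t, 'D_(v s) (transition i j) (x s) = derive1 (mcoord j \o c) s.
  by apply: filterS D => s [_ <-]; rewrite derive1E.
rewrite /prop_for /continuous_at -(nbhs_singleton ne).
apply: cvg_trans (continuous_dphi ox cx cv).
by apply: near_eq_cvg; exact: ne.
Unshelve. all: by end_near. Qed.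

Lemma geodesic_atP i c t : geodesic_at c t -> mdom i (c t) ->
  [/\ {for t, continuous c},
   \forall s \near t, is_derive (s : R) 1 (mcoord i \o c) (derive1 (mcoord i \o c) s) &
   is_derive t 1 (derive1 (mcoord i \o c))
     (- Gam (gram i) (mcoord i (c t)) (derive1 (mcoord i \o c) t) (derive1 (mcoord i \o c) t))].
Proof.
move=> [ct h] it; have [h1 h2 h3] := h i it; split => //.
  by apply: filterS h1 => s ds; rewrite derive1E; exact: derivableP.
split=> //; rewrite -derive1E; apply/rowP => k.
rewrite mxE Gam.unlock mxE; have := h3 k; rewrite -/(mcoord i (c t)).
by move=> /eqP; rewrite addr_eq0 => /eqP ->.
Qed.

(** [geodesic_at] quantifies over all charts around the point. The Hessian of the transition, which
    appears in the second derivative, is cancelled by the transformation law of the Christoffel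
    symbols, so one chart is enough. *)
Lemma geodesic_at_chart i c (x v : R -> 'rV[R]_n) t : {for t, continuous c} ->
  (\forall s \near t, mdom i (c s) /\ mcoord i (c s) = x s) ->
  (\forall s \near t, is_derive (s : R) 1 x (v s)) ->
  is_derive t 1 v (- Gam (gram i) (x t) (v t) (v t)) -> geodesic_at c t.
Proof.
move=> ct nx nd dv; split => // j jt /=.
have cx : {for t, continuous x} by exact: is_derive_continuous (nbhs_singleton nd).
have [it xt] := nbhs_singleton nx.
have ox : overlap i j (x t) by rewrite -xt; exact: overlap_coord.
have njo : \forall s \near t, overlap i j (x s).
  by apply: cx; exact: (near_open (@overlap_open _ _ _ _ _)).
have E : \forall s \near t, transition i j (x s) = (mcoord j \o c) s.
  by apply: filterS nx => s [is_ <-]; rewrite transition_coord.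
have D : \forall s \near t, is_derive (s : R) 1 (mcoord j \o c) ('D_(v s) (transition i j) (x s)).
  near=> s.
  have Es : \forall s \near s, transition i j (x s) = (mcoord j \o c) s.
    by near: s; exact: (near_near E).
  apply: (is_derive_near Es); apply: is_derive_diff_comp; last by near: s.
  by apply: transition_differentiable; near: s.
have ne : \forall s \near t, 'D_(v s) (transition i j) (x s) = derive1 (mcoord j \o c) s.
  by apply: filterS D => s [_ <-]; rewrite derive1E.
have dd := is_derive_near ne (is_derive_differential (@overlap_open _ _ _ i j)
  (@transition_smooth _ _ _ i j) ox (nbhs_singleton nd) dv).
split.
- by apply: filterS D => s [].
- by case: dd.
move=> k; rewrite derive1E; case: (dd) => _ ->.
have -> : mcoord j (c t) = transition i j (x t) by rewrite -xt transition_coord.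
have -> : derive1 (mcoord j \o c) t = 'D_(v t) (transition i j) (x t).
  by rewrite (nbhs_singleton ne).
rewrite -scaleN1r deriveZr; last exact: transition_differentiable.
rewrite christoffel_transition// scaleN1r opprD.
have -> (a b : 'rV[R]_n) : a + (- b - a) = - b by rewrite addrCA subrr addr0.
by rewrite mxE Gam.unlock mxE addNr.
Unshelve. all: by end_near. Qed.

Lemma geodesic_at_C1 c t : geodesic_at c t -> C1_at c t.
Proof.
move=> gt; have it := mdom_chart_at (c t); set i := mchart_at (c t) in it.
have [ct dn d2] := geodesic_atP gt it.
apply: (C1_at_chart (i := i) ct _ dn (is_derive_continuous d2)).
by apply: filterS (near_dom ct it) => s.
Qed.

Lemma geodesic_at_near c c' t : (\forall s \near t, c s = c' s) ->
  geodesic_at c t -> geodesic_at c' t.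
Proof.
move=> ne gt; have it := mdom_chart_at (c t); set i := mchart_at (c t) in it.
have [ct dn d2] := geodesic_atP gt it.
have ct' : {for t, continuous c'}.
  rewrite /prop_for /continuous_at -(nbhs_singleton ne).
  by apply: cvg_trans ct; apply: near_eq_cvg; exact: ne.
apply: (geodesic_at_chart (i := i) ct' _ dn d2).
near=> s; have -> : c' s = c s by symmetry; near: s.
by split => //; near: s; exact: near_dom.
Unshelve. all: by end_near. Qed.

Lemma geodesic_at_affine c (a b t : R) : geodesic_at c (a + b * t) ->
  geodesic_at (fun s => c (a + b * s)) t.
Proof.
move=> gt; have it := mdom_chart_at (c (a + b * t)).
set i := mchart_at _ in it; have [ct dn d2] := geodesic_atP gt it.
have ca : {for t, continuous (fun s : R => a + b * s)}.
  by apply: cvgD; [exact: cvg_cst|apply: cvgM; [exact: cvg_cst|exact: cvg_id]].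
have ct' : {for t, continuous (fun s => c (a + b * s))}.
  exact: (continuous_comp ca).
apply: (geodesic_at_chart (i := i) (x := fun s => mcoord i (c (a + b * s)))
  (v := fun s => b *: derive1 (mcoord i \o c) (a + b * s)) ct').
- by apply: filterS (near_dom ct' it) => s.
- have : \forall s \near t, is_derive (a + b * s) 1 (mcoord i \o c)
     (derive1 (mcoord i \o c) (a + b * s)) by exact: (ca _ dn).
  by apply: filterS => s /is_derive_affine.
- have := is_derive_affine d2; set v := derive1 _ _ => h.
  have := is_deriveZ b h; apply: is_derive_eqr.
  by rewrite GamZl GamZr -!scalerN.
Qed.

Lemma velocity_affine c (a b t : R) : geodesic_at c (a + b * t) ->
  velocity (fun s => c (a + b * s)) t = b *: velocity c (a + b * t).
Proof.
move=> gt; have it := mdom_chart_at (c (a + b * t)).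
have [ct dn d2] := geodesic_atP gt it.
by rewrite (velocityE (is_derive_affine (nbhs_singleton dn))) /velocity.
Qed.

Lemma geodesic_speed_derive c t : (\forall s \near t, geodesic_at c s) ->
  is_derive t 1 (fun s => inner (c s) (velocity c s) (velocity c s)) 0.
Proof.
move=> gn; have gt := nbhs_singleton gn.
have it := mdom_chart_at (c t); set i := mchart_at (c t) in it.
have [ct dn d2] := geodesic_atP gt it.
set x := mcoord i \o c in dn d2; set v := derive1 x in dn d2.
have E : \forall s \near t, bilin (gram i (x s)) (v s) (v s) =
   inner (c s) (velocity c s) (velocity c s).
  near=> s.
  have cs : {for s, continuous c} by have [] : geodesic_at c s by near: s.
  have is_ : mdom i (c s) by near: s; exact: near_dom.
  have ds : is_derive (s : R) 1 x (v s) by near: s.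
  by rewrite (sq_speedE cs is_ ds).
apply: (is_derive_near E).
have Ut : U i (x t) by exact: chart_rangeP.
have := is_derive_metric (@chart_range_open _ _ _ i) (@gram_smooth' _ _ _ i)
  (@gram_sym' _ _ _ i) (@gram_pos' _ _ _ i) Ut (nbhs_singleton dn) d2 d2.
by apply: is_derive_eqr; rewrite addNr bilin0l bilin0r addr0.
Unshelve. all: by end_near. Qed.

Lemma geodesic_const_speed c (a b s t : R) : (forall r, a < r < b -> geodesic_at c r) ->
  a < s < b -> a < t < b ->
  inner (c s) (velocity c s) (velocity c s) = inner (c t) (velocity c t) (velocity c t).
Proof.
move=> g; wlog st : s t / s <= t.
  move=> H sab tab; have [st|/ltW ts] := leP s t; first exact: H.
  by symmetry; exact: H.
move=> /andP[as_ _] /andP[_ tb].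
apply: (derive0_cst (f := fun s => inner (c s) (velocity c s) (velocity c s)) st).
move=> r /andP[sr rt]; apply: geodesic_speed_derive; apply: (near_interval _ g).
by rewrite (lt_le_trans as_ sr) (le_lt_trans rt tb).
Qed.

End Curves.

(** At an end of [0, 1] only one-sided difference quotients are shared, and they already determine
    the derivative. Uniqueness of geodesics is stated on [0, 1], whereas velocities are two-sided
    derivatives. *)
Lemma is_derive_agree (R : realType) (V : normedModType R) (f g : R -> V) (t : R) v w :
  is_derive t 1 f v -> is_derive t 1 g w -> 0 <= t <= 1 ->
  (forall s : R, 0 <= s <= 1 -> f s = g s) -> v = w.
Proof.
move=> df dg t01 fg.
have [dh eh] := is_deriveB df dg.
apply/eqP; rewrite -subr_eq0 -normr_le0 leNgt; apply/negP => e0.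
move: dh; rewrite /derivable => /cvg_ex[l hl].
have lE : l = v - w.
  by rewrite -eh /derive; apply/esym/cvg_lim.
move/cvgrPdist_lt: hl; rewrite lE => /(_ _ e0)/nbhs_normP[d /= d0 hd].
pose s0 := Num.min (d / 2) (2^-1 : R).
have s00 : 0 < s0 by rewrite lt_min; apply/andP; split; lra.
have s0d : s0 < d by rewrite gt_min; apply/orP; left; lra.
have s0h : s0 <= 2^-1 by rewrite ge_min lexx orbT.
have [s [sn0 sd st]] : exists s : R, [/\ s != 0, `|s| < d & 0 <= s + t <= 1].
  move: t01 => /andP[t0 t1]; have [th|th] := leP t 2^-1.
    exists s0; rewrite gt_eqF// gtr0_norm//; split=> //; apply/andP; split; lra.
  exists (- s0); rewrite oppr_eq0 gt_eqF// normrN gtr0_norm//; split=> //.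
  by apply/andP; split; lra.
have := hd s; rewrite subr0 => /(_ sd sn0); rewrite ![s *: _]mulr1.
have h0 r : 0 <= r <= 1 -> (f - g) r = 0.
  by move=> r01; rewrite -[LHS]/(f r - g r) fg// subrr.
by rewrite !h0// subrr scaler0 subr0 ltxx.
Qed.

Lemma zero_in01 (R : realType) : 0 <= (0 : R) <= 1.
Proof. by apply/andP; split; lra. Qed.

Lemma one_in01 (R : realType) : 0 <= (1 : R) <= 1.
Proof. by apply/andP; split; lra. Qed.

Section Geodesics.
Variables (R : realType) (n : nat) (M : riemannianManifold R n).
Implicit Types (p q : M) (c : R -> M) (t s a b : R).

Lemma geodesic_C1 c : geodesic c -> C1_curve c.
Proof.
move=> [d d0 h]; exists d => // t /h; exact: geodesic_at_C1.
Qed.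

Lemma geodesic_at_mem c t : geodesic c -> 0 <= t <= 1 -> geodesic_at c t.
Proof.
by move=> [d d0 h] /andP[t0 t1]; apply: h; apply/andP; split; lra.
Qed.

Lemma geodesic_at_is_derive c t : geodesic_at c t ->
  is_derive t 1 (mcoord (mchart_at (c t)) \o c) (velocity c t).
Proof.
move=> gt; have it := mdom_chart_at (c t).
by have [_ /nbhs_singleton] := geodesic_atP gt it.
Qed.

Lemma geodesic_speed c t : geodesic c -> 0 <= t <= 1 -> speed c t = speed c 0.
Proof.
move=> [d d0 h] /andP[t0 t1]; rewrite /speed; congr Num.sqrt.
by apply: (@geodesic_const_speed R n M c (- d) (1 + d)) => //; apply/andP; split; lra.
Qed.

Lemma geodesic_affine c a b : geodesic c -> 0 <= a <= 1 -> 0 <= b <= 1 ->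
  geodesic (fun t => c (a + (b - a) * t)).
Proof.
move=> [d d0 h] /andP[a0 a1] /andP[b0 b1]; exists d => // t /andP[t0 t1].
apply: geodesic_at_affine; apply: h.
have [ab|ba] := leP a b.
  have [->|ab'] := eqVneq a b; first by apply/andP; split; nra.
  have : 0 < b - a by rewrite subr_gt0 lt_neqAle ab' ab.
  by move=> ?; apply/andP; split; nra.
by apply/andP; split; nra.
Qed.

Lemma geodesic_joins_affine c a b : geodesic c -> 0 <= a <= 1 -> 0 <= b <= 1 ->
  geodesic_joins (fun t => c (a + (b - a) * t)) (c a) (c b).
Proof.
move=> gc a01 b01; split; first exact: geodesic_affine.
  by rewrite mulr0 addr0.
by rewrite mulr1 addrC subrK.
Qed.

Lemma speed_affine c (a b t : R) : geodesic_at c (a + b * t) ->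
  speed (fun s => c (a + b * s)) t = `|b| * speed c (a + b * t).
Proof.
move=> gt; rewrite /speed velocity_affine// /inner bilinZl bilinZr mulrA -expr2.
by rewrite sqrtrM ?sqr_ge0// sqrtr_sqr.
Qed.

Lemma inner_ge0 p u : 0 <= inner p u u.
Proof. exact: (gram_ge0 _ (chart_rangeP (mdom_chart_at p))). Qed.

Lemma sqr_speed c t : speed c t ^+ 2 = inner (c t) (velocity c t) (velocity c t).
Proof. by rewrite sqr_sqrtr// inner_ge0. Qed.

Lemma geodesic_cst p : geodesic (fun=> p).
Proof.
exists 1 => // t _; apply: (geodesic_at_chart (i := mchart_at p)
  (x := fun=> mcoord (mchart_at p) p) (v := fun=> 0)).
- exact: cst_continuous.
- by near=> s; split=> //; exact: mdom_chart_at.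
- by near=> s; exact: is_derive_cst.
- by rewrite Gam0l oppr0; exact: is_derive_cst.
Unshelve. all: by end_near. Qed.

Lemma velocity_agree c1 c2 t : geodesic_at c1 t -> geodesic_at c2 t -> 0 <= t <= 1 ->
  {in `[0, 1], c1 =1 c2} -> velocity c1 t = velocity c2 t.
Proof.
move=> g1 g2 t01 h.
have E s : 0 <= s <= 1 -> c1 s = c2 s by move=> s01; apply: h; rewrite in_itv.
have := geodesic_at_is_derive g1; have := geodesic_at_is_derive g2.
rewrite (E t t01) => d2 d1; apply: (is_derive_agree d1 d2 t01) => s /E /= ->.
by [].
Qed.

End Geodesics.

(** * Geodesics determined by their ends *)

HB.lock Definition gam (R : realType) (n : nat) (M : riemannianManifold R n) (p q : M) : R -> M :=
  xget (fun=> p) [set c | geodesic_joins c p q].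

(** The length of the geodesic, read off as its constant speed. It dominates [dist] at once; the
    converse is [dist_glen]. *)
HB.lock Definition glen (R : realType) (n : nat) (M : riemannianManifold R n) (p q : M) : R :=
  speed (gam p q) 0.

Section UniqueGeodesics.
Variables (R : realType) (n : nat) (M : riemannianManifold R n).
Implicit Types (p q : M) (c : R -> M) (t s a b : R).
Hypothesis UG : uniquely_geodesic M.

Lemma gamP p q : geodesic_joins (gam p q) p q.
Proof. by rewrite gam.unlock; have [+ _] := UG p q; exact: xgetPex. Qed.

Lemma gam_geodesic p q : geodesic (gam p q). Proof. by have [] := gamP p q. Qed.

Lemma gam0 p q : gam p q 0 = p. Proof. by have [] := gamP p q. Qed.

Lemma gam1 p q : gam p q 1 = q. Proof. by have [] := gamP p q. Qed.

Lemma gam_unique c p q : geodesic_joins c p q -> {in `[0, 1], c =1 gam p q}.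
Proof. by move=> h; have [_ +] := UG p q; apply=> //; exact: gamP. Qed.

Lemma gam_eq c p q t : geodesic_joins c p q -> 0 <= t <= 1 -> gam p q t = c t.
Proof. by move=> h t01; rewrite (gam_unique h)// in_itv. Qed.

Lemma gam_sub p q a b t : 0 <= a <= 1 -> 0 <= b <= 1 -> 0 <= t <= 1 ->
  gam (gam p q a) (gam p q b) t = gam p q (a + (b - a) * t).
Proof.
move=> a01 b01 t01.
by rewrite (gam_eq (geodesic_joins_affine (gam_geodesic p q) a01 b01)).
Qed.

Lemma gam_rev p q t : 0 <= t <= 1 -> gam q p t = gam p q (1 - t).
Proof.
move=> t01; have := gam_sub p q (one_in01 R) (zero_in01 R) t01.
by rewrite gam0 gam1 => ->; congr gam; ring.
Qed.

Lemma gam_self p t : 0 <= t <= 1 -> gam p p t = p.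
Proof. by move=> t01; rewrite (@gam_eq (fun=> p) p p)//; split=> //; exact: geodesic_cst. Qed.

Lemma glen_ge0 p q : 0 <= glen p q. Proof. by rewrite glen.unlock sqrtr_ge0. Qed.

Lemma glenE c p q : geodesic_joins c p q -> glen p q = speed c 0.
Proof.
move=> h; have [gc c0 c1] := h; have z01 := zero_in01 R.
rewrite glen.unlock /speed (velocity_agree (c2 := c) _ _ z01).
- by rewrite gam0 c0.
- exact: geodesic_at_mem (gam_geodesic p q) z01.
- exact: geodesic_at_mem gc z01.
- by move=> s s01; rewrite (gam_unique h).
Qed.

Lemma glen_speed p q t : 0 <= t <= 1 -> speed (gam p q) t = glen p q.
Proof. by move=> t01; rewrite glen.unlock geodesic_speed//; exact: gam_geodesic. Qed.

Lemma glen_sub p q a b : 0 <= a <= 1 -> 0 <= b <= 1 ->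
  glen (gam p q a) (gam p q b) = `|b - a| * glen p q.
Proof.
move=> a01 b01; rewrite (glenE (geodesic_joins_affine (gam_geodesic p q) a01 b01)).
rewrite speed_affine ?mulr0 ?addr0 ?glen_speed//.
exact: geodesic_at_mem (gam_geodesic p q) a01.
Qed.

Lemma glen_sym p q : glen p q = glen q p.
Proof.
have := glen_sub q p (one_in01 R) (zero_in01 R).
by rewrite gam0 gam1 sub0r normrN1 mul1r.
Qed.

Lemma glen_self p : glen p p = 0.
Proof.
have a01 := zero_in01 R.
by have := glen_sub p p a01 a01; rewrite gam0 subrr normr0 mul0r.
Qed.

Lemma glen_left p q t : 0 <= t <= 1 -> glen p (gam p q t) = t * glen p q.
Proof.
move=> t01; have := glen_sub p q (zero_in01 R) t01.
by rewrite gam0 subr0 ger0_norm//; case/andP: t01.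
Qed.

Lemma glen_right p q t : 0 <= t <= 1 -> glen (gam p q t) q = (1 - t) * glen p q.
Proof.
move=> t01; have := glen_sub p q t01 (one_in01 R).
by rewrite gam1 ger0_norm//; case/andP: t01 => _ ?; rewrite subr_ge0.
Qed.

Lemma is_expP p v q : is_exp p v q -> v = velocity (gam p q) 0.
Proof.
have z01 := zero_in01 R.
move=> [c h <-]; apply: velocity_agree => //.
- by have [gc _ _] := h; exact: geodesic_at_mem gc z01.
- exact: geodesic_at_mem (gam_geodesic p q) z01.
- exact: gam_unique.
Qed.

Lemma LogE p q : Log p q = velocity (gam p q) 0.
Proof.
apply: xget_unique; first by exists (gam p q) => //; exact: gamP.
by move=> v /is_expP.
Qed.

Lemma inner_Log p q : inner p (Log p q) (Log p q) = glen p q ^+ 2.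
Proof. by rewrite LogE glen.unlock sqr_speed gam0. Qed.

Lemma curve_length_gam p q : curve_length (gam p q) <= glen p q.
Proof.
have Cg := geodesic_C1 (gam_geodesic p q).
have := @curve_length_le R n M (gam p q) (fun t => 0 + t * glen p q) (fun=> glen p q) Cg.
rewrite mul0r mul1r addr0 subr0 add0r; apply=> [t _|t t01]; last by rewrite glen_speed.
have := is_derive_mul (is_derive_id1 t) (is_derive_cst (glen p q) t 1).
move/(is_deriveD (is_derive_cst (0 : R) t 1)).
by apply: is_derive_eqr; rewrite mulr0 mul1r addr0 add0r.
Qed.

Lemma gam_piecewise p q : piecewise_C1_length p q (curve_length (gam p q)).
Proof.
have := piecewise1 (geodesic_C1 (gam_geodesic p q)).
by rewrite gam0 gam1.
Qed.

Lemma dist_le_glen p q : dist p q <= glen p q.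
Proof. exact: le_trans (dist_le (gam_piecewise p q)) (curve_length_gam p q). Qed.

Lemma UG_triangle p q r : dist p r <= dist p q + dist q r.
Proof. by apply: dist_triangle; eexists; exact: gam_piecewise. Qed.

(* Two geodesics that overlap on an interval are parts of a single one. *)
Lemma gam_glue p m q m' (u th : R) : 0 < u < 1 -> 0 < th < 1 ->
  m' = gam p m u -> m = gam m' q th ->
  m = gam p q (u + (1 - u) / th)^-1.
Proof.
move=> /andP[u0 u1] /andP[th0 th1] hm' hm.
(* In the time of [gam p m], the point [m'] is passed at [u], and the stretch from [m'] to [m], of
   duration [1 - u], is the fraction [th] of the geodesic from [m'] to [q]. So [q] is reached at
   time [E]. *)
set E := u + (1 - u) / th.
have k0 : 0 < (1 - u) / th by rewrite divr_gt0// subr_gt0.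
have E1 : 1 < E.
  suff : 1 - u < (1 - u) / th by rewrite /E; lra.
  by rewrite ltr_pdivlMr// gtr_pMr// subr_gt0.
have E0 : 0 < E by lra.
pose c1 := gam p m; pose c2 := gam m' q.
pose c2' t := c2 (- (u * th / (1 - u)) + (th / (1 - u)) * t).
have agree t : u <= t <= 1 -> c1 t = c2' t.
  move=> /andP[tu t1].
  pose r := (t - u) / (1 - u).
  have r01 : 0 <= r <= 1.
    rewrite divr_ge0 ?subr_ge0 ?(ltW u1)//= ler_pdivrMr ?subr_gt0// mul1r.
    lra.
  have -> : c1 t = gam m' m r.
    have u01 : 0 <= u <= 1 by rewrite !ltW.
    have h := @gam_sub p m u 1 r u01 _ r01.
    rewrite gam1 -hm' in h; rewrite h ?zero_in01 ?one_in01// /c1; congr gam.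
    by rewrite /r; field; rewrite subr_eq0 gt_eqF.
  have th01 : 0 <= th <= 1 by rewrite !ltW.
  have h := @gam_sub m' q 0 th r _ th01 r01.
  rewrite gam0 -hm in h; rewrite h ?zero_in01 ?one_in01// /c2' /c2; congr gam.
  by rewrite /r; field; rewrite subr_eq0 gt_eqF.
(* The two curves agree on [u, 1]. Switching at its midpoint gives every time a neighbourhood on
   which the glued curve is one of the two. *)
pose w := (u + 1) / 2.
have w1 : u < w < 1 by rewrite /w; apply/andP; split; lra.
pose C t := if t <= w then c1 t else c2' t.
have [d1 d10 g1] := gam_geodesic p m; have [d2 d20 g2] := gam_geodesic m' q.
have C1 t : - d1 < t -> t < 1 -> geodesic_at C t.
  move=> h1 h2; apply: (@geodesic_at_near R n M c1); last by apply: g1; apply/andP; split; lra.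
  near=> s; rewrite /C; case: ifPn => // /negbTE; rewrite leNgt => /negbFE sw.
  apply: agree; apply/andP; split; first by case/andP: w1 => ? ?; lra.
  by apply/ltW; near: s; exact: lt_nbhsl.
have C2 t : u < t -> t < E + d2 * ((1 - u) / th) -> geodesic_at C t.
  move=> h1 h2; apply: (@geodesic_at_near R n M c2').
    near=> s; rewrite /C; case: ifPn => // sw.
    symmetry; apply: agree; apply/andP; split; last by case/andP: w1 => ? ?; lra.
    by apply/ltW; near: s; exact: lt_nbhsr.
  rewrite /c2'; apply: geodesic_at_affine; apply: g2.
  have h3 : 0 < th / (1 - u) by rewrite divr_gt0// subr_gt0.
  have e1 : - (u * th / (1 - u)) + th / (1 - u) * t = th / (1 - u) * (t - u).
    by field; rewrite subr_eq0 gt_eqF.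
  have e2 : th / (1 - u) * (E + d2 * ((1 - u) / th) - u) = 1 + d2.
    by rewrite /E; field; rewrite subr_eq0 !gt_eqF.
  rewrite e1 -e2; apply/andP; split; last by rewrite ltr_pM2l//; lra.
  have : 0 < th / (1 - u) * (t - u) by rewrite mulr_gt0// subr_gt0.
  by apply: le_lt_trans; rewrite oppr_le0 ltW.
have gC : geodesic (fun t => C (0 + E * t)).
  exists (Num.min (d1 / E) (d2 * ((1 - u) / th) / E)).
    by rewrite lt_min; apply/andP; split; rewrite divr_gt0// mulr_gt0.
  set d := Num.min _ _ => t /andP[t0 t1]; apply: geodesic_at_affine; rewrite add0r.
  have dd1 : d * E <= d1 by rewrite -ler_pdivlMr// ge_min lexx.
  have dd2 : d * E <= d2 * ((1 - u) / th) by rewrite -ler_pdivlMr// ge_min lexx orbT.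
  have [h|h] := ltP (E * t) 1; first by apply: C1 => //; nra.
  by apply: C2; [lra|nra].
have jC : geodesic_joins (fun t => C (0 + E * t)) p q.
  split=> //.
    by rewrite mulr0 addr0 /C ifT ?/c1 ?gam0// /w; lra.
  rewrite mulr1 add0r /C ifF; last by apply/negbTE; rewrite -ltNge; case/andP: w1 => ? ?; lra.
  have e1 : - (u * th / (1 - u)) + th / (1 - u) * E = 1.
    by rewrite /E; field; rewrite subr_eq0 !gt_eqF.
  by rewrite /c2' e1 /c2 gam1.
rewrite (gam_eq jC); last by rewrite invr_ge0 (ltW E0)/= invf_le1// ltW.
rewrite add0r divff ?gt_eqF// /C ifF; last first.
  by apply/negbTE; rewrite -ltNge; case/andP: w1.
by rewrite -agree ?lexx ?ltW// /c1 gam1.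
Unshelve. all: by end_near. Qed.

End UniqueGeodesics.

(** * Continuation of local minima *)

Lemma continuous_pair (S T W : topologicalType) (f : S -> T) (g : S -> W) (x : S) :
  {for x, continuous f} -> {for x, continuous g} ->
  {for x, continuous (fun s : S => (f s, g s))}.
Proof. by move=> cf cg; exact: (cvg_pair cf cg). Qed.

Lemma continuous_cst_at (S T : topologicalType) (a : T) (x : S) :
  {for x, continuous (fun _ : S => a)}.
Proof. exact: (@cst_continuous S T a x). Qed.

Lemma continuousB_at (R : realType) (V : normedModType R) (S : topologicalType) (f g : S -> V) (x : S) :
  {for x, continuous f} -> {for x, continuous g} -> {for x, continuous (fun s : S => f s - g s)}.
Proof. by move=> cf cg; exact: (cvgB cf cg). Qed.

Lemma continuous_norm_sub (R : realType) (V : normedModType R) (T : topologicalType)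
  (f : T -> V) (m : V) (x : T) :
  {for x, continuous f} -> {for x, continuous (fun y : T => `|f y - m|)}.
Proof. by move=> cf; exact: (cvg_norm (cvgB cf (cvg_cst m))). Qed.

Section JointContinuity.
Variables (R : realType) (n : nat).
Local Notation V := 'rV[R]_n.

(** [s] is a parameter: a time in the continuation, the end of a broken geodesic in
    [step_argmin]. *)
Definition jcont (T W : topologicalType) (G : T -> V -> W) (s : T) (x : V) :=
  {for (x, s), continuous (fun z : V * T => G z.2 z.1)}.

Lemma jcont_at (T W : topologicalType) (G : T -> V -> W) s x :
  jcont G s x -> {for x, continuous (G s)}.
Proof.
move=> h; have c1 : {for x, continuous (fun y : V => (y, s))}.
  by apply: continuous_pair; [exact: cvg_id|exact: continuous_cst_at].
exact: (@continuous_comp V (V * T)%type W (fun y : V => (y, s)) (fun z : V * T => G z.2 z.1) x c1 h).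
Qed.

Lemma jcont_par (T W : topologicalType) (G : T -> V -> W) s x :
  jcont G s x -> {for s, continuous (fun s : T => G s x)}.
Proof.
move=> h; have c1 : {for s, continuous (fun s : T => (x, s))}.
  by apply: continuous_pair; [exact: continuous_cst_at|exact: cvg_id].
exact: (@continuous_comp T (V * T)%type W (fun s : T => (x, s)) (fun z : V * T => G z.2 z.1) s c1 h).
Qed.

Lemma jcont_comp (T W : topologicalType) (F : T -> V -> W) (D : T -> V -> V) s x :
  jcont D s x -> jcont F s (D s x) -> jcont (fun (s : T) (x : V) => F s (D s x)) s x.
Proof.
move=> h1 h2.
have c1 : {for (x, s), continuous (fun z : V * T => (D z.2 z.1, z.2))}.
  by apply: continuous_pair; [exact: h1|exact: cvg_snd].
exact: (@continuous_comp (V * T)%type (V * T)%type W (fun z => (D z.2 z.1, z.2))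
  (fun z => F z.2 z.1) (x, s) c1 h2).
Qed.

Lemma jcontB (T : topologicalType) (F G : T -> V -> R) s x :
  jcont F s x -> jcont G s x -> jcont (fun (s : T) (x : V) => F s x - G s x) s x.
Proof. by move=> h1 h2; apply: continuousB_at; [exact: h1|exact: h2]. Qed.

Lemma jcont_cst (T W : topologicalType) (F : T -> V -> W) s x y :
  {for s, continuous (fun s : T => F s y)} -> jcont (fun (s : T) (_ : V) => F s y) s x.
Proof.
move=> h; have c1 : {for (x, s), continuous (fun z : V * T => z.2)} by exact: cvg_snd.
exact: (@continuous_comp (V * T)%type T W (fun z => z.2) (fun s => F s y) (x, s) c1 h).
Qed.

Lemma jcont_fix (T W : topologicalType) (f : V -> W) (s : T) (x : V) :
  {for x, continuous f} -> jcont (fun (_ : T) (x : V) => f x) s x.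
Proof.
move=> h; have c1 : {for (x, s), continuous (fun z : V * T => z.1)} by exact: cvg_fst.
exact: (@continuous_comp (V * T)%type V W (fun z => z.1) f (x, s) c1 h).
Qed.

Lemma jcont_near (T W : topologicalType) (G : T -> V -> W) s x (P : set W) :
  jcont G s x -> nbhs (G s x) P ->
  exists2 d : R, 0 < d & \forall s' \near s, forall y : V, `|y - x| < d -> P (G s' y).
Proof.
move=> h hP; have [[A B] /= [hA hB] AB] := h _ hP.
have [d d0 hd] := (nbhs_normP _ _).1 hA; exists d => //.
by apply: filterS hB => s' Bs y /hd Ay; exact: (AB (y, s')).
Qed.

Lemma jcont_reparam (S T W : topologicalType) (G : T -> V -> W) (phi : S -> T) s x :
  {for s, continuous phi} -> jcont G (phi s) x -> jcont (fun (s : S) (x : V) => G (phi s) x) s x.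
Proof.
move=> cp h; have c1 : {for (x, s), continuous (fun z : V * S => (z.1, phi z.2))}.
  apply: continuous_pair; first exact: cvg_fst.
  have c2 : {for (x, s), continuous (fun z : V * S => z.2)} by exact: cvg_snd.
  exact: (@continuous_comp (V * S)%type S T (fun z => z.2) phi (x, s) c2 cp).
exact: (@continuous_comp (V * S)%type (V * T)%type W (fun z => (z.1, phi z.2))
  (fun z => G z.2 z.1) (x, s) c1 h).
Qed.

Lemma tube (T : topologicalType) (A : set V) (G : T -> V -> R) s : compact A ->
  (forall x, A x -> jcont G s x) -> (forall x, A x -> 0 < G s x) ->
  \forall s' \near s, forall x, A x -> 0 < G s' x.
Proof.
move=> /compact_near_coveringP cA cG h.
apply: (cA T (nbhs s) (fun s' x => 0 < G s' x)) => x Ax.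
have := cG x Ax _ (@lt_nbhsr R _ _ (h x Ax)).
by move=> [[B C] /= [hB hC] BC]; exists (B, C) => //= -[y s'] [/= By Cs]; exact: (BC (y, s')).
Qed.

(** The tube lemma with the gap [mu] itself as the parameter, at the value 0. *)
Lemma tube_gap (A : set V) (f : V -> R) : compact A ->
  (forall x, A x -> {for x, continuous f}) -> (forall x, A x -> 0 < f x) ->
  exists2 mu : R, 0 < mu & forall x, A x -> mu < f x.
Proof.
move=> cA cf h.
have := @tube R A (fun mu x => f x - mu) 0 cA.
case/(_ _ _)/nbhs_normP => [x Ax|x Ax|d d0 hd].
- apply: jcontB; first by apply: jcont_fix; exact: cf.
  by apply: (@jcont_cst R R (fun mu _ => mu) _ _ 0); exact: cvg_id.
- by rewrite subr0; exact: h.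
exists (d / 2) => [|x Ax]; first by rewrite divr_gt0.
rewrite -subr_gt0; apply: hd => //; rewrite subr0 ger0_norm ?divr_ge0 ?ltW//.
by rewrite gtr_pMr// invf_lt1// ltr1n.
Qed.

Lemma compact_annulus (z : V) (a b : R) : compact [set y : V | a <= `|y - z| <= b].
Proof.
have -> : [set y : V | a <= `|y - z| <= b] =
    [set y : V | `|y - z| <= b] `&` (fun y => `|y - z|) @^-1` [set r : R | a <= r].
  by apply/seteqP; split=> y /= => [/andP[]|[h1 h2]] //; apply/andP.
apply: compact_closedI; first exact: compact_norm_ball.
apply: closed_comp => [y _|]; last exact: closed_ge.
apply: (@continuous_norm_sub R V V id); exact: cvg_id.
Qed.

(** On the annulus the values exceed the one at the centre strictly, hence also for nearby
    parameters. A minimizer over the ball exists by compactness and cannot sit on the annulus. *)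
Lemma stable_minimizer (T : topologicalType) (F : T -> V -> R) (m0 : V) (r1 r : R) s :
  0 < r1 -> r1 <= r ->
  (forall x : V, `|x - m0| <= r -> jcont F s x) ->
  (forall x : V, r1 <= `|x - m0| <= r -> F s m0 < F s x) ->
  \forall s' \near s, (forall x : V, `|x - m0| <= r -> {for x, continuous (F s')}) ->
    exists2 x : V, `|x - m0| < r1 & forall y : V, `|y - m0| <= r ->
      F s' x <= F s' y /\ (F s' y = F s' x -> `|y - m0| < r1).
Proof.
move=> r10 r1r jF gF.
have r0 : 0 < r by exact: lt_le_trans r10 r1r.
have := @tube T _ (fun s' x => F s' x - F s' m0) s (@compact_annulus m0 r1 r).
have jm : jcont F s m0 by apply: jF; rewrite subrr normr0 ltW.
case/(_ _ _)/Wrap => [x /andP[_ xr]|x xA|h].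
- by apply: jcontB; [exact: jF|apply: jcont_cst; exact: jcont_par].
- by rewrite subr_gt0; exact: gF.
apply: filterS h => s' h' cF'.
have [||| c ] := @EVT_min_rV R n (F s') [set y : V | `|y - m0| <= r].
- by exists m0; rewrite /= subrr normr0 ltW.
- exact: compact_norm_ball.
- by apply: continuous_in_subspaceT => y; rewrite inE/= => /cF'.
rewrite inE/= => cr hc.
have hm : F s' c <= F s' m0 by apply: hc; rewrite inE/= subrr normr0 ltW.
have out (y : V) : `|y - m0| <= r -> F s' y = F s' c -> `|y - m0| < r1.
  move=> yr yc; rewrite ltNge; apply/negP => r1y.
  by have := h' y; rewrite /= r1y yr => /(_ isT); rewrite subr_gt0 yc ltNge hm.
exists c; first exact: out.
by move=> y yr; split; [apply: hc; rewrite inE|exact: out].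
Qed.

(** Outside a ball around the strict minimizer [c s] the excess over its value is positive on a
    compact set, hence remains positive for nearby parameters [s'], where [c s'] does at least as
    well as [c s]. *)
Lemma argmin_continuous (T : topologicalType) (F : T -> V -> R) (c : T -> V) (m0 : V) (r : R) s :
  (forall x, `|x - m0| <= r -> jcont F s x) ->
  (\forall s' \near s, `|c s' - m0| <= r) ->
  (\forall s' \near s, F s' (c s') <= F s' (c s)) ->
  (forall x, `|x - m0| <= r -> x != c s -> F s (c s) < F s x) ->
  {for s, continuous c}.
Proof.
move=> jF near_c cmin strict; apply/cvgrPdist_lt => e e0.
have cA : compact ([set x : V | `|x - m0| <= r] `&` [set x : V | e <= `|x - c s|]).
  apply: compact_closedI; first exact: compact_norm_ball.
  apply: (@closed_comp _ _ (fun y : V => `|y - c s|) [set r : R | e <= r]) => [y _|]; last exact: closed_ge.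
  by apply: (@continuous_norm_sub R V V id); exact: cvg_id.
have jc : jcont F s (c s) by apply: jF; exact: nbhs_singleton near_c.
have := @tube T _ (fun s' x => F s' x - F s' (c s)) s cA.
case/(_ _ _)/Wrap => [x [xr _]|x [xr /= xe]|near_t].
- by apply: jcontB; [exact: jF|apply: jcont_cst; exact: jcont_par].
- rewrite subr_gt0; apply: strict => //; apply: contraTneq xe => ->.
  by rewrite subrr normr0 -ltNge.
apply: filterS3 near_c cmin near_t => s' h1 h2 h3.
rewrite distrC ltNge; apply/negP => h4.
by have := h3 (c s') (conj h1 h4); rewrite subr_gt0 ltNge h2.
Qed.

End JointContinuity.

(** * Minima detected by a descent map with a single fixed point *)

Section Descent.
Variables (R : realType) (n : nat).
Local Notation V := 'rV[R]_n.
Variables (N : set V) (F : V -> R) (D : V -> V) (m0 : V) (r : R).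
Hypotheses (r0 : 0 < r).
Hypothesis cF : forall x : V, N x -> {for x, continuous F}.
Hypothesis cD : forall x : V, N x -> {for x, continuous D}.
Hypothesis BN : forall x : V, `|x - m0| <= r -> N x.
Hypothesis DN : forall x : V, `|x - m0| <= r -> N (D x).
Hypothesis dec : forall x : V, `|x - m0| <= r -> F (D x) <= F x.
Hypothesis strict : forall x : V, `|x - m0| <= r -> F (D x) = F x -> x = m0.
Hypothesis Dm0 : D m0 = m0.

Lemma descent_lt x : `|x - m0| <= r -> x != m0 -> F (D x) < F x.
Proof.
by move=> xr xm; rewrite lt_neqAle dec// andbT; apply: contra_neq xm; exact: strict.
Qed.

Lemma m0N : N m0. Proof. by apply: BN; rewrite subrr normr0 ltW. Qed.

Lemma annulus_neq (a : R) x : 0 < a -> a <= `|x - m0| -> x != m0.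
Proof. by move=> a0; apply: contraTneq => ->; rewrite subrr normr0 -ltNge. Qed.

(** One application of [D] lowers the value strictly and stays in the region where [F m0] is the
    least one. *)
Lemma local_min_strict (r2 : R) : 0 < r2 -> r2 <= r ->
  (\forall x \near m0, F m0 <= F x) -> exists rc : R,
  [/\ 0 < rc, rc <= r2 & forall x : V, x != m0 -> `|x - m0| <= rc -> F m0 < F x].
Proof.
move=> r20 r2r /nbhs_normP[d d0 hd].
have [e e0 he] := (continuous_normP _ _).1 (cD m0N) _ d0; rewrite Dm0 in he.
pose rc := Num.min (r2 / 2) (e / 2).
have rc0 : 0 < rc by rewrite lt_min !divr_gt0.
have rcr2 : rc <= r2 by rewrite ge_min; apply/orP; left; lra.
have rce : rc < e by rewrite gt_min; apply/orP; right; lra.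
exists rc; split=> // x xm x2.
have xr : `|x - m0| <= r by rewrite (le_trans x2)// (le_trans rcr2).
apply: le_lt_trans (descent_lt xr xm).
by apply/hd/he; exact: le_lt_trans x2 rce.
Qed.

(** Lyapunov stability. The orbit keeps [F < F m0 + mu], while on the annulus between [rc1] and [rc]
    the excess over [F m0] is larger than [mu], and one application of [D] cannot jump over that
    annulus. *)
Lemma small_invariant (r2 : R) : 0 < r2 -> r2 <= r ->
  (\forall x \near m0, F m0 <= F x) ->
  exists2 d : R, 0 < d & forall x : V, `|x - m0| < d -> forall k, `|iter k D x - m0| < r2.
Proof.
move=> r20 r2r lm; have [rc [rc0 rcr2 hF]] := local_min_strict r20 r2r lm.
have rcr := le_trans rcr2 r2r.
have [e1 e10 he1] := (continuous_normP _ _).1 (cD m0N) _ rc0; rewrite Dm0 in he1.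
pose rc1 := Num.min rc (e1 / 2).
have rc10 : 0 < rc1 by rewrite lt_min rc0 divr_gt0.
have rc1c : rc1 <= rc by rewrite ge_min lexx.
have rc1e : rc1 < e1 by rewrite gt_min; apply/orP; right; lra.
have c1 (y : V) : rc1 <= `|y - m0| <= rc -> {for y, continuous (fun x : V => F x - F m0)}.
  move=> /andP[_ xr]; apply: continuousB_at; last exact: continuous_cst_at.
  by apply: cF; apply: BN; exact: le_trans xr rcr.
have c2 (y : V) : rc1 <= `|y - m0| <= rc -> 0 < F y - F m0.
  by move=> /andP[x1 xr]; rewrite subr_gt0; apply: hF => //; exact: annulus_neq x1.
have [mu mu0 hmu] := tube_gap (@compact_annulus R n m0 rc1 rc) c1 c2.
have [e e0 he] := (continuous_normP _ _).1 (cF m0N) _ mu0.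
exists (Num.min e rc1) => [|x]; first by rewrite lt_min e0.
rewrite lt_min => /andP[xe xr] k.
suff : `|iter k D x - m0| < rc1 /\ F (iter k D x) < F m0 + mu.
  by move=> [h _]; apply: lt_le_trans h (le_trans rc1c rcr2).
elim: k => [|k [IH1 IH2]] /=.
  by split=> //; have := he _ xe; rewrite ltr_norml => /andP[_]; lra.
set y := iter k D x in IH1 IH2 *.
have Fy : F (D y) < F m0 + mu.
  apply: le_lt_trans IH2; apply: dec; rewrite (le_trans (ltW IH1))// (le_trans rc1c)//.
split=> //; rewrite ltNge; apply/negP => h.
have yc : `|D y - m0| <= rc by apply/ltW/he1/(lt_trans IH1).
have := hmu (D y); rewrite /= h yc => /(_ isT); lra.
Qed.

(** Away from [m0] each application of [D] loses at least a fixed amount, by compactness, but [F] is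
    bounded on the ball. *)
Lemma orbit_approach x (e : R) : 0 < e ->
  (forall k, `|iter k D x - m0| <= r) -> exists k, `|iter k D x - m0| < e.
Proof.
move=> e0 hk; apply: contrapT => /forallNP h.
have hA k : e <= `|iter k D x - m0| <= r.
  by rewrite hk andbT leNgt; apply/negP; exact: h.
have c1 (y : V) : e <= `|y - m0| <= r -> {for y, continuous (fun x : V => F x - F (D x))}.
  move=> /andP[_ xr]; apply: continuousB_at; first by apply: cF; exact: BN.
  apply: (@continuous_comp _ _ _ D F); first by apply: cD; exact: BN.
  by apply: cF; exact: DN.
have c2 (y : V) : e <= `|y - m0| <= r -> 0 < F y - F (D y).
  move=> /andP[xe xr]; rewrite subr_gt0; apply: descent_lt => //.
  exact: annulus_neq xe.
have [mu mu0 hmu] := tube_gap (@compact_annulus R n m0 e r) c1 c2.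
have [K K0 hK] := @bounded_on_ball R n m0 r F (fun y yr => cF (BN yr)).
have hF k : F (iter k D x) <= F x - k%:R * mu.
  elim: k => [|k IH]; first by rewrite mul0r subr0.
  have := hmu _ (hA k); rewrite iterS -natr1 mulrDl mul1r; lra.
have [k hk1] : exists k : nat, (F x + K) / mu < k%:R.
  by exists (Num.truncn `|(F x + K) / mu|).+1; apply: le_lt_trans (ler_norm _) (truncnS_gt _).
have := hF k; have := hK _ (hk k); rewrite ler_norml => /andP[h1 _].
move: hk1; rewrite ltr_pdivrMr//; lra.
Qed.

Lemma orbit_ge x : (forall k, `|iter k D x - m0| <= r) -> F m0 <= F x.
Proof.
move=> hk.
have hF k : F (iter k D x) <= F x.
  elim: k => [//|k IH]; apply: le_trans IH; rewrite iterS; exact: dec.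
apply/ler_addgt0Pr => e e0.
have [d d0 hd] := (continuous_normP _ _).1 (cF m0N) _ e0.
have [k /hd] := orbit_approach d0 hk.
by rewrite ltr_norml => /andP[h _]; have := hF k; lra.
Qed.

Lemma iter_continuous k x : (forall i, (i < k)%N -> N (iter i D x)) ->
  {for x, continuous (iter k D)}.
Proof.
elim: k => [|k IH] h; first exact: cvg_id.
apply: (@continuous_comp _ _ _ (iter k D) D).
  by apply: IH => i ik; apply: h; exact: ltnW.
by apply: cD; exact: h.
Qed.

Lemma near_ball_open (f : V -> V) (a : R) (x : V) : {for x, continuous f} -> `|f x - m0| < a ->
  \forall y \near x, `|f y - m0| < a.
Proof.
move=> cf h.
have cn := @continuous_norm_sub R V V f m0 x cf.
exact: cn _ (@lt_nbhsl R _ _ h).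
Qed.

Lemma iter_near (r1 : R) k x : r1 <= r ->
  (forall i, (i <= k)%N -> `|iter i D x - m0| < r1) ->
  \forall y \near x, forall i, (i <= k)%N -> `|iter i D y - m0| < r1.
Proof.
move=> r1r; elim: k => [|k IH] h.
  have := near_ball_open (@iter_continuous 0 x (fun i => ltac:(by []))) (h 0%N isT).
  by apply: filterS => y hy [|i].
have ck : {for x, continuous (iter k.+1 D)}.
  apply: iter_continuous => i ik; apply: BN; apply/ltW/(lt_le_trans _ r1r)/h; exact: ltnW.
have h1 := near_ball_open ck (h k.+1 (leqnn _)).
have h2 := IH (fun i ik => h i (leqW ik)).
apply: filterS2 h1 h2 => y y1 y2 i; rewrite leq_eqVlt => /predU1P[->//|].
by rewrite ltnS; exact: y2.
Qed.

(* Along the segment from [m0] to [x], the orbits under [D] that stay near [m0]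
   form an open set, and so do those that escape: an escaping orbit crosses the
   annulus, where it loses [mu] and gets below [F m0]. *)
Lemma local_min_uniform (r1 rB mu : R) : 0 < rB -> rB < r1 -> r1 <= r ->
  (forall x : V, `|x - m0| < r1 -> `|D x - m0| <= r) ->
  (forall x : V, r1 <= `|x - m0| <= r -> mu < F x - F (D x)) ->
  (forall x : V, `|x - m0| < rB -> F x < F m0 + mu) ->
  (\forall x \near m0, F m0 <= F x) ->
  forall x : V, `|x - m0| < rB -> F m0 <= F x.
Proof.
move=> rB0 rBr1 r1r DB gap FB lm x xB.
have r10 := lt_trans rB0 rBr1.
have [d d0 hd] := small_invariant r10 r1r lm.
pose ga t := m0 + t *: (x - m0).
have gaB t : 0 <= t <= 1 -> `|ga t - m0| < rB.
  move=> /andP[t0 t1]; rewrite /ga addrC addKr normrZ ger0_norm//.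
  by apply: le_lt_trans xB; rewrite ler_piMl.
have cga t : {for t, continuous ga}.
  apply: cvgD; first exact: continuous_cst_at.
  by apply: cvgZr_tmp; exact: cvg_id.
pose P t := forall k, `|iter k D (ga t) - m0| < r1.
suff P1 : P 1.
  have -> : x = ga 1 by rewrite /ga scale1r addrC subrK.
  by apply: orbit_ge => k; apply/ltW/(lt_le_trans (P1 k)).
have P0 : P 0.
  move=> k; rewrite /ga scale0r addr0 (_ : iter k D m0 = m0) ?subrr ?normr0//.
  by elim: k => [//|k IH]; rewrite iterS IH.
apply: (@local_propagation R P 0 1) => // s s01.
have near_s : (\forall t \near s, P t) \/ (\forall t \near s, 0 <= t <= 1 -> ~ P t).
  have [Ps|nPs] := pselect (P s).
    left; have [k hk] := orbit_approach d0 (fun k => ltW (lt_le_trans (Ps k) r1r)).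
    have ck : {for ga s, continuous (iter k D)}.
      by apply: iter_continuous => i _; apply: BN; apply/ltW/(lt_le_trans (Ps i)).
    have h1 := near_ball_open ck hk.
    have h2 := @iter_near r1 k (ga s) r1r (fun i _ => Ps i).
    have n1 : \forall t \near s, `|iter k D (ga t) - m0| < d := cga s _ h1.
    have n2 : \forall t \near s, forall i, (i <= k)%N -> `|iter i D (ga t) - m0| < r1 := cga s _ h2.
    apply: filterS2 n1 n2 => t t1 t2 j.
    have [jk|kj] := leqP j k; first exact: t2.
    by rewrite -(subnK (ltnW kj)) iterD; exact: hd.
  right; have exk : exists k, ~~ (`|iter k D (ga s) - m0| < r1).
    by apply: contrapT => /forallNP h; apply: nPs => k; apply/negPn/negP; exact: h.
  case: (ex_minnP exk) => k hk kmin.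
  have lt_k i : (i < k)%N -> `|iter i D (ga s) - m0| < r1.
    by move=> ik; apply/negPn/negP => /kmin; rewrite leqNgt ik.
  set y := iter k D (ga s) in hk *.
  have yr : `|y - m0| <= r.
    rewrite /y; case: (k) lt_k => [|k'] lt_k; last by apply: DB; exact: lt_k.
    by apply/ltW/(lt_le_trans _ r1r)/(lt_trans _ rBr1)/gaB.
  have Fy : F y < F m0 + mu.
    apply: (le_lt_trans _ (FB _ (gaB _ s01))); rewrite /y; clear hk yr y kmin.
    elim: k lt_k => [//|k IH] lt_k; apply: le_trans (IH (fun i ik => lt_k i (ltnW ik))).
    by apply: dec; apply/ltW/(lt_le_trans _ r1r)/lt_k.
  have FDy : F (D y) < F m0.
    have := gap y; rewrite leNgt hk yr => /(_ isT); lra.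
  have cFk : {for ga s, continuous (F \o iter k.+1 D)}.
    apply: (@continuous_comp _ _ _ (iter k.+1 D) F); last by apply: cF; exact: DN.
    apply: iter_continuous => i; rewrite ltnS leq_eqVlt => /predU1P[->|ik]; apply: BN => //.
    by apply/ltW/(lt_le_trans _ r1r)/lt_k.
  have h1 := cFk _ (@lt_nbhsl R _ _ FDy).
  have n1 : \forall t \near s, F (iter k.+1 D (ga t)) < F m0 := cga s _ h1.
  apply: filterS n1 => t ht t01 Pt.
  suff : F m0 <= F (iter k.+1 D (ga t)) by rewrite leNgt ht.
  by apply: orbit_ge => j; rewrite -iterD; apply/ltW/(lt_le_trans (Pt _)).
case: near_s => /nbhs_normP[e e0 he]; exists e => // s1 s2 s101 s201 h1 h2 _ Ps1.
  exact: he.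
by case: (he s1).
Qed.

End Descent.

Section Continuation.
Variables (R : realType) (n : nat).
Local Notation V := 'rV[R]_n.
Variables (N : set V) (F : R -> V -> R) (D : R -> V -> V) (m0 : V) (a b : R).
Hypotheses (ab : a <= b) (oN : open N) (Nm0 : N m0).
Hypothesis jF : forall s x, a <= s <= b -> N x -> jcont F s x.
Hypothesis jD : forall s x, a <= s <= b -> N x -> jcont D s x.
Hypothesis dec : forall s x, a <= s <= b -> N x -> N (D s x) -> F s (D s x) <= F s x.
Hypothesis strict : forall s x, a <= s <= b -> N x -> N (D s x) ->
  F s (D s x) = F s x -> x = m0.
Hypothesis Dm0 : forall s, a <= s <= b -> D s m0 = m0.

(** Open and closed in the parameter. If the property holds at [s], the minimum is strict, so nearby
    parameters have a minimizer near [m0]; [D] cannot lower the value there, so by [strict] this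
    minimizer is [m0]. If the property fails at [s], some point of the ball of radius [rB] has a
    lower value than [m0], and still does for nearby parameters, whereas the property at such a
    parameter would make [m0] minimal on that whole ball: the radius in [local_min_uniform] does not
    depend on the parameter. *)
Lemma local_min_continuation : (\forall x \near m0, F a m0 <= F a x) ->
  \forall x \near m0, F b m0 <= F b x.
Proof.
move=> Pa; apply: (@local_propagation R (fun s => \forall x \near m0, F s m0 <= F s x) a b) => //.
move=> s sab.
have [R0 R00 hR0] := open_normP oN Nm0.
have jm := jD sab Nm0; have jFm := jF sab Nm0.
have nb (e : R) : 0 < e -> nbhs (D s m0) [set y : V | `|y - m0| < e].
  by move=> e0; apply/nbhs_ballP; exists e => //= y; rewrite -ball_normE/= Dm0// distrC.
have [d1 d10 near1] := jcont_near jm (nb _ R00).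
pose r := Num.min (R0 / 2) (d1 / 2).
have r0 : 0 < r by rewrite lt_min !divr_gt0.
have rR0 : r < R0 by rewrite gt_min; apply/orP; left; lra.
have rd1 : r < d1 by rewrite gt_min; apply/orP; right; lra.
have BN x : `|x - m0| <= r -> N x by move=> xr; apply: hR0; exact: le_lt_trans xr rR0.
have [d2 d20 near2] := jcont_near jm (nb _ r0).
pose r1 := Num.min r (d2 / 2).
have r10 : 0 < r1 by rewrite lt_min r0 divr_gt0.
have r1r : r1 <= r by rewrite ge_min lexx.
have r1d2 : r1 < d2 by rewrite gt_min; apply/orP; right; lra.
have DNs x : `|x - m0| <= r -> N (D s x).
  by move=> xr; apply: hR0; apply: (nbhs_singleton near1); exact: le_lt_trans xr rd1.
have jG x : `|x - m0| <= r -> jcont (fun s x => F s x - F s (D s x)) s x.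
  move=> xr; apply: jcontB; first exact: jF (BN _ xr).
  by apply: jcont_comp; [apply: jD => //; exact: BN|apply: jF => //; exact: DNs].
have ltF x : `|x - m0| <= r -> x != m0 -> F s (D s x) < F s x.
  move=> xr xm; rewrite lt_neqAle (dec sab (BN _ xr) (DNs _ xr)) andbT.
  by apply: contra_neq xm; apply: strict => //; [exact: BN|exact: DNs].
have c1 (y : V) : r1 <= `|y - m0| <= r -> {for y, continuous (fun x : V => F s x - F s (D s x))}.
  by move=> /andP[_ xr]; exact: (jcont_at (jG _ xr)).
have c2 (y : V) : r1 <= `|y - m0| <= r -> 0 < F s y - F s (D s y).
  by move=> /andP[x1 xr]; rewrite subr_gt0; apply: ltF => //; exact: annulus_neq x1.
have [mu mu0 hmu] := tube_gap (@compact_annulus R n m0 r1 r) c1 c2.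
have := @tube R n R _ (fun s x => F s x - F s (D s x) - mu) s (@compact_annulus R n m0 r1 r).
case/(_ _ _)/Wrap => [x /andP[_ xr]|x xA|near3].
- apply: (@jcontB R n R (fun s x => F s x - F s (D s x)) (fun _ _ => mu)); first exact: jG.
  by apply: (@jcont_cst R n R R (fun _ _ => mu) _ _ 0); exact: continuous_cst_at.
- by rewrite subr_gt0; exact: hmu.
have jF0 : jcont (fun s x => F s x - F s m0) s m0.
  by apply: jcontB => //; apply: jcont_cst; exact: jcont_par.
have nmu : nbhs (F s m0 - F s m0) [set y : R | y < mu].
  by apply: (@lt_nbhsl R); rewrite subrr.
have [d3 d30 near4] := jcont_near jF0 nmu.
pose rB := Num.min (r1 / 2) d3.
have rB0 : 0 < rB by rewrite lt_min d30 divr_gt0.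
have rBr1 : rB < r1 by rewrite gt_min; apply/orP; left; lra.
have rBd3 : rB <= d3 by rewrite ge_min lexx orbT.
have uni : \forall s' \near s, a <= s' <= b -> (\forall x \near m0, F s' m0 <= F s' x) ->
    forall x : V, `|x - m0| < rB -> F s' m0 <= F s' x.
  apply: filterS (filterI near1 (filterI near2 (filterI near3 near4)))
    => s' [n1 [n2 [n3 n4]]] s'ab lm.
  have DNs' x : `|x - m0| <= r -> N (D s' x).
    by move=> xr; apply/hR0/n1; exact: le_lt_trans xr rd1.
  apply: (@local_min_uniform R n N (F s') (D s') m0 r r0
    (fun x Nx => jcont_at (jF s'ab Nx)) (fun x Nx => jcont_at (jD s'ab Nx)) BN DNs'
    (fun x xr => dec s'ab (BN _ xr) (DNs' _ xr))
    (fun x xr => strict s'ab (BN _ xr) (DNs' _ xr)) (Dm0 s'ab) r1 rB mu) => //.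
  - by move=> x xr; apply/ltW/n2/(lt_trans xr).
  - by move=> x xA; rewrite -subr_gt0; exact: n3.
  - by move=> x xB; rewrite -ltrBlDl; apply: n4; exact: lt_le_trans xB rBd3.
have near_s : (\forall s' \near s, a <= s' <= b -> \forall x \near m0, F s' m0 <= F s' x) \/
    (\forall s' \near s, a <= s' <= b -> ~ \forall x \near m0, F s' m0 <= F s' x).
  have [Ps|nPs] := pselect (\forall x \near m0, F s m0 <= F s x); [left|right].
    have [rc [rc0 rcr hF]] := @local_min_strict R n N (F s) (D s) m0 r r0
      (fun x Nx => jcont_at (jD sab Nx)) BN (fun x xr => dec sab (BN _ xr) (DNs _ xr))
      (fun x xr => strict sab (BN _ xr) (DNs _ xr)) (Dm0 sab) r r0 (lexx _) Ps.
    have [d4 d40 near5] := jcont_near jm (nb _ rc0).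
    pose rd := Num.min rc (d4 / 2).
    have rd0 : 0 < rd by rewrite lt_min rc0 divr_gt0.
    have rdc : rd <= rc by rewrite ge_min lexx.
    have rdd4 : rd < d4 by rewrite gt_min; apply/orP; right; lra.
    have := @stable_minimizer R n R F m0 rd rc s rd0 rdc
      (fun x xr => jF sab (BN _ (le_trans xr rcr))).
    case/(_ _)/Wrap => [x /andP[x1 x2]|near6].
      by apply: hF => //; exact: annulus_neq x1.
    apply: filterS2 near5 near6 => s' h5 h6 s'ab.
    have [x xd hx] := h6 (fun x xr => jcont_at (jF s'ab (BN _ (le_trans xr rcr)))).
    have Dx : `|D s' x - m0| <= rc by apply/ltW/h5/(lt_trans xd).
    have xr : `|x - m0| <= r by rewrite (le_trans _ rcr)// (le_trans (ltW xd)).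
    have E : x = m0.
      apply: (strict s'ab (BN _ xr)); first by apply: BN; exact: le_trans Dx rcr.
      apply/eqP; rewrite eq_le (hx _ Dx).1 andbT; apply: dec => //; first exact: BN.
      by apply: BN; exact: le_trans Dx rcr.
    apply: (nbhs_normP _ _).2; exists rc => // y yr.
    by rewrite -{1}E; apply: (hx _ _).1; exact: ltW.
  have [x [xB xlt]] : exists x : V, `|x - m0| < rB /\ F s x < F s m0.
    apply: contrapT => /forallNP h; apply: nPs; apply: (nbhs_normP _ _).2.
    exists rB => // y yB; rewrite leNgt; apply/negP => ylt; exact: (h y).
  have xN : N x.
    by apply: BN; apply/ltW/(lt_le_trans xB)/(le_trans (ltW rBr1)).
  have cx : {for s, continuous (fun s' => F s' x - F s' m0)}.
    by apply: continuousB_at; [exact: jcont_par (jF sab xN)|exact: jcont_par jFm].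
  have xlt' : F s x - F s m0 < 0 by rewrite subr_lt0.
  have h1 : \forall s' \near s, F s' x - F s' m0 < 0 := cx _ (@lt_nbhsl R _ 0 xlt').
  apply: filterS2 h1 uni => s' /=; rewrite subr_lt0 => h2 h3 s'ab lm.
  by have := h3 s'ab lm x xB; rewrite leNgt h2.
case: near_s => /nbhs_normP[e e0 he]; exists e => // s1 s2 s1ab s2ab h1 h2 _ Ps1.
  exact: he.
by case: (he s1 h1 s1ab).
Qed.

End Continuation.

(** * Uniform local constants of the metric *)

Lemma common_bound (R : realType) (I : finType) (P : I -> R -> Prop) :
  (forall i, exists2 K, 0 <= K & P i K) ->
  (forall i (K K' : R), P i K -> K <= K' -> P i K') ->
  exists2 K, 0 <= K & forall i, P i K.
Proof.
move=> h mono.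
have /choice[k hk] : forall i, exists K, 0 <= K /\ P i K.
  by move=> i; have [K] := h i; exists K.
exists (\sum_i k i) => [|i]; first by apply: sumr_ge0 => i _; case: (hk i).
apply: mono (hk i).2 _; rewrite (bigD1 i)//= lerDl.
by apply: sumr_ge0 => j _; case: (hk j).
Qed.

Lemma tri_le (R : realType) (n : nat) (T : 'I_n -> 'I_n -> 'I_n -> R) (C : R) (u w : 'rV[R]_n) :
  0 <= C -> (forall k a b, `|T k a b| <= C) -> `|tri T u w| <= (n * n)%:R * C * `|u| * `|w|.
Proof.
move=> C0 h; apply: mx_norm_le => [|i k]; first by rewrite !mulr_ge0.
rewrite mxE (le_trans (ler_norm_sum _ _ _))//.
have -> : (n * n)%:R * C * `|u| * `|w| = \sum_(a < n) \sum_(b < n) (C * `|u| * `|w|).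
  by rewrite !sumr_const card_ord -mulrnA -[RHS]mulr_natl !mulrA.
apply: ler_sum => a _; rewrite (le_trans (ler_norm_sum _ _ _))//.
apply: ler_sum => b _; rewrite !normrM.
by apply: ler_pM; rewrite ?mulr_ge0//; [apply: ler_pM => //|]; exact: le_mx_norm.
Qed.

Section Constants.
Variables (R : realType) (n : nat) (U : set 'rV[R]_n) (g : 'rV[R]_n -> 'M[R]_n).
Hypothesis oU : open U.
Hypothesis g_smooth : smooth_on U g.
Hypothesis g_sym : forall x, U x -> (g x)^T = g x.
Hypothesis g_pos : forall x u, U x -> u != 0 -> 0 < bilin (g x) u u.
Local Notation V := 'rV[R]_n.
Implicit Types x y z u w v h k : V.

(** A positive lower bound over the unit sphere of the max norm, then homogeneity. *)
Lemma metric_coercive z : U z -> exists2 lam : R, 0 < lam &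
  forall u, lam * `|u| ^+ 2 <= bilin (g z) u u.
Proof.
move=> Uz.
have cf u : {for u, continuous (fun u : V => bilin (g z) u u)}.
  by apply: continuous_bilin; [exact: continuous_cst_at|exact: cvg_id|exact: cvg_id].
have [|mu mu0 h] := tube_gap (@compact_annulus R n 0 1 1) (fun u _ => cf u).
- move=> u /andP[u1 _]; apply: g_pos => //; apply: contraTneq u1 => ->.
  by rewrite subr0 normr0 -ltNge.
exists mu => // u; have [->|u0] := eqVneq u 0.
  by rewrite normr0 expr0n mulr0 bilin0l.
have n0 : 0 < `|u| by rewrite normr_gt0.
have /(_ _)/ltW := h (`|u|^-1 *: u).
rewrite /= subr0 normrZ normfV normr_id mulVf ?gt_eqF// lexx => /(_ isT).
rewrite bilinZl bilinZr mulrA -invfM -expr2 mulrC ler_pdivlMr ?exprn_gt0//.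
Qed.

Lemma ball_in z : U z -> exists2 r : R, 0 < r & forall x, `|x - z| <= r -> U x.
Proof.
move=> Uz; have [d d0 hd] := open_normP oU Uz.
exists (d / 2) => [|x xr]; first by rewrite divr_gt0.
by apply: hd; apply: le_lt_trans xr _; lra.
Qed.

Lemma metric_lip z (r : R) : (forall x, `|x - z| <= r -> U x) ->
  exists2 K : R, 0 <= K & forall x y, `|x - z| <= r -> `|y - z| <= r ->
    `|g y - g x| <= K * `|y - x|.
Proof.
move=> rU; have [||K K0 h] := @common_bound R ('I_n * 'I_n)%type
  (fun i K => forall x y, `|x - z| <= r -> `|y - z| <= r ->
     `|g y i.1 i.2 - g x i.1 i.2| <= K * `|y - x|).
- move=> [a b] /=; apply: (class_C1_lip rU).
  exact: (metric_entry_smooth oU g_smooth 1).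
- by move=> i K K' h KK' x y xr yr; rewrite (le_trans (h _ _ xr yr))// ler_wpM2r.
exists K => // x y xr yr; apply: mx_norm_le => [|a b]; first by rewrite mulr_ge0.
by rewrite !mxE; exact: (h (a, b)).
Qed.

Lemma metric_taylor z (r : R) : (forall x, `|x - z| <= r -> U x) ->
  exists2 K : R, 0 <= K & forall x y, `|x - z| <= r -> `|y - z| <= r ->
    `|g y - g x - 'D_(y - x) g x| <= K * `|y - x| ^+ 2.
Proof.
move=> rU; have [||K K0 h] := @common_bound R ('I_n * 'I_n)%type
  (fun i K => forall x y, `|x - z| <= r -> `|y - z| <= r ->
     `|g y i.1 i.2 - g x i.1 i.2 - 'D_(y - x) (fun y => g y i.1 i.2) x| <= K * `|y - x| ^+ 2).
- move=> [a b] /=; apply: (class_C2_taylor rU).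
  exact: (metric_entry_smooth oU g_smooth 2).
- by move=> i K K' h KK' x y xr yr; rewrite (le_trans (h _ _ xr yr))// ler_wpM2r// exprn_ge0.
exists K => // x y xr yr; apply: mx_norm_le => [|a b].
  by rewrite mulr_ge0// exprn_ge0.
have := h (a, b) x y xr yr; rewrite /= -derive_entry ?mxE//.
by apply: diff_derivable; apply: (metric_differentiable g_smooth); exact: rU.
Qed.

Lemma christoffel_bounds z (r : R) : (forall x, `|x - z| <= r -> U x) ->
  exists2 K : R, 0 <= K & (forall x (k a b : 'I_n), `|x - z| <= r -> `|christoffel g k a b x| <= K) /\
    (forall x y (k a b : 'I_n), `|x - z| <= r -> `|y - z| <= r ->
       `|christoffel g k a b y - christoffel g k a b x| <= K * `|y - x|).
Proof.
move=> rU; have [||K K0 h] := @common_bound R ('I_n * ('I_n * 'I_n))%type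
  (fun i K => (forall x, `|x - z| <= r -> `|christoffel g i.1 i.2.1 i.2.2 x| <= K) /\
    forall x y, `|x - z| <= r -> `|y - z| <= r ->
     `|christoffel g i.1 i.2.1 i.2.2 y - christoffel g i.1 i.2.1 i.2.2 x| <= K * `|y - x|).
- move=> [k [a b]] /=.
  have [K1 K10 h1] := class_C1_lip rU (christoffel_smooth oU g_smooth g_pos 1 k a b).
  have [K2 K20 h2] := @bounded_on_ball R n z r (christoffel g k a b) (fun y yr =>
    differentiable_continuous (christoffel_differentiable oU g_smooth g_pos k a b (rU y yr))).
  exists (K1 + K2); first by rewrite addr_ge0.
  split=> [x xr|x y xr yr]; first by rewrite (le_trans (h2 _ xr))// lerDr.
  by rewrite (le_trans (h1 _ _ xr yr))// ler_wpM2r// lerDl.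
- move=> i K K' [h1 h2] KK'; split=> [x xr|x y xr yr]; first exact: le_trans (h1 _ xr) KK'.
  by rewrite (le_trans (h2 _ _ xr yr))// ler_wpM2r.
exists K => //; split=> [x k a b xr|x y k a b xr yr]; first exact: (h (k, (a, b))).1.
exact: (h (k, (a, b))).2.
Qed.

(** One radius and one pair of constants for all the local estimates. The radius is so small that
    the quadratic form of the metric varies by at most [lam / 2], which leaves half of the
    coercivity constant found at [z]. *)
Lemma local_constants z : U z -> exists rho K lam : R,
  [/\ 0 < rho, 0 < K, 0 < lam, forall x, `|x - z| <= rho -> U x &
   [/\ forall x u w, `|x - z| <= rho -> `|Gam g x u w| <= K * `|u| * `|w|,
       forall x y u w, `|x - z| <= rho -> `|y - z| <= rho ->
         `|Gam g y u w - Gam g x u w| <= K * `|y - x| * `|u| * `|w|,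
       forall x y u w, `|x - z| <= rho -> `|y - z| <= rho ->
         `|bilin (g y) u w - bilin (g x) u w| <= K * `|y - x| * `|u| * `|w|,
       forall x y u w, `|x - z| <= rho -> `|y - z| <= rho ->
         `|bilin (g y) u w - bilin (g x) u w - dmetric g x (y - x) u w| <=
           K * `|y - x| ^+ 2 * `|u| * `|w| &
       forall x u, `|x - z| <= rho ->
         lam * `|u| ^+ 2 <= bilin (g x) u u /\ bilin (g x) u u <= K * `|u| ^+ 2]].
Proof.
move=> Uz; have [r r0 rU] := ball_in Uz.
have [K1 K10 h1] := metric_lip rU.
have [K2 K20 h2] := metric_taylor rU.
have [K3 K30 [h3 h4]] := christoffel_bounds rU.
have [lam lam0 hl] := metric_coercive Uz.
pose nn : R := (n * n)%:R; have nn0 : 0 <= nn by rewrite /nn ler0n.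
pose rho := Num.min r (lam / (2 * (nn * K1 + 1))).
have C0 : 0 < 2 * (nn * K1 + 1) by rewrite mulr_gt0// ltr_wpDl// mulr_ge0.
have rho0 : 0 < rho by rewrite lt_min r0 divr_gt0.
have rhor : rho <= r by rewrite ge_min lexx.
have rholam : nn * K1 * rho <= lam / 2.
  have : rho * (2 * (nn * K1 + 1)) <= lam by rewrite -ler_pdivlMr// ge_min lexx orbT.
  by have := mulr_ge0 nn0 K10; move: (nn * K1) => q q0; nra.
have zr : `|z - z| <= rho by rewrite subrr normr0 ltW.
have rin x : `|x - z| <= rho -> `|x - z| <= r by move=> /le_trans; apply.
pose Kg := nn * (`|g z| + K1 * rho).
have Kg0 : 0 <= Kg by rewrite mulr_ge0// addr_ge0// mulr_ge0// ltW.
pose K := nn * K1 + nn * K2 + nn * K3 + Kg + 1.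
have [a1 a2 a3] : [/\ 0 <= nn * K1, 0 <= nn * K2 & 0 <= nn * K3] by split; exact: mulr_ge0.
have lipb x y u w : `|x - z| <= rho -> `|y - z| <= rho ->
    `|bilin (g y) u w - bilin (g x) u w| <= nn * K1 * `|y - x| * `|u| * `|w|.
  move=> /rin xr /rin yr; rewrite -bilinBA (le_trans (bilin_le _ _ _))//.
  by rewrite -!mulrA ler_wpM2l// !mulrA !ler_wpM2r// h1.
exists rho, K, (lam / 2); split=> //; [by rewrite /K; lra|by rewrite divr_gt0| |].
  by move=> x /rin; exact: rU.
split.
- move=> x u w /rin xr; rewrite Gam.unlock (le_trans (tri_le _ _ K30 _))//.
    by move=> k a b; exact: h3.
  by rewrite !ler_wpM2r// /K -/nn; lra.
- move=> x y u w /rin xr /rin yr; rewrite Gam.unlock.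
  have -> : tri (fun (k a b : 'I_n) => christoffel g k a b y) u w - tri (fun (k a b : 'I_n) => christoffel g k a b x) u w
    = tri (fun (k a b : 'I_n) => christoffel g k a b y - christoffel g k a b x) u w.
    apply/rowP => k; rewrite !mxE -sumrB; apply: eq_bigr => a _; rewrite -sumrB.
    by apply: eq_bigr => b _; rewrite !mulrBl.
  rewrite (le_trans (tri_le _ _ (mulr_ge0 K30 (normr_ge0 (y - x))) _))//.
    by move=> ? a b; exact: h4.
  by rewrite !mulrA !ler_wpM2r// /K -/nn; lra.
- move=> x y u w xr yr; rewrite (le_trans (lipb _ _ _ _ xr yr))// !ler_wpM2r// /K; lra.
- move=> x y u w /rin xr /rin yr; rewrite dmetric.unlock -!bilinBA (le_trans (bilin_le _ _ _))//.
  rewrite !ler_wpM2r// (le_trans (ler_wpM2l _ (h2 _ _ xr yr)))//.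
  by rewrite mulrA ler_wpM2r ?exprn_ge0// /K -/nn; lra.
move=> x u xr; have := lipb z x u u zr xr; rewrite -mulrA -expr2.
have xz : nn * K1 * `|x - z| <= nn * K1 * rho by rewrite ler_wpM2l.
have uu : 0 <= `|u| ^+ 2 by rewrite exprn_ge0.
move=> h; have {h} := le_trans h (ler_wpM2r uu (le_trans xz rholam)).
rewrite ler_norml => /andP[b1 _].
have b3 := hl u; split.
  by move: b1 b3; move: (bilin _ _ _) (bilin _ _ _) (`|u| ^+ 2) => p q t; lra.
rewrite (le_trans (ler_norm _))// (le_trans (bilin_le _ _ _))//.
rewrite -mulrA -expr2 ler_wpM2r// (@le_trans _ _ Kg)//; last by rewrite /K; lra.
rewrite ler_wpM2l// -[g x](subrK (g z)) addrC (le_trans (ler_normD _ _))// lerD2l.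
rewrite (le_trans (h1 _ _ (rin _ zr) (rin _ xr)))// ler_wpM2l//.
Qed.

End Constants.

(** * Comparison of energies in a chart *)

Lemma energy_arith (R : realType) (K lam H Q S om gyvv gyvk gykk gxvv gxvk dm Ahh Ahk Akk : R) :
  0 < K -> 0 < lam -> 0 <= H -> 0 <= Q -> 0 <= S -> `|om| <= 2^-1 ->
  (K / 2 + K ^+ 2 / lam) * S ^+ 2 <= lam ^+ 2 / (16 * K) ->
  gxvv + dm - K * H ^+ 2 * S ^+ 2 <= gyvv -> gxvk - K * H * S * Q <= gyvk ->
  lam * Q ^+ 2 <= gykk -> Akk <= K * Q ^+ 2 -> lam * H ^+ 2 <= Ahh ->
  0 <= Akk - 2 * om * Ahk + om ^+ 2 * Ahh ->
  gxvv / 2 + (gxvk + dm / 2) + lam / (4 * K) * (- Ahh + 2 * om * Ahk) +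
    lam / (4 * K) / 2 * Ahh <= (gyvv + 2 * gyvk + gykk) / 2.
Proof.
move=> K0 l0 H0 Q0 S0 om1 hS h1 h2 h3 h4 h5 h6.
pose c := lam / (4 * K).
have c0 : 0 < c by rewrite divr_gt0// mulr_gt0.
have K4 : 0 < 4 * K by rewrite mulr_gt0.
have cK : c * K = lam / 4 by rewrite /c; field; rewrite gt_eqF.
have omq : om ^+ 2 <= 4^-1.
  rewrite -real_normK ?num_real//.
  have -> : 4^-1 = 2^-1 ^+ 2 :> R by field.
  by rewrite ler_pXn2r ?nnegrE// invr_ge0.
have AM : K * H * S * Q <= lam / 4 * Q ^+ 2 + K ^+ 2 / lam * S ^+ 2 * H ^+ 2.
  rewrite -subr_ge0.
  have -> : lam / 4 * Q ^+ 2 + K ^+ 2 / lam * S ^+ 2 * H ^+ 2 - K * H * S * Q =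
     (lam * Q / 2 - K * H * S) ^+ 2 / lam by field; rewrite gt_eqF.
  by rewrite divr_ge0 ?sqr_ge0// ltW.
have hS' := ler_wpM2r (sqr_ge0 H) hS.
have e1 : lam ^+ 2 / (16 * K) * H ^+ 2 <= c / 4 * Ahh.
  have -> : lam ^+ 2 / (16 * K) * H ^+ 2 = c / 4 * (lam * H ^+ 2).
    by rewrite /c; field; rewrite gt_eqF.
  by rewrite ler_pM2l// divr_gt0.
have e2 : c * Akk <= lam / 4 * Q ^+ 2 by rewrite -cK -mulrA ler_pM2l.
have Ahh0 : 0 <= Ahh by apply: le_trans h5; rewrite mulr_ge0 ?exprn_ge0// ltW.
have e3 : om ^+ 2 * Ahh <= 4^-1 * Ahh by rewrite ler_wpM2r.
have e4 : c * (2 * om * Ahk - 4^-1 * Ahh) <= c * Akk by rewrite ler_pM2l//; lra.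
have e5 : (K / 2 + K ^+ 2 / lam) * S ^+ 2 * H ^+ 2 =
  K * H ^+ 2 * S ^+ 2 / 2 + K ^+ 2 / lam * S ^+ 2 * H ^+ 2 by ring.
rewrite e5 in hS'; rewrite -/c.
move: h1 h2 h3 AM hS' e1 e2 e4; clear.
have -> : c * (2 * om * Ahk - 4^-1 * Ahh) = c * (om * Ahk) * 2 - c * Ahh / 4 by field.
have -> : c * (- Ahh + 2 * om * Ahk) = c * (om * Ahk) * 2 - c * Ahh by ring.
have -> : c / 2 * Ahh = c * Ahh / 2 by field.
have -> : c / 4 * Ahh = c * Ahh / 4 by field.
move: (c * Ahh) (c * (om * Ahk)) (c * Akk) (lam ^+ 2 / (16 * K) * H ^+ 2) (K ^+ 2 / lam * S ^+ 2 * H ^+ 2) => p q r s s'; lra.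
Qed.

Lemma bilin0A (R : realType) (n : nat) (u w : 'rV[R]_n) : bilin 0 u w = 0.
Proof. by rewrite bilin_def mulmx0 mul0mx mxE. Qed.

Section Energy.
Variables (R : realType) (n : nat) (U : set 'rV[R]_n) (g : 'rV[R]_n -> 'M[R]_n).
Hypothesis oU : open U.
Hypothesis g_smooth : smooth_on U g.
Hypothesis g_sym : forall x, U x -> (g x)^T = g x.
Hypothesis g_pos : forall x u, U x -> u != 0 -> 0 < bilin (g x) u u.
Local Notation V := 'rV[R]_n.
Variables (z : V) (rho K lam s : R).
Hypotheses (rho0 : 0 < rho) (K0 : 0 < K) (lam0 : 0 < lam).
Hypothesis rU : forall x, `|x - z| <= rho -> U x.
Hypothesis lip : forall x y u w, `|x - z| <= rho -> `|y - z| <= rho ->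
  `|bilin (g y) u w - bilin (g x) u w| <= K * `|y - x| * `|u| * `|w|.
Hypothesis taylor : forall x y u w, `|x - z| <= rho -> `|y - z| <= rho ->
  `|bilin (g y) u w - bilin (g x) u w - dmetric g x (y - x) u w| <=
     K * `|y - x| ^+ 2 * `|u| * `|w|.
Hypothesis coercive : forall x u, `|x - z| <= rho ->
  lam * `|u| ^+ 2 <= bilin (g x) u u /\ bilin (g x) u u <= K * `|u| ^+ 2.
Hypothesis s_small : (K / 2 + K ^+ 2 / lam) * s ^+ 2 <= lam ^+ 2 / (16 * K).
Let c := lam / (4 * K).

Lemma energy_c0 : 0 < c. Proof. by rewrite divr_gt0// mulr_gt0. Qed.

Lemma zin : `|z - z| <= rho. Proof. by rewrite subrr normr0 ltW. Qed.

(** Coercivity provides [lam / 2 * |k| ^+ 2] in the velocity difference [k], spent in two halves.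
    One absorbs the mixed error of the metric. The other dominates [c] times the square of [k] in
    the metric at [z]; as [|om| <= 1 / 2], this leaves a surplus of [c / 4] times the squared
    displacement, which absorbs the remaining error since [|v| <= s] is small. *)
Lemma energy_pointwise (x y v k : V) (om : R) : `|x - z| <= rho -> `|y - z| <= rho ->
  `|v| <= s -> `|om| <= 2^-1 ->
  bilin (g x) v v / 2 + (bilin (g x) v k + dmetric g x (y - x) v v / 2)
    + c * (- bilin (g z) (y - x) (y - x) + 2 * om * bilin (g z) (y - x) k)
    + c / 2 * bilin (g z) (y - x) (y - x) <= bilin (g y) (v + k) (v + k) / 2.
Proof.
move=> xr yr vs om1.
have -> : bilin (g y) (v + k) (v + k) = bilin (g y) v v + 2 * bilin (g y) v k + bilin (g y) k k.
  rewrite !bilinDl !bilinDr (metric_sym g_sym k v (rU yr)); ring.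
apply: (@energy_arith R K lam `|y - x| `|k| `|v| om _ _ _ _ _ _ _ _ (bilin (g z) k k)) => //.
- apply: le_trans s_small; rewrite ler_wpM2l ?ler_pXn2r ?nnegrE ?(le_trans _ vs)//.
  by rewrite addr_ge0// ?divr_ge0// ?exprn_ge0// ltW.
- have := taylor v v xr yr; rewrite ler_norml => /andP[+ _].
  have -> : K * `|y - x| ^+ 2 * `|v| * `|v| = K * `|y - x| ^+ 2 * `|v| ^+ 2 by ring.
  lra.
- have := lip v k xr yr; rewrite ler_norml => /andP[+ _]; lra.
- exact: (coercive k yr).1.
- exact: (coercive k zin).2.
- exact: (coercive (y - x) zin).1.
have zU : U z by apply: rU; exact: zin.
have := ip_ge0 (fun u u0 => g_pos zU u0) (k - om *: (y - x)); move: (y - x) => d.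
rewrite !bilinBl !bilinBr !bilinZl !bilinZr (metric_sym g_sym k d zU).
by move: (bilin (g z) k k) (bilin (g z) d k) (bilin (g z) d d) => a1 a2 a3; lra.
Qed.

Lemma energy_derive (x v y : R -> V) w t : U (x t) ->
  is_derive t 1 x (v t) -> is_derive t 1 v (- Gam g (x t) (v t) (v t)) -> is_derive t 1 y w ->
  is_derive t 1 (fun t => bilin (g (x t)) (v t) (y t - x t))
    (bilin (g (x t)) (v t) (w - v t) + dmetric g (x t) (y t - x t) (v t) (v t) / 2).
Proof.
move=> Ux dx dv dy.
have := is_derive_metric oU g_smooth g_sym g_pos Ux dx dv (is_deriveB dy dx).
apply: is_derive_eqr; rewrite addNr bilin0l add0r bilinDr.
rewrite -![(y - x) t]/(y t - x t); congr (_ + _).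
rewrite (metric_sym g_sym (v t) _ Ux).
have := koszul g_smooth g_sym g_pos (v t) (y t - x t) (v t) Ux.
rewrite (derive_metric_sym oU g_smooth g_sym (v t) (y t - x t) (v t) Ux).
move: (bilin _ _ _) (dmetric _ _ _ _ _) (dmetric _ _ _ _ _) => a1 a2 a3; lra.
Qed.

(** A calibration: its derivative is a lower bound for the energy density of [y] minus that of the
    geodesic [x]. The first term is the boundary term of the first variation. The second, with the
    weight [1 / 2 - t] and the metric frozen at [z], acts as a Poincare inequality and leaves a
    positive term in [y - x]. The whole vanishes where [y = x], and at a junction the contributions
    of the two pieces cancel. *)
Definition energy_pot (x v y : R -> V) (t : R) : R :=
  bilin (g (x t)) (v t) (y t - x t) + c * ((2^-1 - t) * bilin (g z) (y t - x t) (y t - x t)).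

Lemma energy_pot_derive (x v y : R -> V) w t : `|x t - z| <= rho -> `|y t - z| <= rho ->
  `|v t| <= s -> 0 <= t <= 1 ->
  is_derive t 1 x (v t) -> is_derive t 1 v (- Gam g (x t) (v t) (v t)) -> is_derive t 1 y w ->
  exists2 e, is_derive t 1 (energy_pot x v y) e &
    bilin (g (x t)) (v t) (v t) / 2 + e + c / 2 * bilin (g z) (y t - x t) (y t - x t)
      <= bilin (g (y t)) w w / 2.
Proof.
move=> xr yr vs /andP[t0 t1] dx dv dy.
have d1 := energy_derive (rU xr) dx dv dy.
have d2 := is_deriveB dy dx.
have d3 := is_derive_bilin (is_derive_cst (g z) t 1) d2 d2.
have d4 := is_derive_mul (is_deriveB (is_derive_cst (2^-1 : R) t 1) (is_derive_id1 t)) d3.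
have d5 := is_deriveD d1 (is_deriveZ c d4).
have om1 : `|2^-1 - t| <= 2^-1 by rewrite ler_norml; apply/andP; split; lra.
have zU : U z by apply: rU; exact: zin.
exists (bilin (g (x t)) (v t) (w - v t) + dmetric g (x t) (y t - x t) (v t) (v t) / 2 +
    c * (- bilin (g z) (y t - x t) (y t - x t) +
   2 * (2^-1 - t) * bilin (g z) (y t - x t) (w - v t))).
  apply: is_derive_eqr d5; congr (_ + _).
  rewrite -[LHS]/(c * ((0 - 1) * bilin (g z) (y t - x t) (y t - x t) + (2^-1 - t) *
   (bilin 0 (y t - x t) (y t - x t) + bilin (g z) (w - v t) (y t - x t) +
    bilin (g z) (y t - x t) (w - v t)))).
  rewrite bilin0A (metric_sym g_sym (w - v t) _ zU).
  by move: (bilin _ _ _) (bilin _ _ _) => a1 a2; ring.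
have := energy_pointwise (w - v t) xr yr vs om1; rewrite [v t + _]addrC subrK.
by rewrite !addrA.
Qed.

(* [e1] and [e2] are the energies of the two pieces of the curve. *)
Lemma two_piece_energy (x v y1 w1 y2 w2 : R -> V) (th l2 e1 e2 : R) :
  0 < th < 1 ->
  (forall t, 0 <= t <= 1 -> [/\ `|x t - z| <= rho, `|v t| <= s, is_derive t 1 x (v t),
     is_derive t 1 v (- Gam g (x t) (v t) (v t)) & bilin (g (x t)) (v t) (v t) = l2]) ->
  (forall t, 0 <= t <= th -> [/\ `|y1 t - z| <= rho, is_derive t 1 y1 (w1 t) &
     bilin (g (y1 t)) (w1 t) (w1 t) = e1]) ->
  (forall t, th <= t <= 1 -> [/\ `|y2 t - z| <= rho, is_derive t 1 y2 (w2 t) &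
     bilin (g (y2 t)) (w2 t) (w2 t) = e2]) ->
  y1 0 = x 0 -> y2 1 = x 1 -> y1 th = y2 th ->
  l2 <= th * e1 + (1 - th) * e2 /\
  (l2 = th * e1 + (1 - th) * e2 -> y1 th = x th).
Proof.
move=> /andP[th0 th1] hx h1 h2 y10 y21 y12.
pose Phi y e t := t * ((e - l2) / 2) - energy_pot x v y t.
have dPhi (y w : R -> V) e t : 0 <= t <= 1 -> `|y t - z| <= rho -> is_derive t 1 y (w t) ->
    bilin (g (y t)) (w t) (w t) = e -> exists2 d, is_derive t 1 (Phi y e) d &
    c / 2 * bilin (g z) (y t - x t) (y t - x t) <= d.
  move=> t01 yr dy ey; have [xr vs dx dv l2E] := hx t t01.
  have [d dd hd] := energy_pot_derive xr yr vs t01 dx dv dy.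
  exists ((e - l2) / 2 - d); last by move: hd; rewrite ey l2E; lra.
  have := is_deriveB (is_derive_mul (is_derive_id1 t) (is_derive_cst ((e - l2) / 2) t 1)) dd.
  by apply: is_derive_eqr; rewrite mul1r mulr0 addr0.
have A0 u : 0 <= bilin (g z) u u by have := (coercive u zin).1; apply: le_trans; rewrite mulr_ge0 ?exprn_ge0// ltW.
have c2 : 0 < c / 2 by rewrite divr_gt0// energy_c0.
have sub1 t : 0 <= t <= th -> 0 <= t <= 1 by move=> /andP[? ?]; apply/andP; split; lra.
have sub2 t : th <= t <= 1 -> 0 <= t <= 1 by move=> /andP[? ?]; apply/andP; split; lra.
have /choice[D1 hD1] : forall t, exists d, 0 <= t <= th -> is_derive t 1 (Phi y1 e1) d /\
    c / 2 * bilin (g z) (y1 t - x t) (y1 t - x t) <= d.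
  move=> t; have [tt|] := boolP (0 <= t <= th); last by exists 0.
  have [yr dy ey] := h1 t tt; have [d] := dPhi y1 w1 e1 t (sub1 _ tt) yr dy ey.
  by exists d.
have /choice[D2 hD2] : forall t, exists d, th <= t <= 1 -> is_derive t 1 (Phi y2 e2) d /\
    c / 2 * bilin (g z) (y2 t - x t) (y2 t - x t) <= d.
  move=> t; have [tt|] := boolP (th <= t <= 1); last by exists 0.
  have [yr dy ey] := h2 t tt; have [d] := dPhi y2 w2 e2 t (sub2 _ tt) yr dy ey.
  by exists d.
have m1 : Phi y1 e1 0 <= Phi y1 e1 th.
  apply: (derive_ge0_le (ltW th0) (fun t tt => (hD1 t tt).1)) => t tt.
  by apply: le_trans (hD1 t tt).2; rewrite mulr_ge0// ltW.
have m2 : Phi y2 e2 th <= Phi y2 e2 1.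
  apply: (derive_ge0_le (ltW th1) (fun t tt => (hD2 t tt).1)) => t tt.
  by apply: le_trans (hD2 t tt).2; rewrite mulr_ge0// ltW.
have E0 : energy_pot x v y1 0 = 0.
  by rewrite /energy_pot y10 subrr !bilin0r !mulr0 addr0.
have E1 : energy_pot x v y2 1 = 0.
  by rewrite /energy_pot y21 subrr !bilin0r !mulr0 addr0.
have Eth : energy_pot x v y1 th = energy_pot x v y2 th by rewrite /energy_pot y12.
move: m1 m2; rewrite /Phi E0 E1 Eth; set q := energy_pot x v y2 th => m1 m2.
split=> [|eq]; first by lra.
have m1' : Phi y1 e1 th <= Phi y1 e1 0.
  by rewrite /Phi E0 Eth -/q; lra.
have D10 t : 0 < t < th -> y1 t = x t.
  move=> tt; have tt' : 0 <= t <= th by case/andP: tt => ? ?; rewrite !ltW.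
  have D0 : D1 t = 0.
    apply: (derive_eq0_of_ends th0 (fun t tt => (hD1 t tt).1) _ m1' tt) => r rr.
    by apply: le_trans (hD1 r rr).2; rewrite mulr_ge0// ltW.
  have := (hD1 t tt').2; rewrite D0 pmulr_rle0// => h0.
  apply/eqP; rewrite -subr_eq0 -normr_eq0 -sqrf_eq0.
  have := le_trans (coercive (y1 t - x t) zin).1 h0; rewrite pmulr_rle0// => h3.
  by rewrite eq_le h3 sqr_ge0.
apply/eqP; rewrite -subr_eq0 -normr_le0 leNgt; apply/negP => e0.
have th00 : 0 <= th <= 1 by rewrite !ltW.
have th0th : 0 <= th <= th by rewrite ltW//=.
have [_ _ dx _ _] := hx th th00; have [_ dy _] := h1 th th0th.
have [d d0 hd] := (continuous_normP _ _).1 (is_derive_continuous (is_deriveB dy dx)) _ e0.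
pose t := Num.max (th / 2) (th - d / 2).
have tt : 0 < t < th.
  by rewrite lt_max gt_max; apply/andP; split; [apply/orP; left; lra|apply/andP; split; lra].
have td : `|t - th| < d.
  have t1 : th - d / 2 <= t by rewrite le_max lexx orbT.
  by case/andP: tt => ? ?; rewrite ltr_norml; apply/andP; split; lra.
have := hd t td; rewrite -[(y1 - x) t]/(y1 t - x t) -[(y1 - x) th]/(y1 th - x th).
by rewrite D10// subrr sub0r normrN ltxx.
Qed.

End Energy.

(** The right side is least at [th = l1 / (l1 + l2)], where it equals [(l1 + l2) ^+ 2]. Both lengths
    are enlarged by [e / 2] to keep [th] strictly between 0 and 1. *)
Lemma le_of_two_piece (R : realType) (l l1 l2 : R) : 0 <= l -> 0 <= l1 -> 0 <= l2 ->
  (forall th, 0 < th < 1 -> l ^+ 2 <= l1 ^+ 2 / th + l2 ^+ 2 / (1 - th)) -> l <= l1 + l2.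
Proof.
move=> l0 l10 l20 H; apply/ler_addgt0Pr => e e0.
pose S := l1 + l2 + e.
have S0 : 0 < S by rewrite /S; lra.
have a0 : 0 < l1 + e / 2 by lra.
have b0 : 0 < l2 + e / 2 by lra.
pose th := (l1 + e / 2) / S.
have th0 : 0 < th by rewrite divr_gt0.
have th1 : 1 - th = (l2 + e / 2) / S by rewrite /th /S; field; rewrite gt_eqF.
have th1' : 0 < 1 - th by rewrite th1 divr_gt0.
have h := H th ltac:(apply/andP; split; lra).
have key (c d : R) : 0 <= c -> c <= d -> 0 < d -> c ^+ 2 / (d / S) <= d * S.
  move=> c0 cd d0; rewrite invf_div mulrA ler_pdivrMr//.
  have -> : d * S * d = d ^+ 2 * S by ring.
  by rewrite ler_pM2r// ler_pXn2r ?nnegrE// ltW.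
have S0' := ltW S0.
rewrite -/S -(@ler_pXn2r _ 2) ?nnegrE//; apply: (le_trans h).
have -> : S ^+ 2 = (l1 + e / 2) * S + (l2 + e / 2) * S by rewrite /S; field.
by rewrite th1 /th; apply: lerD; apply: key => //; lra.
Qed.

(** * Local minimality of geodesics *)

Section LocalGeodesics.
Variables (R : realType) (n : nat) (M : riemannianManifold R n).
Hypothesis UG : uniquely_geodesic M.
Local Notation V := 'rV[R]_n.
Variables (i : mchart M) (z : V) (rho K lam r0 : R) (x v : V -> V -> R -> V).
Local Notation g := (gram i).
Local Notation U := (@chart_range R n M i).
Hypotheses (rho0 : 0 < rho) (K0 : 0 < K) (lam0 : 0 < lam) (r00 : 0 < r0).
Hypothesis rU : forall x : V, `|x - z| <= rho -> U x.
Hypothesis Gam_le : forall x u w : V, `|x - z| <= rho -> `|Gam g x u w| <= K * `|u| * `|w|.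
Hypothesis lip : forall x y u w : V, `|x - z| <= rho -> `|y - z| <= rho ->
  `|bilin (g y) u w - bilin (g x) u w| <= K * `|y - x| * `|u| * `|w|.
Hypothesis taylor : forall x y u w : V, `|x - z| <= rho -> `|y - z| <= rho ->
  `|bilin (g y) u w - bilin (g x) u w - dmetric g x (y - x) u w| <=
     K * `|y - x| ^+ 2 * `|u| * `|w|.
Hypothesis coercive : forall x u : V, `|x - z| <= rho ->
  lam * `|u| ^+ 2 <= bilin (g x) u u /\ bilin (g x) u u <= K * `|u| ^+ 2.
Hypothesis s_small : (K / 2 + K ^+ 2 / lam) * (4 * r0) ^+ 2 <= lam ^+ 2 / (16 * K).
Hypothesis r0rho : r0 <= rho.
Hypothesis hX : forall a b : V, `|a - z| <= r0 -> `|b - z| <= r0 ->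
    [/\ x a b 0 = a, x a b 1 = b,
       (forall t : R, `|x a b t - z| <= rho /\ `|v a b t| <= 2 * `|b - a|) &
       (forall t : R, -1 < t < 2 -> is_derive t 1 (x a b) (v a b t) /\
          is_derive t 1 (v a b) (- Gam g (x a b t) (v a b t) (v a b t)))].
Implicit Types a b m : V.
Local Notation B a := (`|a - z| <= r0).
Local Notation P := (mpoint i).

Let in12 (t : R) : 0 <= t <= 1 -> -1 < t < 2.
Proof. by move=> /andP[? ?]; apply/andP; split; lra. Qed.

Lemma ball_dist a b : B a -> B b -> `|b - a| <= 2 * r0.
Proof.
move=> ha hb; rewrite -(subrKA z) (le_trans (ler_normD _ _))//.
by rewrite (distrC z); lra.
Qed.

Lemma loc_joins a b : B a -> B b -> geodesic_joins (fun t => P (x a b t)) (P a) (P b).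
Proof.
move=> Ba Bb; have [x0 x1 xr dx] := hX Ba Bb; split; rewrite ?x0 ?x1//.
exists 1 => // t t12; have t12' : -1 < t < 2 by case/andP: t12 => ? ?; apply/andP; split; lra.
have [dxt dvt] := dx t t12'.
have ct : {for t, continuous (fun t => P (x a b t))}.
  apply: (@continuous_comp _ _ _ (x a b) P); first exact: is_derive_continuous dxt.
  by apply: mpoint_continuous; apply: rU; exact: (xr t).1.
apply: (geodesic_at_chart (i := i) (x := x a b) (v := v a b) ct) => //.
  near=> s; have Us : U (x a b s) by apply: rU; exact: (xr s).1.
  by split; [exact: mpoint_dom|exact: mpointK].
by apply: (near_interval t12') => s /dx[].
Unshelve. all: by end_near. Qed.

Lemma loc_gam a b t : B a -> B b -> 0 <= t <= 1 -> gam (P a) (P b) t = P (x a b t).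
Proof. by move=> Ba Bb t01; rewrite (gam_eq UG (loc_joins Ba Bb)). Qed.

Definition llen a b := glen (P a) (P b).

Lemma loc_speed a b t : B a -> B b -> 0 <= t <= 1 ->
  bilin (g (x a b t)) (v a b t) (v a b t) = llen a b ^+ 2.
Proof.
move=> Ba Bb t01; have [x0 x1 xr dx] := hX Ba Bb.
have h := loc_joins Ba Bb; have [gc _ _] := h.
rewrite /llen (glenE UG h) -(geodesic_speed gc t01) sqr_speed.
have Ux s : U (x a b s) by apply: rU; exact: (xr s).1.
have [ct _] := geodesic_at_mem gc t01.
have E : \forall s \near t, x a b s = (mcoord i \o (fun t => P (x a b t))) s.
  by near=> s; rewrite /= mpointK.
have ds := is_derive_near E (dx t (in12 t01)).1.
by rewrite (sq_speedE ct (mpoint_dom (Ux t)) ds) mpointK.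
Unshelve. all: by end_near. Qed.

(** [two_piece_energy] for the broken geodesic that reaches [m] in time [th] and [b] in the
    remaining time. Energies, unlike lengths, see the parametrization: equality places [m] at the
    time [th] of the geodesic, not just somewhere on it. *)
Lemma loc_two a m b (th : R) : B a -> B m -> B b -> 0 < th < 1 ->
  llen a b ^+ 2 <= llen a m ^+ 2 / th + llen m b ^+ 2 / (1 - th) /\
  (llen a b ^+ 2 = llen a m ^+ 2 / th + llen m b ^+ 2 / (1 - th) -> m = x a b th).
Proof.
move=> Ba Bm Bb th01; have /andP[th0 th1] := th01.
have th1' : 0 < 1 - th by lra.
have [am0 am1 amr amd] := hX Ba Bm; have [mb0 mb1 mbr mbd] := hX Bm Bb.
have [ab0 ab1 abr abd] := hX Ba Bb.
have := @two_piece_energy R n U g (@chart_range_open _ _ _ i) (@gram_smooth' _ _ _ i)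
  (@gram_sym' _ _ _ i) (@gram_pos' _ _ _ i) z rho K lam (4 * r0) rho0 K0 lam0 rU lip taylor
  coercive s_small (x a b) (v a b)
  (fun t => x a m (0 + th^-1 * t)) (fun t => th^-1 *: v a m (0 + th^-1 * t))
  (fun t => x m b (- (th / (1 - th)) + (1 - th)^-1 * t))
  (fun t => (1 - th)^-1 *: v m b (- (th / (1 - th)) + (1 - th)^-1 * t)) th
  (llen a b ^+ 2) (th^-1 ^+ 2 * llen a m ^+ 2) ((1 - th)^-1 ^+ 2 * llen m b ^+ 2) th01.
have -> : th * (th^-1 ^+ 2 * llen a m ^+ 2) + (1 - th) * ((1 - th)^-1 ^+ 2 * llen m b ^+ 2) =
  llen a m ^+ 2 / th + llen m b ^+ 2 / (1 - th).
  by move: (llen a m) (llen m b) => A1 A2; field; rewrite !gt_eqF.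
have -> : 0 + th^-1 * th = 1 by rewrite add0r mulVf// gt_eqF.
have -> : 0 + th^-1 * 0 = 0 by rewrite mulr0 addr0.
have -> : - (th / (1 - th)) + (1 - th)^-1 * 1 = 1 by field; rewrite gt_eqF.
have -> : - (th / (1 - th)) + (1 - th)^-1 * th = 0 by field; rewrite gt_eqF.
rewrite am0 am1 mb0 mb1 ab0 ab1; apply=> //.
- move=> t t01; have [dx dv] := abd t (in12 t01); split=> //; first exact: (abr t).1.
    by rewrite (le_trans (abr t).2)//; have := ball_dist Ba Bb; lra.
  exact: loc_speed.
- move=> t /andP[t0 t1].
  have t01 : 0 <= 0 + th^-1 * t <= 1.
    by rewrite add0r mulr_ge0 ?invr_ge0 ?(ltW th0)//= mulrC ler_pdivrMr// mul1r.
  have [dx dv] := amd _ (in12 t01); split; first exact: (amr _).1.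
    exact: is_derive_affine.
  by rewrite bilinZl bilinZr mulrA -expr2 loc_speed.
- move=> t /andP[t0 t1].
  have t01 : 0 <= - (th / (1 - th)) + (1 - th)^-1 * t <= 1.
    have -> : - (th / (1 - th)) + (1 - th)^-1 * t = (t - th) / (1 - th).
      by field; rewrite gt_eqF.
    by rewrite divr_ge0 ?subr_ge0 ?(ltW th1)//= ler_pdivrMr// mul1r; lra.
  have [dx dv] := mbd _ (in12 t01); split; first exact: (mbr _).1.
    exact: is_derive_affine.
  by rewrite bilinZl bilinZr mulrA -expr2 loc_speed.
Qed.

Lemma llen_ge0 a b : 0 <= llen a b. Proof. exact: glen_ge0. Qed.

Lemma loc_triangle a m b : B a -> B m -> B b -> llen a b <= llen a m + llen m b.
Proof.
move=> Ba Bm Bb; apply: le_of_two_piece; try exact: llen_ge0.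
by move=> th /(loc_two Ba Bm Bb)[].
Qed.

Lemma loc_lower a b : B a -> B b -> Num.sqrt lam * `|b - a| <= llen a b.
Proof.
move=> Ba Bb; have [x0 x1 xr dx] := hX Ba Bb.
have sl : 0 < Num.sqrt lam by rewrite sqrtr_gt0.
suff : `|x a b 1 - x a b 0| <= llen a b / Num.sqrt lam * (1 - 0).
  by rewrite x0 x1 subr0 mulr1 ler_pdivlMr// mulrC.
apply: (@derive_norm_le R 1 n (x a b) (v a b) 0 1 _ ler01) => t t01.
  exact: (dx t (in12 t01)).1.
rewrite ler_pdivlMr// -(@ler_pXn2r _ 2) ?nnegrE ?mulr_ge0 ?llen_ge0 ?(ltW sl)//.
rewrite exprMn sqr_sqrtr ?(ltW lam0)// mulrC -(loc_speed Ba Bb t01).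
by apply: (coercive _ _).1; exact: (xr t).1.
Qed.

Lemma loc_upper a b : B a -> B b -> llen a b <= 2 * Num.sqrt K * `|b - a|.
Proof.
move=> Ba Bb; have [x0 x1 xr dx] := hX Ba Bb.
rewrite -(@ler_pXn2r _ 2) ?nnegrE ?mulr_ge0 ?llen_ge0 ?sqrtr_ge0//.
rewrite -(loc_speed Ba Bb (zero_in01 R)) (le_trans (coercive _ (xr 0).1).2)//.
have -> : (2 * Num.sqrt K * `|b - a|) ^+ 2 = Num.sqrt K ^+ 2 * (2 * `|b - a|) ^+ 2 by ring.
rewrite sqr_sqrtr ?(ltW K0)// ler_pM2l// ler_pXn2r ?nnegrE ?mulr_ge0//.
exact: (xr 0).2.
Qed.

(** The acceleration is quadratic in the velocity, so the initial velocity [v0] is [b - a] up to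
    [4 * K * |b - a| ^+ 2]; passing from the metric at [a] to the one at [m] costs a multiple of
    [K * |a - m|] in the square. Both errors are small against [|b - a|]. *)
Lemma loc_infinitesimal m (e : R) : B m -> 0 < e -> exists2 d : R, 0 < d &
  forall a b, B a -> B b -> `|a - m| < d -> `|b - m| < d ->
    llen a b <= gnorm (g m) (b - a) + e * `|b - a|.
Proof.
move=> Bm e0.
have mr : `|m - z| <= rho := le_trans Bm r0rho.
have Um := rU mr.
have gs := gram_sym' Um; have gp u := @gram_pos' _ _ _ i m u Um.
pose N := Num.sqrt ((n * n)%:R * `|g m|); have N0 : 0 <= N by exact: sqrtr_ge0.
have KN0 : 0 <= K * N by rewrite mulr_ge0// ltW.
pose d := Num.min (e / (16 * (K * N + 1))) (e ^+ 2 / (16 * K)).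
exists d; first by rewrite lt_min !divr_gt0 ?mulr_gt0 ?exprn_gt0//; lra.
move=> a b Ba Bb ad bd; have [x0 x1 xr dx] := hX Ba Bb.
set v0 := v a b 0.
have hv0 : `|v0| <= 2 * `|b - a| := (xr 0).2.
have hv (t : R) : 0 <= t <= 1 -> `|v a b t - v0| <= 4 * K * `|b - a| ^+ 2.
  move=> /andP[t0 t1].
  have := @derive_norm_le R 1 n (v a b) (fun t => - Gam g (x a b t) (v a b t) (v a b t)) 0 t
    (4 * K * `|b - a| ^+ 2) t0.
  case/(_ _ _)/Wrap => [r /andP[r0' r1']|r /andP[r0' r1']|h].
  - by apply: (dx r _).2; apply/andP; split; lra.
  - rewrite normrN (le_trans (Gam_le _ _ (xr r).1))//.
    have -> : 4 * K * `|b - a| ^+ 2 = K * ((2 * `|b - a|) * (2 * `|b - a|)) by ring.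
    by rewrite -mulrA ler_pM2l// ler_pM//; exact: (xr r).2.
  apply: le_trans h _; rewrite subr0 ler_piMr// mulr_ge0 ?exprn_ge0// mulr_ge0// ltW//.
have hw : `|v0 - (b - a)| <= 4 * K * `|b - a| ^+ 2.
  rewrite distrC.
  have := @derive_norm_le R 1 n (fun t => x a b t - t *: v0) (fun t => v a b t - v0) 0 1
    (4 * K * `|b - a| ^+ 2) ler01.
  rewrite x0 x1 scale1r scale0r !subr0 mulr1.
  have -> : b - v0 - a = b - a - v0 by rewrite addrAC.
  apply=> // t t01.
  have := is_deriveB (dx t (in12 t01)).1 (line_is_derive 0 v0 t).
  by apply: is_derive_near; near=> s; rewrite /= -[LHS]/(x a b s - (0 + s *: v0)) add0r.
have Ka0 : 0 <= K * `|a - m| by rewrite mulr_ge0// ltW.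
have l1 : llen a b <= gnorm (g m) v0 + Num.sqrt (K * `|a - m|) * `|v0|.
  rewrite -(@ler_pXn2r _ 2) ?nnegrE ?addr_ge0 ?mulr_ge0 ?llen_ge0 ?sqrtr_ge0//.
  rewrite -(loc_speed Ba Bb (zero_in01 R)) x0 -/v0 sqrrD (sqr_gnorm gp) exprMn sqr_sqrtr//.
  have := lip v0 v0 mr (le_trans Ba r0rho); rewrite ler_norml => /andP[_].
  have : 0 <= gnorm (g m) v0 * (Num.sqrt (K * `|a - m|) * `|v0|).
    by rewrite !mulr_ge0 ?sqrtr_ge0.
  by rewrite -[K * _ * _ * _]mulrA -expr2; lra.
have l2 : gnorm (g m) v0 <= gnorm (g m) (b - a) + N * (4 * K * `|b - a| ^+ 2).
  rewrite -{1}[v0](subrK (b - a)) addrC (le_trans (gnormD gs gp _ _))// lerD2l.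
  by rewrite (le_trans (gnorm_le _ _))// ler_wpM2l.
have l3 : Num.sqrt (K * `|a - m|) <= e / 4.
  rewrite -(@ler_pXn2r _ 2) ?nnegrE ?sqrtr_ge0 ?divr_ge0 ?(ltW e0)// sqr_sqrtr//.
  have : `|a - m| <= e ^+ 2 / (16 * K) by rewrite (le_trans (ltW ad))// ge_min lexx orbT.
  rewrite ler_pdivlMr ?mulr_gt0// => h.
  have -> : (e / 4) ^+ 2 = e ^+ 2 / 16 by field.
  by rewrite ler_pdivlMr//; lra.
have l4 : N * (4 * K * `|b - a| ^+ 2) <= e / 2 * `|b - a|.
  have -> : N * (4 * K * `|b - a| ^+ 2) = (4 * (K * N) * `|b - a|) * `|b - a| by ring.
  rewrite ler_wpM2r//.
  have h1 : `|b - a| <= 2 * (e / (16 * (K * N + 1))).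
    have dd : d <= e / (16 * (K * N + 1)) by rewrite ge_min lexx.
    rewrite -(subrKA m) (le_trans (ler_normD _ _))// (distrC m).
    by move: ad bd; gn; lra.
  have h2 := ler_wpM2l KN0 h1.
  have h3 : K * N * (2 * (e / (16 * (K * N + 1)))) <= e / 8.
    have -> : K * N * (2 * (e / (16 * (K * N + 1)))) = (e / 8) * (K * N / (K * N + 1)).
      by field; rewrite gt_eqF//; lra.
    by rewrite ler_piMr ?divr_ge0 ?(ltW e0)// ler_pdivrMr ?mul1r; lra.
  by lra.
have l5 : Num.sqrt (K * `|a - m|) * `|v0| <= e / 4 * (2 * `|b - a|).
  by rewrite ler_pM// sqrtr_ge0.
by lra.
Unshelve. all: by end_near. Qed.

End LocalGeodesics.

Lemma common_small (R : realType) (a b c d : R) : 0 < a -> 0 < b -> 0 < c -> 0 < d ->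
  exists2 r, 0 < r & [/\ r <= a, r <= b, r <= c & r <= d].
Proof.
move=> a0 b0 c0 d0; exists (Num.min (Num.min a b) (Num.min c d)).
  by rewrite !lt_min a0 b0 c0.
by split; rewrite !ge_min lexx ?orbT.
Qed.

Lemma min_lip (R : realType) (x y g T : R) : 0 <= g -> x <= y + g ->
  Num.min x T - Num.min y T <= g.
Proof.
by move=> g0 xy; rewrite lerBlDr; case: (leP y T) => h; rewrite ge_min; apply/orP;
  [left|right]; lra.
Qed.

(** * Charts in which short geodesics realize the distance *)

Section GoodCharts.
Variables (R : realType) (n : nat) (M : riemannianManifold R n).
Hypothesis UG : uniquely_geodesic M.
Local Notation V := 'rV[R]_n.

(* A chart around the point of coordinates [z] in which nearby points are joined
   by a controlled family [X] of geodesics. *)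
Record geodesic_chart (i : mchart M) (z : V) (rho r cl cu ct : R) (X : V -> V -> R -> V)
  : Prop := GeodesicChart {
  gc_r : 0 < r;
  gc_rho : r <= rho;
  gc_cl : 0 < cl;
  gc_U : forall a : V, `|a - z| <= rho -> chart_range i a;
  gc_in : forall (a b : V) t, `|a - z| <= r -> `|b - z| <= r -> `|X a b t - z| <= rho;
  gc_gam : forall (a b : V) (t : R), `|a - z| <= r -> `|b - z| <= r -> 0 <= t <= 1 ->
    gam (mpoint i a) (mpoint i b) t = mpoint i (X a b t);
  gc_lip : forall (a b a' b' : V) (t : R), `|a - z| <= r -> `|b - z| <= r ->
    `|a' - z| <= r -> `|b' - z| <= r ->
    `|X a b t - X a' b' t| <= 27 * (`|a - a'| + `|b - b'|);
  gc_time : forall (a b : V) (t t' : R), `|a - z| <= r -> `|b - z| <= r ->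
    0 <= t <= 1 -> 0 <= t' <= 1 -> `|X a b t - X a b t'| <= ct * `|t - t'|;
  gc_two : forall (a m b : V) (th : R), `|a - z| <= r -> `|m - z| <= r -> `|b - z| <= r ->
    0 < th < 1 -> llen i a b ^+ 2 = llen i a m ^+ 2 / th + llen i m b ^+ 2 / (1 - th) ->
    m = X a b th;
  gc_tri : forall a m b : V, `|a - z| <= r -> `|m - z| <= r -> `|b - z| <= r ->
    llen i a b <= llen i a m + llen i m b;
  gc_lower : forall a b : V, `|a - z| <= r -> `|b - z| <= r -> cl * `|b - a| <= llen i a b;
  gc_upper : forall a b : V, `|a - z| <= r -> `|b - z| <= r -> llen i a b <= cu * `|b - a|;
  gc_inf : forall (m : V) (e : R), `|m - z| <= r -> 0 < e -> exists2 d : R, 0 < d &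
    forall a b : V, `|a - z| <= r -> `|b - z| <= r -> `|a - m| < d -> `|b - m| < d ->
    llen i a b <= gnorm (gram i m) (b - a) + e * `|b - a| }.

Lemma geodesic_chart_exists i (z : V) : chart_range i z ->
  exists rho r cl cu ct X, geodesic_chart i z rho r cl cu ct X.
Proof.
move=> Uz.
have [rho [K [lam [rho0 K0 lam0 rU [hG hGl hl ht hc]]]]] :=
  local_constants (@chart_range_open _ _ _ i) (@gram_smooth' _ _ _ i) (@gram_pos' _ _ _ i) Uz.
pose A := (K / 2 + K ^+ 2 / lam) * 16; pose B := lam ^+ 2 / (16 * K).
have A0 : 0 < A by rewrite mulr_gt0// addr_gt0// divr_gt0// exprn_gt0.
have B0 : 0 < B by rewrite divr_gt0// ?mulr_gt0// exprn_gt0.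
have [k k0 kE] : exists2 k : R, 0 < k & 288 * K = k by exists (288 * K); [exact: mulr_gt0|].
(* The first three bounds serve the boundary value problem ([16 * r <= rho], [2 * r <= 1],
   [288 * K * r <= 1]), the last one the energy comparison, where velocities reach [4 * r]. *)
have [r [r0 r1 r2 r3 r4]] : exists r, [/\ 0 < r, r <= rho / 16, r <= 2^-1, r * k <= 1 & r * A <= B].
  have [|||| r r0 [r1 r2 r3 r4]] := @common_small R (rho / 16) (2^-1) k^-1 (B / A).
  - by rewrite divr_gt0.
  - by rewrite invr_gt0.
  - by rewrite invr_gt0.
  - by rewrite divr_gt0.
  exists r; split=> //; last by rewrite -ler_pdivlMr.
  by rewrite -ler_pdivlMr ?div1r.
have rrho : r <= rho by lra.
have small : (K / 2 + K ^+ 2 / lam) * (4 * r) ^+ 2 <= lam ^+ 2 / (16 * K).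
  apply: le_trans r4; have -> : (K / 2 + K ^+ 2 / lam) * (4 * r) ^+ 2 = r * A * r by rewrite /A; ring.
  have rA0 : 0 <= r * A by rewrite mulr_ge0 ?(ltW r0) ?(ltW A0).
  by rewrite ler_piMr//; lra.
have h1 : forall x v : V, `|x - z| <= rho -> `|- Gam (gram i) x v v| <= K * `|v| ^+ 2.
  by move=> a u ar; rewrite normrN (le_trans (hG _ _ _ ar))// -mulrA -expr2.
have h2 : forall x y v w : V, `|x - z| <= rho -> `|y - z| <= rho ->
    `|- Gam (gram i) x v v - - Gam (gram i) y w w| <=
    K * `|x - y| * `|v| ^+ 2 + K * `|v - w| * (`|v| + `|w|).
  move=> a b u w ar br.
  have -> : - Gam (gram i) a u u - - Gam (gram i) b w w =
    (Gam (gram i) b w w - Gam (gram i) b u u) + (Gam (gram i) b u u - Gam (gram i) a u u).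
    by rewrite subrKA opprK addrC.
  rewrite (le_trans (ler_normD _ _))// addrC lerD//.
    by rewrite (distrC a b) (le_trans (hGl _ _ _ _ ar br))// -!mulrA -expr2.
  have e : Gam (gram i) b w w = Gam (gram i) b (w - u) w + Gam (gram i) b u (w - u) + Gam (gram i) b u u.
    by rewrite -addrA -GamDr subrK -GamDl subrK.
  rewrite e addrK (le_trans (ler_normD _ _))//.
  rewrite (le_trans (lerD (hG _ _ _ br) (hG _ _ _ br)))// (distrC u w).
  by move: (`|w - u|) (`|w|) (`|u|) => p q q'; lra.
have [r5 r6 r7] : [/\ 16 * r <= rho, 2 * r <= 1 & 288 * K * r <= 1].
  by split; [lra|lra|rewrite kE mulrC].
have [x [v [hX h27]]] := @bvp_family R n (fun x v => - Gam (gram i) x v v) z rho K (ltW K0)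
  h1 h2 r r0 r5 r6 r7.
exists rho, r, (Num.sqrt lam), (2 * Num.sqrt K), (4 * r), x.
have hX' := hX.
split=> //.
- by rewrite sqrtr_gt0.
- by move=> a b t ar br; have [_ _ /(_ t)[]] := hX a b ar br.
- by move=> a b t; exact: (loc_gam UG rU hX).
- move=> a b t t' ar br t01 t01'.
  have [_ _ xr dx] := hX a b ar br.
  apply: (@derive_norm_le2 R 1 n (x a b) (v a b) 0 1 (4 * r) t' t _ _ t01' t01) => s.
    by move=> /andP[s0 s1]; apply: (dx s _).1; apply/andP; split; lra.
  by move=> _; rewrite (le_trans (xr s).2)//; have := ball_dist ar br; lra.
- move=> a m b th ar mr br th01.
  by have [] := loc_two UG rho0 K0 lam0 rU hl ht hc small hX ar mr br th01.
- by move=> a m b; exact: (loc_triangle UG rho0 K0 lam0 rU hl ht hc small hX).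
- by move=> a b; exact: (loc_lower UG lam0 rU hc hX).
- by move=> a b; exact: (loc_upper UG K0 rU hc hX).
- move=> m e; exact: (loc_infinitesimal UG K0 rU hG hl rrho hX).
Qed.

Section Truncation.
Variables (i : mchart M) (z : V) (rho r cl cu ct : R) (X : V -> V -> R -> V).
Hypothesis H : geodesic_chart i z rho r cl cu ct X.

Definition in_chart (s : R) (q : M) : Prop := mdom i q /\ `|mcoord i q - z| < s.

(** The curves that define [dist] may leave the chart. Truncation at a level attained well inside
    the chart extends the local length function by a constant to all of [M] and keeps it
    infinitesimally 1-Lipschitz, so it is a lower bound for [dist]. *)
Definition trunc (a : V) (q : M) : R :=
  if `[< in_chart r q >] then Num.min (glen (mpoint i a) q) (cl * r / 4) else cl * r / 4.

Lemma trunc_far a q : `|a - z| <= r / 2 -> ~ in_chart (3 / 4 * r) q -> trunc a q = cl * r / 4.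
Proof.
move=> ar nq; rewrite /trunc; case: asboolP => // -[qi qr]; apply/min_idPr.
have r0 := gc_r H.
have far : 3 / 4 * r <= `|mcoord i q - z| by rewrite leNgt; apply/negP => h; exact: nq.
have ar' : `|a - z| <= r by lra.
have := gc_lower H ar' (ltW qr); rewrite /llen mcoordK//; apply: le_trans.
rewrite -mulrA ler_pM2l ?(gc_cl H)//.
have : `|mcoord i q - z| <= `|mcoord i q - a| + `|a - z|.
  by rewrite -{1}(subrKA a) ler_normD.
lra.
Qed.

(** Inside the chart this is the local triangle inequality. Elsewhere the function is locally
    constant, because the image of the closed ball of radius [3 / 4 * r] is compact, hence closed in
    a Hausdorff space. *)
Lemma trunc_lip a p : `|a - z| <= r / 2 -> locally_lip (trunc a) p.
Proof.
move=> ar; have r0 := gc_r H.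
have [[ip pr]|np] := pselect (in_chart r p).
  exists i; split=> // e e0.
  have [d d0 hd] := gc_inf H (ltW pr) e0.
  exists (Num.min d (r - `|mcoord i p - z|)) => [|b c ib ic]; first by rewrite lt_min d0 subr_gt0.
  rewrite !lt_min => /andP[b1 b2] /andP[c1 c2].
  have inr q : `|mcoord i q - mcoord i p| < r - `|mcoord i p - z| -> `|mcoord i q - z| < r.
    have : `|mcoord i q - z| <= `|mcoord i q - mcoord i p| + `|mcoord i p - z|.
      by rewrite -{1}(subrKA (mcoord i p)) ler_normD.
    lra.
  have br := inr b b2; have cr := inr c c2.
  have := hd _ _ (ltW br) (ltW cr) b1 c1; rewrite /llen !mcoordK// => h1.
  have ar' : `|a - z| <= r by lra.
  have := gc_tri H ar' (ltW br) (ltW cr); rewrite /llen !mcoordK// => h2.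
  have h3 := glen_ge0 b c.
  rewrite /trunc !asboolT//.
  rewrite -[Num.sqrt _]/(gnorm _ _).
  by apply: le_trans h1; exact: min_lip.
exists (mchart_at p); split; first exact: mdom_chart_at.
move=> e e0; set j := mchart_at p.
have cK : closed (mpoint i @` [set y : V | `|y - z| <= 3 / 4 * r]).
  apply: (compact_closed (@mcarrier_hausdorff _ _ M)).
  apply: continuous_compact; last exact: compact_norm_ball.
  apply: continuous_in_subspaceT => y; rewrite inE/= => yr; apply: mpoint_continuous.
  by apply: (gc_U H); have := gc_rho H; lra.
have pO : (~` (mpoint i @` [set y : V | `|y - z| <= 3 / 4 * r])) p.
  move=> [y /= yr yp]; have Uy : chart_range i y by apply: (gc_U H); have := gc_rho H; lra.
  apply: np; split; first by rewrite -yp; exact: mpoint_dom.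
  by rewrite -yp mpointK//; lra.
have Uj : chart_range j (mcoord j p) by exact: chart_rangeP (mdom_chart_at p).
have nO : \forall y \near mcoord j p, (~` (mpoint i @` [set y : V | `|y - z| <= 3 / 4 * r])) (mpoint j y).
  apply: (mpoint_continuous Uj); rewrite mcoordK; last exact: mdom_chart_at.
  by apply: near_open => //; exact: closed_openC.
have [d d0 hd] := (nbhs_normP _ _).1 nO.
exists d => // b c jb jc bd cd.
have far q : mdom j q -> `|mcoord j q - mcoord j p| < d -> trunc a q = cl * r / 4.
  move=> jq qd; apply: trunc_far => // -[iq qr]; apply: (hd _ qd).
  by exists (mcoord i q); [exact: ltW|rewrite !mcoordK].
by rewrite !far// subrr addr_ge0 ?sqrtr_ge0// mulr_ge0// ltW.
Qed.

Lemma trunc_le_dist a q : `|a - z| <= r / 2 -> trunc a q <= dist (mpoint i a) q.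
Proof.
move=> ar; have r0 := gc_r H.
have Ua : chart_range i a by apply: (gc_U H); have := gc_rho H; lra.
have t0 : trunc a (mpoint i a) = 0.
  rewrite /trunc asboolT ?glen_self//.
    by apply/min_idPl; rewrite !mulr_ge0 ?(ltW (gc_cl H)) ?(ltW r0).
  by split; [exact: mpoint_dom|rewrite mpointK//; lra].
apply: dist_ge; first by eexists; exact: gam_piecewise.
by move=> l /(piecewise_locally_lip (fun p => trunc_lip p ar)); rewrite t0 subr0.
Qed.

End Truncation.

Lemma geodesic_chart_shrink i z rho r cl cu ct X r' : 0 < r' -> r' <= r ->
  geodesic_chart i z rho r cl cu ct X -> geodesic_chart i z rho r' cl cu ct X.
Proof.
move=> r'0 r'r [h1 h2 h3 h4 h5 h6 h7 h8 h9 h10 h11 h12 h13].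
have s (a : V) : `|a - z| <= r' -> `|a - z| <= r by move=> /le_trans; apply.
split=> //; first exact: le_trans r'r h2.
- by move=> a b t /s ar /s; exact: h5.
- by move=> a b t /s ar /s; exact: h6.
- by move=> a b a' b' t /s ar /s br /s ar' /s; exact: h7.
- by move=> a b t t' /s ar /s; exact: h8.
- by move=> a m b th /s ar /s mr /s; exact: h9.
- by move=> a m b /s ar /s mr /s; exact: h10.
- by move=> a b /s ar /s; exact: h11.
- by move=> a b /s ar /s; exact: h12.
- move=> m e /s mr /(h13 _ _ mr)[d d0 hd]; exists d => // a b /s ar /s br; exact: hd.
Qed.

(** On the radius [r'] the geodesic lengths are at most [2 * |cu| * r' <= cl * r / 8], below the
    truncation level, so the truncated function is the length itself. The same function keeps points
    outside the chart away from the centre. *)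
Lemma good_chart i (z : V) : chart_range i z ->
  exists rho r cl cu ct X T, [/\ geodesic_chart i z rho r cl cu ct X, 0 < T,
    forall a b : V, `|a - z| <= r -> `|b - z| <= r ->
      glen (mpoint i a) (mpoint i b) = dist (mpoint i a) (mpoint i b) &
    forall q, ~ in_chart i z r q -> T <= dist (mpoint i z) q].
Proof.
move=> Uz; have [rho [r [cl [cu [ct [X H]]]]]] := geodesic_chart_exists Uz.
have r0 := gc_r H; have cl0 := gc_cl H.
pose r' := Num.min (r / 2) (cl * r / (16 * (`|cu| + 1))).
have C0 : 0 < 16 * (`|cu| + 1) by rewrite mulr_gt0// ltr_wpDl.
have r'0 : 0 < r' by rewrite lt_min !divr_gt0 ?mulr_gt0.
have r'2 : r' <= r / 2 by rewrite ge_min lexx.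
have r'r : r' <= r by lra.
have r'c : r' * (16 * (`|cu| + 1)) <= cl * r by rewrite -ler_pdivlMr// ge_min lexx orbT.
pose T := Num.min (cl * r') (cl * r / 4).
have T0 : 0 < T by rewrite lt_min !mulr_gt0.
have sr (a : V) : `|a - z| <= r' -> `|a - z| <= r by move=> /le_trans; apply.
exists rho, r', cl, cu, ct, X, T; split=> //.
- exact: geodesic_chart_shrink H.
- move=> a b ar br; apply/eqP; rewrite eq_le dist_le_glen// andbT.
  have Ub : chart_range i b by apply: (gc_U H); have := gc_rho H; have := sr _ br; lra.
  have ar2 : `|a - z| <= r / 2 by lra.
  apply: le_trans (trunc_le_dist H (mpoint i b) ar2).
  rewrite /trunc; case: asboolP => [_|]; last first.
    by case; split; [exact: mpoint_dom|rewrite mpointK//; lra].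
  rewrite le_min lexx/=; apply: le_trans (gc_upper H (sr _ ar) (sr _ br)) _.
  have ab : `|b - a| <= 2 * r' by exact: (ball_dist ar br).
  have h1 : cu * `|b - a| <= `|cu| * `|b - a| by rewrite ler_wpM2r// ler_norm.
  have h2 : `|cu| * `|b - a| <= `|cu| * (2 * r') by rewrite ler_wpM2l.
  have h3 : `|cu| * (2 * r') = r' * (`|cu| * 2) by ring.
  by move: r'c h1 h2 h3 r'0; move: (`|cu|) (cu * _) => c c' *; nra.
move=> q nq; have zz : `|z - z| <= r / 2 by rewrite subrr normr0 ltW// divr_gt0.
apply: le_trans (trunc_le_dist H q zz).
rewrite /trunc; case: asboolP => [[iq qr]|_]; last by rewrite ge_min lexx orbT.
rewrite le_min ge_min [in X in _ && X]ge_min lexx orbT andbT; apply/orP; left.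
have zr : `|z - z| <= r by lra.
have := gc_lower H zr (ltW qr); rewrite /llen mcoordK//; apply: le_trans.
by rewrite ler_pM2l// leNgt; apply/negP => h; apply: nq.
Qed.

End GoodCharts.

Lemma squeeze_continuous (R : realType) (W : normedModType R) (T : topologicalType)
    (f : T -> W) (g : T -> R) (s : T) :
  {for s, continuous g} -> g s = 0 -> (\forall s' \near s, `|f s' - f s| <= g s') ->
  {for s, continuous f}.
Proof.
move=> cg g0 h; apply/cvgrPdist_lt => e e0.
have h2 : \forall s' \near s, g s' < e.
  by apply: (cg _ (@lt_nbhsl R _ _ _)); rewrite g0.
by apply: filterS2 h h2 => s' h1 h3; rewrite distrC (le_lt_trans h1).
Qed.

Lemma continuous_dist0 (R : realType) (W : normedModType R) (T : topologicalType)
    (f : T -> W) (s : T) (k : R) :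
  {for s, continuous f} -> {for s, continuous (fun s' : T => k * `|f s' - f s|)}.
Proof.
by move=> cf; apply: cvgM; [exact: continuous_cst_at|exact: continuous_norm_sub].
Qed.

Lemma continuousD_at (R : realType) (V : normedModType R) (S : topologicalType) (f g : S -> V) (x : S) :
  {for x, continuous f} -> {for x, continuous g} -> {for x, continuous (fun s : S => f s + g s)}.
Proof. by move=> cf cg; exact: (cvgD cf cg). Qed.

Lemma near_norm_lt (R : realType) (W : normedModType R) (T : topologicalType)
    (f : T -> W) (s : T) (z : W) (r : R) :
  {for s, continuous f} -> `|f s - z| < r -> \forall s' \near s, `|f s' - z| < r.
Proof.
move=> cf h; have := @continuous_norm_sub R W T f z s cf.
by move=> /(_ _ (@lt_nbhsl R _ _ h)).
Qed.

(* The length of a path [p, m', d, q] obtained by cutting the corner at [m] of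
   the path [p, m, q]; [Q] is the distance from [m'] to [q]. *)
Lemma corner_cut (R : realType) (a tau e L Q B D : R) (th := e * a / (e * a + tau)) :
  0 < a -> 0 < tau -> 0 < e < 1 -> 0 <= L -> 0 <= Q -> 0 <= B -> 0 <= D ->
  Q <= e * L + B -> D <= (1 - e) * L + th * Q ->
  D ^+ 2 / a + ((1 - th) * Q) ^+ 2 / tau <= L ^+ 2 / a + B ^+ 2 / tau /\
  (D ^+ 2 / a + ((1 - th) * Q) ^+ 2 / tau = L ^+ 2 / a + B ^+ 2 / tau ->
   Q ^+ 2 = (e * L) ^+ 2 / th + B ^+ 2 / (1 - th)).
Proof.
move=> a0 t0 /andP[e0 e1] L0 Q0 B0 D0 hQ hD.
have ea0 : 0 < e * a by rewrite mulr_gt0.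
pose S := e * a + tau; have S0 : 0 < S by rewrite addr_gt0.
have th1 : 1 - th = tau / S by rewrite /th /S; field; rewrite gt_eqF.
have thS : th = e * a / S by [].
have th0 : 0 <= th by rewrite thS divr_ge0 ?ltW.
have ne : 1 - e != 0 by rewrite gt_eqF// subr_gt0.
(* Cauchy-Schwarz: (A + B)^2 <= A^2 / (1 - e) + B^2 / e *)
have k1 : D ^+ 2 <= (1 - e) * L ^+ 2 + (th * Q) ^+ 2 / e.
  apply: (@le_trans _ _ (((1 - e) * L + th * Q) ^+ 2)).
    have q1 : 0 <= (1 - e) * L by rewrite mulr_ge0//; lra.
    have q2 : 0 <= th * Q by rewrite mulr_ge0.
    by rewrite ler_pXn2r ?nnegrE//; apply: addr_ge0.
  rewrite -subr_ge0.
  have -> : (1 - e) * L ^+ 2 + (th * Q) ^+ 2 / e - ((1 - e) * L + th * Q) ^+ 2 =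
    (1 - e) / e * (e * L - th * Q) ^+ 2 by field; rewrite gt_eqF.
  by rewrite mulr_ge0 ?sqr_ge0// divr_ge0 ?subr_ge0 ?ltW.
have k2 : Q ^+ 2 / S <= e * L ^+ 2 / a + B ^+ 2 / tau.
  apply: (@le_trans _ _ ((e * L + B) ^+ 2 / S)).
    by rewrite ler_pM2r ?invr_gt0// ler_pXn2r ?nnegrE// addr_ge0 ?mulr_ge0// ltW.
  rewrite -subr_ge0.
  have -> : e * L ^+ 2 / a + B ^+ 2 / tau - (e * L + B) ^+ 2 / S =
     (L * tau - B * a) ^+ 2 * e / (a * tau * S).
    by rewrite /S; field; rewrite !gt_eqF.
  have q1 : 0 < a * tau * S by rewrite !mulr_gt0.
  by rewrite divr_ge0 ?(ltW q1)// mulr_ge0 ?sqr_ge0// ltW.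
have k3 : (th * Q) ^+ 2 / e / a + ((1 - th) * Q) ^+ 2 / tau = Q ^+ 2 / S.
  by rewrite th1 thS /S; field; rewrite !gt_eqF.
have k4 : D ^+ 2 / a <= ((1 - e) * L ^+ 2 + (th * Q) ^+ 2 / e) / a.
  by rewrite ler_pM2r// invr_gt0.
have k5 : ((1 - e) * L ^+ 2 + (th * Q) ^+ 2 / e) / a =
  L ^+ 2 / a - e * L ^+ 2 / a + (th * Q) ^+ 2 / e / a by field; rewrite !gt_eqF.
split; first by move: k2 k3 k4 k5; gn; lra.
move=> eq; have k6 : Q ^+ 2 / S = e * L ^+ 2 / a + B ^+ 2 / tau.
  by move: k2 k3 k4 k5 eq; gn; lra.
have : Q ^+ 2 = (e * L ^+ 2 / a + B ^+ 2 / tau) * S by rewrite -k6 divfK// gt_eqF.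
by move=> ->; rewrite th1 thS /S; field; rewrite !gt_eqF.
Qed.

(** * Shortening a broken geodesic at its corner *)

Section Birkhoff.
Variables (R : realType) (n : nat) (M : riemannianManifold R n).
Hypothesis UG : uniquely_geodesic M.
Local Notation V := 'rV[R]_n.
Variables (i : mchart M) (z : V) (rho r cl cu ct : R) (X : V -> V -> R -> V).
Hypothesis H : geodesic_chart i z rho r cl cu ct X.
Local Notation P := (mpoint i).

Lemma chart_mem (a : V) : `|a - z| <= r -> chart_range i a.
Proof. by move=> ar; apply: (gc_U H); exact: le_trans ar (gc_rho H). Qed.

Lemma X_continuous (T : topologicalType) (alpha beta : T -> V) (tau : T -> R) s :
  {for s, continuous alpha} -> {for s, continuous beta} -> {for s, continuous tau} ->
  `|alpha s - z| < r -> `|beta s - z| < r -> 0 <= tau s <= 1 ->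
  (\forall s' \near s, 0 <= tau s' <= 1) ->
  {for s, continuous (fun s => X (alpha s) (beta s) (tau s))}.
Proof.
move=> ca cb ctau ar br ts tn.
apply: (@squeeze_continuous R V T _ (fun s' => 27 * `|alpha s' - alpha s| + 27 * `|beta s' - beta s|
  + ct * `|tau s' - tau s|)).
- by do !(apply: continuousD_at; last exact: continuous_dist0); exact: continuous_dist0.
- by rewrite !subrr !normr0 !mulr0 !addr0.
have na := near_norm_lt ca ar; have nb := near_norm_lt cb br.
apply: filterS3 na nb tn => s' a1 b1 t1.
have h1 := gc_lip H (tau s') (ltW a1) (ltW b1) (ltW ar) (ltW br).
have h2 := gc_time H (ltW ar) (ltW br) t1 ts.
rewrite -(subrKA (X (alpha s) (beta s) (tau s'))) (le_trans (ler_normD _ _))//.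
by move: h1 h2; gn; lra.
Qed.

Lemma llen_diff (a b a' b' : V) : `|a - z| <= r -> `|b - z| <= r -> `|a' - z| <= r ->
  `|b' - z| <= r -> `|llen i a b - llen i a' b'| <= cu * `|a - a'| + cu * `|b - b'|.
Proof.
move=> ar br ar' br'.
have t1 := gc_tri H ar ar' br; have t2 := gc_tri H ar' br' br.
have t3 := gc_tri H ar' ar br'; have t4 := gc_tri H ar br br'.
have u1 := gc_upper H ar ar'; have u2 := gc_upper H br br'.
have u3 := gc_upper H ar' ar; have u4 := gc_upper H br' br.
rewrite (distrC a') in u1; rewrite (distrC b') in u2.
rewrite ler_norml; apply/andP; split.
  by move: (llen i a b) (llen i a' b') (llen i a a') (llen i a' a) (llen i b b') (llen i b' b)
   (llen i a b') (llen i a' b) t1 t2 t3 t4 u1 u2 u3 u4 => *; lra.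
by move: (llen i a b) (llen i a' b') (llen i a a') (llen i a' a) (llen i b b') (llen i b' b)
   (llen i a b') (llen i a' b) t1 t2 t3 t4 u1 u2 u3 u4 => *; lra.
Qed.

Lemma llen_continuous (T : topologicalType) (alpha beta : T -> V) s :
  {for s, continuous alpha} -> {for s, continuous beta} ->
  `|alpha s - z| < r -> `|beta s - z| < r ->
  {for s, continuous (fun s => llen i (alpha s) (beta s))}.
Proof.
move=> ca cb ar br.
apply: (@squeeze_continuous R R T _ (fun s' => cu * `|alpha s' - alpha s| + cu * `|beta s' - beta s|)).
- by apply: continuousD_at; exact: continuous_dist0.
- by rewrite !subrr !normr0 !mulr0 addr0.
have na := near_norm_lt ca ar; have nb := near_norm_lt cb br.
apply: filterS2 na nb => s' a1 b1; apply: llen_diff; exact: ltW.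
Qed.

Lemma X_self (a : V) (t : R) : `|a - z| <= r -> 0 <= t <= 1 -> X a a t = a.
Proof.
move=> ar t01; have := gc_gam H ar ar t01; rewrite gam_self// => E.
by rewrite -[RHS](mpointK (chart_mem ar)) E mpointK//; apply: (gc_U H); exact: (gc_in H).
Qed.

(** Comparison with the constant geodesic at [y]. *)
Lemma X_near (a b y : V) (t : R) : `|a - z| <= r -> `|b - z| <= r -> `|y - z| <= r ->
  0 <= t <= 1 -> `|X a b t - y| <= 27 * (`|a - y| + `|b - y|).
Proof. by move=> ar br yr t01; rewrite -{1}(X_self yr t01); exact: (gc_lip H). Qed.

(** Up to a factor 2, the energy of the broken geodesic that runs from [p] to the junction [x] in
    time [a] and on to [y] in time [tau]. *)
Definition corner (p : M) (a tau : R) (y x : V) : R :=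
  glen p (P x) ^+ 2 / a + llen i x y ^+ 2 / tau.

(** Birkhoff's shortening step. The corner is cut from the point reached at time [(1 - e) * a], and
    the new junction is the point at time [a] of the geodesic from there to [y]: [e * a] of its
    duration [e * a + tau] have then elapsed. *)
Definition shortcut (p : M) (a e : R) (y : V) (tau : R) (x : V) : V :=
  X (mcoord i (gam p (P x) (1 - e))) y (e * a / (e * a + tau)).

(** The triangle inequality between [m'], [x] and [y] holds in the chart, the one from [p] through
    [m'] to the new junction is a hypothesis. Equality puts [x] on the geodesic from [m'] to [y]; it
    overlaps the geodesic from [p] between [m'] and [x], and [gam_glue] makes one geodesic of
    both. *)
Lemma corner_shortcut (p : M) (a e tau : R) (y x : V) :
  0 < a -> 0 < tau -> 0 < e < 1 -> `|x - z| <= r -> `|y - z| <= r ->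
  in_chart i z r (gam p (P x) (1 - e)) ->
  glen p (P (shortcut p a e y tau x)) <= glen p (gam p (P x) (1 - e)) +
    glen (gam p (P x) (1 - e)) (P (shortcut p a e y tau x)) ->
  corner p a tau y (shortcut p a e y tau x) <= corner p a tau y x /\
  (corner p a tau y (shortcut p a e y tau x) = corner p a tau y x ->
   P x = gam p (P y) (a / (a + tau))).
Proof.
move=> a0 t0 /andP[e0 e1].
have ee : 0 <= 1 - e <= 1 by apply/andP; split; lra.
have u01 : 0 < 1 - e < 1 by apply/andP; split; lra.
move=> xr yr [im mr] tri.
set m' := gam p (P x) (1 - e) in im mr tri *.
set th := e * a / (e * a + tau).
have ea0 : 0 < e * a by rewrite mulr_gt0.
have th0 : 0 < th by rewrite divr_gt0// addr_gt0.
have th1 : th < 1 by rewrite ltr_pdivrMr ?addr_gt0// mul1r ltrDl.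
have th01 : 0 <= th <= 1 by rewrite !ltW.
have PD : P (shortcut p a e y tau x) = gam m' (P y) th.
  by rewrite /shortcut -/m' -/th -(gc_gam H (ltW mr) yr th01) mcoordK.
have Dl : llen i (shortcut p a e y tau x) y = (1 - th) * glen m' (P y).
  by rewrite /llen PD; exact: (glen_right UG).
have Dm : glen m' (P (shortcut p a e y tau x)) = th * glen m' (P y).
  by rewrite PD; exact: (glen_left UG).
have Lm : glen p m' = (1 - e) * glen p (P x) by exact: (glen_left UG p (P x) ee).
have mx : glen m' (P x) = e * glen p (P x).
  have := glen_right UG p (P x) ee; rewrite -/m' => ->; congr (_ * _); ring.
have tm := gc_tri H (ltW mr) xr yr; rewrite /llen mcoordK// mx in tm.
have := @corner_cut R a tau e (glen p (P x)) (glen m' (P y)) (llen i x y)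
  (glen p (P (shortcut p a e y tau x))) a0 t0.
rewrite -/th e0 e1 => /(_ isT (glen_ge0 _ _) (glen_ge0 _ _) (glen_ge0 _ _) (glen_ge0 _ _) tm).
rewrite -Lm -Dm => /(_ tri) [h1 h2].
rewrite /corner Dl; split=> // /h2 eq.
have X_eq : x = X (mcoord i m') y th.
  by apply: (gc_two H (ltW mr) xr yr); [rewrite th0 th1|rewrite /llen !mcoordK// mx].
have Px : P x = gam m' (P y) th by rewrite -PD /shortcut -/m' -/th -X_eq.
rewrite {1}(gam_glue UG u01 _ (erefl m') Px) ?th0//.
congr gam; rewrite /th; field.
have -> : (1 - e) * (e * a) + (1 - (1 - e)) * (e * a + tau) = e * (a + tau) by ring.
have at0 : 0 < a + tau by exact: addr_gt0.
have eat0 : 0 < e * a + tau by exact: addr_gt0.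
by rewrite !gt_eqF// mulr_gt0.
Qed.

End Birkhoff.

Lemma two_split (R : realType) (a tau A B : R) : 0 < a -> 0 < tau ->
  (A + B) ^+ 2 / (a + tau) <= A ^+ 2 / a + B ^+ 2 / tau.
Proof.
move=> a0 t0; rewrite -subr_ge0.
have at0 : 0 < a + tau by exact: addr_gt0.
have -> : A ^+ 2 / a + B ^+ 2 / tau - (A + B) ^+ 2 / (a + tau) =
  (A * tau - B * a) ^+ 2 / (a * tau * (a + tau)) by field; rewrite !gt_eqF.
by rewrite divr_ge0 ?sqr_ge0// !mulr_ge0 ?ltW.
Qed.

Lemma continuous_near (S T : topologicalType) (f g : S -> T) (x : S) :
  (\forall y \near x, f y = g y) -> {for x, continuous f} -> {for x, continuous g}.
Proof.
move=> ne cf; rewrite /prop_for /continuous_at -(nbhs_singleton ne).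
by apply: cvg_trans cf; apply: near_eq_cvg; exact: ne.
Qed.

Lemma small_prod (R : realType) (x u w : R) : 0 <= x -> 0 <= w -> u <= 2 * (w / (x + 1)) ->
  x * u <= 2 * w.
Proof.
move=> x0 w0 h; have x1 : 0 < x + 1 by lra.
apply: le_trans (ler_wpM2l x0 h) _.
have -> : x * (2 * (w / (x + 1))) = 2 * w * (x / (x + 1)) by field; rewrite gt_eqF.
by rewrite ler_piMr ?mulr_ge0// ler_pdivrMr// mul1r; lra.
Qed.

(** [k * D ^+ 2] is of higher order. As [r1] is bounded below by [rmin], taking square roots costs
    only a factor [1 + e] on a small [D]. *)
Lemma sqr_step (R : realType) (r1 r2 D k rmin e : R) : 0 < rmin -> rmin <= r1 -> 0 <= r2 ->
  0 <= D -> 0 <= e -> k * D <= 2 * rmin * e -> r2 ^+ 2 <= (r1 + D) ^+ 2 + k * D ^+ 2 ->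
  r2 <= r1 + (1 + e) * D.
Proof.
move=> m0 mr r20 D0 e0 kD h.
have r10 : 0 <= r1 by rewrite (le_trans _ mr)// ltW.
rewrite -(@ler_pXn2r _ 2) ?nnegrE ?addr_ge0 ?mulr_ge0 ?addr_ge0//.
apply: (le_trans h).
have h1 : k * D ^+ 2 <= 2 * rmin * e * D by rewrite expr2 mulrA ler_wpM2r.
have h2 : rmin * (e * D) <= (r1 + D) * (e * D).
  by rewrite ler_wpM2r ?mulr_ge0//; lra.
have -> : (r1 + (1 + e) * D) ^+ 2 = (r1 + D) ^+ 2 + 2 * ((r1 + D) * (e * D)) + (e * D) ^+ 2 by ring.
have h3 : 0 <= (e * D) ^+ 2 by exact: sqr_ge0.
have h4 : 2 * rmin * e * D = 2 * (rmin * (e * D)) by ring.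
move: h1 h2 h3; rewrite h4; move: (rmin * (e * D)) ((r1 + D) * (e * D)) ((e * D) ^+ 2) (k * D ^+ 2) ((r1 + D) ^+ 2) => *; lra.
Qed.

Lemma mid_energy (R : realType) (t b rho : R) : 0 < t -> 0 < b ->
  (t / (t + b) * rho) ^+ 2 / t + ((1 - t / (t + b)) * rho) ^+ 2 / b = rho ^+ 2 / (t + b).
Proof.
move=> t0 b0; have tb0 : 0 < t + b by exact: addr_gt0.
by field; rewrite !gt_eqF.
Qed.

(** The junction that is optimal for the first end is a competitor for the second, with a last piece
    longer by at most [D]. The outcome is the triangle inequality up to a multiple of [D ^+ 2], an
    error that disappears over a subdivision into short steps. *)
Lemma mid_bound (R : realType) (t b rho1 rho2 D l : R) : 0 < t -> 0 < b -> 0 <= l ->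
  l <= (1 - t / (t + b)) * rho1 + D ->
  rho2 ^+ 2 / (t + b) <= (t / (t + b) * rho1) ^+ 2 / t + l ^+ 2 / b ->
  rho2 ^+ 2 <= (rho1 + D) ^+ 2 + ((t + b) / b - 1) * D ^+ 2.
Proof.
move=> t0 b0 l0 hl h; have tb0 : 0 < t + b by exact: addr_gt0.
have h2 : l ^+ 2 / b <= ((1 - t / (t + b)) * rho1 + D) ^+ 2 / b.
  by rewrite ler_pM2r ?invr_gt0// ler_pXn2r ?nnegrE// (le_trans l0).
have h3 : rho2 ^+ 2 / (t + b) <=
    (t / (t + b) * rho1) ^+ 2 / t + ((1 - t / (t + b)) * rho1 + D) ^+ 2 / b.
  by apply: (le_trans h); rewrite lerD2l.
move: h3; rewrite ler_pdivrMr//.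
have -> // : ((t / (t + b) * rho1) ^+ 2 / t + ((1 - t / (t + b)) * rho1 + D) ^+ 2 / b) * (t + b) =
  (rho1 + D) ^+ 2 + ((t + b) / b - 1) * D ^+ 2.
by field; rewrite !gt_eqF.
Qed.

(** * The triangle inequality for lengths from [p], transported along a geodesic *)

Section Nice.
Variables (R : realType) (n : nat) (M : riemannianManifold R n).
Hypothesis UG : uniquely_geodesic M.
Local Notation V := 'rV[R]_n.
Implicit Types (p q m : M).

Lemma in_chart_near i (z : V) (s : R) q : in_chart i z s q ->
  \forall q' \near q, in_chart i z s q'.
Proof.
move=> [iq qs].
have h1 : \forall q' \near q, mdom i q' by exact: (near_open (@open_mdom _ _ _ _)).
have h2 := near_norm_lt (continuous_mcoord iq) qs.
by apply: filterS2 h1 h2.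
Qed.

Lemma in_chart_open i (z : V) (s : R) : open (in_chart i z s : set M).
Proof. by rewrite openE => q /in_chart_near. Qed.

Lemma gam_continuous p q (t : R) : 0 <= t <= 1 -> {for t, continuous (gam p q)}.
Proof. by move=> t01; have [] := geodesic_at_mem (gam_geodesic UG p q) t01. Qed.

Variable p : M.

(** What the continuation transports. The triangle inequality makes the shortening step decrease the
    energy; continuity of the geodesic in its end makes it a continuous map. *)
Definition nice q : Prop := exists2 O : set M, open O /\ O q &
  (forall a b, O a -> O b -> glen p b <= glen p a + glen a b) /\
  (forall (t : R) m, 0 <= t <= 1 -> O m -> {for m, continuous (fun m : M => gam p m t)}).

Section Chart.
Variables (i : mchart M) (z : V) (rho r cl cu ct : R) (X : V -> V -> R -> V).
Hypothesis H : geodesic_chart i z rho r cl cu ct X.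
Local Notation P := (mpoint i).

Lemma X_range (a b : V) (t : R) : `|a - z| <= r -> `|b - z| <= r -> chart_range i (X a b t).
Proof. by move=> ar br; apply: (gc_U H); exact: (gc_in H). Qed.

Lemma gam_X m m' (t : R) : in_chart i z r m -> in_chart i z r m' -> 0 <= t <= 1 ->
  gam m m' t = P (X (mcoord i m) (mcoord i m') t).
Proof.
by move=> [im mr] [im' mr'] t01; rewrite -(gc_gam H (ltW mr) (ltW mr') t01) !mcoordK.
Qed.

Lemma gam_chart_continuous (T : topologicalType) (f g : T -> M) (s : T) (t : R) :
  {for s, continuous f} -> {for s, continuous g} -> in_chart i z r (f s) ->
  in_chart i z r (g s) -> 0 <= t <= 1 -> {for s, continuous (fun s : T => gam (f s) (g s) t)}.
Proof.
move=> cf cg fr gr t01.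
have nf : \forall s' \near s, in_chart i z r (f s') := cf _ (in_chart_near fr).
have ng : \forall s' \near s, in_chart i z r (g s') := cg _ (in_chart_near gr).
apply: (@continuous_near _ _ (fun s => P (X (mcoord i (f s)) (mcoord i (g s)) t))).
  by apply: filterS2 nf ng => s' f1 g1; rewrite gam_X.
have [ifs fsr] := fr; have [igs gsr] := gr.
have c1 : {for s, continuous (fun s => mcoord i (f s))}.
  exact: (continuous_comp cf (continuous_mcoord ifs)).
have c2 : {for s, continuous (fun s => mcoord i (g s))}.
  exact: (continuous_comp cg (continuous_mcoord igs)).
have cX := @X_continuous R n M i z rho r cl cu ct X H T _ _ (fun=> t) s c1 c2
  (@continuous_cst_at T R t s) fsr gsr t01.
apply: (continuous_comp (cX _)); first by near=> s'.
by apply: mpoint_continuous; apply: X_range; exact: ltW.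
Unshelve. all: by end_near. Qed.

Lemma nice_chart q : in_chart i z r p -> in_chart i z r q -> nice q.
Proof.
move=> pr qr; exists (in_chart i z r); first by split => //; exact: in_chart_open.
split=> [a b [ia ar] [ib br]|t m t01 mr].
  have [ip pr'] := pr; have := gc_tri H (ltW pr') (ltW ar) (ltW br).
  by rewrite /llen !mcoordK.
apply: (@gam_chart_continuous M (fun=> p) id) => //; exact: continuous_cst_at.
Qed.

Section Step.
Variables (q : M) (t1 s : R).
Hypotheses (t10 : 0 < t1) (t1s : t1 < s) (s1 : s <= 1).
Local Notation c := (gam p q).
Hypothesis c_in : forall t, t1 <= t <= s -> in_chart i z r (c t).
Variables (O : set M).
Hypotheses (oO : open O) (Oc : O (c t1)).
Hypothesis O_tri : forall a b, O a -> O b -> glen p b <= glen p a + glen a b.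
Hypothesis O_cont : forall (t : R) m, 0 <= t <= 1 -> O m ->
  {for m, continuous (fun m : M => gam p m t)}.
Variable e : R.
Hypothesis e01 : 0 < e < 1.
Let x0 := mcoord i (c t1).

(** The junctions at which the shortening step is under control: [x] and the point where the cut
    begins both lie in the nice set [O] and in the chart. *)
Definition step_dom : set V := [set x | `|x - z| < r /\ O (P x) /\
  O (gam p (P x) (1 - e)) /\ in_chart i z r (gam p (P x) (1 - e))].
Local Notation N := step_dom.

Lemma step_e : 0 <= 1 - e <= 1.
Proof. by case/andP: e01 => ? ?; apply/andP; split; lra. Qed.

Lemma step_P_continuous (x : V) : `|x - z| < r -> {for x, continuous P}.
Proof. by move=> xr; apply: mpoint_continuous; apply: (chart_mem H); exact: ltW. Qed.

Lemma step_cut_continuous x : N x -> {for x, continuous (fun x => gam p (P x) (1 - e))}.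
Proof.
move=> [xr [Ox _]].
exact: (continuous_comp (step_P_continuous xr) (O_cont step_e Ox)).
Qed.

Lemma step_dom_open : open N.
Proof.
rewrite openE => x Nx; have [xr [Ox [Om mr]]] := Nx.
have n1 : \forall y \near x, `|y - z| < r by apply: near_norm_lt xr; exact: cvg_id.
have n2 : \forall y \near x, O (P y).
  by apply: (step_P_continuous xr); exact: near_open.
have cm := step_cut_continuous Nx.
have n3 : \forall y \near x, O (gam p (P y) (1 - e)) by apply: cm; exact: near_open.
have n4 : \forall y \near x, in_chart i z r (gam p (P y) (1 - e)).
  by apply: cm; exact: in_chart_near.
by apply: filterS (filterI n1 (filterI n2 (filterI n3 n4))) => y [? [? []]].
Qed.

Lemma step_glen_continuous x : N x -> {for x, continuous (fun x => glen p (P x))}.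
Proof.
move=> Nx; have [xr [Ox _]] := Nx.
apply: (@squeeze_continuous R R V _ (fun y => cu * `|y - x|)).
- exact: (@continuous_dist0 R V V id x cu (cvg_id)).
- by rewrite subrr normr0 mulr0.
have n1 : \forall y \near x, N y by exact: near_open step_dom_open Nx.
apply: filterS n1 => y [yr [Oy _]].
have h1 := O_tri Ox Oy; have h2 := O_tri Oy Ox.
have u := gc_upper H (ltW xr) (ltW yr); rewrite /llen in u.
rewrite (glen_sym UG (P y)) in h2.
rewrite ler_norml; apply/andP; split.
  by move: (glen p (P x)) (glen p (P y)) (glen (P x) (P y)) h1 h2 u => *; lra.
by move: (glen p (P x)) (glen p (P y)) (glen (P x) (P y)) h1 h2 u => *; lra.
Qed.

Lemma step_corner_jcont (y x : V) (tau : R) : N x -> `|y - z| < r -> 0 < tau ->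
  jcont (fun (yt : V * R) (x : V) => corner i p t1 yt.2 yt.1 x) (y, tau) x.
Proof.
move=> Nx yr tau0; have [xr _] := Nx.
have f1 : {for (x, (y, tau)), continuous (fun w : V * (V * R) => w.1)} by exact: cvg_fst.
have f2 : {for (x, (y, tau)), continuous (fun w : V * (V * R) => w.2)} by exact: cvg_snd.
have f3 : {for (x, (y, tau)), continuous (fun w : V * (V * R) => w.2.1)}.
  exact: (@continuous_comp _ (V * R)%type V (fun w : V * (V * R) => w.2) fst _ f2 cvg_fst).
have f4 : {for (x, (y, tau)), continuous (fun w : V * (V * R) => w.2.2)}.
  exact: (@continuous_comp _ (V * R)%type R (fun w : V * (V * R) => w.2) snd _ f2 cvg_snd).
have g1 : {for (x, (y, tau)), continuous (fun w : V * (V * R) => glen p (P w.1))}.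
  exact: (@continuous_comp _ V R (fun w : V * (V * R) => w.1) _ _ f1 (step_glen_continuous Nx)).
have g2 : {for (x, (y, tau)), continuous (fun w : V * (V * R) => llen i w.1 w.2.1)}.
  exact: (llen_continuous H f1 f3 xr yr).
rewrite /jcont /corner; apply: continuousD_at.
  apply: cvgM; last exact: continuous_cst_at.
  by rewrite expr2; under eq_fun do rewrite expr2; exact: cvgM.
apply: cvgM; last by apply: cvgV => //; rewrite gt_eqF.
by rewrite expr2; under eq_fun do rewrite expr2; exact: cvgM.
Qed.

Lemma step_shortcut_jcont (y x : V) (tau : R) : N x -> `|y - z| < r -> 0 < tau ->
  jcont (fun (yt : V * R) (x : V) => shortcut i X p t1 e yt.1 yt.2 x) (y, tau) x.
Proof.
move=> Nx yr tau0; have [xr [Ox [Om [im mr]]]] := Nx.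
have f1 : {for (x, (y, tau)), continuous (fun w : V * (V * R) => w.1)} by exact: cvg_fst.
have f2 : {for (x, (y, tau)), continuous (fun w : V * (V * R) => w.2)} by exact: cvg_snd.
have f3 : {for (x, (y, tau)), continuous (fun w : V * (V * R) => w.2.1)}.
  exact: (@continuous_comp _ (V * R)%type V (fun w : V * (V * R) => w.2) fst _ f2 cvg_fst).
have f4 : {for (x, (y, tau)), continuous (fun w : V * (V * R) => w.2.2)}.
  exact: (@continuous_comp _ (V * R)%type R (fun w : V * (V * R) => w.2) snd _ f2 cvg_snd).
have g1 : {for (x, (y, tau)), continuous (fun w : V * (V * R) => mcoord i (gam p (P w.1) (1 - e)))}.
  have h1 := @continuous_comp _ V M (fun w : V * (V * R) => w.1) _ (x, (y, tau)) f1
    (step_cut_continuous Nx).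
  exact: (continuous_comp h1 (continuous_mcoord im)).
have et0 : 0 < e * t1 by rewrite mulr_gt0//; case/andP: e01.
have g2 : {for (x, (y, tau)), continuous (fun w : V * (V * R) => e * t1 / (e * t1 + w.2.2))}.
  apply: cvgM; first exact: continuous_cst_at.
  apply: cvgV; first by rewrite gt_eqF// addr_gt0.
  have f5 := @continuousD_at R R _ (fun=> e * t1) (fun w : V * (V * R) => w.2.2)
    (x, (y, tau)) (@continuous_cst_at _ R (e * t1) _) f4.
  exact: f5.
have th (b : R) : 0 < b -> 0 <= e * t1 / (e * t1 + b) <= 1.
  move=> b0; have eb : 0 < e * t1 + b by exact: addr_gt0.
  by rewrite divr_ge0 ?(ltW et0) ?(ltW eb)//= ler_pdivrMr// mul1r lerDl ltW.
apply: (X_continuous H g1 f3 g2 mr yr); first exact: th.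
have n1 : \forall w \near (x, (y, tau)), 0 < w.2.2.
  exact: (f4 _ (@lt_nbhsr R _ _ tau0)).
by apply: filterS n1 => w; exact: th.
Qed.

Lemma step_dec (y x : V) (tau : R) : N x -> N (shortcut i X p t1 e y tau x) ->
  `|y - z| < r -> 0 < tau ->
  corner i p t1 tau y (shortcut i X p t1 e y tau x) <= corner i p t1 tau y x /\
  (corner i p t1 tau y (shortcut i X p t1 e y tau x) = corner i p t1 tau y x ->
   P x = gam p (P y) (t1 / (t1 + tau))).
Proof.
move=> [xr [Ox [Om mr]]] [_ [OD _]] yr tau0.
apply: (corner_shortcut UG H t10 tau0 e01 (ltW xr) (ltW yr) mr).
exact: O_tri.
Qed.

Hypothesis O_cut : O (c (t1 * (1 - e))).
Hypothesis cut_in : in_chart i z r (c (t1 * (1 - e))).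

Lemma step_01 (t : R) : t1 <= t <= s -> 0 <= t <= 1.
Proof. by move: t10 s1 => ? ? /andP[? ?]; apply/andP; split; lra. Qed.

Lemma step_t1 : t1 <= t1 <= s. Proof. by rewrite lexx ltW. Qed.

Lemma step_s : t1 <= s <= s. Proof. by rewrite lexx ltW. Qed.

Lemma step_Pc t : t1 <= t <= s -> P (mcoord i (c t)) = c t.
Proof. by move=> /c_in[ic _]; exact: mcoordK. Qed.

Lemma step_cut : gam p (P x0) (1 - e) = c (t1 * (1 - e)).
Proof.
rewrite step_Pc ?step_t1//.
have := gam_sub UG p q (zero_in01 R) (step_01 step_t1) step_e.
by rewrite gam0// add0r subr0.
Qed.

Lemma step_x0 : N x0.
Proof.
split; first by have [] := c_in step_t1.
by rewrite step_cut step_Pc ?step_t1.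
Qed.

Lemma step_gam t : t1 <= t <= s -> gam p (c t) (t1 / (t1 + (t - t1))) = c t1.
Proof.
move=> ts; have t0 : 0 < t by case/andP: ts => + _; exact: lt_le_trans.
have -> : t1 / (t1 + (t - t1)) = t1 / t by rewrite addrC subrK.
have h : 0 <= t1 / t <= 1.
  by case/andP: ts => ? _; rewrite divr_ge0 ?(ltW t10) ?(ltW t0)//= ler_pdivrMr// mul1r.
have := gam_sub UG p q (zero_in01 R) (step_01 ts) h.
by rewrite gam0// add0r subr0 [t * _]mulrC divfK ?gt_eqF.
Qed.

(** The broken geodesic through [x0] has no corner there, being [c] itself, so the cut runs along
    [c] and the junction does not move. *)
Lemma step_fix t : t1 < t <= s -> shortcut i X p t1 e (mcoord i (c t)) (t - t1) x0 = x0.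
Proof.
move=> /andP[tt ts]; have tts : t1 <= t <= s by rewrite ltW.
have [it tr] := c_in tts.
have et0 : 0 < e * t1 by rewrite mulr_gt0//; case/andP: e01.
have b0 : 0 < t - t1 by rewrite subr_gt0.
have eb : 0 < e * t1 + (t - t1) by exact: addr_gt0.
rewrite /shortcut step_cut; set th := e * t1 / _.
have th01 : 0 <= th <= 1.
  by rewrite divr_ge0 ?(ltW et0) ?(ltW eb)//= ler_pdivrMr// mul1r lerDl ltW.
have u01 : 0 <= t1 * (1 - e) <= 1.
  have /andP[h1 h2] := step_e; have /andP[h3 h4] := step_01 step_t1.
  by rewrite mulr_ge0//= mulr_ile1.
have E : P (X (mcoord i (c (t1 * (1 - e)))) (mcoord i (c t)) th) = c t1.
  rewrite -(gam_X cut_in (c_in tts) th01) (gam_sub UG p q u01 (step_01 tts) th01).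
  by congr gam; rewrite /th; field; rewrite gt_eqF.
rewrite /x0 -E mpointK//; apply: X_range; last exact: ltW.
by have [_ /ltW] := cut_in.
Qed.

Lemma step_near_c (Q : set M) (t : R) : 0 <= t <= 1 -> open Q -> Q (c t) -> \forall t' \near t, Q (c t').
Proof. move=> t01 oQ Qt; have h : {for t, continuous (gam p q)} by exact: gam_continuous.
exact: (h _ (near_open oQ Qt)). Qed.

(** As long as [c al] is still in [O], the triangle inequality is available up to the end of the
    broken geodesic, and with [two_split] it gives minimality directly. *)
Lemma step_start : exists2 al, t1 < al <= s &
  \forall x \near x0, corner i p t1 (al - t1) (mcoord i (c al)) x0
    <= corner i p t1 (al - t1) (mcoord i (c al)) x.
Proof.
have /nbhs_normP[d d0 hd] := step_near_c (step_01 step_t1) oO Oc.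
pose al := Num.min s (t1 + d / 2).
have t1al : t1 < al by rewrite lt_min t1s ltrDl divr_gt0.
have als : al <= s by rewrite ge_min lexx.
have Oal : O (c al).
  apply: hd; rewrite gtr0_norm ?subr_gt0//.
  have : al <= t1 + d / 2 by rewrite ge_min lexx orbT.
  by move=> h; rewrite ltrBlDl; apply: le_lt_trans h _; rewrite ltrD2l ltr_pdivrMr// ltr_pMr// ltr1n.
exists al; first by rewrite t1al.
have n1 : \forall x \near x0, N x by exact: near_open step_dom_open step_x0.
apply: filterS n1 => x [xr [Ox _]].
have tal : t1 <= al <= s by rewrite (ltW t1al).
have b0 : 0 < al - t1 by rewrite subr_gt0.
rewrite /corner /llen !step_Pc ?step_t1//.
apply: (@le_trans _ _ ((glen p (P x) + glen (P x) (c al)) ^+ 2 / (t1 + (al - t1)))); last exact: two_split.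
have ttri := O_tri Ox Oal.
have -> : glen p (c t1) = t1 * glen p q by exact: (glen_left UG p q (step_01 step_t1)).
rewrite (glen_sub UG p q (step_01 step_t1) (step_01 tal)) gtr0_norm//.
have -> : (t1 * glen p q) ^+ 2 / t1 + ((al - t1) * glen p q) ^+ 2 / (al - t1) =
   (al * glen p q) ^+ 2 / (t1 + (al - t1)).
  by move: (glen p q) => l; field; rewrite (addrC t1) subrK !gt_eqF//; exact: lt_trans t10 t1al.
have at0 : 0 < t1 + (al - t1) by exact: addr_gt0.
rewrite -(glen_left UG p q (step_01 tal)) ler_pM2r ?invr_gt0//.
by rewrite ler_pXn2r ?nnegrE ?addr_ge0 ?glen_ge0.
Qed.

(** The end of the broken geodesic moves along [c] from [al] to [s], where no triangle inequality is
    known yet, while the junction stays at [c t1]. The shortening step takes place near [c t1],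
    inside [O], and this is all that the continuation needs. *)
Lemma step_local_min : \forall x \near x0,
  corner i p t1 (s - t1) (mcoord i (c s)) x0 <= corner i p t1 (s - t1) (mcoord i (c s)) x.
Proof.
have [al /andP[t1al als] lm] := step_start.
have mem t : al <= t <= s -> t1 < t <= s /\ t1 <= t <= s.
  by move=> /andP[h1 h2]; rewrite h2 !andbT; split; [|apply: ltW]; exact: lt_le_trans t1al h1.
pose phi t := (mcoord i (c t), t - t1).
have cphi (t : R) : al <= t <= s -> {for t, continuous phi}.
  move=> /mem[_ ts]; have [it _] := c_in ts; apply: continuous_pair.
    have h : {for t, continuous (gam p q)} by apply: gam_continuous; exact: step_01.
    exact: (continuous_comp h (continuous_mcoord it)).
  by apply: continuousB_at; [exact: cvg_id|exact: continuous_cst_at].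
have tr t : al <= t <= s -> `|mcoord i (c t) - z| < r by move=> /mem[_ /c_in[]].
have b0 t : al <= t <= s -> 0 < t - t1 by move=> /mem[/andP[? _] _]; rewrite subr_gt0.
apply: (@local_min_continuation R n N (fun t x => corner i p t1 (t - t1) (mcoord i (c t)) x)
  (fun t x => shortcut i X p t1 e (mcoord i (c t)) (t - t1) x) x0 al s als step_dom_open step_x0) => //.
- move=> t x ts Nx.
  exact: (jcont_reparam (cphi t ts) (step_corner_jcont Nx (tr t ts) (b0 t ts))).
- move=> t x ts Nx.
  exact: (jcont_reparam (cphi t ts) (step_shortcut_jcont Nx (tr t ts) (b0 t ts))).
- by move=> t x ts Nx NDx; exact: (step_dec Nx NDx (tr t ts) (b0 t ts)).1.
- move=> t x ts Nx NDx eq; have [_ ts'] := mem t ts.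
  have := (step_dec Nx NDx (tr t ts) (b0 t ts)).2 eq.
  rewrite step_Pc// step_gam// => E; have [xr _] := Nx.
  by rewrite /x0 -E mpointK//; apply: (chart_mem H); exact: ltW.
by move=> t /mem[ts _]; exact: step_fix.
Qed.

Let y0 := mcoord i (c s).
Let b := s - t1.
Local Notation F := (fun y x : V => corner i p t1 b y x).
Local Notation D := (fun y x : V => shortcut i X p t1 e y b x).
Definition step_mid (y : V) : V := mcoord i (gam p (P y) (t1 / s)).

Lemma step_b0 : 0 < b. Proof. by rewrite subr_gt0. Qed.

Lemma step_y0 : `|y0 - z| < r. Proof. by have [] := c_in step_s. Qed.

Lemma step_jF y x : N x -> `|y - z| < r -> jcont F y x.
Proof.
move=> Nx yr; have c1 : {for y, continuous (fun y : V => (y, b))}.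
  by apply: continuous_pair; [exact: cvg_id|exact: continuous_cst_at].
exact: (jcont_reparam c1 (step_corner_jcont Nx yr step_b0)).
Qed.

Lemma step_jD y x : N x -> `|y - z| < r -> jcont D y x.
Proof.
move=> Nx yr; have c1 : {for y, continuous (fun y : V => (y, b))}.
  by apply: continuous_pair; [exact: cvg_id|exact: continuous_cst_at].
exact: (jcont_reparam c1 (step_shortcut_jcont Nx yr step_b0)).
Qed.

Lemma step_s_gam y x : N x -> N (D y x) -> `|y - z| < r -> F y x <= F y (D y x) ->
  P x = gam p (P y) (t1 / s).
Proof.
move=> Nx NDx yr h; have [h1 h2] := step_dec Nx NDx yr step_b0.
by rewrite h2 /b ?(addrC t1) ?subrK//; apply/eqP; rewrite eq_le h1 h.
Qed.

Lemma step_argmin : exists rc r2 : R, [/\ 0 < rc, 0 < r2,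
  forall x : V, `|x - x0| <= rc -> N x &
  forall y : V, `|y - y0| < r2 -> [/\ `|y - z| < r, `|step_mid y - x0| <= rc,
    P (step_mid y) = gam p (P y) (t1 / s) &
    forall x : V, `|x - x0| <= rc -> x != step_mid y -> F y (step_mid y) < F y x]].
Proof.
have Nx0 := step_x0; have yr := step_y0.
have [R0 R00 hR0] := open_normP step_dom_open Nx0.
have jD0 := step_jD Nx0 yr.
have ts : t1 < s <= s by rewrite t1s lexx.
have D0 : D y0 x0 = x0 := step_fix ts.
have nb (d : R) : 0 < d -> nbhs (D y0 x0) [set y : V | `|y - x0| < d].
  by move=> d0; apply/nbhs_ballP; exists d => //= y; rewrite -ball_normE/= D0 distrC.
have [d1 d10 near1] := jcont_near jD0 (nb _ R00).
pose R1 := Num.min (R0 / 2) (d1 / 2).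
have R10 : 0 < R1 by rewrite lt_min !divr_gt0.
have R1R0 : R1 < R0 by rewrite gt_min ltr_pdivrMr// ltr_pMr// ltr1n.
have R1d1 : R1 < d1 by rewrite gt_min orbC ltr_pdivrMr// ltr_pMr// ltr1n.
have BN (x : V) : `|x - x0| <= R1 -> N x by move=> xr; apply: hR0; exact: le_lt_trans xr R1R0.
have DN (x : V) : `|x - x0| <= R1 -> N (D y0 x).
  by move=> xr; apply: hR0; apply: (nbhs_singleton near1); exact: le_lt_trans xr R1d1.
have strict (x : V) : `|x - x0| <= R1 -> F y0 (D y0 x) = F y0 x -> x = x0.
  move=> xr h; have Nx := BN _ xr.
  have := step_s_gam Nx (DN _ xr) yr; rewrite h lexx => /(_ isT).
  have := step_gam step_s; rewrite (addrC t1) subrK step_Pc ?step_s// => -> E.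
  by rewrite /x0 -E mpointK//; apply: (chart_mem H); have [/ltW] := Nx.
have [rc [rc0 rcR1 hF]] := @local_min_strict R n N (F y0) (D y0) x0 R1 R10
  (fun x Nx => jcont_at (step_jD Nx yr)) BN
  (fun x xr => (step_dec (BN _ xr) (DN _ xr) yr step_b0).1) strict D0 R1 R10 (lexx _) step_local_min.
have BNc (x : V) : `|x - x0| <= rc -> N x by move=> /le_trans /(_ rcR1) /BN.
have [d2 d20 near2] := jcont_near jD0 (nb _ rc0).
pose r1 := Num.min rc (d2 / 2).
have r10 : 0 < r1 by rewrite lt_min rc0 divr_gt0.
have r1rc : r1 <= rc by rewrite ge_min lexx.
have r1d2 : r1 < d2 by rewrite gt_min orbC ltr_pdivrMr// ltr_pMr// ltr1n.
have near3 := @stable_minimizer R n _ F x0 r1 rc y0 r10 r1rc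
  (fun x xr => step_jF (BNc _ xr) yr)
  (fun x xA => hF x (annulus_neq r10 (andP xA).1) (andP xA).2).
have near4 : \forall y \near y0, `|y - z| < r by exact: (@near_norm_lt R V V id y0 z r cvg_id yr).
have [s2 s20 hs2] := (nbhs_normP _ _).1 near2.
have [s3 s30 hs3] := (nbhs_normP _ _).1 near3.
have [s4 s40 hs4] := (nbhs_normP _ _).1 near4.
exists rc, (Num.min s2 (Num.min s3 s4)); split=> //; first by rewrite !lt_min s20 s30.
move=> y; rewrite !lt_min => /and3P[/hs2 n2 /hs3 n3 /hs4 yzr].
have [x xr1 hx] := n3 (fun x xr => jcont_at (step_jF (BNc _ xr) yzr)).
have uniq (x' : V) : `|x' - x0| < r1 -> F y x' = F y x -> P x' = gam p (P y) (t1 / s).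
  move=> x'r1 eq; have Dr : `|D y x' - x0| <= rc by apply/ltW/n2/(lt_trans x'r1).
  apply: step_s_gam => //; [apply: BNc; exact: ltW (lt_le_trans x'r1 r1rc)|exact: BNc|].
  by rewrite eq; apply: (hx _ Dr).1.
have coordK (x' : V) : `|x' - x0| <= rc -> P x' = gam p (P y) (t1 / s) -> x' = step_mid y.
  move=> x'r E; rewrite /step_mid -E mpointK//; apply: (chart_mem H).
  by have [/ltW] := BNc _ x'r.
have xrc : `|x - x0| <= rc := ltW (lt_le_trans xr1 r1rc).
have Px := uniq x xr1 erefl; have xE := coordK _ xrc Px.
split=> //; first by rewrite -xE.
- by rewrite -xE.
move=> x' x'r ne; rewrite -xE lt_neqAle (hx _ x'r).1 andbT.
apply: contra_neq ne => /esym eq; apply: coordK => //; apply: uniq => //.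
exact: (hx _ x'r).2.
Qed.

Variable rmin : R.
Hypothesis rmin0 : 0 < rmin.
Hypothesis rmin_le : forall m, in_chart i z r m -> rmin <= glen p m.

Lemma step_mu : 0 < t1 / s < 1.
Proof.
have s0 : 0 < s := lt_trans t10 t1s.
by rewrite divr_gt0//= ltr_pdivrMr// mul1r.
Qed.

(** Continuity: [step_mid y] is the unique minimizer, so it varies continuously with [y]; before it
    the continuity in [O] applies, after it the one in the chart. Triangle inequality: [mid_bound]
    gives it up to second order, and it is accumulated along the geodesic from [a1] to [a2]. *)
Lemma step_nice : nice (c s).
Proof.
have [rc [r2 [rc0 r20 BN hA]]] := step_argmin.
have /andP[mu0 mu1] := step_mu; set mu := t1 / s in mu0 mu1.
have mu01 : 0 <= mu <= 1 by rewrite !ltW.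
(* [27 * (r3 + r3) < r2]: by [X_near], geodesics between points of the ball of radius [r3] stay in
   the one of radius [r2]. *)
pose r3 := r2 / 60.
have r30 : 0 < r3 by rewrite divr_gt0.
have r32 : r3 <= r2 by rewrite ler_pdivrMr// ler_peMr ?(ltW r20)// ler1n.
have inr (y : V) : `|y - y0| < r2 -> in_chart i z r (P y) /\ mcoord i (P y) = y.
  move=> yr; have [yz _ _ _] := hA y yr.
  have Uy : chart_range i y by apply: (chart_mem H); exact: ltW.
  by split; [split; [exact: mpoint_dom|rewrite mpointK]|rewrite mpointK].
have mid_cont (y : V) : `|y - y0| < r2 -> {for y, continuous step_mid}.
  move=> yr; have [yz _ _ hmin] := hA y yr.
  have near_y : \forall y' \near y, `|y' - y0| < r2.
    exact: (@near_norm_lt R V V id y y0 r2 cvg_id yr).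
  apply: (@argmin_continuous R n V F step_mid x0 rc y) => //.
  - by move=> x xr; apply: step_jF => //; exact: BN.
  - by apply: filterS near_y => y' /hA[].
  apply: filterS near_y => y' yr'; have [_ h1 _ hm'] := hA y' yr'; have [_ h2 _ _] := hA y yr.
  by have [->|ne] := eqVneq (step_mid y) (step_mid y'); [exact: lexx|apply/ltW/hm'].
exists (in_chart i y0 r3).
  split; first exact: in_chart_open.
  by have [ic _] := c_in step_s; split => //; rewrite subrr normr0.
split=> [a1 a2 [ia ar] [ib br]|t m t01 [im mr]]; last first.
  set y := mcoord i m; have yr : `|y - y0| < r2 := lt_le_trans mr r32.
  have [yz midr Pmid _] := hA y yr.
  have [Nr [ON _]] := BN _ midr.
  have mid_in : in_chart i z r (P (step_mid y)).
    have Um : chart_range i (step_mid y) by apply: (chart_mem H); exact: ltW.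
    by split; [exact: mpoint_dom|rewrite mpointK].
  have Py : P y = m by rewrite /y mcoordK.
  have near_m : \forall m' \near m, in_chart i y0 r3 m' by apply: in_chart_near.
  have cmid : {for m, continuous (fun m : M => gam p m mu)}.
    apply: (@continuous_near _ _ (fun m => P (step_mid (mcoord i m)))).
      apply: filterS near_m => m' [im' mr'].
      by have [_ _ -> _] := hA (mcoord i m') (lt_le_trans mr' r32); rewrite mcoordK.
    have h1 := continuous_comp (continuous_mcoord im) (mid_cont y yr).
    exact: (continuous_comp h1 (step_P_continuous Nr)).
  have gm : gam p m mu = P (step_mid y) by rewrite Pmid Py.
  have /andP[t0 t1'] := t01.
  have [tmu|mut] := leP t mu.
    have h : 0 <= t / mu <= 1 by rewrite divr_ge0 ?(ltW mu0)//= ler_pdivrMr// mul1r.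
    apply: (@continuous_near _ _ (fun m => gam p (gam p m mu) (t / mu))).
      near=> m'; have := gam_sub UG p m' (zero_in01 R) mu01 h.
      by rewrite gam0// add0r subr0 [mu * _]mulrC divfK ?gt_eqF.
    have h2 : {for gam p m mu, continuous (fun m : M => gam p m (t / mu))}.
      by apply: O_cont => //; rewrite gm.
    exact: (continuous_comp cmid h2).
  have mu1' : 0 < 1 - mu by rewrite subr_gt0.
  have h : 0 <= (t - mu) / (1 - mu) <= 1.
    by rewrite divr_ge0 ?subr_ge0 ?(ltW mu1') ?(ltW mut) ?(ltW mu1)//= ler_pdivrMr// mul1r lerB.
  apply: (@continuous_near _ _ (fun m => gam (gam p m mu) m ((t - mu) / (1 - mu)))).
    near=> m'; have := gam_sub UG p m' mu01 (one_in01 R) h.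
    by rewrite gam1// [(1 - mu) * _]mulrC divfK ?gt_eqF// [mu + _]addrC subrK.
  apply: (@gam_chart_continuous M (fun m => gam p m mu) id m _ cmid cvg_id) => //.
    by rewrite gm.
have s0 : 0 < s := lt_trans t10 t1s.
have sE : s = t1 + b by rewrite /b addrC subrK.
have key (y1 y2 : V) : `|y1 - y0| < r2 -> `|y2 - y0| < r2 ->
    glen p (P y2) ^+ 2 <= (glen p (P y1) + llen i y1 y2) ^+ 2 + (s / b - 1) * llen i y1 y2 ^+ 2.
  move=> yr1 yr2; have [yz1 mr1 Pm1 _] := hA y1 yr1; have [yz2 mr2 Pm2 hm2] := hA y2 yr2.
  have [Nr1 _] := BN _ mr1.
  have le2 : F y2 (step_mid y2) <= F y2 (step_mid y1).
    by have [->|ne] := eqVneq (step_mid y1) (step_mid y2); [exact: lexx|apply/ltW/hm2].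
  have tri := gc_tri H (ltW Nr1) (ltW yz1) (ltW yz2).
  rewrite {2}/llen Pm1 (glen_right UG p (P y1) mu01) in tri.
  move: le2; rewrite /corner {1}/llen Pm1 Pm2 !(glen_left UG p _ mu01) (glen_right UG p (P y2) mu01).
  rewrite /mu sE mid_energy ?step_b0// => le2.
  apply: (@mid_bound R t1 b _ _ _ (llen i (step_mid y1) y2)) => //; first exact: step_b0.
    exact: glen_ge0.
  by rewrite -sE.
set ya := mcoord i a1 in ar; set yb := mcoord i a2 in br.
have [az _ _ _] := hA ya (lt_le_trans ar r32); have [bz _ _ _] := hA yb (lt_le_trans br r32).
have gX (t : R) : 0 <= t <= 1 -> gam a1 a2 t = P (X ya yb t).
  by move=> t01; apply: gam_X.
have Xr (t : R) : 0 <= t <= 1 -> `|X ya yb t - y0| < r2.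
  move=> t01; have := X_near UG H (ltW az) (ltW bz) (ltW step_y0) t01.
  by move: ar br r20; rewrite /r3; gn; lra.
pose L := glen a1 a2; have L0 : 0 <= L by exact: glen_ge0.
pose k := s / b - 1.
have k0 : 0 <= k by rewrite /k subr_ge0 ler_pdivlMr ?step_b0// mul1r /b gerBl ltW.
(* In a short enough time step the quadratic error of [key] is a fraction [ep] of the length
   covered. *)
have E (ep : R) : 0 < ep -> glen p a2 <= glen p a1 + (1 + ep) * L.
  move=> ep0.
  have := @local_propagation R (fun t => glen p (gam a1 a2 t) <= glen p a1 + (1 + ep) * (t * L)) 0 1 ler01.
  rewrite gam0// gam1// mul0r mulr0 addr0 mul1r lexx => /(_ isT); apply => t t01.
  have kL0 : 0 < k * L + 1 by rewrite ltr_wpDl// mulr_ge0.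
  exists (rmin * ep / (k * L + 1)); first by rewrite divr_gt0// mulr_gt0.
  move=> u1 u2 u101 u201 hu1 hu2 u12 IH.
  have D : llen i (X ya yb u1) (X ya yb u2) = (u2 - u1) * L.
    by rewrite /llen -!gX// glen_sub// ger0_norm// subr_ge0.
  have := key _ _ (Xr _ u101) (Xr _ u201); rewrite -!gX// D => h.
  have u0 : 0 <= u2 - u1 by rewrite subr_ge0.
  have := @sqr_step R (glen p (gam a1 a2 u1)) (glen p (gam a1 a2 u2)) ((u2 - u1) * L) k rmin ep
    rmin0 _ (glen_ge0 _ _) (mulr_ge0 u0 L0) (ltW ep0) _ h.
  case/(_ _ _)/Wrap => [||h2].
  - by apply: rmin_le; rewrite gX//; exact: (inr _ (Xr _ u101)).1.
  - have hu : u2 - u1 <= 2 * (rmin * ep / (k * L + 1)).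
      by move: hu1 hu2; rewrite !ltr_norml => /andP[? ?] /andP[? ?]; lra.
    have -> : k * ((u2 - u1) * L) = k * L * (u2 - u1) by ring.
    rewrite -[2 * rmin * ep]mulrA.
    exact: (small_prod (mulr_ge0 k0 L0) (mulr_ge0 (ltW rmin0) (ltW ep0)) hu).
  apply: (le_trans h2).
  have -> : glen p a1 + (1 + ep) * (u2 * L) = glen p a1 + (1 + ep) * (u1 * L) + (1 + ep) * ((u2 - u1) * L) by ring.
  by rewrite lerD2r.
apply/ler_addgt0Pr => ep ep0.
have L1 : 0 < L + 1 by lra.
have h := E (ep / (L + 1)) (divr_gt0 ep0 L1).
apply: (le_trans h); rewrite mulrDl mul1r addrA lerD2l mulrAC ler_pdivrMr//.
by rewrite ler_pM2l//; lra.
Unshelve. all: by end_near. Qed.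

End Step.
End Chart.

(** Around each [c t] there are two cases. Either [p] is in the chart, and everything is local; or
    [p] is at distance at least [T] from [c t], and on a smaller chart the lengths from [p] are at
    least [T / 2], the lower bound required for the square roots in [step_nice]. *)
Lemma nice_all q : nice q.
Proof.
rewrite -(gam1 UG p q); apply: (@local_propagation R (fun t => nice (gam p q t)) 0 1 ler01).
  rewrite gam0//; have it := mdom_chart_at p.
  have [rho [r [cl [cu [ct [X [T [H _ _ _]]]]]]]] := good_chart UG (chart_rangeP it).
  have pr : in_chart (mchart_at p) (mcoord (mchart_at p) p) r p.
    by split=> //; rewrite subrr normr0 (gc_r H).
  exact: (nice_chart H pr pr).
move=> t t01; set c := gam p q.
have it := mdom_chart_at (c t); set i := mchart_at (c t) in it.
have Uz := chart_rangeP it; set z := mcoord i (c t) in Uz.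
have [rho [r [cl [cu [ct [X [T [H T0 _ far]]]]]]]] := good_chart UG Uz.
have Pz : mpoint i z = c t by rewrite mcoordK.
have cc : {for t, continuous c} by exact: gam_continuous.
have [pr|np] := pselect (in_chart i z r p).
  have cin : in_chart i z r (c t) by split=> //; rewrite subrr normr0 (gc_r H).
  have /nbhs_normP[d d0 hd] : \forall s \near t, in_chart i z r (c s) := cc _ (in_chart_near cin).
  by exists d => // t1 s _ _ _ sd _ _; apply: (nice_chart H pr); exact: hd.
have hT := far p np; rewrite Pz in hT.
pose r' := Num.min r (T / (2 * (`|cu| + 1))).
have C0 : 0 < 2 * (`|cu| + 1) by rewrite mulr_gt0// ltr_wpDl.
have r'0 : 0 < r' by rewrite lt_min (gc_r H) divr_gt0.
have r'r : r' <= r by rewrite ge_min lexx.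
have r'T : r' * (2 * (`|cu| + 1)) <= T by rewrite -ler_pdivlMr// ge_min lexx orbT.
have H' := geodesic_chart_shrink r'0 r'r H.
have zr : `|z - z| <= r' by rewrite subrr normr0 ltW.
have rmin_le m : in_chart i z r' m -> T / 2 <= glen p m.
  move=> [im mr]; have := gc_upper H' zr (ltW mr); rewrite /llen Pz mcoordK// => h1.
  have h2 := dist_le_glen UG (c t) m; have h3 := dist_le_glen UG m p.
  have h4 := UG_triangle UG (c t) m p.
  have h5 : cu * `|mcoord i m - z| <= `|cu| * r'.
    by rewrite (le_trans (ler_wpM2r _ (ler_norm cu)))// ler_wpM2l// ltW.
  rewrite (glen_sym UG p m).
  move: r'T h1 h2 h3 h4 h5 r'0 hT.
  move: (dist _ _) (dist _ _) (dist _ _) (glen _ _) (glen _ _) (cu * _) (`|cu|) => d1 d2 d3 g1 g2 x y.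
  have -> : r' * (2 * (y + 1)) = 2 * (y * r') + 2 * r' by ring.
  move: (y * r') => w; lra.
have cin : in_chart i z r' (c t) by split=> //; rewrite subrr normr0.
have /nbhs_normP[d d0 hd] : \forall s \near t, in_chart i z r' (c s) := cc _ (in_chart_near cin).
exists d => // t1 s t101 s01 t1d sd; rewrite le_eqVlt => /predU1P[<-//|t1s] [W [oO Oc] [triO contO]].
have t10 : 0 < t1.
  case/andP: t101 => t10 _; rewrite lt_neqAle t10 andbT; apply/negP => /eqP E.
  apply: np; have [ip pr] := hd _ t1d; rewrite -E /c gam0// in ip pr.
  by split=> //; exact: lt_le_trans pr r'r.
have s1 : s <= 1 by case/andP: s01.
have c_in u : t1 <= u <= s -> in_chart i z r' (c u).
  by move=> us; apply: hd; exact: dist_between t1d sd us.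
have cc1 : {for t1, continuous c} by exact: gam_continuous.
have /nbhs_normP[d1 d10 hd1] : \forall u \near t1, W (c u) := cc1 _ (near_open oO Oc).
have /nbhs_normP[d2 d20 hd2] : \forall u \near t1, in_chart i z r' (c u) := cc1 _ (in_chart_near (hd _ t1d)).
(* So small that the point where the cut begins, [c (t1 * (1 - e))], is still in [W] and in the
   chart. *)
pose e := Num.min (2^-1 : R) (Num.min (d1 / 2) (d2 / 2)).
have e0 : 0 < e by rewrite !lt_min invr_gt0 ltr0n !divr_gt0.
have e1 : e <= 2^-1 by rewrite ge_min lexx.
have ed1 : e <= d1 / 2 by rewrite !ge_min lexx !orbT.
have ed2 : e <= d2 / 2 by rewrite !ge_min lexx !orbT.
have te : `|t1 * (1 - e) - t1| <= e.
  have -> : t1 * (1 - e) - t1 = - (t1 * e) by ring.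
  rewrite normrN ger0_norm ?mulr_ge0 ?(ltW e0) ?(ltW t10)//.
  by rewrite ler_piMl ?(ltW e0)//; case/andP: t101.
apply: (@step_nice i z rho r' cl cu ct X H' q t1 s t10 t1s s1 c_in W oO Oc triO contO e _ _ _
  (T / 2) _ rmin_le).
- by clearbody e; apply/andP; split; lra.
- by apply: hd1; apply: (le_lt_trans te); clearbody e; lra.
- by apply: hd2; apply: (le_lt_trans te); clearbody e; lra.
- by rewrite divr_gt0.
Qed.

Lemma glen_locally_lip q : locally_lip (glen p) q.
Proof.
have iq := mdom_chart_at q; set i := mchart_at q in iq.
have Uz := chart_rangeP iq; set z := mcoord i q in Uz.
have [rho [r [cl [cu [ct [X [T [H T0 _ far]]]]]]]] := good_chart UG Uz.
have [W [oO Oq] [triO _]] := nice_all q.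
exists i; split=> // e e0.
have zr : `|z - z| <= r by rewrite subrr normr0 ltW// (gc_r H).
have [d1 d10 h1] := gc_inf H zr e0.
have nO : \forall y \near z, W (mpoint i y).
  by apply: (mpoint_continuous Uz); rewrite mcoordK//; exact: near_open.
have [d2 d20 h2] := (nbhs_normP _ _).1 nO.
exists (Num.min r (Num.min d1 d2)); first by rewrite !lt_min (gc_r H) d10.
move=> a b ia ib; rewrite !lt_min => /and3P[ar a1 a2] /and3P[br b1 b2].
have := h1 _ _ (ltW ar) (ltW br) a1 b1; rewrite /llen !mcoordK//.
have Oa := h2 _ a2; have Ob := h2 _ b2; rewrite !mcoordK// in Oa Ob.
by apply: le_trans; rewrite lerBlDl; exact: triO.
Qed.

End Nice.

Section DistGlen.
Variables (R : realType) (n : nat) (M : riemannianManifold R n).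
Hypothesis UG : uniquely_geodesic M.

(** [glen p] vanishes at [p] and is infinitesimally 1-Lipschitz on all of [M], so no curve from [p]
    to [q] is shorter than [glen p q]. *)
Theorem dist_glen (p q : M) : dist p q = glen p q.
Proof.
apply/eqP; rewrite eq_le dist_le_glen//=.
apply: dist_ge; first by eexists; exact: gam_piecewise.
move=> l /(piecewise_locally_lip (glen_locally_lip UG p)).
by rewrite glen_self// subr0.
Qed.

Lemma dist_sym (p q : M) : dist p q = dist q p.
Proof. by rewrite !dist_glen glen_sym. Qed.

End DistGlen.

(** * Second variation *)

Lemma peano (R : realType) (n : nat) (f df : R -> 'rV[R]_n) (d2 : 'rV[R]_n) :
  (\forall s \near (0 : R), is_derive (s : R) 1 f (df s)) -> is_derive (0 : R) 1 df d2 ->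
  forall e : R, 0 < e -> exists2 d : R, 0 < d & forall s : R, `|s| < d ->
    `|f s - (f 0 + s *: df 0 + (s ^+ 2 / 2) *: d2)| <= e * s ^+ 2.
Proof.
move=> /nbhs_normP[d1 d10 h1] [dd dE] e e0.
have := dd; rewrite /derivable => /cvg_ex[l hl].
have lE : l = d2 by rewrite -dE /derive; apply/esym/cvg_lim.
move/cvgrPdist_lt: hl; rewrite lE => /(_ _ e0)/nbhs_normP[d2' /= d20 h2].
have h2' (s : R) : `|s| < d2' -> `|df s - df 0 - s *: d2| <= e * `|s|.
  move=> sd; have [->|s0] := eqVneq s 0; first by rewrite scale0r subrr subr0 !normr0 mulr0.
  have := h2 s; rewrite subr0 => /(_ sd s0) /ltW.
  have -> : s%:A + 0 = s by rewrite addr0 [_%:A]mulr1.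
  move=> h.
  have -> : df s - df 0 - s *: d2 = - (s *: (d2 - s^-1 *: (df s - df 0))).
    by rewrite scalerBr scalerA mulfV// scale1r opprB.
  by rewrite normrN normrZ mulrC ler_wpM2r.
exists (Num.min d1 d2') => [|s]; first by rewrite lt_min d10.
rewrite lt_min => /andP[s1 s2].
pose F (r : R) := f r - (r *: df 0 + (r ^+ 2 / 2) *: d2).
have dF (r : R) : - `|s| <= r <= `|s| -> is_derive r 1 F (df r - df 0 - r *: d2).
  move=> rs; have rd : `|r - 0| < d1 by rewrite subr0 (le_lt_trans _ s1)// ler_norml.
  have q1 := line_is_derive 0 (df 0) r.
  have q2 : is_derive r 1 (fun r : R => (r ^+ 2 / 2) *: d2) (r *: d2).
    apply/is_derive_mxP => i j; rewrite !mxE.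
    have := is_derive_mul (is_derive_mul (is_derive_id1 r) (is_derive_id1 r))
      (is_derive_cst (2^-1 * d2 i j) r 1).
    move=> h; apply: (@is_derive_near R R (fun s : R => s * s * (2^-1 * d2 i j))).
      by near=> t; rewrite !mxE expr2 !mulrA.
    by move: h; apply: is_derive_eqr; rewrite /cst mulr0 addr0 mul1r mulr1; field.
  have := is_deriveB (h1 r rd) (is_deriveD q1 q2).
  move=> h; apply: (@is_derive_near R _ _ F _ _ _ (is_derive_eqr _ h)); last first.
    by rewrite opprD addrA.
  by near=> t; rewrite /F /= -[LHS]/(f t - ((0 + t *: df 0) + (t ^+ 2 / 2) *: d2)) add0r.
have := @derive_norm_le2 R 1 n F (fun r => df r - df 0 - r *: d2) (- `|s|) `|s| (e * `|s|) 0 s dF.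
case/(_ _ _ _)/Wrap => [r rs|||].
- have rn : `|r| <= `|s| by rewrite ler_norml.
  by rewrite (le_trans (h2' r (le_lt_trans rn s2)))// ler_pM2l.
- by rewrite oppr_le0 normr_ge0.
- by rewrite -ler_norml.
have -> : e * `|s| * `|s - 0| = e * s ^+ 2 by rewrite subr0 -mulrA -expr2 real_normK ?num_real.
have -> : F s - F 0 = f s - (f 0 + s *: df 0 + (s ^+ 2 / 2) *: d2) => //.
rewrite /F scale0r expr0n/= mul0r scale0r addr0 subr0.
by rewrite -[f 0 + _ + _]addrA [- (f 0 + _)]opprD addrA [RHS]addrAC.
Unshelve. all: by end_near. Qed.

Lemma taylor2_le (R : realType) (G G1 G2 : R -> R) (d M s : R) :
  (forall r : R, `|r| < d -> is_derive r 1 G (G1 r) /\ is_derive r 1 G1 (G2 r)) ->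
  (forall r : R, `|r| < d -> G2 r <= M) -> `|s| < d ->
  G s <= G 0 + s * G1 0 + s ^+ 2 / 2 * M.
Proof.
wlog s0 : s G G1 G2 / 0 <= s.
  move=> H h1 h2 sd; have [s0|/ltW s0] := leP 0 s; first exact: (H s G G1 G2).
  have e (r : R) : 0 + -1 * r = - r by rewrite add0r mulN1r.
  have H' : forall r : R, `|r| < d -> `|0 + -1 * r| < d by move=> r rd; rewrite e normrN.
  have := H (- s) (fun r => G (0 + -1 * r)) (fun r => -1 * G1 (0 + -1 * r)) (fun r => G2 (0 + -1 * r)).
  case/(_ _ _ _ _)/Wrap => [|r rd|r rd||].
  - by rewrite oppr_ge0.
  - have [q1 q2] := h1 _ (H' _ rd); split; first exact: is_derive_affine q1.
    have := is_deriveZ (-1 : R) (is_derive_affine q2).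
    by apply: is_derive_eqr; rewrite scalerA mulrNN mulr1 scale1r.
  - exact: h2 (H' _ rd).
  - by rewrite normrN.
  by rewrite !e opprK oppr0 sqrrN [- s * _]mulrA mulrN1 opprK.
move=> h1 h2 sd.
have rd r : 0 <= r <= s -> `|r| < d.
  by move=> /andP[r0 rs]; rewrite ger0_norm// (le_lt_trans rs)// -(ger0_norm s0).
have b1 r : 0 <= r <= s -> G1 r <= G1 0 + r * M.
  move=> /andP[r0 rs].
  have := @derive_le_le R G1 G2 (fun r => r * M) (fun=> M) 0 r r0.
  case/(_ _ _ _)/Wrap => [t /andP[t0 tr]|t _|t /andP[t0 tr]|].
  - by apply: (h1 t _).2; apply: rd; rewrite t0 (le_trans tr).
  - have := is_derive_mul (is_derive_id1 t) (is_derive_cst M t 1).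
    by apply: is_derive_eqr; rewrite mul1r mulr0 addr0.
  - by apply: h2; apply: rd; rewrite t0 (le_trans tr).
  by rewrite mul0r; lra.
have := @derive_le_le R G G1 (fun r => r * G1 0 + r * r * (M / 2)) (fun r => G1 0 + r * M) 0 s s0.
case/(_ _ _ _)/Wrap => [t ts|t _|t ts|].
- by apply: (h1 t _).1; exact: rd.
- have q1 := is_derive_mul (is_derive_id1 t) (is_derive_cst (G1 0) t 1).
  have q2 := is_derive_mul (is_derive_mul (is_derive_id1 t) (is_derive_id1 t)) (is_derive_cst (M / 2) t 1).
  by move: (is_deriveD q1 q2); apply: is_derive_eqr; rewrite /cst mul1r !mulr0 !addr0 mul1r mulr1; field.
- exact: b1.
by rewrite expr2; lra.
Qed.

Section Variation.
Variables (R : realType) (n : nat) (U : set 'rV[R]_n) (g : 'rV[R]_n -> 'M[R]_n).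
Hypothesis oU : open U.
Hypothesis g_smooth : smooth_on U g.
Hypothesis g_sym : forall x, U x -> (g x)^T = g x.
Hypothesis g_pos : forall x u, U x -> u != 0 -> 0 < bilin (g x) u u.
Local Notation V := 'rV[R]_n.
Local Notation Gam := (Gam g).
Local Notation dGam := (dGam g).

Lemma tri_continuous (T : topologicalType) (c : T -> 'I_n -> 'I_n -> 'I_n -> R) (u w : T -> V) (y : T) :
  (forall k a b, {for y, continuous (fun y : T => c y k a b)}) ->
  {for y, continuous u} -> {for y, continuous w} ->
  {for y, continuous (fun y : T => tri (c y) (u y) (w y))}.
Proof.
move=> hc cu cw; apply/cvgrPdist_lt => e e0.
have ck (k : 'I_n) : {for y, continuous (fun y : T => tri (c y) (u y) (w y) 0 k)}.
  rewrite (_ : (fun y => _) = (fun y => \sum_a \sum_b c y k a b * u y 0 a * w y 0 b)); last first.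
    by apply/funext => y'; rewrite mxE.
  apply: continuous_bigsum => a; apply: continuous_bigsum => b.
  apply: cvgM; last exact: continuous_coord cw.
  by apply: cvgM; [exact: hc|exact: continuous_coord cu].
have nk : \forall y' \near y, forall k : 'I_n,
    `|tri (c y) (u y) (w y) 0 k - tri (c y') (u y') (w y') 0 k| < e / 2.
  apply: filter_forall => k; have := ck k => /cvgrPdist_lt; apply.
  by rewrite divr_gt0.
apply: filterS nk => y' h; apply: (@le_lt_trans _ _ (e / 2)); last by lra.
apply: mx_norm_le => [|i j]; first by rewrite divr_ge0// ltW.
by rewrite ord1 !mxE; have := h j; rewrite !mxE => /ltW.
Qed.

Lemma christoffel_continuous k a b x : U x -> {for x, continuous (christoffel g k a b)}.
Proof.
move=> Ux; apply: differentiable_continuous.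
exact: (christoffel_differentiable oU g_smooth g_pos).
Qed.

Lemma Gam_continuous (T : topologicalType) (x u w : T -> V) (y : T) : U (x y) ->
  {for y, continuous x} -> {for y, continuous u} -> {for y, continuous w} ->
  {for y, continuous (fun y : T => Gam (x y) (u y) (w y))}.
Proof.
move=> Ux cx cu cw; rewrite Gam.unlock; apply: tri_continuous => // k a b.
have c1 : {for x y, continuous (christoffel g k a b)} by exact: christoffel_continuous.
exact: (continuous_comp cx c1).
Qed.

Lemma dGam_continuous (T : topologicalType) (x z u w : T -> V) (y : T) : U (x y) ->
  {for y, continuous x} -> {for y, continuous z} ->
  {for y, continuous u} -> {for y, continuous w} ->
  {for y, continuous (fun y : T => dGam (x y) (z y) (u y) (w y))}.
Proof.
move=> Ux cx cz cu cw; rewrite dGam.unlock; apply: tri_continuous => // k a b.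
have nU : \forall y' \near y, U (x y') := cx _ (near_open oU Ux).
apply: (@continuous_near _ _ (fun y => \sum_c z y 0 c *: 'D_(delta_mx 0 c) (christoffel g k a b) (x y))).
  apply: filterS nU => y' Uy; rewrite -derive_sum_delta//.
  exact: (christoffel_differentiable oU g_smooth g_pos).
apply: continuous_bigsum => l; apply: cvgM; first exact: continuous_coord cz.
have c1 : {for x y, continuous ('D_(delta_mx 0 l) (christoffel g k a b))}.
  by have [_ h] := christoffel_smooth oU g_smooth g_pos 1 k a b; exact: (h (delta_mx 0 l) _ Ux).
exact: (continuous_comp cx c1).
Qed.

End Variation.

Lemma uniform_near (R : realType) (P : R -> R -> Prop) (a b : R) : a <= b ->
  (forall t : R, a <= t <= b -> exists2 d : R, 0 < d &
     forall s r : R, `|s| < d -> `|r - t| < d -> P s r) ->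
  exists2 d : R, 0 < d & forall s r : R, `|s| < d -> a <= r <= b -> P s r.
Proof.
move=> ab h.
apply: (@local_propagation R (fun c => exists2 d : R, 0 < d &
  forall s r : R, `|s| < d -> a <= r <= c -> P s r) a b ab).
  have [d d0 hd] := h a ltac:(by rewrite lexx ab).
  exists d => // s r sd; rewrite -eq_le => /eqP <-; apply: hd => //.
  by rewrite subrr normr0.
move=> t tab; have [d d0 hd] := h t tab; exists d => // s1 s2 s1ab s2ab s1d s2d s12 [d1 d10 h1].
exists (Num.min d d1) => [|s r]; first by rewrite lt_min d0.
rewrite lt_min => /andP[sd sd1] /andP[ar rs2].
have [rs1|s1r] := leP r s1; first by apply: h1 => //; rewrite ar.
by apply: hd => //; apply: (dist_between s1d s2d); rewrite (ltW s1r).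
Qed.

Section Variation.
Variables (R : realType) (n : nat) (U : set 'rV[R]_n) (g : 'rV[R]_n -> 'M[R]_n).
Hypothesis oU : open U.
Hypothesis g_smooth : smooth_on U g.
Hypothesis g_sym : forall x, U x -> (g x)^T = g x.
Hypothesis g_pos : forall x u, U x -> u != 0 -> 0 < bilin (g x) u u.
Local Notation V := 'rV[R]_n.
Local Notation Gam := (Gam g).
Local Notation dGam := (dGam g).
Local Notation Rop := (Rop g).

Lemma dGam_sym (x z u w : V) : U x -> dGam x z u w = dGam x z w u.
Proof.
move=> Ux.
have dl : is_derive (0 : R) 1 (fun s : R => x + s *: z) z := line_is_derive x z 0.
have du (y : V) : is_derive (0 : R) 1 (fun _ : R => y) 0 by exact: is_derive_cst.
have Ux0 : U (x + (0 : R) *: z) by rewrite scale0r addr0.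
have h (u w : V) := is_derive_Gam oU g_smooth g_pos Ux0 dl (du u) (du w).
have n1 : \forall s \near (0 : R), U (x + s *: z) :=
  is_derive_continuous dl (near_open oU Ux0).
have h1 : is_derive (0 : R) 1 (fun s : R => Gam (x + s *: z) u w)
    (dGam (x + (0 : R) *: z) z w u + Gam (x + (0 : R) *: z) 0 u + Gam (x + (0 : R) *: z) w 0).
  apply: is_derive_near (h w u); apply: filterS n1 => s Us.
  exact: (Gam_sym oU g_smooth g_sym g_pos).
have := is_derive_unique (h u w) h1.
by rewrite !Gam0l !Gam0r !addr0 scale0r addr0.
Qed.

Lemma dGamZ2 (x z u w : V) (c : R) : dGam x z (c *: u) w = c *: dGam x z u w.
Proof. by rewrite dGam.unlock triZl. Qed.
Lemma dGamZ3 (x z u w : V) (c : R) : dGam x z u (c *: w) = c *: dGam x z u w.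
Proof. by rewrite dGam.unlock triZr. Qed.
Lemma dGamZ1 (x z u w : V) (c : R) : U x -> dGam x (c *: z) u w = c *: dGam x z u w.
Proof.
move=> Ux; rewrite dGam.unlock; apply/rowP => k; rewrite !mxE mulr_sumr.
apply: eq_bigr => a _; rewrite mulr_sumr; apply: eq_bigr => b _.
by rewrite deriveZr ?mulrA//; exact: (christoffel_differentiable oU g_smooth g_pos).
Qed.

Lemma RopZ (x E v : V) (f : R) : U x ->
  bilin (g x) (Rop x (f *: E) v (f *: E)) v = f ^+ 2 * bilin (g x) (Rop x E v E) v.
Proof.
move=> Ux; rewrite -bilinZl; congr (bilin _ _ _).
by rewrite /Rop expr2 -scalerA !GamZl !GamZr !dGamZ2 !dGamZ3 dGamZ1// !scalerDr !scalerN.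
Qed.

Section Quadratic.
Variables (x v W W1 A A1 : V).
(** At a fixed time, [var_pos] is the transverse curve of the variation, and [var_vel s] is the
    velocity of the varied curve with parameter [s]. [var_D] and [var_DD] are the first and second
    covariant derivatives of this velocity in [s], and [var_G] is the squared speed. *)
Definition var_pos (s : R) : V := x + s *: W + (s ^+ 2) *: A.
Definition var_vel (s : R) : V := v + s *: W1 + (s ^+ 2) *: A1.
Definition var_posd (s : R) : V := W + (2 * s) *: A.
Definition var_veld (s : R) : V := W1 + (2 * s) *: A1.
Definition var_D (s : R) : V := var_veld s + Gam (var_pos s) (var_posd s) (var_vel s).
Definition var_DD (s : R) : V := 2 *: A1
  + (dGam (var_pos s) (var_posd s) (var_posd s) (var_vel s)
     + Gam (var_pos s) (2 *: A) (var_vel s)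
     + Gam (var_pos s) (var_posd s) (var_veld s))
  + Gam (var_pos s) (var_posd s) (var_D s).
Definition var_G (s : R) : R := bilin (g (var_pos s)) (var_vel s) (var_vel s).
Definition var_G1 (s : R) : R := 2 * bilin (g (var_pos s)) (var_D s) (var_vel s).
Definition var_G2 (s : R) : R := 2 * (bilin (g (var_pos s)) (var_DD s) (var_vel s)
  + bilin (g (var_pos s)) (var_D s) (var_D s)).

Lemma is_derive_quad (a b c : V) (s : R) :
  is_derive s 1 (fun s : R => a + s *: b + (s ^+ 2) *: c) (b + (2 * s) *: c).
Proof.
have q2 : is_derive s 1 (fun s : R => (s ^+ 2) *: c) ((2 * s) *: c).
  apply/is_derive_mxP => i j; rewrite !mxE.
  have h := is_derive_mul (is_derive_mul (is_derive_id1 s) (is_derive_id1 s))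
    (is_derive_cst (c i j) s 1).
  apply: (@is_derive_near R R (fun s : R => s * s * c i j)).
    by near=> t; rewrite !mxE expr2.
  by move: h; apply: is_derive_eqr; rewrite /cst mulr0 addr0 mul1r mulr1; ring.
exact: (is_deriveD (line_is_derive a b s) q2).
Unshelve. all: by end_near. Qed.

Lemma is_derive_lin (b c : V) (s : R) :
  is_derive s 1 (fun s : R => b + (2 * s) *: c) (2 *: c).
Proof.
apply: (@is_derive_near R V (fun s : R => b + s *: (2 *: c))); last exact: line_is_derive.
by near=> t; rewrite scalerA mulrC.
Unshelve. all: by end_near. Qed.

Lemma is_derive_var_G s : U (var_pos s) -> is_derive s 1 var_G (var_G1 s).
Proof.
move=> Us; have hp := is_derive_quad x W A s; have hv := is_derive_quad v W1 A1 s.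
refine (is_derive_eqr _ (is_derive_metric oU g_smooth g_sym g_pos Us hp hv hv)).
rewrite -/(var_pos s) -/(var_vel s) -/(var_posd s) -/(var_veld s) -/(var_D s) /var_G1.
by rewrite (metric_sym g_sym (var_vel s) (var_D s) Us); ring.
Qed.

Lemma is_derive_var_G1 s : U (var_pos s) -> is_derive s 1 var_G1 (var_G2 s).
Proof.
move=> Us; have hp := is_derive_quad x W A s; have hv := is_derive_quad v W1 A1 s.
have hp1 := is_derive_lin W A s; have hv1 := is_derive_lin W1 A1 s.
have hD := is_deriveD hv1 (is_derive_Gam oU g_smooth g_pos Us hp hp1 hv).
have hh := is_deriveZ (2 : R) (is_derive_metric oU g_smooth g_sym g_pos Us hp hD hv).
exact: hh.
Qed.

End Quadratic.


Section Curves.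
Variables (x v E : R -> V) (f f1 : R -> R) (k2 a b : R).
Hypothesis x_in : forall t : R, a < t < b -> U (x t).
Hypothesis dx : forall t : R, a < t < b -> is_derive t 1 x (v t).
Hypothesis dv : forall t : R, a < t < b -> is_derive t 1 v (- Gam (x t) (v t) (v t)).
Hypothesis dE : forall t : R, a < t < b -> is_derive t 1 E (- Gam (x t) (v t) (E t)).
Hypothesis df : forall t : R, is_derive t 1 f (f1 t).
Hypothesis df1 : forall t : R, is_derive t 1 f1 (k2 * f t).
Hypothesis curv : forall (t : R) (u : V), a < t < b ->
  bilin (g (x t)) (Rop (x t) u (v t) u) (v t) <= k2 * bilin (g (x t)) u u.

Definition var_W (t : R) : V := f t *: E t.
Definition var_W1 (t : R) : V := f1 t *: E t - f t *: Gam (x t) (v t) (E t).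
(** The choice that makes the transverse curves geodesics to second order at [s = 0]. Their
    acceleration then contributes nothing, and the second derivative of the squared speed reduces to
    curvature and the derivative of [W]. *)
Definition var_A (t : R) : V := - 2^-1 *: Gam (x t) (var_W t) (var_W t).
Definition var_A1 (t : R) : V := - 2^-1 *: (dGam (x t) (v t) (var_W t) (var_W t)
  + Gam (x t) (var_W1 t) (var_W t) + Gam (x t) (var_W t) (var_W1 t)).
Definition var_curve (s t : R) : V := var_pos (x t) (var_W t) (var_A t) s.
Definition var_speed (s t : R) : V := var_vel (v t) (var_W1 t) (var_A1 t) s.

Lemma is_derive_scale (h : R -> R) (y : R -> V) (t dh : R) (dy : V) :
  is_derive t 1 h dh -> is_derive t 1 y dy ->
  is_derive t 1 (fun t : R => h t *: y t) (dh *: y t + h t *: dy).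
Proof.
move=> hh hy; apply/is_derive_mxP => i j; rewrite !mxE.
have hy' := (is_derive_mxP _ _ _).1 hy i j.
apply: (@is_derive_near R R (fun t : R => h t * y t i j)).
  by near=> s; rewrite !mxE.
exact: (is_derive_mul hh hy').
Unshelve. all: by end_near. Qed.

Lemma is_derive_var_W t : a < t < b -> is_derive t 1 var_W (var_W1 t).
Proof.
move=> tab; have := is_derive_scale (df t) (dE tab).
by apply: is_derive_eqr; rewrite /var_W1 scalerN.
Qed.

Lemma is_derive_var_A t : a < t < b -> is_derive t 1 var_A (var_A1 t).
Proof.
move=> tab; have hW := is_derive_var_W tab.
exact: (is_deriveZ (- 2^-1 : R)
  (is_derive_Gam oU g_smooth g_pos (x_in tab) (dx tab) hW hW)).
Qed.

Lemma is_derive_var_curve s t : a < t < b -> is_derive t 1 (var_curve s) (var_speed s t).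
Proof.
move=> tab; have hW := is_deriveZ s (is_derive_var_W tab).
have hA := is_deriveZ (s ^+ 2) (is_derive_var_A tab).
exact: (is_deriveD (is_deriveD (dx tab) hW) hA).
Qed.

Definition var_sq (s t : R) : R := var_G (x t) (v t) (var_W t) (var_W1 t) (var_A t) (var_A1 t) s.

Lemma var_pos0 (y w c : V) : var_pos y w c 0 = y.
Proof. by rewrite /var_pos scale0r expr0n scale0r !addr0. Qed.
Lemma var_posd0 (w c : V) : var_posd w c 0 = w.
Proof. by rewrite /var_posd mulr0 scale0r addr0. Qed.

Lemma var_D0 t : a < t < b ->
  var_D (x t) (v t) (var_W t) (var_W1 t) (var_A t) (var_A1 t) 0 = f1 t *: E t.
Proof.
move=> tab; rewrite /var_D /var_veld var_pos0 var_posd0 [var_vel _ _ _ _]var_pos0.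
rewrite mulr0 scale0r addr0 /var_W1 /var_W GamZl.
rewrite (Gam_sym oU g_smooth g_sym g_pos (E t) (v t) (x_in tab)).
by rewrite subrK.
Qed.

(** The integrand of the index form of [W = f *: E]. The covariant derivative of [W] is [f1 *: E],
    as [E] is parallel; the curvature term is [f ^+ 2] times the quantity bounded by [curv]. *)
Lemma var_G2_0 t : a < t < b ->
  var_G2 (x t) (v t) (var_W t) (var_W1 t) (var_A t) (var_A1 t) 0 <=
  2 * ((f1 t ^+ 2 + k2 * f t ^+ 2) * bilin (g (x t)) (E t) (E t)).
Proof.
move=> tab; have Ux := x_in tab.
have sG (u w : V) : Gam (x t) u w = Gam (x t) w u.
  exact: (Gam_sym oU g_smooth g_sym g_pos).
rewrite /var_G2 ler_pM2l// var_D0// var_pos0 [var_vel _ _ _ _]var_pos0.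
have -> : var_DD (x t) (v t) (var_W t) (var_W1 t) (var_A t) (var_A1 t) 0 =
    Rop (x t) (var_W t) (v t) (var_W t).
  rewrite /var_DD var_D0// var_pos0 !var_posd0 [var_vel _ _ _ _]var_pos0.
  rewrite [var_veld _ _ _]var_posd0 /Rop.
  have -> : 2 *: var_A1 t = - (dGam (x t) (v t) (var_W t) (var_W t)
      + Gam (x t) (var_W t) (var_W1 t) + Gam (x t) (var_W t) (var_W1 t)).
    rewrite /var_A1 (sG (var_W1 t)) scalerA mulrN mulfV ?pnatr_eq0//.
    by rewrite scaleN1r.
  have -> : 2 *: var_A t = - Gam (x t) (var_W t) (var_W t).
    by rewrite /var_A scalerA mulrN mulfV ?pnatr_eq0// scaleN1r.
  have -> : Gam (x t) (var_W t) (f1 t *: E t) =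
      Gam (x t) (var_W t) (var_W1 t) + Gam (x t) (var_W t) (Gam (x t) (v t) (var_W t)).
    rewrite -GamDr; congr (Gam _ _ _).
    by rewrite /var_W1 /var_W GamZr subrK.
  have -> : Gam (x t) (- Gam (x t) (var_W t) (var_W t)) (v t) =
      - Gam (x t) (v t) (Gam (x t) (var_W t) (var_W t)).
    by rewrite -[- Gam _ _ _]scaleN1r GamZl scaleN1r sG.
  rewrite (dGam_sym _ (var_W t) (v t) Ux).
  move: (dGam _ _ _ _) (dGam _ _ _ _) (Gam _ _ _) (Gam _ _ _) (Gam _ _ _) => p q r s u.
  by apply/rowP => k; rewrite !mxE; ring.
rewrite RopZ// bilinZl bilinZr.
have := curv (E t) tab; have := sqr_ge0 (f t).
move: (bilin _ _ _) (bilin _ _ _) (f t ^+ 2) (f1 t) => p q r s r0 pq.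
have := ler_wpM2l r0 pq; rewrite expr2; lra.
Qed.


Lemma metric_continuous (T : topologicalType) (y : T -> V) (t : T) : U (y t) ->
  {for t, continuous y} -> {for t, continuous (fun s : T => g (y s))}.
Proof.
move=> Uy cy; have c1 : {for y t, continuous g}.
  by apply: differentiable_continuous; exact: (metric_differentiable g_smooth).
exact: (continuous_comp cy c1).
Qed.

Lemma continuous_scale (T : topologicalType) (h : T -> R) (y : T -> V) (t : T) :
  {for t, continuous h} -> {for t, continuous y} ->
  {for t, continuous (fun s : T => h s *: y s)}.
Proof. by move=> ch cy; exact: (cvgZ ch cy). Qed.

Lemma var_curves_continuous t : a < t < b ->
  [/\ {for t, continuous x}, {for t, continuous v}, {for t, continuous var_W},
   {for t, continuous var_W1} & {for t, continuous var_A} /\ {for t, continuous var_A1}].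
Proof.
move=> tab; have Ux := x_in tab.
have cx := is_derive_continuous (dx tab); have cv := is_derive_continuous (dv tab).
have cE := is_derive_continuous (dE tab); have cf := is_derive_continuous (df t).
have cf1 := is_derive_continuous (df1 t).
have cW := is_derive_continuous (is_derive_var_W tab).
have cA := is_derive_continuous (is_derive_var_A tab).
have cW1 : {for t, continuous var_W1}.
  apply: continuousB_at; first exact: continuous_scale.
  apply: continuous_scale => //; exact: (Gam_continuous oU g_smooth g_pos).
have Gm (y z : R -> V) (cy : {for t, continuous y}) (cz : {for t, continuous z}) :=
  Gam_continuous oU g_smooth g_pos Ux cx cy cz.
have dG := dGam_continuous oU g_smooth g_pos Ux cx cv cW cW.
have cA1 : {for t, continuous var_A1}.
  apply: continuous_scale; first exact: continuous_cst_at.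
  exact: (continuousD_at (continuousD_at dG (Gm _ _ cW1 cW)) (Gm _ _ cW cW1)).
exact: (And5 cx cv cW cW1 (conj cA cA1)).
Qed.

Lemma var_G2_continuous t : a < t < b ->
  {for ((0 : R), t), continuous (fun z : R * R => var_G2 (x z.2) (v z.2) (var_W z.2)
     (var_W1 z.2) (var_A z.2) (var_A1 z.2) z.1)} /\
  {for ((0 : R), t), continuous (fun z : R * R => var_curve z.1 z.2)}.
Proof.
move=> tab; have Ux := x_in tab; have [cx cv cW cW1 [cA cA1]] := var_curves_continuous tab.
have c1 : {for ((0 : R), t), continuous (fun z : R * R => z.1)} by exact: cvg_fst.
have c2 : {for ((0 : R), t), continuous (fun z : R * R => z.2)} by exact: cvg_snd.
have lift (y : R -> V) : {for t, continuous y} ->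
    {for ((0 : R), t), continuous (fun z : R * R => y z.2)}.
  by move=> cy; exact: (@continuous_comp (R * R)%type R V (fun z => z.2) y ((0 : R), t) c2 cy).
have quad (p q r : R -> V) : {for t, continuous p} -> {for t, continuous q} ->
    {for t, continuous r} -> {for ((0 : R), t),
     continuous (fun z : R * R => var_pos (p z.2) (q z.2) (r z.2) z.1)}.
  move=> cp cq cr; apply: continuousD_at; last first.
    apply: continuous_scale; last exact: lift.
    by rewrite (_ : (fun s : R * R => s.1 ^+ 2) = (fun s : R * R => s.1 * s.1));
      [exact: (cvgM c1 c1)|apply/funext => z; rewrite expr2].
  apply: continuousD_at; first exact: lift.
  by apply: continuous_scale => //; exact: lift.
have lin (q r : R -> V) : {for t, continuous q} -> {for t, continuous r} ->
    {for ((0 : R), t), continuous (fun z : R * R => var_posd (q z.2) (r z.2) z.1)}.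
  move=> cq cr; apply: continuousD_at; first exact: lift.
  apply: continuous_scale; last exact: lift.
  by apply: (cvgM _ c1); exact: (@continuous_cst_at (R * R)%type R).
have two (r : R -> V) : {for t, continuous r} ->
    {for ((0 : R), t), continuous (fun z : R * R => 2 *: r z.2)}.
  by move=> cr; apply: continuous_scale; [exact: continuous_cst_at|exact: lift].
have U0 : U (var_pos (x t) (var_W t) (var_A t) 0) by rewrite var_pos0.
have cpos := quad _ _ _ cx cW cA; have cvel := quad _ _ _ cv cW1 cA1.
have cposd := lin _ _ cW cA; have cveld := lin _ _ cW1 cA1.
split; last exact: cpos.
have cG (u w : R * R -> V) (cu : {for ((0 : R), t), continuous u})
    (cw : {for ((0 : R), t), continuous w}) :=
  @Gam_continuous R n U g oU g_smooth g_pos (R * R)%type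
    (fun z : R * R => var_pos (x z.2) (var_W z.2) (var_A z.2) z.1) u w ((0 : R), t) U0 cpos cu cw.
have cdG := @dGam_continuous R n U g oU g_smooth g_pos (R * R)%type
    (fun z : R * R => var_pos (x z.2) (var_W z.2) (var_A z.2) z.1) _ _ _ ((0 : R), t) U0
    cpos cposd cposd cvel.
have cg := @metric_continuous (R * R)%type _ ((0 : R), t) U0 cpos.
have cD : {for ((0 : R), t), continuous (fun z : R * R =>
    var_D (x z.2) (v z.2) (var_W z.2) (var_W1 z.2) (var_A z.2) (var_A1 z.2) z.1)} :=
  continuousD_at cveld (cG _ _ cposd cvel).
have cDD : {for ((0 : R), t), continuous (fun z : R * R =>
    var_DD (x z.2) (v z.2) (var_W z.2) (var_W1 z.2) (var_A z.2) (var_A1 z.2) z.1)} :=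
  continuousD_at (continuousD_at (two _ cA1)
    (continuousD_at (continuousD_at cdG (cG _ _ (two _ cA) cvel)) (cG _ _ cposd cveld)))
    (cG _ _ cposd cD).
apply: (cvgM (@continuous_cst_at (R * R)%type R _ _)).
exact: (continuousD_at (continuous_bilin cg cDD cvel) (continuous_bilin cg cD cD)).
Qed.

(** The second derivative in [s] exceeds the bound at [s = 0] by at most [2 * e] for small [s],
    uniformly in time by compactness of [t1, t2]. Continuity is enough for this, so no third
    derivative enters. *)
Lemma var_sq_le (t1 t2 e : R) : a < t1 -> t1 <= t2 -> t2 < b -> 0 < e ->
  exists2 d : R, 0 < d & forall s t : R, `|s| < d -> t1 <= t <= t2 ->
    U (var_curve s t) /\
    var_sq s t <= bilin (g (x t)) (v t) (v t) + 2 * s * f1 t * bilin (g (x t)) (E t) (v t)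
      + s ^+ 2 * ((f1 t ^+ 2 + k2 * f t ^+ 2) * bilin (g (x t)) (E t) (E t) + e).
Proof.
move=> at1 t12 t2b e0.
have tin t : t1 <= t <= t2 -> a < t < b.
  by move=> /andP[h1 h2]; rewrite (lt_le_trans at1)// (le_lt_trans h2).
pose G2 (s t : R) := var_G2 (x t) (v t) (var_W t) (var_W1 t) (var_A t) (var_A1 t) s.
have := @uniform_near R (fun s t => U (var_curve s t) /\
  G2 s t <= 2 * ((f1 t ^+ 2 + k2 * f t ^+ 2) * bilin (g (x t)) (E t) (E t)) + 2 * e) t1 t2 t12.
case=> [t /tin tab|d d0 hd].
  have [c2 c1] := var_G2_continuous tab.
  pose B (t : R) := 2 * ((f1 t ^+ 2 + k2 * f t ^+ 2) * bilin (g (x t)) (E t) (E t)) + 2 * e.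
  have cB : {for t, continuous B}.
    have cf := is_derive_continuous (df t); have cf1 := is_derive_continuous (df1 t).
    have cE := is_derive_continuous (dE tab).
    have cx := is_derive_continuous (dx tab).
    have cM (p q : R -> R) : {for t, continuous p} -> {for t, continuous q} ->
      {for t, continuous (fun t : R => p t * q t)} by move=> cp cq; exact: (cvgM cp cq).
    have cC (p : R) : {for t, continuous (fun _ : R => p)} by exact: continuous_cst_at.
    apply: continuousD_at; last exact: cC.
    apply: (cM (fun=> 2)); first exact: cC.
    apply: (cM _ _); last by apply: continuous_bilin => //; exact: metric_continuous (x_in tab) cx.
    rewrite (_ : (fun t => _) = (fun t => f1 t * f1 t + k2 * (f t * f t))).
      apply: continuousD_at; first exact: cM.
      by apply: (cM (fun=> k2)); [exact: cC|exact: cM].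
    by apply/funext => s; rewrite !expr2.
  have cB2 : {for ((0 : R), t), continuous (fun z : R * R => B z.2 - G2 z.1 z.2)}.
    apply: continuousB_at; last exact: c2.
    have c3 : {for ((0 : R), t), continuous (fun z : R * R => z.2)} by exact: cvg_snd.
    exact: (@continuous_comp (R * R)%type R R (fun z => z.2) B ((0 : R), t) c3 cB).
  have pos : 0 < B t - G2 0 t.
    have := var_G2_0 tab; rewrite -/(G2 0 t) /B.
    move: (G2 0 t) (bilin _ _ _) (f1 t ^+ 2 + _) => p q r; lra.
  have n1 : \forall z \near ((0 : R), t), 0 < B z.2 - G2 z.1 z.2 := cB2 _ (@lt_nbhsr _ _ _ pos).
  have U0 : U (var_curve 0 t) by rewrite /var_curve var_pos0; exact: x_in.
  have n2 : \forall z \near ((0 : R), t), U (var_curve z.1 z.2) := c1 _ (near_open oU U0).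
  have [[A1 A2] /= [hA1 hA2] hA] := filterI n1 n2.
  have [d1 d10 hd1] := (nbhs_normP _ _).1 hA1; have [d2 d20 hd2] := (nbhs_normP _ _).1 hA2.
  exists (Num.min d1 d2) => [|s r]; first by rewrite lt_min d10.
  rewrite !lt_min => /andP[sd _] /andP[_ rd].
  have [] := hA (s, r); first by split; [apply: hd1; rewrite subr0|exact: hd2].
  by move=> /= h1 h2; split=> //; rewrite -subr_ge0 ltW.
exists d => // s t sd t12'; have [h1 h2] := hd s t sd t12'; split=> //.
have tab := tin _ t12'.
have := @taylor2_le R (fun s => var_sq s t)
  (var_G1 (x t) (v t) (var_W t) (var_W1 t) (var_A t) (var_A1 t)) (fun s => G2 s t) d
  (2 * ((f1 t ^+ 2 + k2 * f t ^+ 2) * bilin (g (x t)) (E t) (E t)) + 2 * e) s.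
case/(_ _ _ _)/Wrap => [r rd|r rd||].
- have [Ur _] := hd r t rd t12'.
  by split; [exact: is_derive_var_G|exact: is_derive_var_G1].
- exact: (hd r t rd t12').2.
- by [].
rewrite {2}/var_sq /var_G /var_G1 var_D0// var_pos0 [var_vel _ _ _ _]var_pos0 bilinZl.
move: (var_sq _ _) (bilin _ _ _) (bilin _ _ _) (bilin _ _ _) (f1 t) (f1 t ^+ 2 + _) => p q r u w y.
move: (s ^+ 2) => z; lra.
Qed.

End Curves.

End Variation.

(** [T] is the third derivative of [phi]; its symmetry makes it drop out of the transformation of
    the curvature. *)
Lemma is_derive_hess (R : realType) (m n : nat) (U : set 'rV[R]_m) (phi : 'rV[R]_m -> 'rV[R]_n)
    (x : 'rV[R]_m) : open U -> smooth_on U phi -> U x ->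
  exists T : 'rV[R]_m -> 'rV[R]_m -> 'rV[R]_m -> 'rV[R]_n,
    (forall u w z, is_derive (0 : R) 1 (fun s : R => hess phi (x + s *: u) w z) (T u w z)) /\
    (forall u w z, T u w z = T w u z).
Proof.
move=> oU sm Ux.
pose f k a := 'D_(delta_mx 0 a) (fun y => phi y 0 k).
have sf k a : class_C 2 U (f k a).
  by have [_ h] := class_C_entry (0 : 'I_1) k oU (sm 3); exact: h.
pose D u w k a := 'D_u ('D_w (f k a)) x.
have DC u w k a : D u w k a = D w u k a by exact: (class_C2_schwarz _ _ oU Ux).
exists (fun u w z => \row_k \sum_a z 0 a * D u w k a); split=> u w z; last first.
  clearbody D; apply/rowP => k; rewrite !mxE; apply: eq_bigr => a _; by rewrite DC.
apply/is_derive_mxP => i k; rewrite ord1 !mxE.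
rewrite (_ : (fun s : R => _) = (fun s : R => \sum_a z 0 a * 'D_w (f k a) (x + s *: u))); last first.
  by apply/funext => s; rewrite hessE.
apply: is_derive_bigsum => a.
have [_ h] := sf k a; have [d _] := h w.
have dk : differentiable ('D_w (f k a)) (x + (0 : R) *: u).
  by rewrite scale0r addr0; exact: d.
have := is_derive_mul (is_derive_cst (z 0 a) (0 : R) 1) (is_derive_line dk).
by apply: is_derive_eqr; rewrite mul0r add0r scale0r addr0.
Qed.

Lemma row_free2 (R : realType) (n : nat) (u v : 'rV[R]_n) : v != 0 ->
  (forall c : R, u != c *: v) -> row_free (col_mx u v).
Proof.
move=> v0 uv; rewrite -kermx_eq0; apply/eqP/row_matrixP => i.
have : row i (kermx (col_mx u v)) *m col_mx u v = 0.
  by apply/eqP; rewrite -sub_kermx row_sub.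
move: (row _ _) => y; rewrite row0 -[y]hsubmxK mul_row_col.
rewrite (mx11_scalar (lsubmx y)) (mx11_scalar (rsubmx y)) !mul_scalar_mx.
move: (lsubmx y 0 0) (rsubmx y 0 0) => a b h.
have [a0|a0] := eqVneq a 0.
  move: h; rewrite a0 scale0r add0r => /eqP; rewrite scaler_eq0 (negPf v0) orbF => /eqP ->.
  have -> : 0%:M = 0 :> 'M[R]_1 by apply/matrixP => p q; rewrite !mxE mul0rn.
  by rewrite row_mx0.
have /eqP := uv (- (a^-1 * b)); case.
apply: (scalerI a0); rewrite scalerA mulrN mulrA mulfV// mul1r.
by apply/eqP; rewrite -subr_eq0 scaleNr opprK h.
Qed.

Lemma reorder_terms (R : realType) (n : nat) (d q h1 h2 h3 t y d' q' : 'rV[R]_n) :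
  d + h3 + h2 + t - y + (q + h1 + y) = d + q + (h1 + h2 + h3 + t) /\
  d + q + (h1 + h2 + h3 + t) - (d' + q' + (h2 + h1 + h3 + t)) = d - d' + q - q'.
Proof. by split; apply/rowP => k; rewrite !mxE; ring. Qed.

(** * The curvature bound in an arbitrary chart *)

Section Tensoriality.
Variables (R : realType) (n : nat) (M : riemannianManifold R n).
Implicit Types (i j : mchart M) (x u v w z : 'rV[R]_n).

(** Differentiating the law of the Christoffel symbols in the direction [a] gives a tensorial part
    and terms that are symmetric in [a] and [b], which cancel in the curvature. This is needed
    because curvature is bounded in the chart [mchart_at p] only, while the variation lives in the
    chart at hand. *)
Lemma Rop_transition i j x u w z : overlap i j x ->
  'D_(Rop (gram i) x u w z) (transition i j) x =
  Rop (gram j) (transition i j x) ('D_u (transition i j) x) ('D_w (transition i j) x)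
    ('D_z (transition i j) x).
Proof.
move=> ox; set phi := transition i j.
have oW := @overlap_open R n M i j; have sm := @transition_smooth R n M i j.
have Ui := overlap_sub ox; have Uj := transition_range ox.
have [T [dT Tsym]] := is_derive_hess oW sm ox.
have Gi := is_derive_Gam (@chart_range_open R n M i) (@gram_smooth' R n M i) (@gram_pos' R n M i).
have Gj := is_derive_Gam (@chart_range_open R n M j) (@gram_smooth' R n M j) (@gram_pos' R n M j).
have sG (a b : 'rV[R]_n) : Gam (gram j) (phi x) a b = Gam (gram j) (phi x) b a.
  exact: (Gam_sym (@chart_range_open R n M j) (@gram_smooth' R n M j) (@gram_sym' R n M j) (@gram_pos' R n M j)).
have sH := hess_sym oW sm.
have dcst (y : 'rV[R]_n) : is_derive (0 : R) 1 (fun _ : R => y) 0 by exact: is_derive_cst.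
have key (a b : 'rV[R]_n) :
    'D_(dGam (gram i) x a b z + Gam (gram i) x a (Gam (gram i) x b z)) phi x =
    dGam (gram j) (phi x) ('D_a phi x) ('D_b phi x) ('D_z phi x)
    + Gam (gram j) (phi x) ('D_a phi x) (Gam (gram j) (phi x) ('D_b phi x) ('D_z phi x))
    + (Gam (gram j) (phi x) ('D_a phi x) (hess phi x b z)
       + Gam (gram j) (phi x) ('D_b phi x) (hess phi x a z)
       + Gam (gram j) (phi x) (hess phi x a b) ('D_z phi x) + T a b z).
  have dl : is_derive (0 : R) 1 (fun s : R => x + s *: a) a := line_is_derive x a 0.
  have x0 : x + (0 : R) *: a = x by rewrite scale0r addr0.
  have ox0 : overlap i j (x + (0 : R) *: a) by rewrite x0.
  have L1 := is_derive_differential oW sm ox0 dl (Gi _ _ _ _ _ _ _ (overlap_sub ox0) dl (dcst b) (dcst z)).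
  have dphi : is_derive (0 : R) 1 (fun s : R => phi (x + s *: a)) ('D_a phi (x + (0 : R) *: a)).
    by apply: is_derive_diff_comp dl; exact: transition_differentiable.
  have L2 := is_deriveD (Gj _ _ _ _ _ _ _ (transition_range ox0) dphi
    (is_derive_differential oW sm ox0 dl (dcst b)) (is_derive_differential oW sm ox0 dl (dcst z))) (dT a b z).
  have nW : \forall s \near (0 : R), overlap i j (x + s *: a) :=
    is_derive_continuous dl (near_open oW ox0).
  have nC : \forall s \near (0 : R), 'D_(Gam (gram i) (x + s *: a) b z) phi (x + s *: a) =
      Gam (gram j) (phi (x + s *: a)) ('D_b phi (x + s *: a)) ('D_z phi (x + s *: a))
      + hess phi (x + s *: a) b z.
    by apply: filterS nW => s os; exact: christoffel_transition.
  have L3 := is_derive_near nC L1.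
  have := is_derive_unique L3 L2.
  rewrite !x0 !Gam0l !Gam0r !derive0 !addr0 -/phi => E1.
  rewrite deriveDr; last exact: transition_differentiable.
  have -> : 'D_(Gam (gram i) x a (Gam (gram i) x b z)) phi x =
      Gam (gram j) (phi x) ('D_a phi x) (Gam (gram j) (phi x) ('D_b phi x) ('D_z phi x))
      + Gam (gram j) (phi x) ('D_a phi x) (hess phi x b z)
      + hess phi x a (Gam (gram i) x b z).
    by rewrite !christoffel_transition// -/phi GamDr.
  have -> : 'D_(dGam (gram i) x a b z) phi x =
      dGam (gram j) (phi x) ('D_a phi x) ('D_b phi x) ('D_z phi x) +
      Gam (gram j) (phi x) (hess phi x a b) ('D_z phi x) +
      Gam (gram j) (phi x) ('D_b phi x) (hess phi x a z) + T a b z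
      - hess phi x a (Gam (gram i) x b z).
    by rewrite -E1 [X in _ = X - _]addrC addrK.
  exact: (reorder_terms _ _ _ _ _ _ _ 0 0).1.
have -> : Rop (gram i) x u w z =
    (dGam (gram i) x u w z + Gam (gram i) x u (Gam (gram i) x w z))
    - (dGam (gram i) x w u z + Gam (gram i) x w (Gam (gram i) x u z)).
  by rewrite /Rop opprD [RHS]addrACA [RHS]addrA.
rewrite -[- (_ + _)]scaleN1r deriveDr; last exact: transition_differentiable.
rewrite deriveZr; last exact: transition_differentiable.
rewrite !key scaleN1r (Tsym w u) (sH _ w u ox) /Rop.
exact: (reorder_terms _ _ _ _ _ _ 0 _ _).2.
Qed.

(** By antisymmetry the left side is minus the numerator of the sectional curvature, at most
    [|kmin|] times the Gram determinant of [u] and [v] when [kmin < 0]. The sectional bound concerns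
    independent vectors; for [v = 0] and for collinear pairs the left side is 0. *)
Lemma curvature_le_chart kmin kmax (k2 rho2 : R) p u v i : sectional_curvature_in M kmin kmax ->
  mdom i p -> 0 <= k2 -> (kmin < 0 -> `|kmin| * rho2 <= k2) ->
  bilin (gram i (mcoord i p)) v v <= rho2 ->
  bilin (gram i (mcoord i p)) (Rop (gram i) (mcoord i p) u v u) v
    <= k2 * bilin (gram i (mcoord i p)) u u.
Proof.
wlog -> : i u v / i = mchart_at p.
  move=> H sc ip k20 hk vr; set j := mchart_at p; have jp : mdom j p by exact: mdom_chart_at.
  have ox := overlap_coord ip jp.
  have := H j ('D_u (transition i j) (mcoord i p)) ('D_v (transition i j) (mcoord i p))
    erefl sc jp k20 hk.
  rewrite -!(transition_coord j ip) -transition_isom// => /(_ vr).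
  by rewrite -Rop_transition// -!transition_isom.
move=> sc ip k20 hk vr; set x := mcoord _ p; set g := gram _.
have Ux : chart_range (mchart_at p) x by exact: chart_rangeP.
have gs := gram_symp ip; have gp := gram_posp ip.
have as34 a b := Rop_antisym34 (@chart_range_open R n M _) (@gram_smooth' R n M (mchart_at p))
  (@gram_sym' R n M _) (@gram_pos' R n M _) u v a b Ux.
have uu0 := gram_ge0 u Ux; have vv0 := gram_ge0 v Ux.
have cs := cauchy_schwarz gs gp u v.
rewrite -/x -/g in uu0 vv0 cs vr *.
have R0 (c : R) : Rop g x (c *: v) v v = 0.
  rewrite /Rop !GamZl (dGamZ1 (@chart_range_open R n M _)
    (@gram_smooth' R n M (mchart_at p)) (@gram_pos' R n M _))// dGamZ2.
  by rewrite GamZr subrr add0r subrr.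
have [->|v0] := eqVneq v 0; first by rewrite bilin0r mulr_ge0.
rewrite as34.
have [[c uc]|nuc] := pselect (exists c : R, u = c *: v).
  by rewrite uc R0 bilin0l oppr0 mulr_ge0// -uc.
have nuc' (c : R) : u != c *: v by apply/eqP => uc; apply: nuc; exists c.
have /andP[h _] := sc p u v (row_free2 v0 nuc').
move: h; rewrite /sectional_curvature -/x -/g (curvature_opE (@chart_range_open R n M _)
    (@gram_smooth' R n M (mchart_at p)) (@gram_pos' R n M _))//.
have w0 : 0 < bilin (g x) (u - (bilin (g x) u v / bilin (g x) v v) *: v)
    (u - (bilin (g x) u v / bilin (g x) v v) *: v).
  by apply: gp; rewrite subr_eq0; exact: nuc'.
have vv : 0 < bilin (g x) v v by exact: gp.
have D0 : 0 < bilin (g x) u u * bilin (g x) v v - bilin (g x) u v ^+ 2.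
  move: w0; rewrite !bilinBl !bilinBr !bilinZl !bilinZr (bilinC v u gs) -/x -/g.
  move: vv; move: (bilin _ _ _) (bilin _ _ _) (bilin _ _ _) => a b c a0.
  rewrite divfK ?gt_eqF// subrr subr0 => h.
  have -> : b * c - a ^+ 2 = c * (b - a / c * a) by field; rewrite gt_eqF.
  by rewrite mulr_gt0.
rewrite ler_pdivlMr// => h.
have h2 : 0 <= bilin (g x) u v ^+ 2 by exact: sqr_ge0.
have [k0|k0] := leP 0 kmin.
  apply: le_trans (mulr_ge0 k20 uu0); rewrite oppr_le0; apply: le_trans h.
  by apply: mulr_ge0 => //; exact: ltW.
refine (le_trans _ (ler_wpM2r uu0 (hk k0))); rewrite (ltr0_norm k0).
have h3 := ler_wpM2l uu0 vr.
have h4 : kmin * (bilin (g x) u u * rho2) <= kmin * (bilin (g x) u u * bilin (g x) v v).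
  by rewrite ler_nM2l.
have h5 : kmin * bilin (g x) u v ^+ 2 <= 0 by rewrite nmulr_rle0.
move: h h4 h5.
move: (bilin _ _ _) (bilin _ _ _) (bilin _ _ _ ^+ 2) (bilin _ _ _) => *; lra.
Qed.

End Tensoriality.

(** * Barriers for the distance *)

(** The second order Taylor polynomial of the geodesic from [x] with velocity [w]. A barrier for
    second derivatives only sees points up to [o(s ^+ 2)], so this polynomial stands in for the
    exponential map. Its form makes it a transverse curve of the variation. *)
Definition jet (R : realType) (n : nat) (M : riemannianManifold R n) (i : mchart M)
  (x w : 'rV[R]_n) (s : R) : 'rV[R]_n := var_pos x w (- 2^-1 *: Gam (gram i) x w w) s.

Section Jets.
Variables (R : realType) (n : nat) (M : riemannianManifold R n).
Implicit Types (i j : mchart M) (p q : M) (x u v w : 'rV[R]_n).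
Hypothesis UG : uniquely_geodesic M.
Local Notation V := 'rV[R]_n.

Lemma dist_self p : dist p p = 0.
Proof. by rewrite (dist_glen UG) glen_self. Qed.

Lemma dist_chart_le i x : chart_range i x -> exists r K : R, [/\ 0 < r, 0 < K &
  forall a b : V, `|a - x| <= r -> `|b - x| <= r ->
    dist (mpoint i a) (mpoint i b) <= K * `|b - a|].
Proof.
move=> Ux; have [rho [r [cl [cu [ct [X H]]]]]] := geodesic_chart_exists UG Ux.
exists r, (`|cu| + 1); split; [exact: gc_r H|by rewrite ltr_wpDl|move=> a b ar br].
rewrite (dist_glen UG); apply: le_trans (gc_upper H ar br) _.
by rewrite ler_wpM2r// (le_trans (ler_norm cu))// lerDl.
Qed.

Lemma jet0 i x w : jet i x w 0 = x.
Proof. exact: var_pos0. Qed.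

Lemma is_derive_jet i x w (s : R) : is_derive s 1 (jet i x w) (w - s *: Gam (gram i) x w w).
Proof.
move: (is_derive_quad x w (- 2^-1 *: Gam (gram i) x w w) s).
apply: is_derive_eqr; rewrite scalerA mulrN scaleNr; congr (_ - _ *: _).
by rewrite mulrAC mulfV ?mul1r ?pnatr_eq0.
Qed.

Lemma dist_jet i (sg : R -> M) (y dy : R -> V) (e : R) :
  (\forall s \near (0 : R), mdom i (sg s) /\ mcoord i (sg s) = y s) ->
  (\forall s \near (0 : R), is_derive (s : R) 1 y (dy s)) ->
  is_derive (0 : R) 1 dy (- Gam (gram i) (y 0) (dy 0) (dy 0)) -> 0 < e ->
  exists2 d : R, 0 < d & forall s : R, `|s| < d ->
    dist (sg s) (mpoint i (jet i (y 0) (dy 0) s)) <= e * s ^+ 2.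
Proof.
move=> ny nd d2 e0.
have U0 : chart_range i (y 0) by have [h <-] := nbhs_singleton ny; exact: chart_rangeP.
have [r [K [r0 K0 hK]]] := dist_chart_le U0.
have [d1 d10 h1] := peano nd d2 (divr_gt0 e0 K0).
have cy := is_derive_continuous (nbhs_singleton nd).
have cj := is_derive_continuous (is_derive_jet i (y 0) (dy 0) 0).
have n1 : \forall s \near (0 : R), `|y s - y 0| < r.
  by apply: near_norm_lt cy _; rewrite subrr normr0.
have n2 : \forall s \near (0 : R), `|jet i (y 0) (dy 0) s - y 0| < r.
  by apply: near_norm_lt cj _; rewrite jet0 subrr normr0.
have [d2' d20 h2] := (nbhs_normP _ _).1 (filterI ny (filterI n1 n2)).
exists (Num.min d1 d2') => [|s]; first by rewrite lt_min d10.
rewrite lt_min => /andP[s1 s2].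
have [[ds ys] [q1 q2]] := h2 s ltac:(by rewrite subr0).
have := h1 s s1.
have -> : y 0 + s *: dy 0 + (s ^+ 2 / 2) *: - Gam (gram i) (y 0) (dy 0) (dy 0) =
    jet i (y 0) (dy 0) s.
  by rewrite /jet /var_pos scalerA mulrN scaleNr scalerN.
move=> h; rewrite -(mcoordK ds) ys; apply: le_trans (hK _ _ (ltW q1) (ltW q2)) _.
by rewrite distrC -ler_pdivlMl// mulrA [K^-1 * _]mulrC.
Qed.

(** The image of a jet under the transition satisfies the geodesic equation at 0, by the law of the
    Christoffel symbols, so [dist_jet] compares it with the jet in the other chart. *)
Lemma dist_jet_transition i j x w (e : R) : overlap j i x -> 0 < e ->
  exists2 d : R, 0 < d & forall s : R, `|s| < d ->
    dist (mpoint j (jet j x w s))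
      (mpoint i (jet i (transition j i x) ('D_w (transition j i) x) s)) <= e * s ^+ 2.
Proof.
move=> ox e0; set phi := transition j i.
have cj := is_derive_continuous (is_derive_jet j x w 0).
have ox0 : overlap j i (jet j x w 0) by rewrite jet0.
have nW : \forall s \near (0 : R), overlap j i (jet j x w s) :=
  cj _ (near_open (@overlap_open _ _ _ _ _) ox0).
have := @dist_jet i (fun s => mpoint j (jet j x w s)) (fun s => phi (jet j x w s))
  (fun s => 'D_(w - s *: Gam (gram j) x w w) phi (jet j x w s)) e.
rewrite jet0 scale0r subr0; apply => //.
- apply: filterS nW => s os; split => //.
  by have [_] := (overlapP _ _ _).1 os.
- apply: filterS nW => s os; apply: is_derive_diff_comp (is_derive_jet _ _ _ _).
  exact: transition_differentiable.
have dl : is_derive (0 : R) 1 (fun s : R => w - s *: Gam (gram j) x w w) (- Gam (gram j) x w w).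
  have := line_is_derive w (- Gam (gram j) x w w) 0; apply: is_derive_near.
  by near=> s; rewrite scalerN.
have := is_derive_differential (@overlap_open _ _ _ j i) (@transition_smooth _ _ _ j i) ox0
  (is_derive_jet j x w 0) dl.
rewrite jet0 scale0r subr0; apply: is_derive_eqr.
rewrite -[- Gam _ _ _ _]scaleN1r deriveZr; last exact: transition_differentiable.
by rewrite christoffel_transition// scaleN1r opprD addrCA subrr addr0.
Unshelve. all: by end_near. Qed.

End Jets.

(** It replaces the speed by an expression that is linear in the squared speed, with a free [lam].
    Bounds with the same [lam] add up over consecutive pieces, and [lam] is chosen at the very
    end. *)
Lemma am_gm_sqrt (R : realType) (q lam : R) : 0 <= q -> 0 < lam ->
  Num.sqrt q <= (q / lam + lam) / 2.
Proof.
move=> q0 l0; rewrite -[X in X / lam]sqr_sqrtr// ler_pdivlMr//.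
set a := Num.sqrt q; have -> : a ^+ 2 / lam + lam = ((a - lam) ^+ 2 + 2 * a * lam) / lam.
  by field; rewrite gt_eqF.
rewrite ler_pdivlMr//.
have := sqr_ge0 (a - lam); lra.
Qed.

Lemma chart_change_arith (R : realType) (z e S lam L t : R) : 0 < lam -> lam <= L -> 0 < e -> 0 <= S ->
  ((z + e / 2 * S) / lam + lam * t) / 2 + e / (4 * L) * S <= ((z + e * S) / lam + lam * t) / 2.
Proof.
move=> lam0 lamL e0 S0; have L0 := lt_le_trans lam0 lamL.
rewrite -subr_ge0.
have -> : ((z + e * S) / lam + lam * t) / 2 - (((z + e / 2 * S) / lam + lam * t) / 2 + e / (4 * L) * S)
    = (e * S / 4) * (lam^-1 - L^-1) by field; rewrite !gt_eqF.
rewrite mulr_ge0 ?subr_ge0 ?lef_pV2 ?posrE//.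
by rewrite divr_ge0// mulr_ge0// ltW.
Qed.

Lemma small_step (R : realType) (L d : R) : 0 <= L -> 0 < d -> d * (8 * (L + 1)) <= 1 ->
  4 * d <= 1 /\ L * (4 * d) <= 2^-1.
Proof. by move=> L0 d0 h; have := mulr_ge0 L0 (ltW d0); split; lra. Qed.

(** A primitive in [t] of the bound on the speed, by [(f * f1)' = f1 ^+ 2 + k2 * f ^+ 2]. The
    constants [b0] and [h0] are the inner products of the parallel field with the velocity and with
    itself. *)
Definition barrier_prim (R : realType) (f f1 : R -> R) (s b0 h0 l2 e lam t : R) : R :=
  f t * (s * b0 / lam) + f t * f1 t * (s ^+ 2 * h0 / (2 * lam))
  + t * (((l2 + e * s ^+ 2) / lam + lam) / 2).

Lemma is_derive_barrier_prim (R : realType) (f f1 : R -> R) (k2 s b0 h0 l2 e lam t : R) :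
  lam != 0 -> is_derive t 1 f (f1 t) -> is_derive t 1 f1 (k2 * f t) ->
  is_derive t 1 (barrier_prim f f1 s b0 h0 l2 e lam)
   (((l2 + 2 * s * f1 t * b0 + s ^+ 2 * ((f1 t ^+ 2 + k2 * f t ^+ 2) * h0 + e)) / lam + lam) / 2).
Proof.
move=> lam0 df df1.
have c (y : R) := is_derive_cst y t (1 : R).
have q1 := is_derive_mul df (c (s * b0 / lam)).
have q2 := is_derive_mul (is_derive_mul df df1) (c (s ^+ 2 * h0 / (2 * lam))).
have q3 := is_derive_mul (is_derive_id1 t) (c (((l2 + e * s ^+ 2) / lam + lam) / 2)).
have := is_deriveD (is_deriveD q1 q2) q3.
apply: is_derive_eqr; rewrite /cst; field; exact: lam0.
Qed.

Lemma barrier_arith (R : realType) (f f1 : R -> R) (s b1 b0 h1 h0 l2 e lam t1 t2 D A : R) :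
  0 < lam -> 0 <= e -> t1 <= t2 -> t2 - t1 <= 1 -> b1 = b0 -> h1 = h0 ->
  D <= ((l2 * t1 + 2 * s * f t1 * b1 + s ^+ 2 * (f t1 * f1 t1 * h1) + e / 2 * s ^+ 2) / lam
         + lam * t1) / 2 ->
  A <= barrier_prim f f1 s b0 h0 l2 (e / 2) lam t2 - barrier_prim f f1 s b0 h0 l2 (e / 2) lam t1 ->
  D + A <= ((l2 * t2 + 2 * s * f t2 * b0 + s ^+ 2 * (f t2 * f1 t2 * h0) + e * s ^+ 2) / lam
         + lam * t2) / 2.
Proof.
move=> lam0 e0 t12 t21 -> -> hD hA; apply: le_trans (lerD hD hA) _; rewrite -subr_ge0.
have -> : ((l2 * t2 + 2 * s * f t2 * b0 + s ^+ 2 * (f t2 * f1 t2 * h0) + e * s ^+ 2) / lam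
         + lam * t2) / 2 -
  (((l2 * t1 + 2 * s * f t1 * b0 + s ^+ 2 * (f t1 * f1 t1 * h0) + e / 2 * s ^+ 2) / lam
         + lam * t1) / 2 +
   (barrier_prim f f1 s b0 h0 l2 (e / 2) lam t2 - barrier_prim f f1 s b0 h0 l2 (e / 2) lam t1))
  = e * s ^+ 2 * (1 - (t2 - t1)) / (4 * lam).
  by rewrite /barrier_prim; field; rewrite gt_eqF.
apply: divr_ge0; last by rewrite mulr_ge0// ltW.
by rewrite mulr_ge0 ?subr_ge0// mulr_ge0// sqr_ge0.
Qed.

(** * Propagation of the barrier along a geodesic *)

Section Barrier.
Variables (R : realType) (n : nat) (M : riemannianManifold R n).
Implicit Types (i j : mchart M) (x u v w : 'rV[R]_n).
Hypothesis UG : uniquely_geodesic M.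
Local Notation V := 'rV[R]_n.
Variables (c : R -> M) (dc : R) (f f1 : R -> R) (kmin kmax k2 l2 : R).
Hypothesis dc0 : 0 < dc.
Hypothesis gc : forall t : R, - dc < t < 1 + dc -> geodesic_at c t.
Hypothesis sc : sectional_curvature_in M kmin kmax.
Hypothesis df : forall t : R, is_derive t 1 f (f1 t).
Hypothesis df1 : forall t : R, is_derive t 1 f1 (k2 * f t).
Hypothesis f0 : f 0 = 0.
Hypothesis k20 : 0 <= k2.
Hypothesis hk2 : kmin < 0 -> `|kmin| * l2 <= k2.
Hypothesis l2E : inner (c 0) (velocity c 0) (velocity c 0) = l2.

Definition cpos i (t : R) : V := mcoord i (c t).
Definition cvel i (t : R) : V := derive1 (mcoord i \o c) t.

(** A bound for the integral over [0, t] of the squared speed of the varied curve. The index form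
    integrates to the boundary value [f t * f1 t * <u, u>], since [f 0 = 0]. *)
Definition bar_rhs i (t s e : R) u : R := l2 * t
  + 2 * s * f t * bilin (gram i (cpos i t)) u (cvel i t)
  + s ^+ 2 * (f t * f1 t * bilin (gram i (cpos i t)) u u) + e * s ^+ 2.

(** All directions [u] at once, since the parallel field of the next stretch decides which one is
    used. [lam] is bounded by [L], and [d] is chosen before it, so that an error in [s ^+ 2] on the
    distance can be absorbed into [e] when the chart changes. *)
Definition barrier i (t : R) : Prop := mdom i (c t) /\
  forall u (L e : R), 0 < L -> 0 < e -> exists2 d : R, 0 < d &
  forall s lam : R, `|s| < d -> 0 < lam <= L ->
    dist (c 0) (mpoint i (jet i (cpos i t) (f t *: u) s)) <=
      (bar_rhs i t s e u / lam + lam * t) / 2.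

Lemma in_dc t : 0 <= t <= 1 -> - dc < t < 1 + dc.
Proof. by move: dc0 => d0 /andP[h1 h2]; apply/andP; split; lra. Qed.

Lemma curve_chart i t : - dc < t < 1 + dc -> mdom i (c t) ->
  [/\ chart_range i (cpos i t), is_derive t 1 (cpos i) (cvel i t),
   is_derive t 1 (cvel i) (- Gam (gram i) (cpos i t) (cvel i t) (cvel i t)) &
   bilin (gram i (cpos i t)) (cvel i t) (cvel i t) = l2].
Proof.
move=> tc it; have [ct nd d2] := geodesic_atP (gc tc) it.
have d1 := nbhs_singleton nd.
apply: (And4 (chart_rangeP it) d1 d2).
rewrite -l2E; apply: etrans (esym (sq_speedE ct it d1)) _.
apply: (geodesic_const_speed gc tc); exact: in_dc (zero_in01 R).
Qed.

Lemma barrier0 i : mdom i (c 0) -> barrier i 0.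
Proof.
move=> i0; split=> // u L e L0 e0; exists 1 => // s lam _ /andP[lam0 _].
rewrite f0 scale0r /jet /var_pos Gam0l !scaler0 !addr0 mcoordK// (dist_self UG).
rewrite /bar_rhs f0 !mulr0 !mul0r !mulr0 !add0r addr0.
have h := mulr_ge0 (ltW e0) (sqr_ge0 s).
exact: divr_ge0 (divr_ge0 h (ltW lam0)) (ler0n _ _).
Qed.

Lemma barrier_chart i j t : 0 <= t <= 1 -> barrier i t -> mdom j (c t) -> barrier j t.
Proof.
move=> t01 [it hi] jt; split=> // u L e L0 e0.
have tc := in_dc t01.
have [Ui di _ _] := curve_chart tc it; have [Uj dj _ _] := curve_chart tc jt.
have [ct _] := gc tc.
have ox : overlap j i (cpos j t) by exact: overlap_coord.
set phi := transition j i.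
have e2 : 0 < e / 2 by rewrite divr_gt0.
have [d1 d10 h1] := hi ('D_u phi (cpos j t)) L (e / 2) L0 e2.
have e4 : 0 < e / (4 * L) by rewrite divr_gt0// mulr_gt0.
have [d2 d20 h2] := dist_jet_transition UG (f t *: u) ox e4.
exists (Num.min d1 d2) => [|s lam]; first by rewrite lt_min d10.
rewrite lt_min => /andP[s1 s2] lamL; have /andP[lam0 lamL'] := lamL.
have := h1 s lam s1 lamL; have := h2 s s2.
have -> : transition j i (cpos j t) = cpos i t by exact: transition_coord.
rewrite deriveZr; last exact: transition_differentiable.
rewrite -/phi; move: (mpoint j _) (mpoint i _) => a b hab hb.
have tri : dist (c 0) a <= dist (c 0) b + dist b a by exact: UG_triangle.
rewrite (dist_sym UG b a) in tri.
have vE : cvel i t = 'D_(cvel j t) phi (cpos j t).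
  exact: (is_derive_unique di (is_derive_transition ct jt it dj)).
have xE : phi (cpos j t) = cpos i t by exact: transition_coord.
have iso (y y' : V) : bilin (gram i (cpos i t)) ('D_y phi (cpos j t)) ('D_y' phi (cpos j t)) =
    bilin (gram j (cpos j t)) y y' by rewrite -xE -transition_isom.
move: hb; rewrite /bar_rhs vE !iso => hb.
apply: le_trans tri (le_trans (lerD hb hab) _).
by apply: chart_change_arith => //; exact: sqr_ge0.
Qed.

(** The radius [5 * d] leaves room for a parallel field on the interval of radius [4 * d] around any
    time within [d] of [t0]. *)
Lemma good_interval i t0 : 0 <= t0 <= 1 -> mdom i (c t0) -> exists d L : R,
  [/\ 0 < d, 4 * d <= 1, 0 <= L, L * (4 * d) <= 2^-1 &
  forall t : R, `|t - t0| < 5 * d -> [/\ - dc < t < 1 + dc, mdom i (c t) &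
     forall w, `|Gam (gram i) (cpos i t) (cvel i t) w| <= L * `|w|]].
Proof.
move=> t01 it; have tc := in_dc t01.
have [Ui di d2i _] := curve_chart tc it; have [ct _] := gc tc.
have [rho [K [lam [rho0 K0 _ _ [hG _ _ _ _]]]]] :=
  local_constants (@chart_range_open _ _ _ i) (@gram_smooth' _ _ _ i) (@gram_pos' _ _ _ i) Ui.
have n1 : \forall t \near t0, - dc < t < 1 + dc by exact: near_interval tc _.
have n2 := near_dom ct it.
have n3 : \forall t \near t0, `|cpos i t - cpos i t0| < rho.
  by apply: near_norm_lt (is_derive_continuous di) _; rewrite subrr normr0.
have n4 : \forall t \near t0, `|cvel i t - cvel i t0| < 1.
  by apply: near_norm_lt (is_derive_continuous d2i) _; rewrite subrr normr0.
have [e e0 he] := (nbhs_normP _ _).1 (filterI (filterI n1 n2) (filterI n3 n4)).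
pose L := K * (`|cvel i t0| + 1).
have L0 : 0 <= L by rewrite mulr_ge0 ?addr_ge0// ltW.
pose d := Num.min (e / 5) (8 * (L + 1))^-1.
have L1 : 0 < 8 * (L + 1) by rewrite mulr_gt0// ltr_wpDl.
have d0 : 0 < d by rewrite lt_min divr_gt0//= invr_gt0.
have de : d <= e / 5 by rewrite ge_min lexx.
have dL : d * (8 * (L + 1)) <= 1.
  by rewrite -ler_pdivlMr// div1r ge_min lexx orbT.
have [d41 Ld] := small_step L0 d0 dL.
exists d, L; split=> //.
move=> t td; have [|[h1 h2] [h3 h4]] := he t; first by lra.
split=> // w; apply: le_trans (hG _ _ _ (ltW h3)) _.
rewrite ler_wpM2r// /L ler_wpM2l ?ltW//.
have := ler_normB (cvel i t - cvel i t0) (- cvel i t0).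
by rewrite opprK subrK normrN; move: h4; move: `|_| `|_| `|_| => *; lra.
Qed.

Lemma parallel_exists i t1 (d L : R) u : 0 < d -> d <= 1 -> 0 <= L -> L * d <= 2^-1 ->
  (forall t : R, `|t - t1| <= d -> [/\ - dc < t < 1 + dc, mdom i (c t) &
     forall w, `|Gam (gram i) (cpos i t) (cvel i t) w| <= L * `|w|]) ->
  exists E : R -> V, E t1 = u /\ forall t, `|t - t1| < d ->
    is_derive t 1 E (- Gam (gram i) (cpos i t) (cvel i t) (E t)).
Proof.
move=> d0 d1 L0 Ld h.
have h' (t : R) : - d <= t <= d -> `|t1 + t - t1| <= d by rewrite addrC addKr ler_norml.
have [|t w w' td|y cy|E0 [E00 hE]] := @linear_ode_exists R n
  (fun t w => - Gam (gram i) (cpos i (t1 + t)) (cvel i (t1 + t)) w) d L u d0 d1 L0 Ld.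
- by move=> t _; rewrite Gam0r oppr0.
- have [_ _ hL] := h _ (h' t td).
  have -> : - Gam (gram i) (cpos i (t1 + t)) (cvel i (t1 + t)) w
      - - Gam (gram i) (cpos i (t1 + t)) (cvel i (t1 + t)) w' =
      - Gam (gram i) (cpos i (t1 + t)) (cvel i (t1 + t)) (w - w').
    by rewrite -[w - w']addrC -[- w']scaleN1r GamDr GamZr scaleN1r opprD !opprK addrC.
  by rewrite normrN; exact: hL.
- move=> t; have dd : - d <= d by move: d0; lra.
  have [tc it _] := h _ (h' _ (clamp_in t dd)).
  have [Ui di d2i _] := curve_chart tc it.
  have cc : {for t, continuous (fun t : R => t1 + clamp (- d) d t)}.
    by apply: continuousD_at; [exact: continuous_cst_at|exact: clamp_continuous].
  have cx : {for t, continuous (fun t : R => cpos i (t1 + clamp (- d) d t))} :=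
    continuous_comp cc (is_derive_continuous di).
  have cv : {for t, continuous (fun t : R => cvel i (t1 + clamp (- d) d t))} :=
    continuous_comp cc (is_derive_continuous d2i).
  have cyt : {for t, continuous y} by exact: cy.
  have cG := @Gam_continuous R n _ _ (@chart_range_open _ _ _ i) (@gram_smooth' _ _ _ i)
    (@gram_pos' _ _ _ i) R (fun t : R => cpos i (t1 + clamp (- d) d t))
    (fun t : R => cvel i (t1 + clamp (- d) d t)) y t Ui cx cv cyt.
  exact: (cvgN cG).
exists (fun t => E0 (- t1 + 1 * t)); split; first by rewrite mul1r addNr.
move=> t td.
have td' : - d < - t1 + 1 * t < d by move: td; rewrite mul1r addrC ltr_norml.
have := is_derive_affine (hE _ td').
apply: is_derive_eqr; rewrite scale1r; have -> // : t1 + (- t1 + 1 * t) = t by ring.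
Qed.

Lemma dist_chart_curve i (y z : R -> V) (Psi psi : R -> R) (t1 t2 d : R) :
  t1 <= t2 -> t2 - t1 <= 1 -> 0 < d ->
  (forall t : R, t1 - d < t < t2 + d ->
     [/\ chart_range i (y t), is_derive t 1 y (z t) & {for t, continuous z}]) ->
  (forall t : R, t1 <= t <= t2 -> is_derive t 1 Psi (psi t) /\
     Num.sqrt (bilin (gram i (y t)) (z t) (z t)) <= psi t) ->
  dist (mpoint i (y t1)) (mpoint i (y t2)) <= Psi t2 - Psi t1.
Proof.
move=> t12 t21 d0 hy hP; pose al (r : R) := t1 + (t2 - t1) * r.
pose sg (r : R) := mpoint i (y (al r)).
have [al0 al1] : al 0 = t1 /\ al 1 = t2 by rewrite /al mulr0 addr0 mulr1 addrC subrK.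
have t120 : 0 <= t2 - t1 by rewrite subr_ge0.
have in1 r : - d < r < 1 + d -> t1 - d < al r < t2 + d.
  move=> /andP[r1 r2]; rewrite /al.
  have [r0|r0] := leP 0 r.
    have q1 := mulr_ge0 t120 r0.
    have [r3|r3] := leP r 1.
      by have q2 := ler_wpM2l t120 r3; apply/andP; split; lra.
    have q3 : 0 <= r - 1 by lra.
    by have q2 := ler_wpM2r q3 t21; apply/andP; split; lra.
  have q3 : 0 <= - r by lra.
  by have q2 := ler_wpM2r q3 t21; have q4 := mulr_ge0 t120 q3; apply/andP; split; lra.
have in2 r : 0 <= r <= 1 -> t1 <= al r <= t2.
  by move=> /andP[r1 r2]; rewrite /al; have q1 := mulr_ge0 t120 r1;
    have q2 := ler_wpM2l t120 r2; apply/andP; split; lra.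
have dy r : - d < r < 1 + d -> is_derive r 1 (fun r => y (al r)) ((t2 - t1) *: z (al r)).
  by move=> /in1 /hy[_ h _]; exact: is_derive_affine.
have csg r : - d < r < 1 + d -> {for r, continuous sg}.
  move=> rd; have [Uy _ _] := hy _ (in1 _ rd).
  exact: (continuous_comp (is_derive_continuous (dy r rd)) (mpoint_continuous Uy)).
have C1 : C1_curve sg.
  exists d => // r rd; have [Uy _ cz] := hy _ (in1 _ rd).
  apply: (@C1_at_chart _ _ _ i sg (fun r => y (al r)) (fun r => (t2 - t1) *: z (al r)) r (csg r rd)).
  - apply: near_interval rd _ => r' rd'; have [Uy' _ _] := hy _ (in1 _ rd').
    by split; [exact: mpoint_dom|exact: mpointK].
  - by apply: near_interval rd _ => r' rd'; exact: dy.
  apply: continuous_scale; first exact: continuous_cst_at.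
  have cal : {for r, continuous al}.
    exact: (is_derive_continuous (is_derive_affine (is_derive_id1 _))).
  exact: (continuous_comp cal cz).
have := dist_le (piecewise1 C1); rewrite /sg al0 al1 => /le_trans; apply.
rewrite -al0 -al1.
apply: (@curve_length_le _ _ _ sg (fun r => Psi (al r)) (fun r => (t2 - t1) * psi (al r)) C1) => r r01.
  have [h _] := hP _ (in2 _ r01); exact: is_derive_affine.
have rd : - d < r < 1 + d by case/andP: r01 => *; apply/andP; split; lra.
have [Uy _ _] := hy _ (in1 _ rd); have [_ h] := hP _ (in2 _ r01).
have Esg : \forall r' \near r, y (al r') = (mcoord i \o sg) r'.
  apply: near_interval rd _ => r' rd'; have [Uy' _ _] := hy _ (in1 _ rd').
  by rewrite /= mpointK.
rewrite (speedE (csg r rd) (mpoint_dom Uy) (is_derive_near Esg (dy r rd))) mpointK//.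
rewrite bilinZl bilinZr mulrA -expr2 sqrtrM ?sqr_ge0// sqrtr_sqr ger0_norm//.
exact: ler_wpM2l.
Qed.

(** The field [E] is parallel with [E t2 = u]. The barrier at [t1], in the direction [E t1], covers
    the curve up to [t1], and the varied curve in the chart covers [t1, t2]; each is given the error
    [e / 2]. At [t2] the varied curve ends on the jet of [f t2 *: u]. *)
Lemma barrier_step i t0 : 0 <= t0 <= 1 -> mdom i (c t0) -> exists2 d : R, 0 < d &
  forall t1 t2 : R, 0 <= t1 <= 1 -> 0 <= t2 <= 1 -> `|t1 - t0| < d -> `|t2 - t0| < d ->
  t1 <= t2 -> barrier i t1 -> barrier i t2.
Proof.
move=> t01 it; have [d [L [d0 d41 L0 Ld hd]]] := good_interval t01 it.
exists d => // t1 t2 t1c t2c t1d t2d t12 [it1 h1].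
have hd2 t : `|t - t2| <= 4 * d -> `|t - t0| < 5 * d.
  move=> h; have := ler_normD (t - t2) (t2 - t0).
  by rewrite addrA subrK; move: h t2d; move: `|_| `|_| `|_| => *; lra.
have [|_ it2 _] := hd t2.
  by apply: hd2; rewrite subrr normr0; lra.
split=> // u L' e L'0 e0.
have d40 : 0 < 4 * d by rewrite mulr_gt0.
have [E [Eu dE]] := @parallel_exists i t2 (4 * d) L u d40 d41 L0 Ld (fun t h => hd t (hd2 t h)).
pose a := t2 - 4 * d; pose b := t2 + 4 * d.
have ab t : a < t < b -> `|t - t2| < 4 * d.
  by rewrite /a /b ltr_norml => /andP[p q]; apply/andP; split; lra.
have abd t : a < t < b -> - dc < t < 1 + dc /\ mdom i (c t).
  by move=> /ab/ltW/hd2/hd[].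
have x_in t : a < t < b -> chart_range i (cpos i t).
  by move=> /abd[q1 q2]; have [] := curve_chart q1 q2.
have dx t : a < t < b -> is_derive t 1 (cpos i) (cvel i t).
  by move=> /abd[q1 q2]; have [] := curve_chart q1 q2.
have dv t : a < t < b -> is_derive t 1 (cvel i) (- Gam (gram i) (cpos i t) (cvel i t) (cvel i t)).
  by move=> /abd[q1 q2]; have [] := curve_chart q1 q2.
have vv t : a < t < b -> bilin (gram i (cpos i t)) (cvel i t) (cvel i t) = l2.
  by move=> /abd[q1 q2]; have [] := curve_chart q1 q2.
have dE' t : a < t < b -> is_derive t 1 E (- Gam (gram i) (cpos i t) (cvel i t) (E t)).
  by move=> /ab; exact: dE.
have curv t w : a < t < b ->
    bilin (gram i (cpos i t)) (Rop (gram i) (cpos i t) w (cvel i t) w) (cvel i t) <=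
    k2 * bilin (gram i (cpos i t)) w w.
  move=> tab; have [q1 q2] := abd t tab.
  by apply: (curvature_le_chart (rho2 := l2) w sc q2 k20 hk2); rewrite -/(cpos i t) vv.
have o := @chart_range_open _ _ M i; have gS := @gram_smooth' _ _ M i.
have gs := @gram_sym' _ _ M i; have gp := @gram_pos' _ _ M i.
have t1d2 : t2 - t1 < 2 * d.
  by move: t1d t2d; rewrite !ltr_norml => /andP[? ?] /andP[? ?]; lra.
have e2 : 0 < e / 2 by rewrite divr_gt0.
have [|||d1 d10 hd1] := @var_sq_le R n _ _ o gS gs gp (cpos i) (cvel i) E f f1 k2 a b
  x_in dx dv dE' df df1 curv (t1 - d) (t2 + d) (e / 2) _ _ _ e2.
- by rewrite /a; lra.
- by lra.
- by rewrite /b; lra.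
have [d2 d20 hd2'] := h1 (E t1) L' (e / 2) L'0 e2.
exists (Num.min d1 d2) => [|s lam]; first by rewrite lt_min d10.
rewrite lt_min => /andP[s1 s2] lamL; have /andP[lam0 _] := lamL.
have in_ab t : t1 - d <= t <= t2 + d -> a < t < b.
  by rewrite /a /b => /andP[? ?]; apply/andP; split; lra.
have in12 t : t1 <= t <= t2 -> t1 - d <= t <= t2 + d.
  by move=> /andP[? ?]; apply/andP; split; lra.
have dE0 t : a < t < b -> is_derive t 1 (fun t => bilin (gram i (cpos i t)) (E t) (cvel i t)) 0.
  move=> tab; have := is_derive_metric o gS gs gp (x_in t tab) (dx t tab) (dE' t tab) (dv t tab).
  by apply: is_derive_eqr; rewrite !addNr bilin0l bilin0r addr0.
have dE1 t : a < t < b -> is_derive t 1 (fun t => bilin (gram i (cpos i t)) (E t) (E t)) 0.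
  move=> tab; have := is_derive_metric o gS gs gp (x_in t tab) (dx t tab) (dE' t tab) (dE' t tab).
  by apply: is_derive_eqr; rewrite !addNr bilin0l bilin0r addr0.
have cst (F : R -> R) : (forall t, a < t < b -> is_derive t 1 F 0) ->
    forall t, t1 <= t <= t2 -> F t = F t2.
  move=> hF t /andP[q1 q2]; apply: derive0_cst q2 _ => r /andP[r1 r2]; apply: hF.
  by apply: in_ab; apply: in12; rewrite r2 (le_trans q1).
have bE := cst _ dE0; have hE := cst _ dE1.
have t21 : t2 - t1 <= 1 by lra.
have t12' : t1 <= t1 <= t2 by rewrite lexx.
have t22' : t1 <= t2 <= t2 by rewrite lexx andbT.
pose y t := var_curve (gram i) (cpos i) E f s t.
pose z t := var_speed (gram i) (cpos i) (cvel i) E f f1 s t.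
have step : dist (mpoint i (y t1)) (mpoint i (y t2)) <=
    barrier_prim f f1 s (bilin (gram i (cpos i t2)) (E t2) (cvel i t2))
      (bilin (gram i (cpos i t2)) (E t2) (E t2)) l2 (e / 2) lam t2
    - barrier_prim f f1 s (bilin (gram i (cpos i t2)) (E t2) (cvel i t2))
      (bilin (gram i (cpos i t2)) (E t2) (E t2)) l2 (e / 2) lam t1.
  apply: (@dist_chart_curve i y z _ (fun t => ((l2 + 2 * s * f1 t * bilin (gram i (cpos i t2)) (E t2) (cvel i t2)
     + s ^+ 2 * ((f1 t ^+ 2 + k2 * f t ^+ 2) * bilin (gram i (cpos i t2)) (E t2) (E t2) + e / 2)) / lam + lam) / 2)
     t1 t2 d t12 t21 d0) => t tt.
    have tt' : t1 - d <= t <= t2 + d by case/andP: tt => q1 q2; rewrite !ltW.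
    have tab := in_ab t tt'; have [Uy _] := hd1 s t s1 tt'.
    have dyt : is_derive t 1 y (z t).
      exact: (is_derive_var_curve o gS gp x_in dx dE' df).
    apply: (And3 Uy dyt).
    have [_ cv _ cW1 [_ cA1]] := var_curves_continuous o gS gp x_in dx dv dE' df df1 tab.
    have cs := @continuous_cst_at R R s t; have cs2 := @continuous_cst_at R R (s ^+ 2) t.
    exact: (continuousD_at (continuousD_at cv (continuous_scale cs cW1)) (continuous_scale cs2 cA1)).
  have tab := in_ab t (in12 t tt).
  split; first by apply: is_derive_barrier_prim => //; rewrite gt_eqF.
  have [Uy hG] := hd1 s t s1 (in12 t tt).
  have G0 : 0 <= var_sq (gram i) (cpos i) (cvel i) E f f1 s t by exact: gram_ge0.
  rewrite -(bE t tt) -(hE t tt) -(vv t tab).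
  apply: le_trans (am_gm_sqrt (le_trans G0 hG) lam0).
  by rewrite ler_wsqrtr.
have h := hd2' s lam s2 lamL.
have tri : dist (c 0) (mpoint i (y t2)) <= dist (c 0) (mpoint i (y t1))
    + dist (mpoint i (y t1)) (mpoint i (y t2)) by exact: UG_triangle.
have <- : y t2 = jet i (cpos i t2) (f t2 *: u) s by rewrite -Eu.
apply: le_trans tri _; rewrite /bar_rhs -Eu.
exact: (barrier_arith lam0 (ltW e0) t12 t21 (bE t1 t12') (hE t1 t12') h step).
Qed.

Lemma barrier1 i : mdom i (c 1) -> barrier i 1.
Proof.
move=> i1; have i0 : mdom (mchart_at (c 0)) (c 0) by exact: mdom_chart_at.
have [//|||j hj] := @local_propagation R (fun t => exists i, barrier i t) 0 1.
- by exists (mchart_at (c 0)); exact: barrier0.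
- move=> t t01; set j := mchart_at (c t); have jt : mdom j (c t) by exact: mdom_chart_at.
  have [d d0 hd] := barrier_step t01 jt.
  have [ct _] := gc (in_dc t01).
  have [d' d'0 hd'] := (nbhs_normP _ _).1 (near_dom ct jt).
  exists (Num.min d d') => [|s1 s2 s1c s2c]; first by rewrite lt_min d0.
  rewrite !lt_min => /andP[q1 q2] /andP[q3 q4] s12 [i' hi'].
  exists j; apply: (hd s1 s2) => //.
  by apply: barrier_chart hi' _ => //; exact: hd'.
exact: barrier_chart (one_in01 R) hj i1.
Qed.

End Barrier.

(** * Uniqueness of the geodesic with a given initial velocity *)

Lemma gam_diff_arith (R : realType) (K B p q a b : R) : 0 <= K -> 0 <= p -> 0 <= q ->
  0 <= a -> 0 <= b -> a <= B -> b <= B ->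
  K * p * b * b + (K * q * a + K * b * q) <= (K * B ^+ 2 + 2 * K * B) * (p + q).
Proof.
move=> K0 p0 q0 a0 b0 aB bB; have B0 := le_trans a0 aB.
have h1 : b * b <= B * B by exact: ler_pM.
have h2 := ler_wpM2l (mulr_ge0 K0 p0) h1.
have h3 := ler_wpM2l (mulr_ge0 K0 q0) aB; have h4 := ler_wpM2l (mulr_ge0 K0 q0) bB.
have h5 := mulr_ge0 (mulr_ge0 K0 q0) (mulr_ge0 B0 B0).
have h6 := mulr_ge0 (mulr_ge0 K0 p0) B0.
rewrite expr2; lra.
Qed.

Lemma norm_lt2 (R : realType) (V : normedModType R) (a b c : V) :
  `|a - c| < 1 -> `|b - c| < 1 -> `|a - b| <= 2.
Proof.
move=> h1 h2; have := ler_normB (a - c) (b - c); rewrite opprB addrA subrK.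
by move: h1 h2; move: `|_| `|_| `|_| => *; lra.
Qed.

Lemma Gam_diff (R : realType) (n : nat) (g : 'rV[R]_n -> 'M[R]_n) (x y v w : 'rV[R]_n) :
  - Gam g x v v - - Gam g y w w =
  (Gam g y w w - Gam g x w w) - (Gam g x (v - w) v + Gam g x w (v - w)).
Proof.
rewrite GamDl GamDr -[- w]scaleN1r GamZl GamZr !scaleN1r.
move: (Gam g x v v) (Gam g y w w) (Gam g x w w) (Gam g x w v) => a b c d.
by apply/rowP => k; rewrite !mxE; ring.
Qed.

Section ExpUnique.
Variables (R : realType) (n : nat) (M : riemannianManifold R n).
Implicit Types (i j : mchart M) (p q : M) (x u v w : 'rV[R]_n).
Local Notation V := 'rV[R]_n.

(** On an interval this short the supremum of [|v - w|] is at most half of itself. *)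
Lemma gronwall_zero (x y v w : R -> V) (s0 d A : R) : 0 <= A -> 0 < d -> d <= 1 -> 4 * A * d <= 1 ->
  x s0 = y s0 -> v s0 = w s0 ->
  (forall s : R, s0 - d <= s <= s0 + d -> is_derive s 1 x (v s) /\ is_derive s 1 y (w s)) ->
  (exists dv dw : R -> V, forall s : R, s0 - d <= s <= s0 + d ->
     [/\ is_derive s 1 v (dv s), is_derive s 1 w (dw s) &
      `|dv s - dw s| <= A * (`|x s - y s| + `|v s - w s|)]) ->
  (exists K : R, forall s : R, s0 - d <= s <= s0 + d -> `|v s - w s| <= K) ->
  forall s : R, s0 - d <= s <= s0 + d -> x s = y s /\ v s = w s.
Proof.
move=> A0 d0 d1 Ad xy0 vw0 hx [dv [dw hv]] [K hK].
have s0in : s0 - d <= s0 <= s0 + d by apply/andP; split; lra.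
have dist0 (s : R) : s0 - d <= s <= s0 + d -> `|s - s0| <= d.
  by rewrite ler_norml => /andP[? ?]; apply/andP; split; lra.
have xm (m : R) : 0 <= m -> (forall s : R, s0 - d <= s <= s0 + d -> `|v s - w s| <= m) ->
    forall s : R, s0 - d <= s <= s0 + d -> `|x s - y s| <= m * d.
  move=> m0 hm s sd.
  have D (t : R) : s0 - d <= t <= s0 + d -> is_derive t 1 (fun s => x s - y s) (v t - w t).
    by move=> /hx[h1 h2]; exact: is_deriveB.
  have := derive_norm_le2 D hm s0in sd.
  rewrite xy0 subrr subr0 => /le_trans; apply; apply: ler_wpM2l => //; exact: dist0.
have half (m : R) : 0 <= m -> (forall s : R, s0 - d <= s <= s0 + d -> `|v s - w s| <= m) ->
    forall s : R, s0 - d <= s <= s0 + d -> `|v s - w s| <= m / 2.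
  move=> m0 hm s sd.
  have D (t : R) : s0 - d <= t <= s0 + d -> is_derive t 1 (fun s => v s - w s) (dv t - dw t).
    by move=> /hv[h1 h2 _]; exact: is_deriveB.
  have B (t : R) : s0 - d <= t <= s0 + d -> `|dv t - dw t| <= A * (m * d + m).
    move=> td; have [_ _ h] := hv t td; apply: le_trans h _; apply: ler_wpM2l => //.
    by apply: lerD; [exact: xm|exact: hm].
  have := derive_norm_le2 D B s0in sd.
  rewrite vw0 subrr subr0 => /le_trans; apply.
  have Am : 0 <= A * (m * d + m) by rewrite mulr_ge0// addr_ge0// mulr_ge0// ltW.
  apply: le_trans (ler_wpM2l Am (dist0 s sd)) _.
  have h1 : m * d <= m * 1 by apply: ler_wpM2l.
  have Ad0 : 0 <= A * d by rewrite mulr_ge0// ltW.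
  have h2 := ler_wpM2l Ad0 h1; have h3 := ler_wpM2l m0 Ad; lra.
pose S := [set `|v s - w s| | s in [set s : R | s0 - d <= s <= s0 + d]].
have supS : has_sup S.
  split; first by exists `|v s0 - w s0|; exists s0.
  by exists K => _ [s sd <-]; exact: hK.
have ubS (s : R) : s0 - d <= s <= s0 + d -> `|v s - w s| <= sup S.
  by move=> sd; apply: (sup_upper_bound supS); exists s.
have sup0 : 0 <= sup S by apply: le_trans (ubS s0 s0in).
have : sup S <= sup S / 2.
  apply: ge_sup; first by case: supS.
  by move=> _ [s sd <-]; exact: half.
move=> h2; have sS : sup S = 0 by apply/eqP; rewrite eq_le sup0 andbT; lra.
move=> s sd; have := ubS s sd; rewrite sS normr_le0 subr_eq0 => /eqP vw.
have := xm (sup S) sup0 ubS s sd; rewrite sS mul0r normr_le0 subr_eq0 => /eqP xy.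
by split.
Qed.

Definition agree (c c' : R -> M) (t : R) : Prop := c t = c' t /\
  exists2 i, mdom i (c t) & derive1 (mcoord i \o c) t = derive1 (mcoord i \o c') t.

Lemma agree_chart c c' t j : geodesic_at c t -> geodesic_at c' t -> agree c c' t ->
  mdom j (c t) -> derive1 (mcoord j \o c) t = derive1 (mcoord j \o c') t.
Proof.
move=> g g' [e [i it h]] jt.
have it' : mdom i (c' t) by rewrite -e.
have jt' : mdom j (c' t) by rewrite -e.
have [ct nd _] := geodesic_atP g it; have [ct' nd' _] := geodesic_atP g' it'.
have [_ ndj _] := geodesic_atP g jt; have [_ ndj' _] := geodesic_atP g' jt'.
rewrite (is_derive_unique (nbhs_singleton ndj) (is_derive_transition ct it jt (nbhs_singleton nd))).
rewrite (is_derive_unique (nbhs_singleton ndj') (is_derive_transition ct' it' jt' (nbhs_singleton nd'))).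
by rewrite h e.
Qed.

Lemma agree_local c c' s0 : (\forall s \near s0, geodesic_at c s /\ geodesic_at c' s) ->
  agree c c' s0 -> \forall s \near s0, agree c c' s.
Proof.
move=> ng ag; have [g g'] := nbhs_singleton ng; have [e [i it h]] := ag.
have it' : mdom i (c' s0) by rewrite -e.
have [ct nd d2] := geodesic_atP g it; have [ct' nd' d2'] := geodesic_atP g' it'.
have Ui := chart_rangeP it.
have [rho [K [lam [rho0 K0 _ _ [hG hL _ _ _]]]]] :=
  local_constants (@chart_range_open _ _ _ i) (@gram_smooth' _ _ _ i) (@gram_pos' _ _ _ i) Ui.
pose x s := mcoord i (c s); pose y s := mcoord i (c' s).
pose v s := derive1 (mcoord i \o c) s; pose w s := derive1 (mcoord i \o c') s.
have xy : x s0 = y s0 by rewrite /x /y e.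
have cx := is_derive_continuous (nbhs_singleton nd).
have cy := is_derive_continuous (nbhs_singleton nd').
have n1 : \forall s \near s0, `|x s - x s0| < rho.
  by apply: near_norm_lt cx _; rewrite subrr normr0.
have n2 : \forall s \near s0, `|y s - x s0| < rho.
  by rewrite xy; apply: near_norm_lt cy _; rewrite subrr normr0.
pose B := `|v s0| + 1.
have n3 : \forall s \near s0, `|v s - v s0| < 1.
  by apply: near_norm_lt (is_derive_continuous d2) _; rewrite subrr normr0.
have n4 : \forall s \near s0, `|w s - v s0| < 1.
  by rewrite /v h; apply: near_norm_lt (is_derive_continuous d2') _; rewrite subrr normr0.
have n5 : \forall s \near s0, mdom i (c s) /\ mdom i (c' s).
  exact: filterI (near_dom ct it) (near_dom ct' it').
have [e0 e00 he] := (nbhs_normP _ _).1 (filterI (filterI ng n5) (filterI (filterI n1 n2) (filterI n3 n4))).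
have B0 : 0 <= B by rewrite addr_ge0.
pose A := K * B ^+ 2 + 2 * K * B.
have A0 : 0 <= A by rewrite addr_ge0 ?mulr_ge0 ?exprn_ge0// ltW.
pose d := Num.min (e0 / 2) (4 * (A + 1))^-1.
have A1 : 0 < 4 * (A + 1) by rewrite mulr_gt0// ltr_wpDl.
have d0 : 0 < d by rewrite lt_min divr_gt0//= invr_gt0.
have de : d <= e0 / 2 by rewrite ge_min lexx.
have dA : d * (4 * (A + 1)) <= 1 by rewrite -ler_pdivlMr// div1r ge_min lexx orbT.
have Ad0 := mulr_ge0 A0 (ltW d0).
have din (s : R) : s0 - d <= s <= s0 + d -> `|s - s0| < e0.
  by rewrite ltr_norml => /andP[? ?]; apply/andP; split; lra.
have nB (a b : V) : `|a - b| < 1 -> `|a| <= `|b| + 1.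
  move=> q; have := ler_normD (a - b) b; rewrite subrK; move: q.
  by move: `|_| `|_| `|_| => *; lra.
have := @gronwall_zero x y v w s0 d A A0 d0.
case/(_ _ _ _ _ _ _ _)/Wrap => [||||s sd|||H].
- lra.
- lra.
- exact: xy.
- exact: h.
- have [[[gs gs'] [ds ds']] _] := he s (din s sd).
  have [_ q1 _] := geodesic_atP gs ds; have [_ q2 _] := geodesic_atP gs' ds'.
  by split; [exact: nbhs_singleton q1|exact: nbhs_singleton q2].
- exists (fun s => - Gam (gram i) (x s) (v s) (v s)), (fun s => - Gam (gram i) (y s) (w s) (w s)).
  move=> s sd; have [[[gs gs'] [ds ds']] [[q1 q2] [q3 q4]]] := he s (din s sd).
  have [_ _ q5] := geodesic_atP gs ds; have [_ _ q6] := geodesic_atP gs' ds'.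
  split; [exact: q5|exact: q6|].
  have -> : - Gam (gram i) (x s) (v s) (v s) - - Gam (gram i) (y s) (w s) (w s) =
      (Gam (gram i) (y s) (w s) (w s) - Gam (gram i) (x s) (w s) (w s))
      - (Gam (gram i) (x s) (v s - w s) (v s) + Gam (gram i) (x s) (w s) (v s - w s)).
    exact: Gam_diff.
  have b1 := nB _ _ q3; have b2 := nB _ _ q4.
  have h1 := hL (x s) (y s) (w s) (w s) (ltW q1) (ltW q2).
  have h2 := hG (x s) (v s - w s) (v s) (ltW q1).
  have h3 := hG (x s) (w s) (v s - w s) (ltW q1).
  apply: le_trans (ler_normB _ _) _; apply: le_trans (lerD h1 (ler_normD _ _)) _.
  apply: le_trans (lerD (lexx _) (lerD h2 h3)) _.
  rewrite (distrC (y s)); exact: (gam_diff_arith (ltW K0) (normr_ge0 _) (normr_ge0 _)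
    (normr_ge0 _) (normr_ge0 _) b1 b2).
- exists 2 => s sd; have [_ [_ [q3 q4]]] := he s (din s sd).
  exact: norm_lt2 q3 q4.
apply/nbhs_normP; exists d; [exact: d0|move=> s sd].
have sd' : s0 - d <= s <= s0 + d.
  by move: sd; rewrite ltr_norml => /andP[? ?]; apply/andP; split; lra.
have [[_ [ds ds']] _] := he s (din s sd'); have [xs vs] := H s sd'.
split; last by exists i.
by rewrite -(mcoordK ds) -(mcoordK ds') [mcoord i (c s)]xs.
Qed.

(** Agreement is open by local uniqueness. It is closed by the Hausdorff property as regards the
    points, and by continuity in a chart as regards the velocities. *)
Lemma agree_all (c c' : R -> M) : geodesic c -> geodesic c' -> c 0 = c' 0 -> velocity c 0 = velocity c' 0 ->
  c 1 = c' 1.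
Proof.
move=> [d d0 g] [d' d'0 g'] c0 v0.
have gn (t : R) : 0 <= t <= 1 -> \forall s \near t, geodesic_at c s /\ geodesic_at c' s.
  move=> /andP[t0 t1]; apply: filterI.
    by apply: near_interval g; apply/andP; split; lra.
  by apply: near_interval g'; apply/andP; split; lra.
have z01 := zero_in01 R.
suff [] : agree c c' 1 by [].
apply: (@local_propagation R (agree c c') 0 1 ler01).
  split; first exact: c0.
  exists (mchart_at (c 0)); first exact: mdom_chart_at.
  by move: v0; rewrite /velocity -c0.
move=> t t01; have [gt gt'] := nbhs_singleton (gn t t01).
have [ct _] := gt; have [ct' _] := gt'.
have [ag|nag] := pselect (agree c c' t).
  have [e e0 he] := (nbhs_normP _ _).1 (agree_local (gn t t01) ag).
  by exists e; [exact: e0|move=> s1 s2 _ _ _ s2d _ _; exact: (he _ s2d)].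
suff nn : \forall s \near t, ~ agree c c' s.
  have [e e0 he] := (nbhs_normP _ _).1 nn.
  by exists e; [exact: e0|move=> s1 s2 _ _ s1d _ _ ag; case: (he _ s1d ag)].
have [ctt|ctt] := pselect (c t = c' t); last first.
  apply: contra_notP ctt => nn; apply: mcarrier_hausdorff => A B hA hB.
  apply: contrapT => AB; apply: nn.
  have n1 : \forall s \near t, A (c s) := ct _ hA.
  have n2 : \forall s \near t, B (c' s) := ct' _ hB.
  apply: filterS2 n1 n2 => s As Bs [e _]; apply: AB; exists (c s); split=> //.
  by rewrite e.
have it : mdom (mchart_at (c t)) (c t) by exact: mdom_chart_at.
set i := mchart_at (c t) in it.
have it' : mdom i (c' t) by rewrite -ctt.
have [_ _ d2] := geodesic_atP gt it; have [_ _ d2'] := geodesic_atP gt' it'.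
pose D s := derive1 (mcoord i \o c) s - derive1 (mcoord i \o c') s.
have cD : {for t, continuous D}.
  by apply: continuousB_at; [exact: is_derive_continuous d2|exact: is_derive_continuous d2'].
have Dt : D t != 0.
  by apply/eqP => /eqP; rewrite subr_eq0 => /eqP h; apply: nag; split=> //; exists i.
have n1 : \forall s \near t, D s <> 0.
  have Dt0 : 0 < `|D t| by rewrite normr_gt0.
  have n1 : \forall s \near t, `|D s - D t| < `|D t|.
    by apply: near_norm_lt cD _; rewrite subrr normr0.
  by apply: filterS n1 => s h e; move: h; rewrite e sub0r normrN ltxx.
have n2 := near_dom ct it; have n3 := gn t t01.
apply: filterS2 (filterI n1 n2) n3 => s [Ds ds] [gs gs'] ag; apply: Ds.
by rewrite /D (agree_chart gs gs' ag ds) subrr.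
Qed.

(** [uniquely_geodesic] concerns geodesics with the same two ends. That the velocity at [p]
    determines the other end comes from the differential equation, and it makes [Exp] independent of
    the choice in its definition. *)
Lemma exp_unique p v q q' : is_exp p v q -> is_exp p v q' -> q = q'.
Proof.
move=> [c [gc c0 c1] cv] [c' [gc' c0' c1'] cv']; rewrite -c1 -c1'.
apply: (agree_all gc gc'); first by rewrite c0.
by rewrite cv.
Qed.

End ExpUnique.

(** [f t] is [t], or twice [sinh (k * t)] with [k = rho * sqrt |kmin|]. Geodesics are run in time 1
    at speed at most [rho], hence the factor [rho ^+ 2] in [k2]. The normalized boundary term of the
    index form is [f1 1 / f 1 = k * coth k]: this is where [zeta] comes from. *)
Lemma zeta_profile (R : realType) (kmin rho : R) : 0 < rho -> exists f f1 : R -> R, exists k2 : R,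
  [/\ forall t : R, is_derive t 1 f (f1 t), forall t : R, is_derive t 1 f1 (k2 * f t),
     f 0 = 0, 0 < f 1 & [/\ f1 1 = zeta kmin rho * f 1, 0 <= k2 &
     kmin < 0 -> `|kmin| * rho ^+ 2 <= k2]].
Proof.
move=> rho0; have [kn|kp] := ltP kmin 0; last first.
  exists id, (fun=> 1), 0; split=> //.
  - by move=> t; exact: is_derive_id1.
  - by move=> t; rewrite mul0r; exact: is_derive_cst.
  by split=> //; rewrite /zeta ltNge kp /= mulr1.
pose k := rho * Num.sqrt `|kmin|.
have k0 : 0 < k by rewrite mulr_gt0// sqrtr_gt0 normr_gt0 lt_eqF.
have de (a t : R) : is_derive t 1 (fun t : R => expR (0 + a * t)) (a * expR (0 + a * t)).
  exact: (is_derive_affine (is_derive_expR _)).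
have pos : 0 < expR k - expR (- k) by rewrite subr_gt0 ltr_expR; lra.
exists (fun t => expR (0 + k * t) - expR (0 + - k * t)).
exists (fun t => k * (expR (0 + k * t) + expR (0 + - k * t))), (k ^+ 2); split.
- move=> t; move: (is_deriveB (de k t) (de (- k) t)).
  by apply: is_derive_eqr; rewrite mulrDr mulNr opprK.
- move=> t; move: (is_deriveZ k (is_deriveD (de k t) (de (- k) t))).
  by apply: is_derive_eqr; rewrite [_ *: _]mulrDr expr2; move: (expR _) (expR _) => *; ring.
- by rewrite !mulr0 subrr.
- by rewrite !mulr1 !add0r.
rewrite !mulr1 !add0r; split.
- rewrite /zeta kn -/k /coth -mulrA divfK// gt_eqF//.
- exact: sqr_ge0.
by move=> _; rewrite /k exprMn sqr_sqrtr// mulrC.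
Qed.

Lemma zeta_ge0 (R : realType) (kmin r : R) : 0 <= r -> 0 <= zeta kmin r.
Proof.
move=> r0; rewrite /zeta; case: ifP => // _.
set y := r * _; have y0 : 0 <= y by rewrite mulr_ge0.
apply: mulr_ge0 => //; rewrite /coth; apply: divr_ge0; first by rewrite addr_ge0 ?expR_ge0.
by rewrite subr_ge0 ler_expR; lra.
Qed.

(** [lam = D] gives the claim. If [D = 0], this choice is not admissible, and small values of [lam]
    exclude a negative [Y] instead. *)
Lemma sq_le_of_quad (R : realType) (D Y L : R) : 0 <= D -> D <= L -> 1 <= L ->
  (forall lam : R, 0 < lam <= L -> D <= (Y / lam + lam) / 2) -> D ^+ 2 <= Y.
Proof.
move=> D0 DL L1 h; have [D00|D00] := eqVneq D 0; last first.
  have Dp : 0 < D by rewrite lt_neqAle eq_sym D00.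
  have := h D; rewrite Dp DL => /(_ isT) h1.
  rewrite -(@ler_pM2l _ D^-1) ?invr_gt0// expr2 mulrA mulVf// mul1r mulrC; lra.
rewrite D00 expr0n leNgt; apply/negP => Y0.
pose lam := Num.min 1 (- Y / 2).
have l1 : lam <= 1 by rewrite ge_min lexx.
have l2 : lam <= - Y / 2 by rewrite ge_min lexx orbT.
have l0 : 0 < lam by rewrite lt_min ltr01 divr_gt0// oppr_gt0.
have := h lam; rewrite l0 (le_trans l1 L1) D00 => /(_ isT) h1.
have : 0 <= Y / lam + lam by lra.
rewrite -(@pmulr_lge0 _ lam)// mulrDl divfK ?gt_eqF// => h2.
have h3 := ler_wpM2l (ltW l0) l1; lra.
Qed.

Lemma barrier_square_arith (R : realType) (D1 D Y L eta S e : R) : 0 <= D -> D <= L -> D ^+ 2 <= Y ->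
  0 <= D1 -> D1 <= D + eta * S -> 0 <= S -> S <= 1 -> 0 <= eta -> eta <= 1 -> (2 * L + 1) * eta <= e ->
  D1 ^+ 2 <= Y + e * S.
Proof.
move=> D0 DL DY D10 h S0 S1 e0 e1 he.
have eS : 0 <= eta * S by exact: mulr_ge0.
have h1 : D1 ^+ 2 <= (D + eta * S) ^+ 2 by rewrite ler_sqr ?nnegrE ?addr_ge0.
have h2 := ler_wpM2r eS DL.
have h3 : (eta * S) * (eta * S) <= eta * S by rewrite -[leRHS]mulr1 ler_wpM2l// mulr_ile1.
have h4 := ler_wpM2r S0 he.
apply: le_trans h1 _; rewrite sqrrD [(eta * S) ^+ 2]expr2 mulr2n; lra.
Qed.

Lemma quad_bound_arith (R : realType) (l2 b h e s : R) : 0 <= h -> 0 <= e -> 0 <= l2 -> `|s| <= 1 ->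
  l2 + 2 * s * b + s ^+ 2 * h + e * s ^+ 2 <= l2 + 2 * `|b| + h + e.
Proof.
move=> h0 e0 l20 s1.
have s2 : s ^+ 2 <= 1 by rewrite -real_normK ?num_real// expr_le1.
have h1 : s * b <= `|b|.
  by apply: le_trans (ler_norm _) _; rewrite normrM ler_piMl.
have h2 := ler_wpM2r h0 s2; have h3 := ler_wpM2l e0 s2; lra.
Qed.

Lemma quad_le_of_bound (R : realType) (D Y L : R) : 1 <= L -> Y <= L - 1 ->
  D <= (Y / L + L) / 2 -> D <= L.
Proof.
move=> L1 YL; have L0 := lt_le_trans ltr01 L1.
have h : Y / L <= 1 by rewrite ler_pdivrMr// mul1r; lra.
lra.
Qed.

Lemma sum_halves (R : realType) (a S h e : R) :
  a + S * h + e / 2 * S + e / 2 * S = a + S * (h + e).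
Proof. by field. Qed.

(** * The barrier for the squared distance *)

Section SquareDist.
Variables (R : realType) (n : nat) (M : riemannianManifold R n).
Implicit Types (i j : mchart M) (p q : M) (x u v w : 'rV[R]_n).
Hypothesis UG : uniquely_geodesic M.
Local Notation V := 'rV[R]_n.

Lemma Log_rev p q : velocity (gam p q) 1 = - Log q p.
Proof.
have g1 : geodesic_at (gam p q) (1 + -1 * 0).
  by rewrite mulr0 addr0; exact: geodesic_at_mem (gam_geodesic UG p q) (one_in01 R).
have h := velocity_affine g1; rewrite mulr0 addr0 in h g1.
have gr : geodesic_at (fun s : R => gam p q (1 + -1 * s)) 0.
  by apply: geodesic_at_affine; rewrite mulr0 addr0.
rewrite (LogE UG) -(@velocity_agree _ _ _ (fun s : R => gam p q (1 + -1 * s)) _ 0 gr).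
- by rewrite h scaleN1r opprK.
- exact: geodesic_at_mem (gam_geodesic UG q p) (zero_in01 R).
- exact: zero_in01.
by move=> s; rewrite in_itv/= => s01; rewrite mulN1r -(gam_rev UG).
Qed.

(** The barrier at time 1 of the geodesic from [p] to [ga s0], in the direction [w / f 1], which
    normalizes the profile to 1 at its end. [L] is large enough to dominate [D], so that [lam = D]
    is admissible, and [eta] is the precision with which [ga] follows its jet. *)
Lemma sq_dist_barrier kmin kmax (ga : R -> M) (s0 rho : R) p (e : R) :
  sectional_curvature_in M kmin kmax -> 0 < rho ->
  (\forall s \near s0, geodesic_at ga s) -> dist p (ga s0) <= rho -> 0 < e ->
  exists2 d : R, 0 < d & forall s : R, `|s| < d ->
    dist p (ga (s0 + s)) ^+ 2 <= dist p (ga s0) ^+ 2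
      + 2 * s * - inner (ga s0) (Log (ga s0) p) (velocity ga s0)
      + s ^+ 2 * (zeta kmin rho * inner (ga s0) (velocity ga s0) (velocity ga s0) + e).
Proof.
move=> sc rho0 nga drho e0.
have [f [f1 [k2 [df df1 f00 f10 [fz k20 hk2]]]]] := zeta_profile kmin rho0.
set q := ga s0 in drho *; pose c := gam p q.
have [dc dc0 gc] := gam_geodesic UG p q.
pose l2 := dist p q ^+ 2.
have l2E : inner (c 0) (velocity c 0) (velocity c 0) = l2.
  rewrite /l2 (dist_glen UG) -sqr_speed /c; congr (_ ^+ 2).
  exact: glen_speed (zero_in01 R).
have hk2' : kmin < 0 -> `|kmin| * l2 <= k2.
  move=> /hk2; apply: le_trans; apply: ler_wpM2l => //.
  by rewrite /l2 ler_sqr ?nnegrE ?dist_ge0// ltW.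
have c1 : c 1 = q by exact: gam1.
set i := mchart_at q; have iq : mdom i q by exact: mdom_chart_at.
have ic1 : mdom i (c 1) by rewrite c1.
have [_ hB] := barrier1 UG dc0 gc sc df df1 f00 k20 hk2' l2E ic1.
have gs0 := nbhs_singleton nga.
pose w := velocity ga s0; pose u := (f 1)^-1 *: w.
have wu : f 1 *: u = w by rewrite /u scalerA mulfV ?scale1r// gt_eqF.
have xE : cpos c i 1 = mcoord i q by rewrite /cpos c1.
have vE : cvel c i 1 = - Log q p.
  by rewrite -Log_rev /cvel /velocity -/c c1.
pose b := - inner q (Log q p) w; pose b2 := inner q w w.
have b20 : 0 <= b2 by exact: inner_ge0.
have z0 : 0 <= zeta kmin rho := zeta_ge0 kmin (ltW rho0).
have inC : bilin (gram i (mcoord i q)) w (Log q p) = inner q (Log q p) w.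
  exact: (bilinC _ _ (gram_symp iq)).
have rhsE s e' : bar_rhs c f f1 l2 i 1 s e' u =
    l2 + 2 * s * b + s ^+ 2 * (zeta kmin rho * b2) + e' * s ^+ 2.
  rewrite /bar_rhs xE vE mulr1 /u !bilinZl !bilinZr bilinNr inC -/(inner q w w) -/b2 fz /b.
  by field; rewrite gt_eqF.
pose L := l2 + 2 * `|b| + zeta kmin rho * b2 + e / 2 + 1.
have zb : 0 <= zeta kmin rho * b2 by exact: mulr_ge0.
have l20 : 0 <= l2 by exact: sqr_ge0.
have e2 : 0 < e / 2 by rewrite divr_gt0.
have L1 : 1 <= L.
  by rewrite /L lerDr; apply: addr_ge0 (ltW e2); apply: addr_ge0 zb; rewrite addr_ge0// mulr_ge0.
have L2 : 0 < 2 * L + 1 by rewrite ltr_wpDl// mulr_ge0// (le_trans ler01 L1).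
pose eta := Num.min 1 (e / 2 / (2 * L + 1)).
have eta0 : 0 < eta by rewrite lt_min ltr01 divr_gt0.
have eta1 : eta <= 1 by rewrite ge_min lexx.
have etaL : (2 * L + 1) * eta <= e / 2 by rewrite mulrC -ler_pdivlMr// ge_min lexx orbT.
have [d1 d10 h1] := hB u L (e / 2) (lt_le_trans ltr01 L1) e2.
pose ga' (s : R) := ga (s0 + 1 * s).
have ga0 : ga' 0 = q by rewrite /ga' mulr0 addr0.
have g' : geodesic_at ga' 0.
  by apply: geodesic_at_affine; rewrite mulr0 addr0; exact: gs0.
have iq' : mdom i (ga' 0) by rewrite ga0.
have [ct nd dd] := geodesic_atP g' iq'.
have nm : \forall s \near (0 : R), mdom i (ga' s) /\ mcoord i (ga' s) = (mcoord i \o ga') s.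
  by apply: filterS (near_dom ct iq') => s.
have [d2 d20 h2] := dist_jet UG nm nd dd eta0.
have wE : derive1 (mcoord i \o ga') 0 = w.
  have gs0' : geodesic_at ga (s0 + 1 * 0) by rewrite mulr0 addr0; exact: gs0.
  have := velocity_affine gs0'; rewrite scale1r mulr0 addr0 -/w => <-.
  rewrite -/ga'; change (derive1 (mcoord i \o ga') 0 = derive1 (mcoord (mchart_at (ga' 0)) \o ga') 0).
  by rewrite ga0.
exists (Num.min 1 (Num.min d1 d2)) => [|s]; first by rewrite !lt_min ltr01 d10.
rewrite !lt_min => /andP[s1 /andP[sd1 sd2]].
have := h2 s sd2; rewrite wE [(_ \o _) 0]/= ga0 => h3.
have c0 : c 0 = p by exact: gam0.
pose Y := l2 + 2 * s * b + s ^+ 2 * (zeta kmin rho * b2) + e / 2 * s ^+ 2.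
have h4 (lam : R) : 0 < lam <= L ->
    dist p (mpoint i (jet i (mcoord i q) w s)) <= (Y / lam + lam) / 2.
  by move=> lamL; have := h1 s lam sd1 lamL; rewrite rhsE wu mulr1 -/c c0 xE.
set D := dist p _ in h4.
have D0 : 0 <= D by exact: dist_ge0.
have YL : Y <= L - 1.
  by rewrite /L addrK; exact: (quad_bound_arith b zb (ltW e2) l20 (ltW s1)).
have DL : D <= L.
  by apply: (quad_le_of_bound L1 YL); apply: h4; rewrite (lt_le_trans ltr01 L1) lexx.
have DY : D ^+ 2 <= Y := sq_le_of_quad D0 DL L1 h4.
have tri : dist p (ga' s) <= D + eta * s ^+ 2.
  apply: le_trans (UG_triangle UG p _ _) _; apply: lerD; first exact: lexx.
  by rewrite (dist_sym UG).
have S1 : s ^+ 2 <= 1 by rewrite -real_normK ?num_real// expr_le1// ltW.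
have := barrier_square_arith D0 DL DY (dist_ge0 _ _) tri (sqr_ge0 s) S1 (ltW eta0) eta1 etaL.
by rewrite /ga' mul1r /Y sum_halves.
Qed.

End SquareDist.

Lemma quad_continuous (R : realType) (a b c t : R) :
  {for t, continuous (fun s : R => a + 2 * s * b + s ^+ 2 * c)}.
Proof.
have i1 := is_derive_mul (is_derive_cst (2 : R) t (1 : R)) (is_derive_id1 t).
have i2 := is_derive_mul i1 (is_derive_cst b t (1 : R)).
have i3 := is_derive_mul (is_derive_mul (is_derive_id1 t) (is_derive_id1 t)) (is_derive_cst c t (1 : R)).
have i4 := is_derive_continuous (is_deriveD (is_deriveD (is_derive_cst a t (1 : R)) i2) i3).
by move: i4; apply: continuous_near; near=> s; rewrite expr2.
Unshelve. all: by end_near. Qed.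

(** * The descent inequality *)

(** The second order bound holds only where [H <= rho2]. Let [D] be the excess of [H] over the
    parabola with the slightly larger coefficient [Z + ka], and let [S1] be a time where [D] equals
    a level [nu] below the slack. Then [D - m * s] vanishes at 0 and at [S1] and is negative just
    after 0, so it has a minimum in between. There [D < nu], hence [H <= rho2], and the barrier with
    the smaller coefficient [Z + ka / 2] contradicts minimality. *)
Lemma concave_bound (R : realType) (H beta : R -> R) (Z rho2 S : R) : 0 <= S -> 0 <= Z ->
  beta 0 <= 0 -> H 0 + S ^+ 2 * Z < rho2 ->
  (forall t : R, 0 <= t <= S -> {for t, continuous H}) ->
  (forall s0 e : R, 0 <= s0 < S -> H s0 <= rho2 -> 0 < e -> exists2 d : R, 0 < d &
    forall s : R, `|s| < d -> H (s0 + s) <= H s0 + 2 * s * beta s0 + s ^+ 2 * (Z + e)) ->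
  H S <= H 0 + 2 * S * beta 0 + S ^+ 2 * Z.
Proof.
move=> S0 Z0 b0 slack cH bar; rewrite leNgt; apply/negP => gap.
have Sp : 0 < S.
  rewrite lt_neqAle S0 andbT eq_sym; apply/eqP => e; move: gap.
  by rewrite e mulr0 !mul0r expr0n !mul0r !addr0 ltxx.
pose g := H S - (H 0 + 2 * S * beta 0 + S ^+ 2 * Z); pose sl := rho2 - (H 0 + S ^+ 2 * Z).
have g0 : 0 < g by rewrite subr_gt0.
have sl0 : 0 < sl by rewrite subr_gt0.
pose ka := Num.min g sl / (2 * S ^+ 2).
have S20 : 0 < S ^+ 2 by rewrite exprn_gt0.
have mn0 : 0 < Num.min g sl by rewrite lt_min g0.
have ka0 : 0 < ka by rewrite divr_gt0// mulr_gt0.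
have kaE : S ^+ 2 * ka = Num.min g sl / 2 by rewrite /ka; field; rewrite gt_eqF.
have mg : Num.min g sl <= g by rewrite ge_min lexx.
have ms : Num.min g sl <= sl by rewrite ge_min lexx orbT.
pose D s := H s - (H 0 + 2 * s * beta 0 + s ^+ 2 * (Z + ka)).
have D0 : D 0 = 0 by rewrite /D mulr0 !mul0r expr0n !mul0r !addr0 subrr.
have DS : 0 < D S by rewrite /D mulrDr kaE; move: g0 mg; rewrite /g; lra.
pose nu := Num.min (sl / 2) (D S).
have nu0 : 0 < nu by rewrite lt_min divr_gt0.
have nusl : nu <= sl / 2 by rewrite ge_min lexx.
have nuD : nu <= D S by rewrite ge_min lexx orbT.
have cD (m t : R) : 0 <= t <= S -> {for t, continuous (fun s => D s - m * s)}.
  move=> t0S.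
  have i5 := is_derive_mul (is_derive_cst m t (1 : R)) (is_derive_id1 t).
  exact: (continuousB_at (continuousB_at (cH t t0S) (@quad_continuous R _ _ _ t))
    (is_derive_continuous i5)).
have [S1 S1in DS1] : exists2 c, c \in `[0, S] & D c - 0 * c = nu.
  apply: (@IVT _ (fun s => D s - 0 * s)) => //.
    by apply: continuous_in_subspaceT => t; rewrite inE/= in_itv/=; exact: cD.
  by rewrite !mul0r !subr0 D0 minEle maxEle (ltW DS) (ltW nu0).
rewrite mul0r subr0 in DS1; rewrite in_itv/= in S1in; have /andP[S10 S1S] := S1in.
have S1p : 0 < S1.
  rewrite lt_neqAle S10 andbT eq_sym; apply/eqP => e; move: nu0.
  by rewrite -DS1 e D0 ltxx.
pose m := nu / S1; have m0 : 0 < m by rewrite divr_gt0.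
have mS1 : m * S1 = nu by rewrite /m divfK// gt_eqF.
have [s1 s1in s1min] : exists2 c, c \in `[0, S1] & forall t, t \in `[0, S1] -> D c - m * c <= D t - m * t.
  apply: (@EVT_min _ (fun s => D s - m * s)) => //.
  apply: continuous_in_subspaceT => t; rewrite inE/= in_itv/= => /andP[t0 t1].
  by apply: cD; rewrite t0 (le_trans t1).
rewrite in_itv/= in s1in; have /andP[s10 s1S] := s1in.
have neg : D s1 - m * s1 < 0.
  have z0 : 0 <= (0 : R) < S by rewrite lexx.
  have H00 : H 0 <= rho2.
    by apply: ltW; apply: le_lt_trans slack; rewrite lerDl mulr_ge0// ltW.
  have [d d0 hd] := bar 0 ka z0 H00 ka0.
  pose s := Num.min (d / 2) S1.
  have sp : 0 < s by rewrite lt_min divr_gt0.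
  have sS1 : s <= S1 by rewrite ge_min lexx orbT.
  have sd : s <= d / 2 by rewrite ge_min lexx.
  have := hd s; rewrite ger0_norm ?(ltW sp)// => /(_ ltac:(lra)); rewrite add0r => h2.
  have sin : s \in `[0, S1] by rewrite in_itv/= ltW.
  apply: le_lt_trans (s1min s sin) _.
  have := mulr_gt0 m0 sp; rewrite /D; move: h2; lra.
have s1p : 0 < s1.
  rewrite lt_neqAle s10 andbT eq_sym; apply/eqP => e; move: neg.
  by rewrite e D0 mulr0 subrr ltxx.
have s1S1 : s1 < S1.
  rewrite lt_neqAle s1S andbT; apply/eqP => e; move: neg.
  by rewrite e DS1 mS1 subrr ltxx.
have s1S' : s1 < S by exact: lt_le_trans S1S.
have H1 : H s1 <= rho2.
  have h1 : m * s1 <= nu by rewrite -mS1 ler_pM2l.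
  have h2 : s1 * beta 0 <= 0 by rewrite pmulr_rle0.
  have h3 : s1 ^+ 2 * (Z + ka) <= S ^+ 2 * (Z + ka).
    by apply: ler_wpM2r; [rewrite addr_ge0// ltW|rewrite ler_sqr ?nnegrE// ltW].
  by move: neg h1 h2 h3 nusl ms; rewrite /D mulrDr [S ^+ 2 * (_ + _)]mulrDr kaE /sl; lra.
have s1in' : 0 <= s1 < S by rewrite s10.
have [d d0 hd] := bar s1 (ka / 2) s1in' H1 (divr_gt0 ka0 (ltr0Sn _ 1)).
pose c := 2 * beta s1 - 2 * beta 0 - 2 * s1 * (Z + ka) - m.
pose sg := Num.min (d / 2) (Num.min s1 (S1 - s1)).
have sg0 : 0 < sg by rewrite !lt_min divr_gt0//= s1p subr_gt0.
have sgd : sg <= d / 2 by rewrite ge_min lexx.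
have sg1 : sg <= s1 by rewrite !ge_min lexx orbT.
have sg2 : sg <= S1 - s1 by rewrite !ge_min lexx !orbT.
have key (s : R) : `|s| = sg -> s * c <= 0 -> False.
  move=> ss sc; have s2 : 0 < s ^+ 2 by rewrite -real_normK ?num_real// ss exprn_gt0.
  have := hd s; rewrite ss => /(_ ltac:(lra)) h1.
  have sl1 : - sg <= s by rewrite -ss lerNl -normrN ler_norm.
  have sl2 : s <= sg by rewrite -ss ler_norm.
  have := s1min (s1 + s); rewrite in_itv/= => /(_ ltac:(apply/andP; split; lra)).
  have := mulr_gt0 s2 ka0; move: sc h1; rewrite /D /c !expr2; lra.
(* The increment is chosen against the sign of the linear coefficient, so that only the negative
   quadratic term remains. *)
have [c0|c0] := leP 0 c.
  by apply: (key (- sg)); rewrite ?normrN ?gtr0_norm// mulNr oppr_le0 mulr_ge0// ltW.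
by apply: (key sg); rewrite ?gtr0_norm// nmulr_lle0// ltW.
Qed.

Section Descent.
Variables (R : realType) (n : nat) (M : riemannianManifold R n).
Implicit Types (i j : mchart M) (p q : M) (x u v w : 'rV[R]_n).
Hypothesis UG : uniquely_geodesic M.
Local Notation V := 'rV[R]_n.

Lemma dist_continuous p q : {for q, continuous (fun q' : M => dist p q')}.
Proof.
set i := mchart_at q; have iq : mdom i q by exact: mdom_chart_at.
have [r [K [r0 K0 hK]]] := dist_chart_le UG (chart_rangeP iq).
have n1 : \forall q' \near q, mdom i q' by exact: (near_open (@open_mdom _ _ _ _)).
have n2 : \forall q' \near q, `|mcoord i q' - mcoord i q| < r.
  by apply: near_norm_lt (continuous_mcoord iq) _; rewrite subrr normr0.
apply: (@squeeze_continuous R R M _ (fun q' => K * `|mcoord i q' - mcoord i q|)).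
- exact: (@continuous_dist0 R V M (mcoord i) q K (continuous_mcoord iq)).
- by rewrite subrr normr0 mulr0.
apply: filterS2 n1 n2 => q' iq' qr.
have h : dist q q' <= K * `|mcoord i q' - mcoord i q|.
  rewrite -{1}(mcoordK iq) -{1}(mcoordK iq'); apply: hK; last exact: ltW.
  by rewrite subrr normr0 ltW.
have t1 := UG_triangle UG p q q'; have t2 := UG_triangle UG p q' q.
rewrite (dist_sym UG q' q) in t2.
by rewrite ler_norml; apply/andP; split; move: h t1 t2; move: (dist _ _) (dist _ _) (dist _ _) (K * _) => *; lra.
Qed.

(** [concave_bound] asks for strict slack, which [S < 1] provides through [S ^+ 2 * Zb < Zb]; the
    full step follows by continuity. The budget of the method allows only the nonstrict inequality
    at [S = 1]. *)
Lemma sq_dist_descent kmin kmax (ga : R -> M) (rho Zb : R) p (b0 := - inner (ga 0) (Log (ga 0) p) (velocity ga 0)) :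
  sectional_curvature_in M kmin kmax -> 0 < rho -> geodesic ga -> b0 <= 0 -> 0 < Zb ->
  zeta kmin rho * inner (ga 0) (velocity ga 0) (velocity ga 0) <= Zb ->
  dist p (ga 0) ^+ 2 + Zb <= rho ^+ 2 ->
  dist p (ga 1) ^+ 2 <= dist p (ga 0) ^+ 2 + 2 * b0 + Zb.
Proof.
move=> sc rho0 gga b00 Zb0 hZ hr; have [d d0 gd] := gga.
pose H t := dist p (ga t) ^+ 2.
pose beta t := - inner (ga t) (Log (ga t) p) (velocity ga t).
have cH (t : R) : 0 <= t <= 1 -> {for t, continuous H}.
  move=> t01; have [ct _] := geodesic_at_mem gga t01.
  have cd : {for t, continuous (fun t => dist p (ga t))}.
    exact: (continuous_comp ct (@dist_continuous p (ga t))).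
  by apply: (@continuous_near R R (fun t => dist p (ga t) * dist p (ga t))); [near=> s; rewrite /H expr2|exact: (cvgM cd cd)].
have small (S : R) : 0 <= S < 1 -> H S <= H 0 + 2 * S * beta 0 + S ^+ 2 * Zb.
  move=> /andP[S0 S1]; apply: (@concave_bound R H beta Zb (rho ^+ 2)) => //.
  - exact: ltW.
  - apply: lt_le_trans hr; rewrite ltrD2l gtr_pMl// expr_lt1//.
  - by move=> t /andP[t0 t1]; apply: cH; rewrite t0 (le_trans t1)// ltW.
  move=> s0 e /andP[s00 s0S] hs e0.
  have s01 : 0 <= s0 <= 1 by rewrite s00 ltW// (lt_trans s0S).
  have nga : \forall s \near s0, geodesic_at ga s.
    by apply: near_interval gd; case/andP: s01 => *; apply/andP; split; lra.
  have hd : dist p (ga s0) <= rho by rewrite -(@ler_sqr R) ?nnegrE ?dist_ge0// ltW.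
  have [d' d'0 hd'] := sq_dist_barrier UG sc rho0 nga hd e0.
  exists d' => // s sd; apply: le_trans (hd' s sd) _; rewrite lerD2l.
  apply: ler_wpM2l; first exact: sqr_ge0.
  rewrite lerD2r -sqr_speed (geodesic_speed gga s01) sqr_speed; exact: hZ.
pose Q S := H 0 + 2 * S * beta 0 + S ^+ 2 * Zb - H S.
have cQ : {for 1, continuous Q}.
  exact: (continuousB_at (@quad_continuous R _ _ _ 1) (cH 1 (one_in01 R))).
have : 0 <= Q 1.
  rewrite leNgt; apply/negP => neg.
  have n1 : \forall s \near (1 : R), Q s < 0 := cQ _ (@lt_nbhsl _ _ _ neg).
  have [d1 d10 h1] := (nbhs_normP _ _).1 n1.
  pose s := 1 - Num.min (d1 / 2) (1 / 2).
  have m0 : 0 < Num.min (d1 / 2) (1 / 2) by rewrite lt_min !divr_gt0.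
  have m1 : Num.min (d1 / 2) (1 / 2) <= d1 / 2 by rewrite ge_min lexx.
  have m2 : Num.min (d1 / 2) (1 / 2) <= 1 / 2 by rewrite ge_min lexx orbT.
  have := h1 s; rewrite /s addrC addKr normrN ger0_norm ?(ltW m0)// => /(_ ltac:(lra)).
  rewrite ltNge /Q subr_ge0 small//.
  by apply/andP; split; lra.
by rewrite /Q mulr1 expr1n mul1r subr_ge0.
Unshelve. all: by end_near. Qed.

End Descent.

Lemma coth_le (R : realType) (x y : R) : 0 < x -> x <= y -> coth y <= coth x.
Proof.
move=> x0 xy; rewrite /coth.
have d (z : R) : 0 < z -> 0 < expR z - expR (- z) by move=> z0; rewrite subr_gt0 ltr_expR; lra.
have dx := d x x0; have dy := d y (lt_le_trans x0 xy).
rewrite ler_pdivrMr// mulrAC ler_pdivlMr//.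
have h1 : expR x <= expR y by rewrite ler_expR.
have h2 : expR (- y) <= expR (- x) by rewrite ler_expR lerN2.
have h3 : expR x * expR (- y) <= expR y * expR (- x) by apply: ler_pM => //; exact: expR_ge0.
move: h3; move: (expR x) (expR y) (expR (- x)) (expR (- y)) => *; lra.
Qed.

Lemma zeta_gt0 (R : realType) (kmin r : R) : 0 < r -> 0 < zeta kmin r.
Proof.
move=> r0; rewrite /zeta; case: ifPn => // k0.
set y := r * _; have y0 : 0 < y by rewrite mulr_gt0// sqrtr_gt0 normr_gt0 lt_eqF.
apply: mulr_gt0 => //; rewrite /coth; apply: divr_gt0; first by rewrite addr_gt0 ?expR_gt0.
by rewrite subr_gt0 ltr_expR; lra.
Qed.

(** [coth] decreases, so only the factor [sqrt 2] in front remains, rounded up to 2. *)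
Lemma zeta_sqrt2 (R : realType) (kmin r : R) : 0 < r ->
  zeta kmin (Num.sqrt 2 * r) <= 2 * zeta kmin r.
Proof.
move=> r0; have z0 := zeta_gt0 kmin r0.
rewrite /zeta in z0 *; case: ifP z0 => [k0|k0] z0; last by rewrite mulr1 ler1n.
move: z0; set y := r * _ => z0; have y0 : 0 < y by rewrite mulr_gt0// sqrtr_gt0 normr_gt0 lt_eqF.
have s1 : 1 <= Num.sqrt 2 :> R by rewrite -[X in X <= _]sqrtr1 ler_sqrt// ler1n.
have s2 : Num.sqrt 2 <= 2 :> R.
  by rewrite -(@ler_sqr R) ?nnegrE ?sqrtr_ge0// sqr_sqrtr//; lra.
have -> : Num.sqrt 2 * r * Num.sqrt `|kmin| = Num.sqrt 2 * y by rewrite /y mulrA.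
have c0 : 0 < coth y by move: z0; rewrite pmulr_rgt0.
have ys : y <= Num.sqrt 2 * y by rewrite ler_peMl// ltW.
have h1 := coth_le y0 ys.
have h2 : Num.sqrt 2 * y <= 2 * y by rewrite ler_pM2r.
have sy : 0 <= Num.sqrt 2 * y := le_trans (ltW y0) ys.
apply: le_trans (ler_wpM2l sy h1) _.
by rewrite [2 * (y * _)]mulrA ler_pM2r.
Qed.

(** * Subgradient steps and geodesic averages *)

Section Iterates.
Variables (R : realType) (n : nat) (M : riemannianManifold R n).
Implicit Types (i j : mchart M) (p q : M) (v w : 'rV[R]_n).
Hypothesis UG : uniquely_geodesic M.
Local Notation V := 'rV[R]_n.

(** The geodesic of the step is defined slightly before time 0, and its point [q] there lies in the
    direction [+ v] from [p]: without completeness this is how such a point is found. Then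
    [f q - f p] is at least [t * eta * |v| ^+ 2] and at most [G * t * eta * |v|]. The strict bound
    on [dist o p] keeps [q] in the ball. *)
Lemma subgradient_norm (f : M -> R) (G rho eta : R) (o p : M) (c : R -> M) v :
  0 <= G -> 0 < eta -> glipschitz_on G (closed_riemannian_ball o rho) f ->
  subdifferential (closed_riemannian_ball o rho) f p v -> dist o p < rho ->
  geodesic c -> c 0 = p -> velocity c 0 = - eta *: v -> inner p v v <= G ^+ 2.
Proof.
move=> G0 eta0 lip sub op [d d0 gd] c0 vc.
have z : - d < (0 : R) < 1 + d by apply/andP; split; lra.
have [ct _] := gd 0 z.
have cd : {for 0, continuous (fun t : R => dist o (c t))}.
  exact: (continuous_comp ct (@dist_continuous R n M UG o (c 0))).
have n1 : \forall s \near (0 : R), dist o (c s) < rho.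
  by apply: (cd _ (@lt_nbhsl _ _ _ _)); rewrite c0.
have [e e0 he] := (nbhs_normP _ _).1 n1.
pose t := Num.min (d / 2) (e / 2).
have t0 : 0 < t by rewrite lt_min !divr_gt0.
have td : t <= d / 2 by rewrite ge_min lexx.
have te : t <= e / 2 by rewrite ge_min lexx orbT.
have oq : dist o (c (0 + - t * 1)) < rho.
  by apply: he; rewrite mulr1 add0r subr0 normrN ger0_norm ?(ltW t0)//; lra.
set q := c (0 + - t * 1) in oq.
have g0 : geodesic_at c (0 + - t * 0) by rewrite mulr0 addr0; exact: gd.
have ex : is_exp p ((t * eta) *: v) q.
  exists (fun s => c (0 + - t * s)).
    split=> //; last by rewrite mulr0 addr0.
    exists (1 / 2); first by rewrite divr_gt0.
    move=> s /andP[s1 s2]; apply: geodesic_at_affine; apply: gd.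
    by have q1 := mulr_gt0 t0 (ltac:(lra) : 0 < s + 1 / 2);
      have q2 := mulr_gt0 t0 (ltac:(lra) : 0 < 1 + 1 / 2 - s); apply/andP; split; lra.
  by rewrite (velocity_affine g0) mulr0 addr0 vc scalerA mulrNN.
have LE : Log p q = (t * eta) *: v by rewrite (LogE UG) (is_expP UG ex).
have Xq : closed_riemannian_ball o rho q by exact: ltW.
have Xp : closed_riemannian_ball o rho p by exact: ltW.
have h1 := sub q Xq; have h2 := lip p q Xp Xq.
have h3 := inner_Log UG p q.
rewrite LE in h1 h3; rewrite /inner bilinZl bilinZr -/(inner p v v) in h3.
rewrite /inner bilinZr -/(inner p v v) in h1.
rewrite (dist_glen UG) in h2.
have N0 : 0 <= inner p v v by exact: inner_ge0.
have g0' : 0 <= glen p q by exact: glen_ge0.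
have te0 : 0 < t * eta by exact: mulr_gt0.
have h4 : (t * eta) * inner p v v <= G * glen p q.
  by apply: le_trans h2; rewrite distrC; apply: le_trans _ (ler_norm _); lra.
move: h3 h4 N0 g0' te0; move: (inner p v v) (glen p q) (t * eta) => N l a h3 h4 N0 l0 a0.
have [->|Nn] := eqVneq N 0; first exact: sqr_ge0.
have Np : 0 < N by rewrite lt_neqAle eq_sym Nn.
have aN : 0 <= a * N by rewrite mulr_ge0// ltW.
have h5 : (a * N) ^+ 2 <= (G * l) ^+ 2.
  by rewrite ler_sqr// nnegrE ?mulr_ge0.
rewrite !exprMn -h3 in h5.
rewrite -(@ler_pM2l _ (a ^+ 2 * N)) ?mulr_gt0 ?exprn_gt0//.
by move: h5; rewrite !expr2; lra.
Qed.

Lemma Exp_gam p q (t : R) : 0 <= t <= 1 -> Exp p (t *: Log p q) = gam p q t.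
Proof.
move=> t01; have g0 : geodesic_at (gam p q) (0 + (t - 0) * 0).
  by rewrite mulr0 addr0; exact: geodesic_at_mem (gam_geodesic UG p q) (zero_in01 R).
have ex : is_exp p (t *: Log p q) (gam p q t).
  exists (fun s => gam p q (0 + (t - 0) * s)).
    have := geodesic_joins_affine (gam_geodesic UG p q) (zero_in01 R) t01.
    by rewrite (gam0 UG).
  by rewrite (velocity_affine g0) mulr0 addr0 subr0 (LogE UG).
rewrite /Exp; case: xgetP => [y _ ey|/(_ _ ex)//].
exact: (exp_unique ey ex).
Qed.

Lemma gam_convex (X : set M) (f : M -> R) p q (t : R) : gconvex_on X f -> X p -> X q ->
  0 <= t <= 1 -> X (gam p q t) /\ f (gam p q t) <= (1 - t) * f p + t * f q.
Proof.
move=> [cX cf] Xp Xq t01; have [c jc hc] := cX p q Xp Xq.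
have hX (s : R) : 0 <= s <= 1 -> X (gam p q s).
  by move=> s01; rewrite (gam_eq UG jc s01); exact: hc.
split; first exact: hX.
by have := cf _ (gam_geodesic UG p q) hX t t01; rewrite (gam0 UG) (gam1 UG).
Qed.

(** Jensen's inequality multiplied by the number of points, so that the weight [1 / m.+2] of a new
    point contributes exactly its value. *)
Lemma average_le (X : set M) (f : M -> R) (x : nat -> M) m : gconvex_on X f ->
  (forall t, (t <= m)%N -> X (x t)) -> X (geodesic_average x m) /\
  m.+1%:R * f (geodesic_average x m) <= \sum_(t < m.+1) f (x t).
Proof.
move=> cf; elim: m => [|m IH] Xx /=.
  by split; [exact: Xx|rewrite big_ord1 mul1r].
have [Xa ha] := IH (fun t tm => Xx t (leqW tm)).
set b := geodesic_average x m in Xa ha *.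
have t01 : 0 <= (m.+2%:R^-1 : R) <= 1 by rewrite invr_ge0 ler0n invf_le1 ?ler1n ?ltr0n.
rewrite Exp_gam//; have [Xg hg] := gam_convex cf Xa (Xx m.+1 (leqnn _)) t01.
split=> //; rewrite big_ord_recr/=; apply: le_trans _ (lerD ha (lexx _)).
have mp : 0 < m.+2%:R :> R by rewrite ltr0n.
apply: le_trans (ler_wpM2l (ltW mp) hg) _.
rewrite mulrDr !mulrA mulfV ?gt_eqF// mul1r mulrBr mulr1 mulfV ?gt_eqF//.
by rewrite -[m.+2%:R]natr1 addrK.
Qed.

End Iterates.

(** The second bound says [A <= r * G * sqrt (Z * T)], and the first that the square of the right
    side is at most [(eps * T) ^+ 2]. *)
Lemma average_gap_arith (R : realType) (r G Z T eps A : R) : 0 < r -> 0 < G -> 0 < T -> 0 < Z -> 0 < eps ->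
  Z * G ^+ 2 * r ^+ 2 <= eps ^+ 2 * T ->
  2 * (r / (G * Num.sqrt (Z * T))) * A <= 2 * r ^+ 2 -> A <= eps * T.
Proof.
move=> r0 G0 T0 Z0 e0 h hA.
set s := Num.sqrt (Z * T) in hA.
have ZT : 0 < Z * T by exact: mulr_gt0.
have s0 : 0 < s by rewrite sqrtr_gt0.
have sE : s ^+ 2 = Z * T by rewrite sqr_sqrtr// ltW.
have h1 : A <= r * (G * s).
  have : (r / (G * s)) * A <= r ^+ 2 by lra.
  rewrite mulrAC ler_pdivrMr ?mulr_gt0// expr2 -mulrA ler_pM2l//.
have p1 : 0 <= r * (G * s) by rewrite ltW// !mulr_gt0.
have p2 : 0 <= eps * T by rewrite ltW// mulr_gt0.
apply: le_trans h1 _; rewrite -(@ler_sqr R) ?nnegrE// !exprMn sE.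
by have := ler_wpM2r (ltW T0) h; rewrite !expr2; lra.
Qed.

Theorem theorem4 (R : realType) :
  exists C : R, 0 < C /\
  forall (n : nat) (M : riemannianManifold R n) (kmin kmax : R)
    (f : M -> R) (xstar : M) (G : R) (T : nat)
    (x : nat -> M) (v : nat -> 'rV[R]_n),
  let r := dist (x 0%N) xstar in
  let X := closed_riemannian_ball xstar (Num.sqrt 2 * r) in
  let eta := r / (G * Num.sqrt (zeta kmin (Num.sqrt 2 * r) * T%:R)) in
  uniquely_geodesic M ->
  sectional_curvature_in M kmin kmax ->
  (forall y, f xstar <= f y) ->
  gconvex_on X f ->
  0 < G -> glipschitz_on G X f ->
  (0 < T)%N ->
  (forall t, (t < T)%N ->
     [/\ subdifferential X f (x t) (v t),
         exp_dom (x t) (- eta *: v t) &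
         x t.+1 = Exp (x t) (- eta *: v t)]) ->
  (forall t, (t <= T)%N -> X (x t)) /\
  (forall eps : R, 0 < eps ->
     C * (zeta kmin r * G ^+ 2 * r ^+ 2 / eps ^+ 2) <= T%:R ->
     f (geodesic_average x T.-1) - f xstar <= eps).
Proof.
(* The factor 2 is the one of [zeta_sqrt2]: the step size involves [zeta] at [sqrt 2 * r], the
   condition on [T] involves it at [r]. *)
exists 2; split=> // n M kmin kmax f o G T x v r X eta UG sc omin cf G0 lip T0 step.
have stepE t : (t < T)%N -> exists c : R -> M, [/\ geodesic c, c 0 = x t, c 1 = x t.+1 &
    velocity c 0 = - eta *: v t].
  move=> /step[_ [q eq] xt].
  have : is_exp (x t) (- eta *: v t) (x t.+1).
    by rewrite xt /Exp; case: xgetP => [y _ //|/(_ _ eq)].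
  by move=> [c [gc c0 c1] vc]; exists c.
have r0 : 0 <= r by exact: dist_ge0.
have Xo : X o by rewrite /X /closed_riemannian_ball/= (dist_self UG) mulr_ge0.
have Tp : 0 < T%:R :> R by rewrite ltr0n.
have Tm : T.-1.+1 = T by rewrite prednK.
have mean (S : R) eps : (forall t, (t <= T)%N -> X (x t)) ->
    \sum_(t < T) (f (x t) - f o) = S -> S <= eps * T%:R ->
    f (geodesic_average x T.-1) - f o <= eps.
  move=> hX hS Se; have [_ h] := average_le UG cf (fun t (tm : (t <= T.-1)%N) => hX t (leq_trans tm (leq_pred T))).
  rewrite Tm in h; rewrite -(ler_pM2l Tp) mulrBr [T%:R * eps]mulrC; apply: le_trans Se.
  rewrite -hS sumrB sumr_const card_ord -[f o *+ T]mulr_natl.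
  by rewrite lerD2r.
(* If [r = 0], then [eta = 0], and [x 0] is [o] because [Log] between them has norm 0. All iterates
   then stay at [o], since the geodesic with velocity 0 is constant. *)
have [rz|rp] := eqVneq r 0.
  have eta0 : eta = 0 by rewrite /eta rz mul0r.
  have xo : x 0%N = o.
    have h := inner_Log UG (x 0%N) o; rewrite -(dist_glen UG) -/r rz expr0n in h.
    have L0 : Log (x 0%N) o = 0.
      apply/eqP; apply/negP => /negP L0.
      have := gram_posp (mdom_chart_at (x 0%N)) L0.
      by rewrite -/(inner (x 0%N) (Log (x 0%N) o) (Log (x 0%N) o)) h ltxx.
    have e1 := Exp_gam UG (x 0%N) o (one_in01 R); have e0 := Exp_gam UG (x 0%N) o (zero_in01 R).
    by move: e1 e0; rewrite L0 !scaler0 gam0// gam1// => -> <-.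
  have xt t : (t <= T)%N -> x t = o.
    elim: t => [//|t IH] tT; have [c [gc c0 c1 vc]] := stepE t tT.
    have xto := IH (ltnW tT).
    have e1 : is_exp (x t) 0 (x t.+1) by exists c; rewrite ?vc ?eta0 ?oppr0 ?scale0r.
    have e2 : is_exp (x t) 0 (x t).
      exists (gam (x t) (x t)); first exact: gamP.
      have h := inner_Log UG (x t) (x t); rewrite glen_self// expr0n in h.
      rewrite -(LogE UG); apply/eqP; apply/negP => /negP L0.
      have := gram_posp (mdom_chart_at (x t)) L0.
      by rewrite -/(inner (x t) (Log (x t) (x t)) (Log (x t) (x t))) h ltxx.
    by rewrite (exp_unique e1 e2).
  have hX t : (t <= T)%N -> X (x t) by move=> /xt ->.
  split=> // eps eps0 _; apply: (mean 0 eps hX); last by rewrite mulr_ge0 ?ltW.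
  by rewrite big1// => t _; rewrite xt ?subrr// ltnW.
have {r0 rp} r0 : 0 < r by rewrite lt_neqAle eq_sym rp.
pose rho := Num.sqrt 2 * r; pose Z := zeta kmin rho.
have rho0 : 0 < rho by rewrite mulr_gt0// sqrtr_gt0.
have rho2 : rho ^+ 2 = 2 * r ^+ 2 by rewrite exprMn sqr_sqrtr.
have Z0 : 0 < Z by exact: zeta_gt0.
have ZT : 0 < Z * T%:R by exact: mulr_gt0.
have s0 : 0 < Num.sqrt (Z * T%:R) by rewrite sqrtr_gt0.
have eta0 : 0 < eta by rewrite divr_gt0// mulr_gt0.
(* The step size makes the bound [Z * (eta * G) ^+ 2] on the quadratic term of a step equal to
   [r ^+ 2 / T]. *)
have etaE : Z * (eta ^+ 2 * G ^+ 2) = r ^+ 2 / T%:R.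
  rewrite /eta -/rho -/Z !exprMn exprVn exprMn sqr_sqrtr ?ltW//.
  by field; rewrite !gt_eqF.
pose S t := \sum_(s < t) (f (x s) - f o).
have S0 t : 0 <= S t by apply: sumr_ge0 => s _; rewrite subr_ge0.
have r2 : 0 < r ^+ 2 by exact: exprn_gt0.
pose c2 := r ^+ 2 / T%:R; have c20 : 0 < c2 by rewrite divr_gt0.
have c2E : T%:R * c2 = r ^+ 2 by rewrite /c2 mulrC divfK// gt_eqF.
(* Without the nonnegative sum this confines the iterates to the ball; with it, at [t = T], it
   bounds the sum of the gaps. For [t < T] it leaves room for one more [c2] below [2 * r ^+ 2], and
   in particular the strict inequality needed by [subgradient_norm]. *)
have inv t : (t <= T)%N -> dist o (x t) ^+ 2 <= r ^+ 2 - 2 * eta * S t + t%:R * c2.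
  elim: t => [_|t IH tT].
    by rewrite /S big_ord0 mulr0 subr0 mul0r addr0 (dist_sym UG).
  have D := IH (ltnW tT); have [c [gc c0 c1 vc]] := stepE t tT.
  have [sub _ _] := step t tT.
  have t1 : t%:R * c2 + c2 <= r ^+ 2.
    by rewrite -c2E -{2}[c2]mul1r -mulrDl ler_pM2r// natr1 ler_nat.
  have eS : 0 <= eta * S t by rewrite mulr_ge0// ltW.
  have Dlt : dist o (x t) ^+ 2 < rho ^+ 2 by rewrite rho2; lra.
  have dlt : dist o (x t) < rho by rewrite -(@ltr_sqr R) ?nnegrE ?dist_ge0// ltW.
  have vG := subgradient_norm UG (ltW G0) eta0 lip sub dlt gc c0 vc.
  have := sub o Xo => gap.
  have := @sq_dist_descent R n M UG kmin kmax c rho c2 o.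
  rewrite c0 c1 vc => /(_ sc rho0 gc).
  have b0E : - inner (x t) (Log (x t) o) (- eta *: v t) = eta * inner (x t) (v t) (Log (x t) o).
    rewrite /inner bilinZr mulNr opprK; congr (_ * _).
    by rewrite (bilinC _ _ (gram_symp (mdom_chart_at (x t)))).
  have b0le : eta * inner (x t) (v t) (Log (x t) o) <= - (eta * (f (x t) - f o)).
    by rewrite -mulrN ler_pM2l// opprB; move: gap; rewrite -/(inner _ _ _); lra.
  have ff : 0 <= eta * (f (x t) - f o) by rewrite mulr_ge0 ?subr_ge0// ltW.
  rewrite b0E => /(_ ltac:(lra) c20).
  have hz : zeta kmin rho * inner (x t) (- eta *: v t) (- eta *: v t) <= c2.
    have -> : inner (x t) (- eta *: v t) (- eta *: v t) = eta ^+ 2 * inner (x t) (v t) (v t).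
      by rewrite /inner bilinZl bilinZr mulrA mulrNN -expr2.
    by rewrite -/Z /c2 -etaE ler_pM2l// ler_pM2l// exprn_gt0.
  move=> /(_ hz ltac:(rewrite rho2; lra)) h; apply: le_trans h _.
  rewrite /S big_ord_recr/= -/(S t) mulrSr mulrDl mul1r; lra.
have hX t : (t <= T)%N -> X (x t).
  move=> tT; rewrite /X /closed_riemannian_ball/= -/rho -(@ler_sqr R) ?nnegrE ?dist_ge0 ?(ltW rho0)//.
  apply: le_trans (inv t tT) _; rewrite rho2.
  have h1 : t%:R * c2 <= r ^+ 2 by rewrite -c2E ler_pM2r// ler_nat.
  have eS : 0 <= eta * S t by rewrite mulr_ge0// ltW.
  lra.
split=> // eps eps0 hT; apply: (mean (S T) eps hX erefl).
have fin := le_trans (sqr_ge0 _) (inv T (leqnn T)); rewrite c2E in fin.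
apply: (@average_gap_arith R r G Z T%:R eps) => //; last by rewrite -/rho -/Z in fin *; rewrite /eta in fin; lra.
have zz := zeta_sqrt2 kmin r0; rewrite -/rho -/Z in zz.
have e2 : 0 < eps ^+ 2 by exact: exprn_gt0.
have h1 : 2 * zeta kmin r * (G ^+ 2 * r ^+ 2) <= eps ^+ 2 * T%:R.
  rewrite [eps ^+ 2 * _]mulrC -ler_pdivrMr//; apply: le_trans hT; rewrite !mulrA; exact: lexx.
apply: le_trans h1; rewrite -mulrA ler_wpM2r//.
by rewrite mulr_ge0// ?exprn_ge0// ltW.
Qed.
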